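(* Let $m\in\{2,3\}$, let $k>0$, and let $D\subset\mathbb{R}^m$ be a bounded open set (possibly with several components) whose boundary $\partial D$ is a $C^2$-smooth closed curve/surface, such that $\mathbb{R}^m\setminus\overline{D}$ is connected and $k^2$ is not a Dirichlet eigenvalue of $-\Delta$ in $D$. Let $u_\infty(\hat x,\hat y)$, $\hat x,\hat y\in\Omega$, be the far field pattern of the sound-soft scattering problem for $D$ with incident plane wave $e^{ikx\cdot\hat y}$, let $F:L^2(\Omega)\to L^2(\Omega)$, $(Fg)(\hat x)=\int_\Omega u_\infty(\hat x,\hat y)g(\hat y)\,ds(\hat y)$, and for $z\in\mathbb{R}^m$ define $\varphi_z(\hat x)=e^{-ikz\cdot\hat x}$ and $$W_1(z)=(F\varphi_z,\varphi_z)_{L^2(\Omega)}.$$ Then, for sampling points $z\in\mathbb{R}^m\setminus\overline{D}$, $$W_1(z)=O\big(\operatorname{dist}(z,D)^{1-m}\big)\quad\text{as }\operatorname{dist}(z,D)\to\infty.$$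
   Context: $\Omega$ is the unit sphere in $\mathbb{R}^m$ (unit circle if $m=2$). The sound-soft scattering problem: for an incident field $u^i$, the scattered field $u^s$ solves $\Delta u^s+k^2u^s=0$ in $\mathbb{R}^m\setminus\overline{D}$, $u^s=-u^i$ on $\partial D$, and the radiation condition $\partial_ru^s-iku^s=O(r^{-(m+1)/2})$ as $r=|x|\to\infty$; the far field pattern is defined by $u^s(x)=\frac{e^{ik|x|}}{|x|^{(m-1)/2}}u_\infty(\hat x)+O(|x|^{-(m+1)/2})$, $\hat x=x/|x|$. *)

(* Defs.v *)
From mathcomp Require Import all_boot all_algebra.
From mathcomp Require Import all_classical all_reals all_analysis.
From mathcomp Require Import complex.
Import GRing.Theory Num.Theory ComplexField.
Import numFieldNormedType.Exports.
Set Implicit Arguments. Unset Strict Implicit. Unset Printing Implicit Defensive.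
Local Open Scope classical_set_scope.
Local Open Scope ring_scope.

Section Scattering.
Variables (R : realType) (m : nat).
Notation vec := 'rV[R]_m.

Definition dotv (x y : vec) : R := \sum_(i < m) x 0 i * y 0 i.
Definition enorm (x : vec) : R := Num.sqrt (dotv x x).
Definition unitv (i : 'I_m) : vec := \row_j (i == j)%:R.

Definition dist_set (z : vec) (D : set vec) : R :=
  inf [set enorm (z - y) | y in D].

Definition partial (i : 'I_m) (f : vec -> R) (x : vec) : R :=
  derive1 (fun t : R => f (x + t *: unitv i)) 0.

Definition has_partial (i : 'I_m) (f : vec -> R) (x : vec) : Prop :=
  derivable (fun t : R => f (x + t *: unitv i)) 0 1.

Definition C2_on (U : set vec) (f : vec -> R) : Prop :=
  {within U, continuous f} /\
  (forall i x, U x -> has_partial i f x) /\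
  (forall i, {within U, continuous (partial i f)}) /\
  (forall i j x, U x -> has_partial j (partial i f) x) /\
  (forall i j, {within U, continuous (partial j (partial i f))}).

Definition laplacian (f : vec -> R) (x : vec) : R :=
  \sum_(i < m) partial i (partial i f) x.

Definition radial_deriv (f : vec -> R) (x : vec) : R :=
  \sum_(i < m) (x 0 i / enorm x) * partial i f x.

Definition ReF (u : vec -> R[i]) : vec -> R := fun x => complex.Re (u x).
Definition ImF (u : vec -> R[i]) : vec -> R := fun x => complex.Im (u x).
Definition cabs (z : R[i]) : R := Num.sqrt (complex.Re z ^+ 2 + complex.Im z ^+ 2).
Definition expi (t : R) : R[i] := (cos t +i* sin t)%C.

(* C^2 boundary: near every boundary point, in rotated coordinates, D is the
   region below the graph of a C^2 function of the first m-1 coordinates. *)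
Definition lastc (y : vec) : R := \sum_(i < m | (i : nat) == m.-1) y 0 i.
Definition flat (y : vec) : vec := \row_i (if (i : nat) == m.-1 then 0 else y 0 i).

Definition boundary_of (D : set vec) : set vec := closure D `\` D.

Definition C2_boundary (D : set vec) : Prop :=
  forall p, boundary_of D p ->
    exists (r : R) (Q : 'M[R]_m) (h : vec -> R),
      0 < r /\ Q *m Q^T = 1%:M /\ C2_on setT h /\
      (forall x, enorm (x - p) < r ->
         (D x <-> lastc ((x - p) *m Q) < h (flat ((x - p) *m Q)))).

Definition dirichlet_eigenvalue (D : set vec) (k : R) : Prop :=
  exists u : vec -> R,
    C2_on D u /\ {within closure D, continuous u} /\
    (forall x, boundary_of D x -> u x = 0) /\
    (forall x, D x -> laplacian u x + k ^+ 2 * u x = 0) /\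
    (exists x, D x /\ u x != 0).

Definition sound_soft_scattered (D : set vec) (k : R) (ui us : vec -> R[i]) : Prop :=
  let E := ~` closure D in
  C2_on E (ReF us) /\ C2_on E (ImF us) /\
  {within closure E, continuous (ReF us)} /\
  {within closure E, continuous (ImF us)} /\
  (forall x, E x -> laplacian (ReF us) x + k ^+ 2 * ReF us x = 0 /\
                   laplacian (ImF us) x + k ^+ 2 * ImF us x = 0) /\
  (forall x, boundary_of D x -> us x = - ui x) /\
  (exists (C r0 : R), forall x, r0 <= enorm x ->
     cabs ((radial_deriv (ReF us) x +i* radial_deriv (ImF us) x)%C
            - 'i%C * k%:C%C * us x)
       <= C * enorm x `^ (- ((m%:R + 1) / 2))).

Definition far_field_of (k : R) (us : vec -> R[i]) (uinf : vec -> R[i]) : Prop :=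
  exists (C r0 : R), forall x, r0 <= enorm x ->
    cabs (us x - expi (k * enorm x) / (enorm x `^ ((m%:R - 1) / 2))%:C%C
                   * uinf ((enorm x)^-1 *: x))
      <= C * enorm x `^ (- ((m%:R + 1) / 2)).

Definition circ_pt (t : R) : vec :=
  \row_i (if (i : nat) == 0%N then cos t else sin t).
Definition sph_pt (th ph : R) : vec :=
  \row_i (if (i : nat) == 0%N then sin th * cos ph
          else if (i : nat) == 1%N then sin th * sin ph else cos th).

Definition sphere_int (g : vec -> R) : R :=
  if m == 2%N then
    Rintegral lebesgue_measure `[0, 2 * pi]%classic (fun t => g (circ_pt t))
  else
    Rintegral lebesgue_measure `[0, pi]%classic (fun th =>
      Rintegral lebesgue_measure `[0, 2 * pi]%classic (fun ph =>
        g (sph_pt th ph) * sin th)).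

Definition csphere_int (g : vec -> R[i]) : R[i] :=
  (sphere_int (fun x => complex.Re (g x)) +i* sphere_int (fun x => complex.Im (g x)))%C.

Definition farfield_op (uinf : vec -> vec -> R[i]) (g : vec -> R[i]) : vec -> R[i] :=
  fun xh => csphere_int (fun yh => uinf xh yh * g yh).

Definition phi_z (k : R) (z : vec) : vec -> R[i] :=
  fun xh => expi (- (k * dotv z xh)).

Definition L2_inner (f g : vec -> R[i]) : R[i] :=
  csphere_int (fun xh => f xh * (g xh)^*%C).

Definition W1 (k : R) (uinf : vec -> vec -> R[i]) (z : vec) : R[i] :=
  L2_inner (farfield_op uinf (phi_z k z)) (phi_z k z).

End Scattering.

(* Main.v *)
(** The number [W1 z] pairs the test function [phi_z] with the far field of the superposition
    [v_z = \int phi_z(y) us(., y) ds(y)]. This is an outgoing solution in the exterior [E] of [D]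
    whose boundary values are minus the Herglotz wave [\int exp(i k (x - z).y) ds(y)]. Along every ray
    the Herglotz wave solves the radial Helmholtz equation, hence it is [O(|z|^(-(m-1)/2))] on the
    boundary. By Green's formula the pairing of [phi_z] with the far field of an outgoing [v] is an
    integral over a fixed shell of [v] against the entire radial solution centred at [z]; this gives a
    second factor [|z|^(-(m-1)/2)] times the supremum of [|v|] near the obstacle.

    That supremum is controlled by the boundary values without any uniqueness theorem. Outgoing fields
    with small boundary values are precompact near the obstacle (interior gradient estimates, and
    barriers from tangent balls at the boundary). Hence every outgoing [v] differs by at most a constant
    times [sup |v|] on the boundary from an outgoing [v'] with arbitrarily small boundary values, and an
    energy identity with a logarithmic cutoff shows that the far field of [v'] is arbitrarily small.
    The integral over [y] enters only through Riemann sums, so only finite combinations of the given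
    scattered fields occur. *)

From mathcomp Require Import all_boot all_order all_algebra.
From mathcomp Require Import all_classical all_reals all_analysis.
From mathcomp Require Import complex ring lra.
Require Import Defs.
Import Order.TTheory GRing.Theory Num.Theory.
Import numFieldNormedType.Exports.
Set Implicit Arguments. Unset Strict Implicit. Unset Printing Implicit Defensive.
Local Open Scope classical_set_scope.
Local Open Scope ring_scope.

(** * One-variable derivatives and Euclidean vectors *)

Section Deriv.
Variable R : realType.
Implicit Types (f g : R -> R) (df dg : R).

Definition der f (x l : R) : Prop := is_derive x (1 : R) f l.

Lemma derD f g x df dg : der f x df -> der g x dg ->
  der (fun t => f t + g t) x (df + dg).
Proof. by move=> ? ?; exact: is_deriveD. Qed.
Lemma derN f x df : der f x df -> der (fun t => - f t) x (- df).
Proof. by move=> ?; exact: is_deriveN. Qed.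
Lemma derB f g x df dg : der f x df -> der g x dg ->
  der (fun t => f t - g t) x (df - dg).
Proof. by move=> ? ?; exact: is_deriveB. Qed.
Lemma derM f g x df dg : der f x df -> der g x dg ->
  der (fun t => f t * g t) x (df * g x + f x * dg).
Proof.
move=> hf hg; have H := @is_deriveM R R f g x 1 df dg hf hg.
by apply: (is_derive_eq H); rewrite addrC [df * _]mulrC.
Qed.
Lemma derZ f c x df : der f x df -> der (fun t => c * f t) x (c * df).
Proof. by move=> ?; exact: is_deriveZ. Qed.
Lemma derC (c : R) x : der (fun _ => c) x 0.
Proof. exact: is_derive_cst. Qed.
Lemma derI x : der (fun t => t) x 1.
Proof. exact: is_derive_id. Qed.
Lemma derX f n x df : der f x df ->
  der (fun t => f t ^+ n) x (n%:R * f x ^+ n.-1 * df).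
Proof.
case: n => [|n] h.
  have -> : (fun t => f t ^+ 0) = (fun _ => 1) by apply/funext => t; rewrite expr0.
  by rewrite !mul0r; exact: derC.
have H : is_derive x (1 : R) (f ^+ n.+1) (n.+1%:R *: f x ^+ n *: df) by exact: is_deriveX.
have -> : (fun t => f t ^+ n.+1) = (f ^+ n.+1 : R -> R).
  by apply/funext => t; elim: (n.+1) => // p IH; rewrite !exprS IH.
by apply: is_derive_eq.
Qed.
Lemma derV f x df : f x != 0 -> der f x df ->
  der (fun t => (f t)^-1) x (- df / f x ^+ 2).
Proof.
move=> fx h.
have [h1 h2] := h.
apply: DeriveDef; first exact: derivableV.
rewrite deriveV// h2.
by rewrite -[_ *: df]/(_ * df) mulNr mulrC -mulNr.
Qed.
Lemma der_comp f g x df dg : der g x dg -> der f (g x) df ->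
  der (fun t => f (g t)) x (df * dg).
Proof.
move=> hg hf; have H := @is_derive1_comp R f g x df dg hf hg.
by apply: (is_derive_eq H); rewrite mulrC.
Qed.
Lemma der_eq f x a b : der f x a -> a = b -> der f x b.
Proof. by move=> h <-. Qed.
Lemma der_fun f g x a : der f x a -> f =1 g -> der g x a.
Proof. by move=> h /funext <-. Qed.
Lemma der_cont f x a : der f x a -> {for x, continuous f}.
Proof. by case=> /derivable1_diffP/differentiable_continuous. Qed.
Lemma der_uniq f x a b : der f x a -> der f x b -> a = b.
Proof. by case=> _ <- [_ <-]. Qed.
Lemma der_derive1 f x a : der f x a -> derive1 f x = a.
Proof. by case=> _ <-; rewrite derive1E. Qed.
Lemma der_near f g x a : (\forall t \near x, f t = g t) -> der f x a -> der g x a.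
Proof. by move=> h; apply: near_eq_is_derive => //; exact: oner_neq0. Qed.

Lemma der_shift f x c a : der f (x + c) a -> der (fun t => f (t + c)) x a.
Proof.
move=> h; have := der_comp (derD (derI x) (derC c x)) h.
by move=> H; apply: (der_eq H); rewrite addr0 mulr1.
Qed.

Lemma mvt f (df : R -> R) a b : a < b ->
  (forall x, a <= x <= b -> der f x (df x)) ->
  exists c, [/\ a < c, c < b & f b - f a = df c * (b - a)].
Proof.
move=> ab h.
have [x||c] := @MVT R f df a b ab.
- by rewrite in_itv/= => /andP[/ltW ax /ltW xb]; apply: h; rewrite ax.
- apply/continuous_in_subspaceT => x; rewrite inE/= in_itv/= => /h hx.
  exact: der_cont hx.
- by rewrite in_itv/= => /andP[? ?] ?; exists c.
Qed.

Lemma mvt_abs f (df : R -> R) a b M : 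
  (forall x, Num.min a b <= x <= Num.max a b -> der f x (df x)) ->
  (forall x, Num.min a b <= x <= Num.max a b -> `|df x| <= M) ->
  `|f b - f a| <= M * `|b - a|.
Proof.
wlog ab : a b / a <= b.
  move=> W; case: (leP a b) => ab; first by move: (W _ _ ab); rewrite min_l// max_r.
  move: (W _ _ (ltW ab)); rewrite min_l ?max_r ?(ltW ab)//.
  by rewrite distrC (distrC a).
rewrite min_l// max_r//.
move: ab; rewrite le_eqVlt => /orP[/eqP <-|ab] h1 h2; first by rewrite !subrr normr0 mulr0.
have [c [ac cb ->]] := mvt ab h1.
by rewrite normrM ler_wpM2r// h2// !ltW.
Qed.

Lemma der_ge0_le f (df : R -> R) a b : a <= b ->
  (forall x, a <= x <= b -> der f x (df x)) ->
  (forall x, a <= x <= b -> 0 <= df x) -> f a <= f b.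
Proof.
rewrite le_eqVlt => /orP[/eqP <-//|ab] h1 h2.
have [c [ac cb e]] := mvt ab h1.
by rewrite -subr_ge0 e mulr_ge0 ?h2 ?subr_ge0 ?(ltW ab)// !ltW.
Qed.

Lemma der0_const f a b : (forall x, Num.min a b <= x <= Num.max a b -> der f x 0) -> f a = f b.
Proof.
move=> h; have := @mvt_abs f (fun _ => 0) a b 0 h.
rewrite mul0r => H; apply/eqP; rewrite eq_sym -subr_eq0 -normr_le0; apply: H.
by move=> *; rewrite normr0.
Qed.

End Deriv.

Lemma cvg_sumr (R : realType) (T : Type) (F : set_system T) {FF : Filter F} (I : Type)
    (r : seq I) (f : I -> T -> R) (l : I -> R) :
  (forall i, f i @ F --> l i) ->
  (fun x => \sum_(i <- r) f i x) @ F --> \sum_(i <- r) l i.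
Proof.
move=> h; elim: r => [|i r IH].
  rewrite big_nil (_ : (fun _ => _) = fun _ => 0); first exact: cvg_cst.
  by apply/funext => x; rewrite big_nil.
rewrite big_cons (_ : (fun _ => _) = fun x => f i x + \sum_(j <- r) f j x).
  by apply: cvgD.
by apply/funext => x; rewrite big_cons.
Qed.

Section Cont.
Variables (R : realType) (T : topologicalType).
Implicit Types (f g : T -> R) (x : T).
Definition ctat f x : Prop := {for x, continuous f}.
Lemma ctD f g x : ctat f x -> ctat g x -> ctat (fun y => f y + g y) x.
Proof. by move=> ? ?; exact: cvgD. Qed.
Lemma ctM f g x : ctat f x -> ctat g x -> ctat (fun y => f y * g y) x.
Proof. by move=> ? ?; exact: cvgM. Qed.
Lemma ctN f x : ctat f x -> ctat (fun y => - f y) x.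
Proof. by move=> ?; exact: cvgN. Qed.
Lemma ctB f g x : ctat f x -> ctat g x -> ctat (fun y => f y - g y) x.
Proof. by move=> ? ?; exact: cvgB. Qed.
Lemma ctC (c : R) x : ctat (fun _ => c) x.
Proof. exact: cvg_cst. Qed.
Lemma ctX f n x : ctat f x -> ctat (fun y => f y ^+ n) x.
Proof.
move=> h; elim: n => [|n IH]; first exact: ctC.
by under eq_fun do rewrite exprS; exact: ctM.
Qed.
Lemma ctV f x : f x != 0 -> ctat f x -> ctat (fun y => (f y)^-1) x.
Proof. by move=> ? ?; exact: cvgV. Qed.
Lemma ct_sum (I : Type) (r : seq I) (f : I -> T -> R) x :
  (forall i, ctat (f i) x) -> ctat (fun y => \sum_(i <- r) f i y) x.
Proof. by move=> h; apply: cvg_sumr => i; exact: h. Qed.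
Lemma ct_comp (g : R -> R) f x : ctat f x -> {for f x, continuous g} ->
  ctat (fun y => g (f y)) x.
Proof. by move=> hf hg; exact: (continuous_comp hf hg). Qed.
Lemma ct_abs f x : ctat f x -> ctat (fun y => `|f y|) x.
Proof. by move=> ?; exact: cvg_norm. Qed.
Lemma ct_near f g x : (\forall y \near x, f y = g y) -> ctat f x -> ctat g x.
Proof.
move=> h hf; rewrite /ctat/prop_for/continuous_at -(nbhs_singleton h).
by apply: cvg_trans hf; exact: near_eq_cvg.
Qed.
End Cont.

Section Vec.
Variables (R : realType) (m : nat).
Notation vec := 'rV[R]_m.
Implicit Types x y z : vec.

Lemma dotvC x y : dotv x y = dotv y x.
Proof. by apply: eq_bigr => i _; rewrite mulrC. Qed.
Lemma dotvDl x y z : dotv (x + y) z = dotv x z + dotv y z.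
Proof. by rewrite -big_split; apply: eq_bigr => i _; rewrite mxE mulrDl. Qed.
Lemma dotvDr x y z : dotv x (y + z) = dotv x y + dotv x z.
Proof. by rewrite dotvC dotvDl !(dotvC x). Qed.
Lemma dotvZl c x z : dotv (c *: x) z = c * dotv x z.
Proof. by rewrite mulr_sumr; apply: eq_bigr => i _; rewrite mxE mulrA. Qed.
Lemma dotvZr c x z : dotv x (c *: z) = c * dotv x z.
Proof. by rewrite dotvC dotvZl dotvC. Qed.
Lemma dotvNl x z : dotv (- x) z = - dotv x z.
Proof. by rewrite -scaleN1r dotvZl mulN1r. Qed.
Lemma dotvNr x z : dotv x (- z) = - dotv x z.
Proof. by rewrite dotvC dotvNl dotvC. Qed.
Lemma dotvBl x y z : dotv (x - y) z = dotv x z - dotv y z.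
Proof. by rewrite dotvDl dotvNl. Qed.
Lemma dotvBr x y z : dotv x (y - z) = dotv x y - dotv x z.
Proof. by rewrite dotvDr dotvNr. Qed.
Lemma dotv0l x : dotv 0 x = 0.
Proof. by rewrite -(scale0r 0) dotvZl mul0r. Qed.
Lemma dotv0r x : dotv x 0 = 0. Proof. by rewrite dotvC dotv0l. Qed.
Lemma dotvv_ge0 x : 0 <= dotv x x.
Proof. by apply: sumr_ge0 => i _; rewrite -expr2 sqr_ge0. Qed.
Lemma dotv_unit x i : dotv x (unitv R i) = x 0 i.
Proof.
rewrite /dotv (bigD1 i)//= big1 ?addr0 => [|j ji]; rewrite mxE ?eqxx ?mulr1//.
by rewrite eq_sym (negPf ji) mulr0.
Qed.
Lemma enorm_ge0 x : 0 <= enorm x. Proof. exact: sqrtr_ge0. Qed.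
Lemma enorm_sqr x : enorm x ^+ 2 = dotv x x.
Proof. by rewrite sqr_sqrtr// dotvv_ge0. Qed.
Lemma dotvv_eq0 x : dotv x x = 0 -> x = 0.
Proof.
move/eqP; rewrite psumr_eq0; last by move=> i _; rewrite -expr2 sqr_ge0.
move=> /allP h; apply/rowP => i; rewrite mxE; apply/eqP.
by have := h i (mem_index_enum _); rewrite /= mulf_eq0 orbb.
Qed.
Lemma enorm_eq0 x : enorm x = 0 -> x = 0.
Proof. by move=> h; apply: dotvv_eq0; rewrite -enorm_sqr h expr0n. Qed.
Lemma enorm0 : enorm (0 : vec) = 0. Proof. by rewrite /enorm dotv0l sqrtr0. Qed.
Lemma enormZ c x : enorm (c *: x) = `|c| * enorm x.
Proof. by rewrite /enorm dotvZl dotvZr mulrA -expr2 sqrtrM ?sqr_ge0// sqrtr_sqr. Qed.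
Lemma enormN x : enorm (- x) = enorm x.
Proof. by rewrite -scaleN1r enormZ normrN1 mul1r. Qed.
Lemma enormB x y : enorm (x - y) = enorm (y - x).
Proof. by rewrite -enormN opprB. Qed.
Lemma enorm_unit i : enorm (unitv R i : vec) = 1.
Proof. by rewrite /enorm dotv_unit mxE eqxx sqrtr1. Qed.

Lemma dotv_CS x y : `|dotv x y| <= enorm x * enorm y.
Proof.
rewrite -ler_sqr ?nnegrE ?mulr_ge0 ?enorm_ge0// exprMn !enorm_sqr real_normK ?num_real//.
have [y0|y0] := eqVneq (dotv y y) 0.
  by rewrite (dotvv_eq0 y0) !dotv0r expr0n mulr0.
have yp : 0 < dotv y y by rewrite lt_neqAle eq_sym y0 dotvv_ge0.
have := dotvv_ge0 (x - (dotv x y / dotv y y) *: y).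
rewrite dotvBl !dotvBr !dotvZl !dotvZr (dotvC y x).
set a := dotv x y; set b := dotv y y => h.
have : 0 <= (dotv x x - a / b * a - (a / b * a - a / b * (a / b * b))) * b.
  by apply: mulr_ge0 => //; exact: ltW.
rewrite (_ : _ * b = dotv x x * b - a ^+ 2); last by field.
by rewrite subr_ge0.
Qed.

Lemma enormD x y : enorm (x + y) <= enorm x + enorm y.
Proof.
rewrite -ler_sqr ?nnegrE ?addr_ge0 ?enorm_ge0// sqrrD !enorm_sqr.
rewrite dotvDl !dotvDr (dotvC y x) mulr2n.
have := ler_normlW (dotv_CS x y); lra.
Qed.
Lemma enorm_leB x y : enorm x - enorm y <= enorm (x - y).
Proof. by rewrite lerBlDr -{1}(subrK y x); exact: enormD. Qed.
Lemma enorm_dist x y : `|enorm x - enorm y| <= enorm (x - y).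
Proof. by rewrite ler_norml enorm_leB lerNl opprB [enorm (x - y)]enormB enorm_leB. Qed.

Lemma coord_enorm x i : `|x 0 i| <= enorm x.
Proof. by rewrite -dotv_unit (le_trans (dotv_CS _ _))// enorm_unit mulr1. Qed.
Lemma normv_leP x c : 0 <= c -> (`|x| <= c <-> forall i, `|x 0 i| <= c).
Proof.
move=> c0; rewrite /Num.norm/= mx_normrE; split.
  move=> /bigmax_leP[_ h] i; exact: (h (0, i)).
by move=> h; apply/bigmax_leP; split => // -[i j] _; rewrite ord1; exact: h.
Qed.
Lemma coord_norm x i : `|x 0 i| <= `|x|.
Proof. by have [/(_ (lexx _))] := normv_leP x (normr_ge0 x). Qed.
Lemma norm_enorm x : `|x| <= enorm x.
Proof. by apply/normv_leP; [exact: enorm_ge0|exact: coord_enorm]. Qed.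
Lemma enorm_norm x : enorm x <= m%:R * `|x|.
Proof.
have H : enorm x <= \sum_i `|x 0 i|.
  have {1}-> : x = \sum_i x 0 i *: unitv R i.
    apply/rowP => j; rewrite summxE (bigD1 j)//= big1 ?addr0 => [|k kj]; rewrite !mxE ?eqxx ?mulr1//.
    by rewrite (negPf kj) mulr0.
  elim/big_ind2 : _ => [|a b a' b' h1 h2|i _].
  - by rewrite enorm0.
  - by apply: le_trans (enormD _ _) _; exact: lerD.
  - by rewrite enormZ enorm_unit mulr1.
apply: le_trans H _; rewrite -[X in X%:R]card_ord -sum1_card natr_sum mulr_suml.
by apply: ler_sum => i _; rewrite mul1r coord_norm.
Qed.

Lemma dotv_cont y : continuous (fun x => dotv x y).
Proof.
move=> x; rewrite /dotv; apply: ct_sum => i.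
by apply: ctM; [exact: coord_continuous|exact: ctC].
Qed.
Lemma dotvv_cont : continuous (fun x => dotv x x).
Proof.
move=> x; rewrite /dotv; apply: ct_sum => i.
by apply: ctM; exact: coord_continuous.
Qed.
Lemma enorm_cont : continuous (@enorm R m).
Proof.
move=> x; apply: (@cvg_comp _ _ _ (fun x => dotv x x) Num.sqrt); first exact: dotvv_cont.
exact: sqrt_continuous.
Qed.

End Vec.

Section EpsDelta.
Variable R : realType.

(** The inequality is multiplied out by |h|, so h = 0 is included and no quotient has to be handled
    later. *)
Lemma derP (f : R -> R) (x l : R) : der f x l <-> forall e : R, 0 < e ->
  exists2 d : R, 0 < d & forall h, `|h| < d -> `|f (x + h) - f x - l * h| <= e * `|h|.
Proof.
split=> [[h1 h2] e e0|H].
  move: h1 h2; rewrite /derivable /derive => h1 h2.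
  have hl : (fun h : R => h^-1 *: (f (h *: (1 : R) + x) - f x)) @ 0^' --> l by rewrite -h2.
  move/cvgrPdist_le: hl => /(_ e e0).
  rewrite /dnbhs /within/= => /nbhs_ballP[d/= d0 hd]; exists d => // h hh.
  have [->|hn] := eqVneq h 0; first by rewrite addr0 subrr mulr0 subr0 normr0 mulr0.
  have := hd h; rewrite /ball/= sub0r normrN => /(_ hh hn).
  rewrite -[_ *: (_ - _)]/(_ * (_ - _)) -[h *: 1]/(h * 1) mulr1 (addrC h x) => H.
  rewrite (_ : f _ - _ - _ = - (l - h^-1 * (f (x + h) - f x)) * h); last by field.
  by rewrite normrM normrN ler_wpM2r.
have C : (fun h : R => h^-1 *: (f (h *: (1 : R) + x) - f x)) @ 0^' --> l.
  apply/cvgrPdist_le => e e0; have [d d0 hd] := H _ e0.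
  rewrite /dnbhs /within/=; apply/nbhs_ballP; exists d => //= h.
  rewrite /ball/= sub0r normrN => hh hn.
  rewrite -[_ *: (_ - _)]/(_ * (_ - _)) -[h *: 1]/(h * 1) mulr1 (addrC h x).
  rewrite -(ler_pM2r (_ : 0 < `|h|)) ?normr_gt0// -normrM.
  rewrite (_ : _ * h = - (f (x + h) - f x - l * h)); last by field.
  by rewrite normrN hd.
apply: DeriveDef; first by apply/cvg_ex; exists l.
by apply: cvg_lim.
Qed.

Lemma ctP (V : normedModType R) (f : V -> R) x : ctat f x <-> forall e : R, 0 < e ->
  exists2 d : R, 0 < d & forall y, `|y - x| < d -> `|f y - f x| < e.
Proof.
split=> [/cvgrPdist_lt H e /H /nbhs_normP[d/= d0 hd]|H].
  by exists d => // y xy; rewrite distrC; apply: hd; rewrite /ball_/= distrC.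
apply/cvgrPdist_lt => e /H[d d0 hd]; apply/nbhs_normP; exists d => //= y.
by rewrite /ball_/= distrC => /hd; rewrite distrC.
Qed.
End EpsDelta.

Lemma nbhs_vec (R : realType) m (x : 'rV[R]_m) (P : set 'rV[R]_m) :
  nbhs x P <-> exists2 d : R, 0 < d & forall y, `|y - x| < d -> P y.
Proof.
split.
  by move=> /nbhs_normP[d/= d0 hd]; exists d => // y yx; apply: hd; rewrite /ball_/= distrC.
move=> [d d0 hd]; apply: (@nbhs_normP _ 'rV[R]_m x P).2; exists d => // y.
by rewrite /ball_/= distrC; exact: hd.
Qed.

(** The common radius is a finite minimum; it starts from 1 so that the empty family is covered. *)
Lemma fin_eps (R : realType) n (P : 'I_n -> R -> Prop) :
  (forall i, exists2 d : R, 0 < d & P i d) ->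
  (forall i d d', 0 < d' -> d' <= d -> P i d -> P i d') ->
  exists2 d : R, 0 < d & forall i, P i d.
Proof.
move=> h mon.
have [f fP] := choice (fun i => let: ex_intro2 d d0 Pd := h i in ex_intro (fun d => 0 < d /\ P i d) d (conj d0 Pd)).
exists (\big[Num.min/1]_i f i).
  by elim/big_ind : _ => // [a b a0 b0|i _]; [rewrite lt_min a0|exact: (fP i).1].
move=> i; apply: (mon i (f i)); [|exact: bigmin_le_cond|exact: (fP i).2].
by elim/big_ind : _ => // [a b a0 b0|j _]; [rewrite lt_min a0|exact: (fP j).1].
Qed.

(** * Partial derivatives and total differentiability *)

Section Partial.
Variables (R : realType) (m : nat).
Notation vec := 'rV[R]_m.
Implicit Types (x y : vec) (F : vec -> R) (i : 'I_m).

Definition isp i F x l := der (fun t : R => F (x + t *: unitv R i)) 0 l.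

Lemma has_partial_isp i F x : has_partial i F x -> isp i F x (partial i F x).
Proof. by move=> h; apply: DeriveDef => //; rewrite /partial derive1E. Qed.
Lemma isp_line i F x t l : isp i F (x + t *: unitv R i) l ->
  der (fun s => F (x + s *: unitv R i)) t l.
Proof.
move=> h; have := @der_shift R (fun s => F (x + t *: unitv R i + s *: unitv R i)) t (- t) l.
rewrite subrr => /(_ h) H; apply: (der_fun H) => s.
by rewrite -addrA -scalerDl addrCA subrr addr0.
Qed.

Lemma coordD1 x i t j : (x + t *: unitv R i) 0 j = x 0 j + (if i == j then t else 0).
Proof. by rewrite !mxE; case: eqP => _; rewrite ?mulr1 ?mulr0. Qed.

(* Moves from [x] to [x + xi] one coordinate at a time, so that only partial derivatives are needed. *)
Lemma mvt_coords F (G : 'I_m -> vec -> R) x (xi : vec) (c eps : 'I_m -> R) :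
  (forall i y, (forall j, `|y 0 j - x 0 j| <= `|xi 0 j|) -> isp i F y (G i y)) ->
  (forall i y, (forall j, `|y 0 j - x 0 j| <= `|xi 0 j|) -> `|G i y - c i| <= eps i) ->
  `|F (x + xi) - F x - \sum_i c i * xi 0 i| <= \sum_i eps i * `|xi 0 i|.
Proof.
move=> H1 H2.
pose p (n : nat) : vec := \row_j (if (j < n)%N then x 0 j + xi 0 j else x 0 j).
have pS (i : 'I_m) : p i.+1 = p i + xi 0 i *: unitv R i.
  apply/rowP => j; rewrite coordD1 !mxE ltnS.
  case: eqP => [<-|/eqP ij]; first by rewrite leqnn ltnn.
  rewrite leq_eqVlt (_ : (j == i :> nat) = false) ?addr0//.
  by apply/eqP => /val_inj ji; rewrite ji eqxx in ij.
have step (i : 'I_m) : `|F (p i.+1) - F (p i) - c i * xi 0 i| <= eps i * `|xi 0 i|.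
  pose f t := F (p i + t *: unitv R i) - c i * t.
  have inb t : Num.min 0 (xi 0 i) <= t <= Num.max 0 (xi 0 i) ->
      forall j, `|(p i + t *: unitv R i) 0 j - x 0 j| <= `|xi 0 j|.
    move=> ht j; rewrite coordD1 mxE.
    case: eqP => [<-|_].
      rewrite ltnn addrAC subrr add0r.
      move: ht; case: (leP 0 (xi 0 i)) => h /andP[h1 h2].
        by rewrite !ger0_norm.
      by rewrite !ler0_norm// ?lerN2// ltW.
    by rewrite addr0; case: ifP => _; [rewrite addrAC subrr add0r|rewrite subrr normr0].
  have -> : F (p i.+1) - F (p i) - c i * xi 0 i = f (xi 0 i) - f 0.
    by rewrite /f -pS scale0r addr0 mulr0 subr0 addrAC.
  rewrite -{2}(subr0 (xi 0 i)).
  apply: (@mvt_abs R f (fun t => G i (p i + t *: unitv R i) - c i * 1)).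
    move=> t ht; apply: derB; first by apply: isp_line; apply: H1; exact: inb.
    by apply: derZ; exact: derI.
  by move=> t ht; rewrite mulr1; apply: H2; exact: inb.
have -> : F (x + xi) - F x - \sum_i c i * xi 0 i =
    \sum_(i < m) (F (p i.+1) - F (p i) - c i * xi 0 i).
  rewrite sumrB; congr (_ - _).
  rewrite -(big_mkord xpredT (fun i : nat => F (p i.+1) - F (p i))) (telescope_sumr (fun n => F (p n)))//.
  congr (F _ - F _); apply/rowP => j; rewrite !mxE ?ltn_ord//.
apply: le_trans (ler_norm_sum _ _ _) _.
by apply: ler_sum => i _; exact: step.
Qed.

(** Continuous partial derivatives give total differentiability: along the coordinate path of
    [mvt_coords] each partial stays close to its value at [x]. *)
Lemma fd_eps F G x : (\forall y \near x, forall i, isp i F y (G i y)) ->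
  (forall i, ctat (G i) x) ->
  forall e : R, 0 < e -> exists2 d : R, 0 < d & forall xi, `|xi| < d ->
   `|F (x + xi) - F x - \sum_i G i x * xi 0 i| <= e * `|xi|.
Proof.
move=> /nbhs_normP[d1/= d10 h1] h2 e e0.
(* An equal share of the error for each coordinate; [m.+1] keeps the quotient meaningful in
   dimension zero. *)
pose e' := e / (m.+1%:R).
have e'0 : 0 < e' by rewrite divr_gt0.
have [d2 d20 h3] : exists2 d : R, 0 < d & forall i (y : vec), `|y - x| < d -> `|G i y - G i x| <= e'.
  apply: (fin_eps (P := fun i d => forall y, `|y - x| < d -> `|G i y - G i x| <= e')) => i.
    by have [d d0 hd] := (ctP (G i) x).1 (h2 i) _ e'0; exists d => // y /hd/ltW.
  by move=> d d' d'0 dd' h y yd; apply: h; exact: lt_le_trans yd dd'.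
exists (Num.min d1 d2); first by rewrite lt_min d10.
move=> xi; rewrite lt_min => /andP[x1 x2].
have inb y : (forall j, `|y 0 j - x 0 j| <= `|xi 0 j|) -> `|y - x| <= `|xi|.
  move=> h; apply/normv_leP => // i; rewrite !mxE.
  exact: le_trans (h i) (coord_norm _ _).
apply: le_trans (mvt_coords (eps := fun _ => e') _ _) _.
- move=> i y /inb yx; apply: (h1 y _ i); rewrite /ball_/= distrC.
  exact: le_lt_trans yx _.
- by move=> i y /inb yx; apply: h3; exact: le_lt_trans yx _.
apply: (@le_trans _ _ (\sum_(i < m) e' * `|xi|)).
  by apply: ler_sum => i _; rewrite ler_wpM2l ?(ltW e'0)// coord_norm.
rewrite sumr_const card_ord -mulr_natr mulrAC ler_wpM2r//.
rewrite /e' -mulrA -[leRHS]mulr1 ler_wpM2l ?(ltW e0)// mulrC ler_pdivrMr// mul1r ler_nat//.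
Qed.

Lemma C1_ct F G x : (\forall y \near x, forall i, isp i F y (G i y)) ->
  (forall i, ctat (G i) x) -> ctat F x.
Proof.
move=> h1 h2; apply/ctP => e e0.
have [d d0 hd] := fd_eps h1 h2 ltr01.
pose K := 1 + \sum_i `|G i x|.
have K0 : 0 < K by rewrite ltr_pwDl// sumr_ge0.
exists (Num.min d (e / K)); first by rewrite lt_min d0 divr_gt0.
move=> y; rewrite lt_min => /andP[y1 y2].
have := hd _ y1; rewrite (addrC x) subrK mul1r => H.
have : `|F y - F x| <= K * `|y - x|.
  rewrite -[_ - _](subrK (\sum_i G i x * (y - x) 0 i)).
  apply: le_trans (ler_normD _ _) _; rewrite mulrDl mul1r lerD//.
  apply: le_trans (ler_norm_sum _ _ _) _; rewrite mulr_suml; apply: ler_sum => i _.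
  by rewrite normrM ler_wpM2l// coord_norm.
move/le_lt_trans; apply; by rewrite mulrC -ltr_pdivlMr.
Qed.

Lemma chain_rule F G (g : R -> vec) (g' : 'I_m -> R) t :
  (\forall y \near g t, forall i, isp i F y (G i y)) -> (forall i, ctat (G i) (g t)) ->
  (forall i, der (fun s => g s 0 i) t (g' i)) ->
  der (fun s => F (g s)) t (\sum_i G i (g t) * g' i).
Proof.
move=> h1 h2 h3; apply/derP => e e0.
set A := \sum_i `|G i (g t)|; set B := \sum_i `|g' i|.
have A0 : 0 <= A by exact: sumr_ge0.
have B0 : 0 <= B by exact: sumr_ge0.
(* The entry 1 bounds the increment of [g] by (B + 1)|h|; the other entry makes the coordinate
   errors, weighted by the gradient, cost at most e/2. *)
pose e1 := Num.min 1 (e / (2 * (A + 1))).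
have e10 : 0 < e1 by rewrite lt_min ltr01 divr_gt0// mulr_gt0// ltr_wpDl.
pose e2 := e / (2 * (B + 1)).
have e20 : 0 < e2 by rewrite divr_gt0// mulr_gt0// ltr_wpDl.
have [d1 d10 hd1] := fd_eps h1 h2 e20.
have [d2 d20 hd2] : exists2 d : R, 0 < d & forall i h, `|h| < d ->
    `|g (t + h) 0 i - g t 0 i - g' i * h| <= e1 * `|h|.
  apply: (fin_eps (P := fun i d => forall h, `|h| < d ->
    `|g (t + h) 0 i - g t 0 i - g' i * h| <= e1 * `|h|)) => i.
    by have [d d0 hd] := (derP _ _ _).1 (h3 i) _ e10; exists d.
  by move=> d d' d'0 dd' h y yd; apply: h; exact: lt_le_trans yd dd'.
exists (Num.min d2 (d1 / (B + 1))); first by rewrite lt_min d20 divr_gt0// ltr_wpDl.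
move=> h; rewrite lt_min => /andP[hh1 hh2].
have xi_le : `|g (t + h) - g t| <= (B + 1) * `|h|.
  apply/normv_leP; first by rewrite mulr_ge0// addr_ge0.
  move=> i; rewrite !mxE -[_ - _](subrK (g' i * h)).
  apply: le_trans (ler_normD _ _) _; rewrite addrC mulrDl lerD//.
    rewrite normrM ler_wpM2r// /B (bigD1 i)//= lerDl; exact: sumr_ge0.
  by apply: le_trans (hd2 i _ hh1) _; rewrite ler_wpM2r// ge_min lexx.
have xi_lt : `|g (t + h) - g t| < d1.
  apply: le_lt_trans xi_le _; rewrite mulrC -ltr_pdivlMr// ltr_wpDl//.
have := hd1 _ xi_lt; rewrite (addrC (g t)) subrK => H.
set S1 := \sum_i _ in H.
rewrite -[_ - _ * h](subrK (F (g (t + h)) - F (g t) - S1)).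
apply: le_trans (ler_normD _ _) _.
rewrite (_ : e * `|h| = e / 2 * `|h| + e / 2 * `|h|); last by field.
rewrite lerD//; last first.
  apply: le_trans H _; apply: le_trans (ler_wpM2l (ltW e20) xi_le) _.
  rewrite mulrA ler_wpM2r//.
  have : B + 1 != 0 by rewrite gt_eqF// ltr_wpDl.
  move=> b1; rewrite le_eqVlt; apply/orP; left; apply/eqP; rewrite /e2; by field.
rewrite (_ : _ - _ - _ = \sum_i G i (g t) * (g (t + h) 0 i - g t 0 i - g' i * h)).
  apply: le_trans (ler_norm_sum _ _ _) _.
  apply: (@le_trans _ _ (A * (e1 * `|h|))).
    rewrite mulr_suml; apply: ler_sum => i _; rewrite normrM ler_wpM2l//.
    exact: hd2.
  rewrite mulrA ler_wpM2r//.
  apply: (@le_trans _ _ ((A + 1) * (e / (2 * (A + 1))))).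
    by rewrite ler_pM// ?(ltW e10)// ?lerDl// /e1 ge_min lexx orbT.
  have : A + 1 != 0 by rewrite gt_eqF// ltr_wpDl.
  move=> b1; rewrite le_eqVlt; apply/orP; left; apply/eqP; by field.
rewrite opprB addrC addrA subrK.
rewrite /S1 mulr_suml -sumrB; apply: eq_bigr => i _; rewrite !mxE; ring.
Qed.

End Partial.

(** * Integrals on the line and on the sphere *)

Section Int.
Variable R : realType.
Implicit Types (f g : R -> R) (a b c : R).

Definition int a b f : R := Rintegral lebesgue_measure `[a, b]%classic f.
Definition cont f : Prop := forall t, ctat f t.

Lemma contD f g : cont f -> cont g -> cont (fun t => f t + g t).
Proof. by move=> hf hg t; exact: ctD. Qed.
Lemma contM f g : cont f -> cont g -> cont (fun t => f t * g t).
Proof. by move=> hf hg t; exact: ctM. Qed.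
Lemma contZ c g : cont g -> cont (fun t => c * g t).
Proof. by move=> hg t; apply: ctM; [exact: ctC|exact: hg]. Qed.
Lemma contC c : cont (fun t => c).
Proof. by move=> t; exact: ctC. Qed.
Lemma contB f g : cont f -> cont g -> cont (fun t => f t - g t).
Proof. by move=> hf hg t; exact: ctB. Qed.
Lemma contN f : cont f -> cont (fun t => - f t).
Proof. by move=> hf t; exact: ctN. Qed.
Lemma contI : cont (fun t => t).
Proof. by move=> t; exact: cvg_id. Qed.
Lemma cont_sin : cont (@sin R). Proof. by move=> t; exact: continuous_sin. Qed.
Lemma cont_cos : cont (@cos R). Proof. by move=> t; exact: continuous_cos. Qed.
Lemma contX f n : cont f -> cont (fun t => f t ^+ n).
Proof. by move=> hf t; exact: ctX. Qed.

Lemma cont_integrable a b f : cont f ->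
  (@lebesgue_measure R).-integrable `[a, b]%classic (EFin \o f).
Proof.
move=> cf; apply: continuous_compact_integrable; first exact: segment_compact.
by apply: continuous_subspaceT => x; exact: cf.
Qed.

Lemma intD a b f g : cont f -> cont g ->
  int a b (fun t => f t + g t) = int a b f + int a b g.
Proof. by move=> hf hg; rewrite /int RintegralD//; exact: cont_integrable. Qed.
Lemma intB a b f g : cont f -> cont g ->
  int a b (fun t => f t - g t) = int a b f - int a b g.
Proof. by move=> hf hg; rewrite /int RintegralB//; exact: cont_integrable. Qed.
Lemma intZ a b c f : cont f -> int a b (fun t => c * f t) = c * int a b f.
Proof. by move=> hf; rewrite /int RintegralZl//; exact: cont_integrable. Qed.
Lemma int_ext a b f g : (forall t, a <= t <= b -> f t = g t) -> int a b f = int a b g.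
Proof.
move=> h; apply: eq_Rintegral => t; rewrite inE/= in_itv/= => ht; exact: h.
Qed.
Lemma int_le a b f g : cont f -> cont g -> (forall t, a <= t <= b -> f t <= g t) ->
  int a b f <= int a b g.
Proof.
move=> hf hg h; apply: le_Rintegral => //.
- exact: cont_integrable.
- exact: cont_integrable.
Qed.
Lemma int_cst a b c : a <= b -> int a b (fun _ => c) = c * (b - a).
Proof.
move=> ab; rewrite /int Rintegral_cst//= lebesgue_measure_itv/= lte_fin.
move: ab; rewrite le_eqVlt => /orP[/eqP->|ab]; first by rewrite ltxx subrr.
by rewrite ab.
Qed.
Lemma int_abs a b f c : a <= b -> cont f -> (forall t, a <= t <= b -> `|f t| <= c) ->
  `|int a b f| <= c * (b - a).
Proof.
move=> ab hf h; rewrite ler_norml -mulNr -!int_cst//; apply/andP; split; apply: int_le => //;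
  try exact: contC; by move=> t /h; rewrite ler_norml => /andP[].
Qed.
Lemma int_chasles a b c f : a <= b -> b <= c -> cont f -> int a c f = int a b f + int b c f.
Proof.
move=> ab bc hf.
have := @Rintegral_itvB R f (BLeft a) (BRight c) b (@cont_integrable a c f hf).
rewrite !bnd_simp => /(_ ab bc) H; apply/eqP; rewrite addrC -subr_eq; apply/eqP.
rewrite /int H Rintegral_itv_obnd_cbnd//.
apply: integrableS (@cont_integrable b c f hf) => //=.
by move=> t/=; rewrite !in_itv/= => /andP[/ltW -> ->].
Qed.

Lemma int_FTC a b f F : a <= b -> (forall t, der F t (f t)) -> cont f ->
  int a b f = F b - F a.
Proof.
rewrite le_eqVlt => /orP[/eqP <-|ab] dF cf.
  by rewrite subrr /int set_itv1 Rintegral_set1.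
have cF : cont F by move=> t; exact: der_cont (dF t).
rewrite /int /Rintegral (@continuous_FTC2 _ f F a b)//.
- by apply: continuous_subspaceT => x; exact: cf.
- split=> [t _||]; first by case: (dF t).
  + by apply: cvg_at_right_filter; exact: cF.
  + by apply: cvg_at_left_filter; exact: cF.
- by move=> t _; exact: der_derive1 (dF t).
Qed.

(** A positive value f t forces f >= f t / 2 on a nondegenerate subinterval, which would contribute
    positively to the integral. *)
Lemma int_pos0 a b f : a < b -> cont f -> (forall t, a <= t <= b -> 0 <= f t) ->
  int a b f = 0 -> forall t, a <= t <= b -> f t = 0.
Proof.
move=> ab cf f0 i0 t tab; apply/eqP; rewrite eq_le f0// andbT leNgt; apply/negP => ft.
have ft2 : 0 < f t / 2 by rewrite divr_gt0.
have [d d0 hd] := (ctP f t).1 (cf t) _ ft2.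
(* [t] may be an end point, so the subinterval lies to its right when t < b and to its left
   otherwise. *)
have [s1 [s2 [as1 s12 s2b st]]] : exists s1 s2, [/\ a <= s1, s1 < s2, s2 <= b &
    forall s, s1 <= s <= s2 -> `|s - t| < d].
  case/andP: tab => at1 tb.
  have [tb'|bt] := ltP t b.
    exists t, (Num.min b (t + d / 2)); split=> //.
    - by rewrite lt_min tb' ltrDl divr_gt0.
    - by rewrite ge_min lexx.
    - move=> s /andP[ts]; rewrite le_min => /andP[_ sd].
      rewrite ger0_norm ?subr_ge0//; lra.
  exists (Num.max a (t - d / 2)), t; split=> //.
  - by rewrite le_max lexx.
  - rewrite gt_max; apply/andP; split; first exact: lt_le_trans bt.
    by rewrite ltrBlDr ltrDl divr_gt0.
  - move=> s /andP[]; rewrite ge_max => /andP[_ sd] st.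
    rewrite ler0_norm ?subr_le0//; lra.
have P : f t / 2 * (s2 - s1) <= int s1 s2 f.
  rewrite -int_cst ?(ltW s12)//; apply: int_le => //; first exact: contC.
  move=> s /st/hd; rewrite ltr_norml => /andP[+ _]; lra.
have Q1 : 0 <= int a s1 f.
  have <- : int a s1 (fun _ => 0) = 0 by rewrite int_cst// mul0r.
  apply: int_le => //; first exact: contC.
  by move=> s /andP[sa ss]; apply: f0; rewrite sa; lra.
have Q2 : 0 <= int s2 b f.
  have <- : int s2 b (fun _ => 0) = 0 by rewrite int_cst// mul0r.
  apply: int_le => //; first exact: contC.
  by move=> s /andP[sa ss]; apply: f0; rewrite ss andbT; lra.
have : 0 < f t / 2 * (s2 - s1) by rewrite mulr_gt0// subr_gt0.
move: i0; rewrite (@int_chasles a s1 b) ?(@int_chasles s1 s2 b) ?(ltW s12)//; last first.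
  by apply: le_trans s2b; exact: ltW.
lra.
Qed.

Definition jcont (T : topologicalType) (f : T -> R -> R) : Prop :=
  forall p : T * R, ctat (fun p : T * R => f p.1 p.2) p.

(** The tube lemma: joint continuity near each point of the compact segment becomes uniform
    closeness over the whole segment. *)
Lemma jcont_unif (T : topologicalType) (f : T -> R -> R) a b x (e : R) : jcont f -> 0 < e ->
  \forall y \near x, forall t, a <= t <= b -> `|f y t - f x t| <= e.
Proof.
move=> jf e0.
have := (compact_near_coveringP `[a, b]).1 (@segment_compact R a b).
move=> /(_ T (nbhs x) (fun y t => `|f y t - f x t| <= e) _) H.
apply: filterS (H _) => [y hy t tab|]; first by apply: hy; rewrite /= in_itv.
move=> t _.
have e20 : 0 < e / 2 by rewrite divr_gt0.
have : \forall q \near (x, t), `|f x t - f q.1 q.2| < e / 2.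
  have := jf (x, t); rewrite /ctat/prop_for/continuous_at => /cvgrPdist_lt; exact.
move=> [[U1 U2]/= [hU1 hU2] hU].
exists (U2, U1) => //= -[s y]/= [us uy].
have h1 := hU (y, s) (conj uy us).
have h2 := hU (x, s) (conj (nbhs_singleton hU1) us).
rewrite -[_ - _](subrKA (f x t)); apply: le_trans (ler_normD _ _) _.
rewrite distrC; move: h1 h2 => /=; lra.
Qed.

Lemma jcont_cont (T : topologicalType) (f : T -> R -> R) x : jcont f -> cont (f x).
Proof.
move=> jf t.
apply/cvgrPdist_lt => e e0.
have : \forall q \near (x, t), `|f x t - f q.1 q.2| < e.
  have := jf (x, t); rewrite /ctat/prop_for/continuous_at => /cvgrPdist_lt; exact.
move=> [[U1 U2]/= [hU1 hU2] hU]; apply: filterS hU2 => s us.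
exact: (hU (x, s) (conj (nbhs_singleton hU1) us)).
Qed.

Lemma int_param_cont (T : topologicalType) (f : T -> R -> R) a b : a <= b -> jcont f ->
  forall x, ctat (fun x => int a b (f x)) x.
Proof.
move=> ab jf x; apply/cvgrPdist_le => e e0.
pose e' := e / (b - a + 1).
have ba0 : 0 < b - a + 1 by rewrite ltr_wpDl// subr_ge0.
have e'0 : 0 < e' by rewrite divr_gt0.
apply: filterS (jcont_unif a b x jf e'0) => y hy.
have cf z : cont (f z) by exact: jcont_cont.
rewrite -intB//.
apply: le_trans (@int_abs _ _ _ e' ab _ _) _ => [|t tab|].
- by apply: contB.
- by rewrite distrC hy.
rewrite /e' mulrAC ler_pdivrMr// ler_wpM2l ?(ltW e0)//; lra.
Qed.

Lemma int_param_der (f f1 : R -> R -> R) a b s : a <= b ->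
  (forall s t, der (f ^~ t) s (f1 s t)) -> jcont f1 -> (forall s, cont (f s)) ->
  der (fun s => int a b (f s)) s (int a b (f1 s)).
Proof.
move=> ab df jf1 cf; apply/derP => e e0.
pose e' := e / (b - a + 1).
have ba0 : 0 < b - a + 1 by rewrite ltr_wpDl// subr_ge0.
have e'0 : 0 < e' by rewrite divr_gt0.
have /nbhs_normP[d/= d0 hd] := jcont_unif a b s jf1 e'0.
have cf1 z : cont (f1 z) by exact: jcont_cont.
exists d => // h hh.
rewrite -intB// mulrC -intZ// -intB; [|by apply: contB|by apply: contZ].
apply: (@le_trans _ _ (e' * `|h| * (b - a))).
  apply: int_abs => // [|t tab].
    by apply: contB; [apply: contB|apply: contZ].
  (* With the linear part removed, the mean value theorem bounds the remainder by the oscillation of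
     [f1], which is uniform in [t]. *)
  pose g u := f u t - u * f1 s t.
  have -> : f (s + h) t - f s t - h * f1 s t = g (s + h) - g s by rewrite /g; ring.
  have -> : `|h| = `|s + h - s| by rewrite (addrC s) addrK.
  apply: (@mvt_abs _ g (fun u => f1 u t - 1 * f1 s t)).
    by move=> u _; apply: derB => //; apply: der_eq (derM (derI u) (derC (f1 s t) u)) _; ring.
  move=> u hu; rewrite mul1r; apply: hd => //; rewrite /ball_/=.
  apply: le_lt_trans hh.
  move: hu; case: (leP s (s + h)) => h0 /andP[u1 u2].
    rewrite ler0_norm ?subr_le0// ger0_norm; lra.
  rewrite ger0_norm ?subr_ge0// ler0_norm; lra.
rewrite mulrAC ler_wpM2r// /e' mulrAC ler_pdivrMr// ler_wpM2l ?(ltW e0)//; lra.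
Qed.

Lemma riemann a b f (e : R) N : a <= b -> cont f ->
  (forall s t, a <= s <= b -> a <= t <= b -> `|s - t| <= (b - a) / N.+1%:R ->
     `|f s - f t| <= e) ->
  `|int a b f - \sum_(j < N.+1) (b - a) / N.+1%:R * f (a + j%:R * ((b - a) / N.+1%:R))|
     <= e * (b - a).
Proof.
move=> ab cf h; set w := (b - a) / N.+1%:R.
have w0 : 0 <= w by rewrite divr_ge0// subr_ge0.
pose x (j : nat) := a + j%:R * w.
have xS j : x j.+1 = x j + w by rewrite /x -natr1 mulrDl mul1r addrA.
have xN : x N.+1 = b by rewrite /x /w mulrC divfK ?pnatr_eq0// addrC subrK.
have xb j : (j <= N.+1)%N -> a <= x j <= b.
  move=> jN; rewrite lerDl mulr_ge0//= -xN lerD2l ler_wpM2r// ler_nat//.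
have I n : (n <= N.+1)%N -> int a (x n) f = \sum_(j < n) int (x j) (x j.+1) f.
  elim: n => [|n IH] nN.
    by rewrite big_ord0 /x mul0r addr0 /int set_itv1 Rintegral_set1.
  rewrite big_ord_recr/= -IH ?(ltnW nN)//; apply: int_chasles => //.
    by case/andP: (xb n (ltnW nN)).
  by rewrite xS lerDl.
rewrite -{1}xN I// -sumrB.
have -> : e * (b - a) = \sum_(j < N.+1) e * w.
  by rewrite sumr_const card_ord -mulr_natr -mulrA /w divfK// pnatr_eq0.
apply: le_trans (ler_norm_sum _ _ _) _; apply: ler_sum => j _.
have E : w * f (x j) = int (x j) (x j.+1) (fun _ => f (x j)).
  by rewrite int_cst xS ?lerDl// addrAC subrr add0r mulrC.
rewrite -/(x j) E -intB//; last exact: contC.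
have -> : e * w = e * (x j.+1 - x j) by rewrite xS addrAC subrr add0r.
apply: int_abs; [by rewrite xS lerDl|by apply: contB => //; exact: contC|].
move=> t /andP[t1 t2].
have /andP[a1 a2] := xb j (ltnW (ltn_ord j)).
have /andP[b1 b2] := xb j.+1 (ltn_ord j).
apply: h; rewrite ?a1 ?a2//; first by rewrite (le_trans a1)//= (le_trans t2).
by rewrite ger0_norm ?subr_ge0//; move: t2; rewrite xS; rewrite -/w; lra.
Qed.

End Int.

(** * Continuous functions on the unit sphere and their integrals *)

Section SCont.
Variables (R : realType) (m : nat).
Notation vec := 'rV[R]_m.
Implicit Types (F G : vec -> R).

Definition sph : set vec := [set x | enorm x = 1].
(** Continuity in the subspace topology: far fields are controlled only at unit vectors, and their
    values elsewhere are arbitrary. *)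
Definition scont F : Prop := forall x : subspace sph, ctat (F : subspace sph -> R) x.

Lemma scontP F : scont F <-> forall x, sph x -> forall e : R, 0 < e ->
  exists2 d : R, 0 < d & forall y, sph y -> `|y - x| < d -> `|F y - F x| < e.
Proof.
have E : scont F <-> {within sph, continuous F} by [].
rewrite E; split.
  move=> /subspace_continuousP H x sx e e0.
  have /cvgrPdist_lt/(_ _ e0) := H x sx.
  rewrite /within/= => /nbhs_normP[d/= d0 hd]; exists d => // y sy yx.
  by rewrite distrC; apply: hd => //; rewrite /ball_/= distrC.
move=> H; apply/subspace_continuousP => x sx; apply/cvgrPdist_lt => e e0.
have [d d0 hd] := H x sx e e0.
have : nbhs (x : vec) [set y | sph y -> `|F x - F y| < e].
  by apply/nbhs_vec; exists d => //= y yx sy; rewrite distrC; exact: hd.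
by [].
Qed.

Lemma scont_comp (T : topologicalType) F (g : T -> vec) t : scont F ->
  (forall s, sph (g s)) -> {for t, continuous g} -> ctat (fun s => F (g s)) t.
Proof.
move=> /scontP sF hg cg; apply/cvgrPdist_lt => e e0.
have [d d0 hd] := sF _ (hg t) _ e0.
have : \forall s \near t, `|g s - g t| < d.
  move/cvgrPdist_lt : cg => /(_ _ d0); apply: filterS => s; by rewrite distrC.
by apply: filterS => s hs; rewrite distrC; exact: hd.
Qed.

Lemma scontD F G : scont F -> scont G -> scont (fun y => F y + G y).
Proof. by move=> hf hg t; exact: (ctD (hf t) (hg t)). Qed.
Lemma scontM F G : scont F -> scont G -> scont (fun y => F y * G y).
Proof. by move=> hf hg t; exact: (ctM (hf t) (hg t)). Qed.
Lemma scontB F G : scont F -> scont G -> scont (fun y => F y - G y).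
Proof. by move=> hf hg t; exact: (ctB (hf t) (hg t)). Qed.
Lemma scontN F : scont F -> scont (fun y => - F y).
Proof. by move=> hf t; exact: (ctN (hf t)). Qed.
Lemma scontC c : scont (fun y => c).
Proof. by move=> t; exact: ctC. Qed.
Lemma scontZ c F : scont F -> scont (fun y => c * F y).
Proof. by move=> hf; apply: scontM => //; exact: scontC. Qed.
Lemma scont_abs F : scont F -> scont (fun y => `|F y|).
Proof. by move=> hf t; exact: (ct_abs (hf t)). Qed.
Lemma scontX F n : scont F -> scont (fun y => F y ^+ n).
Proof.
move=> hf; elim: n => [|n IH]; first exact: scontC.
by under eq_fun do rewrite exprS; exact: scontM.
Qed.
Lemma scont_fun (f : R -> R) F : (forall t, ctat f t) -> scont F -> scont (fun y => f (F y)).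
Proof. by move=> hf hF t; apply: (ct_comp (hF t)); exact: hf. Qed.
Lemma cont_scont F : (forall x, ctat F x) -> scont F.
Proof.
move=> h; apply/scontP => x _ e e0.
by have [d d0 hd] := (ctP F x).1 (h x) e e0; exists d => // y _; exact: hd.
Qed.
Lemma scont_ext F G : (forall x, sph x -> F x = G x) -> scont F -> scont G.
Proof.
move=> h /scontP hF; apply/scontP => x sx e e0; have [d d0 hd] := hF x sx e e0.
by exists d => // y sy yx; rewrite -!h//; exact: hd.
Qed.
(** Closure under uniform limits is how continuity of far fields is obtained, since it is not among
    the data. *)
Lemma scont_lim F : (forall e : R, 0 < e -> exists2 G, scont G & forall x, sph x -> `|F x - G x| <= e) ->
  scont F.
Proof.
move=> h; apply/scontP => x sx e e0.
have e3 : 0 < e / 4 by rewrite divr_gt0.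
have [G /scontP sG hG] := h _ e3.
have [d d0 hd] := sG x sx _ e3; exists d => // y sy yx.
rewrite -[_ - _](subrKA (G y)); apply: le_lt_trans (ler_normD _ _) _.
rewrite -[G y - _](subrKA (G x)).
apply: le_lt_trans (lerD (lexx _) (ler_normD _ _)) _.
have := hG y sy; have := hd y sy yx; have := hG x sx; rewrite (distrC (F x)); lra.
Qed.
Lemma scont_dot a : scont (fun y => dotv a y).
Proof. by apply: cont_scont => x; under eq_fun do rewrite dotvC; exact: dotv_cont. Qed.

Lemma ct_row (T : topologicalType) (g : T -> vec) t :
  (forall i, ctat (fun s => g s 0 i) t) -> {for t, continuous g}.
Proof.
move=> h; apply/cvgrPdist_lt => e e0.
have e20 : 0 < e / 2 by rewrite divr_gt0.
have H i : \forall s \near t, `|g t 0 i - g s 0 i| < e / 2.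
  have /cvgrPdist_lt := h i; exact.
have : \forall s \near t, forall i, i \in enum 'I_m -> `|g t 0 i - g s 0 i| < e / 2.
  elim: (enum 'I_m) => [|i r IH]; first by apply: filterE.
  near=> s; move=> j; rewrite inE => /orP[/eqP ->|].
    by near: s; exact: H.
  by move: j; near: s.
apply: filterS => s hs; apply: (@le_lt_trans _ _ (e / 2)); last by rewrite ltr_pdivrMr// ltr_pMr// ltr1n.
apply/normv_leP; first exact: ltW.
by move=> i; rewrite !mxE; apply: ltW; apply: hs; rewrite mem_enum.
Unshelve. all: by end_near. Qed.

Lemma ct_scale (T : topologicalType) (f : T -> R) (g : T -> vec) t : ctat f t ->
  {for t, continuous g} -> {for t, continuous (fun s => f s *: g s)}.
Proof. by move=> ? ?; exact: cvgZ. Qed.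
End SCont.

Section Circ.
Variable R : realType.
Notation vec2 := 'rV[R]_2.
Notation vec3 := 'rV[R]_3.

Lemma circ0 (t : R) : circ_pt 2 t 0 0 = cos t. Proof. by rewrite mxE. Qed.
Lemma circ1 (t : R) : circ_pt 2 t 0 1 = sin t. Proof. by rewrite mxE. Qed.
Lemma circ_sph (t : R) : sph (circ_pt 2 t).
Proof.
by rewrite /sph/= /enorm /dotv !big_ord_recl big_ord0 addr0 !mxE/= -!expr2 cos2Dsin2 sqrtr1.
Qed.
Lemma ord2P (i : 'I_2) : i = 0 \/ i = 1.
Proof. by case: i => -[|[|//]] h; [left|right]; apply/val_inj. Qed.
Lemma circ_ct t : {for t, continuous (fun t : R => circ_pt 2 t)}.
Proof.
apply: ct_row => i; case: (ord2P i) => ->.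
  by under eq_fun do rewrite circ0; exact: cont_cos.
by under eq_fun do rewrite circ1; exact: cont_sin.
Qed.
Lemma sph0 (a b : R) : sph_pt 3 a b 0 0 = sin a * cos b. Proof. by rewrite mxE. Qed.
Lemma sph1 (a b : R) : sph_pt 3 a b 0 1 = sin a * sin b. Proof. by rewrite mxE. Qed.
Lemma sph2 (a b : R) : sph_pt 3 a b 0 2 = cos a. Proof. by rewrite mxE. Qed.
Lemma ord3P (i : 'I_3) : [\/ i = 0, i = 1 | i = 2].
Proof. by case: i => -[|[|[|//]]] h; [apply: Or31|apply: Or32|apply: Or33]; apply/val_inj. Qed.
Lemma sph_sph (a b : R) : sph (sph_pt 3 a b).
Proof.
rewrite /sph/= /enorm /dotv !big_ord_recl big_ord0 addr0 !mxE/=.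
rewrite (_ : _ + _ = 1) ?sqrtr1//.
have := cos2Dsin2 a; have := cos2Dsin2 b => h1 h2.
transitivity (sin a ^+ 2 * (cos b ^+ 2 + sin b ^+ 2) + cos a ^+ 2); first by ring.
by rewrite h1 mulr1 addrC.
Qed.
Lemma ct_fst (T1 T2 : topologicalType) (f : T1 -> R) (p : T1 * T2) : ctat f p.1 ->
  ctat (fun q : T1 * T2 => f q.1) p.
Proof. by move=> h; apply: (cvg_comp _ _ (@cvg_fst _ _ (nbhs p.1) (nbhs p.2) _)). Qed.
Lemma ct_snd (T1 T2 : topologicalType) (f : T2 -> R) (p : T1 * T2) : ctat f p.2 ->
  ctat (fun q : T1 * T2 => f q.2) p.
Proof. by move=> h; apply: (cvg_comp _ _ (@cvg_snd _ _ (nbhs p.1) (nbhs p.2) _)). Qed.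
Lemma sph_ct (p : R * R) : {for p, continuous (fun q : R * R => sph_pt 3 q.1 q.2)}.
Proof.
apply: ct_row => i; case: (ord3P i) => ->.
- under eq_fun do rewrite sph0; apply: ctM.
    by apply: (ct_fst (f := @sin R)); exact: cont_sin.
  by apply: (ct_snd (f := @cos R)); exact: cont_cos.
- under eq_fun do rewrite sph1; apply: ctM.
    by apply: (ct_fst (f := @sin R)); exact: cont_sin.
  by apply: (ct_snd (f := @sin R)); exact: cont_sin.
- under eq_fun do rewrite sph2.
  by apply: (ct_fst (f := @cos R)); exact: cont_cos.
Qed.

Lemma sphere_int2 (F : vec2 -> R) :
  sphere_int F = int 0 (2 * pi) (fun t => F (circ_pt 2 t)).
Proof. by []. Qed.
Lemma sphere_int3 (F : vec3 -> R) :
  sphere_int F = int 0 pi (fun a => int 0 (2 * pi) (fun b => F (sph_pt 3 a b) * sin a)).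
Proof. by []. Qed.

Lemma cont_circ (F : vec2 -> R) : scont F -> cont (fun t => F (circ_pt 2 t)).
Proof. by move=> hF t; apply: scont_comp => //; [exact: circ_sph|exact: circ_ct]. Qed.
Lemma jcont_sph (F : vec3 -> R) : scont F -> jcont (fun a b => F (sph_pt 3 a b) * sin a).
Proof.
move=> hF p; apply: ctM.
  by apply: (scont_comp (g := fun q : R * R => sph_pt 3 q.1 q.2)) => // [q|]; [exact: sph_sph|exact: sph_ct].
by apply: (ct_fst (f := @sin R)); exact: cont_sin.
Qed.
Lemma cont_sph_in (F : vec3 -> R) a : scont F -> cont (fun b => F (sph_pt 3 a b) * sin a).
Proof. by move=> hF; apply: (jcont_cont (f := fun a b => F (sph_pt 3 a b) * sin a)); exact: jcont_sph. Qed.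
Lemma pi2_ge0 : 0 <= 2 * pi :> R. Proof. by rewrite mulr_ge0// pi_ge0. Qed.
Lemma cont_sph_out (F : vec3 -> R) : scont F ->
  cont (fun a => int 0 (2 * pi) (fun b => F (sph_pt 3 a b) * sin a)).
Proof. by move=> hF t; apply: int_param_cont; [exact: pi2_ge0|exact: jcont_sph]. Qed.
End Circ.

Opaque sphere_int.

Section Sphere.
Variables (R : realType) (m : nat).
Hypothesis hm : m = 2%N \/ m = 3%N.
Notation vec := 'rV[R]_m.
Implicit Types (F G : vec -> R).

Lemma sig_ext F G : (forall x, sph x -> F x = G x) -> sphere_int F = sphere_int G.
Proof.
move: F G; case: hm => -> F G h.
  by rewrite !sphere_int2; apply: int_ext => t _; apply: h; exact: circ_sph.
rewrite !sphere_int3; apply: int_ext => a _; apply: int_ext => b _; rewrite h//; exact: sph_sph.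
Qed.
Lemma sigD F G : scont F -> scont G ->
  sphere_int (fun x => F x + G x) = sphere_int F + sphere_int G.
Proof.
move: F G; case: hm => -> F G hF hG.
  by rewrite !sphere_int2 intD//; exact: cont_circ.
rewrite !sphere_int3 -intD; try exact: cont_sph_out.
apply: int_ext => a _; rewrite -intD; try exact: cont_sph_in.
by apply: int_ext => b _; rewrite mulrDl.
Qed.
Lemma sigZ c F : scont F -> sphere_int (fun x => c * F x) = c * sphere_int F.
Proof.
move: F; case: hm => -> F hF.
  by rewrite !sphere_int2 intZ//; exact: cont_circ.
rewrite !sphere_int3 -intZ; try exact: cont_sph_out.
apply: int_ext => a _; rewrite -intZ; try exact: cont_sph_in.
by apply: int_ext => b _; rewrite mulrA.
Qed.
Lemma sigB F G : scont F -> scont G ->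
  sphere_int (fun x => F x - G x) = sphere_int F - sphere_int G.
Proof.
move=> hF hG; rewrite (@sig_ext _ (fun x => F x + -1 * G x)).
  by rewrite (sigD hF (@scontZ _ _ (-1) _ hG)) (sigZ (-1) hG) mulN1r.
by move=> x _; rewrite mulN1r.
Qed.
Lemma sig_le F G : scont F -> scont G -> (forall x, sph x -> F x <= G x) ->
  sphere_int F <= sphere_int G.
Proof.
move: F G; case: hm => -> F G hF hG h.
  rewrite !sphere_int2; apply: int_le; [exact: cont_circ|exact: cont_circ|].
  by move=> t _; apply: h; exact: circ_sph.
rewrite !sphere_int3; apply: int_le; try exact: cont_sph_out.
move=> a a0; apply: int_le; try exact: cont_sph_in.
move=> b _; rewrite ler_wpM2r//; last by apply: h; exact: sph_sph.
by apply: sin_ge0_pi.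
Qed.
Definition sig1 : R := @sphere_int R m (fun _ => 1).
Lemma sig1_gt0 : 0 < sig1.
Proof.
rewrite /sig1; case: hm => ->.
  by rewrite sphere_int2 int_cst ?pi2_ge0// mul1r subr0 mulr_gt0// pi_gt0.
rewrite sphere_int3.
rewrite (int_ext (g := fun a => (2 * pi) * sin a)).
  rewrite intZ; last exact: cont_sin.
  rewrite (int_FTC (F := fun a => - cos a)) ?pi_ge0//; last exact: cont_sin.
    rewrite cos0 cospi; apply: mulr_gt0; last by lra.
    by rewrite mulr_gt0// pi_gt0.
  by move=> t; rewrite -[sin t]opprK; apply: derN; exact: is_derive_cos.
by move=> a _; rewrite int_cst ?pi2_ge0// subr0 mul1r mulrC.
Qed.
Lemma sig_cst c : @sphere_int R m (fun _ => c) = c * sig1.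
Proof.
rewrite /sig1 -sigZ; last exact: scontC.
by apply: sig_ext => x _; rewrite mulr1.
Qed.
Lemma sig_abs F c : scont F -> (forall x, sph x -> `|F x| <= c) -> `|sphere_int F| <= c * sig1.
Proof.
move=> hF h; rewrite ler_norml -mulNr -!sig_cst; apply/andP; split; apply: sig_le => //;
  try exact: scontC; by move=> x /h; rewrite ler_norml => /andP[].
Qed.
Lemma sig_ct (T : topologicalType) (F : T -> vec -> R) t : (forall s, scont (F s)) ->
  (forall e : R, 0 < e -> \forall s \near t, forall x, sph x -> `|F s x - F t x| <= e) ->
  ctat (fun s => sphere_int (F s)) t.
Proof.
move=> hF h; apply/cvgrPdist_le => e e0.
have e1 : 0 < e / sig1 by rewrite divr_gt0// sig1_gt0.
apply: filterS (h _ e1) => s hs; rewrite distrC -sigB//.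
apply: le_trans (sig_abs _ hs) _; first exact: scontB.
by rewrite divfK// gt_eqF// sig1_gt0.
Qed.

Lemma sig_der (F F1 : R -> vec -> R) s : (forall s, scont (F s)) -> scont (F1 s) ->
  (forall e : R, 0 < e -> exists2 d : R, 0 < d & forall h x, `|h| < d -> sph x ->
     `|F (s + h) x - F s x - F1 s x * h| <= e * `|h|) ->
  der (fun s => sphere_int (F s)) s (sphere_int (F1 s)).
Proof.
move=> hF hF1 H; apply/derP => e e0.
have e1 : 0 < e / sig1 by rewrite divr_gt0// sig1_gt0.
have [d d0 hd] := H _ e1; exists d => // h hh.
rewrite -sigB// mulrC -sigZ// -sigB; [|exact: scontB|exact: scontZ].
apply: le_trans (@sig_abs _ (e / sig1 * `|h|) _ _) _.
- by apply: scontB; [exact: scontB|exact: scontZ].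
- by move=> x sx; rewrite (mulrC h); exact: hd.
- by rewrite mulrAC divfK// gt_eqF// sig1_gt0.
Qed.

End Sphere.

Section Pos.
Variable R : realType.

Lemma circle_angle (u v : R) : u ^+ 2 + v ^+ 2 = 1 ->
  exists2 t, 0 <= t <= 2 * pi & u = cos t /\ v = sin t.
Proof.
move=> h.
have u1 : -1 <= u <= 1.
  by rewrite -ler_norml -(expr_le1 (n := 2))// real_normK ?num_real// -h lerDl sqr_ge0.
have s2 : Num.sqrt (1 - u ^+ 2) = `|v| by rewrite -h addrAC subrr add0r sqrtr_sqr.
have a0 := acos_ge0 u1; have api := acos_lepi u1.
have [v0|v0] := leP 0 v.
  exists (acos u); first by rewrite a0/=; have := pi_ge0 R; lra.
  by rewrite acosK// sin_acos// s2 ger0_norm.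
(* [acos] only reaches the upper half circle; reflection covers v < 0. *)
exists (2 * pi - acos u); first by apply/andP; split; lra.
rewrite [2 * _]mulr_natl cosB sinB cos2pi sin2pi acosK// sin_acos// s2 ltr0_norm//; split; ring.
Qed.

Lemma circ_surj (x : 'rV[R]_2) : sph x -> exists2 t, 0 <= t <= 2 * pi & x = circ_pt 2 t.
Proof.
rewrite /sph/= => h; have := enorm_sqr x.
rewrite h expr1n /dotv !big_ord_recl big_ord0 addr0 => /esym H.
have {}H : x 0 0 ^+ 2 + x 0 1 ^+ 2 = 1.
  by rewrite !expr2 -[RHS]H; congr (_ + x 0 _ * x 0 _); apply/val_inj.
have [t t0 [e1 e2]] := circle_angle H.
by exists t => //; apply/rowP => i; case: (ord2P i) => ->; rewrite ?circ0 ?circ1.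
Qed.

Lemma sph_surj (x : 'rV[R]_3) : sph x ->
  exists2 a, 0 <= a <= pi & exists2 b, 0 <= b <= 2 * pi & x = sph_pt 3 a b.
Proof.
rewrite /sph/= => h; have := enorm_sqr x.
rewrite h expr1n /dotv !big_ord_recl big_ord0 addr0 => /esym H.
have {}H : x 0 0 ^+ 2 + (x 0 1 ^+ 2 + x 0 2 ^+ 2) = 1.
  by rewrite !expr2 -[RHS]H; congr (_ + (x 0 _ * x 0 _ + x 0 _ * x 0 _)); apply/val_inj.
have u1 : -1 <= x 0 2 <= 1.
  by rewrite -ler_norml -(expr_le1 (n := 2))// real_normK ?num_real//;
    have := sqr_ge0 (x 0 0); have := sqr_ge0 (x 0 1); lra.
exists (acos (x 0 2)); first by rewrite acos_ge0// acos_lepi.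
have sa := sin_acos u1; set s := sin _ in sa.
have s2 : s ^+ 2 = x 0 0 ^+ 2 + x 0 1 ^+ 2.
  rewrite sa sqr_sqrtr; first by rewrite -H; ring.
  by have := sqr_ge0 (x 0 0); have := sqr_ge0 (x 0 1); lra.
(* At a pole every longitude represents the point, and 0 is chosen; elsewhere the horizontal part is
   normalised by the sine of the polar angle. *)
have [s0|s0] := eqVneq s 0.
  exists 0; first by rewrite lexx pi2_ge0.
  move: s2; rewrite s0 expr0n/= => /esym s2.
  have x0 : x 0 0 = 0.
    apply/eqP; rewrite -sqrf_eq0; apply/eqP; have := sqr_ge0 (x 0 0); have := sqr_ge0 (x 0 1); lra.
  have x1 : x 0 1 = 0.
    apply/eqP; rewrite -sqrf_eq0; apply/eqP; have := sqr_ge0 (x 0 0); have := sqr_ge0 (x 0 1); lra.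
  by apply/rowP => i; case: (ord3P i) => ->; rewrite ?sph0 ?sph1 ?sph2 -?/s ?s0 ?mul0r ?acosK.
have H1 : (x 0 0 / s) ^+ 2 + (x 0 1 / s) ^+ 2 = 1.
  by rewrite !exprMn -mulrDl -s2 exprVn divff// sqrf_eq0.
have [t t0 [e1 e2]] := circle_angle H1.
exists t => //.
apply/rowP => i; case: (ord3P i) => ->; rewrite ?sph0 ?sph1 ?sph2 -?/s ?acosK//.
  by rewrite -e1 mulrC divfK.
by rewrite -e2 mulrC divfK.
Qed.

Lemma cont_zero_ends (g : R -> R) (a b : R) : a < b -> cont g ->
  (forall t, a < t < b -> g t = 0) -> forall t, a <= t <= b -> g t = 0.
Proof.
move=> ab cg h t /andP[at1 tb]; apply/eqP/negPn/negP => gt.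
have g0 : 0 < `|g t| by rewrite normr_gt0.
have [d d0 hd] := (ctP g t).1 (cg t) _ g0.
have q0 : 0 < Num.min (d / 2) ((b - a) / 4) by rewrite lt_min !divr_gt0// subr_gt0.
have q1 : Num.min (d / 2) ((b - a) / 4) <= d / 2 by rewrite ge_min lexx.
have q2 : Num.min (d / 2) ((b - a) / 4) <= (b - a) / 4 by rewrite ge_min lexx orbT.
move: (Num.min _ _) q0 q1 q2 => q q0 q1 q2.
have [s [s1 s2 s3]] : exists s, [/\ `|s - t| < d, a < s & s < b].
  have [tm|tm] := ltP t ((a + b) / 2).
    exists (t + q); rewrite addrAC subrr add0r gtr0_norm//; split; lra.
  exists (t - q); rewrite addrAC subrr add0r normrN gtr0_norm//; split; lra.
by have := hd s s1; rewrite h ?s2// sub0r normrN ltxx.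
Qed.

End Pos.

Section SigPos.
Variables (R : realType) (m : nat).
Hypothesis hm : m = 2%N \/ m = 3%N.

(** In space the weight [sin a] hides the values at the poles; there the vanishing is recovered by
    continuity, through [cont_zero_ends]. *)
Lemma sig_pos0 (F : 'rV[R]_m -> R) : scont F -> (forall x, sph x -> 0 <= F x) ->
  sphere_int F = 0 -> forall x, sph x -> F x = 0.
Proof.
move: F; case: hm => -> F hF h.
  rewrite sphere_int2 => i0 x /circ_surj[t t0 ->].
  apply: (int_pos0 _ (cont_circ hF) _ i0) => //; first by rewrite mulr_gt0// pi_gt0.
  by move=> s _; apply: h; exact: circ_sph.
rewrite sphere_int3 => i0 x /sph_surj[a a0 [b b0 ->]].
have H1 : forall a, 0 <= a <= pi -> int 0 (2 * pi) (fun b => F (sph_pt 3 a b) * sin a) = 0.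
  apply: (int_pos0 (pi_gt0 R) (cont_sph_out hF) _ i0) => s s0.
  apply: (@le_trans _ _ (int 0 (2 * pi) (fun _ => 0))); first by rewrite int_cst ?mul0r// pi2_ge0.
  apply: int_le; [exact: contC|exact: cont_sph_in|move=> t _].
  by rewrite mulr_ge0 ?sin_ge0_pi// h//; exact: sph_sph.
have H2 a' : 0 < a' < pi -> F (sph_pt 3 a' b) = 0.
  move=> /[dup] a'0 /andP[/ltW q1 /ltW q2].
  have q : 0 <= a' <= pi by rewrite q1.
  have p2 : 0 < 2 * pi :> R by rewrite mulr_gt0// pi_gt0.
  have P t : 0 <= t <= 2 * pi -> 0 <= F (sph_pt 3 a' t) * sin a'.
    by move=> _; rewrite mulr_ge0 ?sin_ge0_pi// h//; exact: sph_sph.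
  have /eqP := int_pos0 p2 (cont_sph_in hF) P (H1 _ q) b0.
  by rewrite mulf_eq0 (gt_eqF (sin_gt0_pi a'0)) orbF => /eqP.
apply: (cont_zero_ends (pi_gt0 R) (g := fun a => F (sph_pt 3 a b))) => // t.
apply: (scont_comp (g := fun s : R => sph_pt 3 s b)) => // [s|]; first exact: sph_sph.
apply: ct_row => i; case: (ord3P i) => ->.
- under eq_fun do rewrite sph0; apply: ctM; [exact: cont_sin|exact: ctC].
- under eq_fun do rewrite sph1; apply: ctM; [exact: cont_sin|exact: ctC].
- under eq_fun do rewrite sph2; exact: cont_cos.
Qed.

Lemma sin_lip (s t : R) : `|sin s - sin t| <= `|s - t|.
Proof.
rewrite -[leRHS]mul1r; apply: (@mvt_abs _ _ (fun t => cos t)) => x _; last exact: cos_max.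
exact: is_derive_sin.
Qed.
Lemma cos_lip (s t : R) : `|cos s - cos t| <= `|s - t|.
Proof.
rewrite -[leRHS]mul1r; apply: (@mvt_abs _ _ (fun t => - sin t)) => x _; last by rewrite normrN; exact: sin_max.
exact: is_derive_cos.
Qed.

Lemma circ_lip (s t : R) : `|circ_pt 2 s - circ_pt 2 t| <= `|s - t|.
Proof.
apply/normv_leP => // i; case: (ord2P i) => ->; rewrite mxE [X in _ + X]mxE ?circ0 ?circ1.
  exact: cos_lip.
exact: sin_lip.
Qed.
Lemma prod_lip (a b c d : R) : `|a| <= 1 -> `|d| <= 1 -> `|a * b - c * d| <= `|a - c| + `|b - d|.
Proof.
move=> a1 d1; have -> : a * b - c * d = a * (b - d) + (a - c) * d by ring.
apply: le_trans (ler_normD _ _) _; rewrite addrC !normrM lerD//.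
  by rewrite -[leRHS]mulr1 ler_wpM2l.
by rewrite -[leRHS]mul1r ler_wpM2r.
Qed.
Lemma sph_lip (a b a' b' : R) : `|sph_pt 3 a b - sph_pt 3 a' b'| <= `|a - a'| + `|b - b'|.
Proof.
apply/normv_leP => [|i]; first exact: addr_ge0.
case: (ord3P i) => ->; rewrite mxE [X in _ + X]mxE ?sph0 ?sph1 ?sph2.
- apply: le_trans (prod_lip _ _ (sin_max _) (cos_max _)) _.
  by apply: lerD; [exact: sin_lip|exact: cos_lip].
- apply: le_trans (prod_lip _ _ (sin_max _) (sin_max _)) _.
  by apply: lerD; [exact: sin_lip|exact: sin_lip].
- by apply: le_trans (cos_lip _ _) _; rewrite lerDl.
Qed.

Lemma archi_mesh (d c : R) : 0 < d -> 0 <= c -> exists N : nat, c / N.+1%:R < d.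
Proof.
move=> d0 c0; exists (Num.truncn (c / d)).
rewrite ltr_pdivrMr// mulrC -ltr_pdivrMr//; exact: truncnS_gt.
Qed.

(** Nodes and weights depend on the moduli [e], [d], [M] alone. One set of nodes can therefore serve
    a whole family of integrands at once. *)
Lemma sig_riemann : exists2 K : R, 0 < K & forall e d M : R, 0 < e -> 0 < d -> 0 < M ->
  exists (I : finType) (w : I -> R) (y : I -> 'rV[R]_m), (forall j, sph (y j)) /\
  forall F : 'rV[R]_m -> R, scont F -> (forall x, sph x -> `|F x| <= M) ->
    (forall x x', sph x -> sph x' -> `|x - x'| < d -> `|F x - F x'| <= e) ->
    `|sphere_int F - \sum_j w j * F (y j)| <= K * e.
Proof.
have pi2 := pi2_ge0 R; have pi0 := pi_ge0 R; have pip := pi_gt0 R.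
case: hm => ->.
  exists (2 * pi); first by rewrite mulr_gt0.
  move=> e d M e0 d0 M0.
  have [N hN] := archi_mesh d0 pi2.
  exists 'I_N.+1, (fun _ => (2 * pi - 0) / N.+1%:R), (fun j : 'I_N.+1 => circ_pt 2 (0 + j%:R * ((2 * pi - 0) / N.+1%:R))).
  split=> [j|F hF _ hd]; first exact: circ_sph.
  rewrite sphere_int2.
  have := @riemann R 0 (2 * pi) (fun t => F (circ_pt 2 t)) e N pi2 (cont_circ hF).
  rewrite subr0 (mulrC _ e); apply => s t _ _ st.
  apply: hd; [exact: circ_sph|exact: circ_sph|].
  by apply: le_lt_trans (circ_lip _ _) _; exact: le_lt_trans st _.
(* The outer sum errs by at most 2e over an area 2 pi^2, the inner sums by e over the same area. *)
exists (6 * pi ^+ 2); first by rewrite mulr_gt0// exprn_gt0.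
move=> e d M e0 d0 M0.
(* The entry e/M pays for the variation of the weight [sin a], which multiplies values of size
   [M]. *)
pose d' := Num.min d (e / M).
have d'0 : 0 < d' by rewrite lt_min d0 divr_gt0.
have [N hN] := archi_mesh d'0 pi2.
have pN : pi / N.+1%:R < d'.
  apply: le_lt_trans hN; rewrite ler_pM2r ?invr_gt0//; lra.
pose wa := (pi - 0 : R) / N.+1%:R; pose wb := (2 * pi - 0 : R) / N.+1%:R.
pose pa (j : nat) := 0 + j%:R * wa; pose pb (j : nat) := 0 + j%:R * wb.
exists ('I_N.+1 * 'I_N.+1)%type, (fun j : 'I_N.+1 * 'I_N.+1 => wa * wb * sin (pa j.1)),
  (fun j : 'I_N.+1 * 'I_N.+1 => sph_pt 3 (pa j.1) (pb j.2)).
split=> [j|F hF hM hd]; first exact: sph_sph.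
have -> : \sum_(j : 'I_N.+1 * 'I_N.+1) wa * wb * sin (pa j.1) * F (sph_pt 3 (pa j.1) (pb j.2)) =
  \sum_(i < N.+1) wa * \sum_(j < N.+1) wb * (F (sph_pt 3 (pa i) (pb j)) * sin (pa i)).
  rewrite -(pair_bigA _ (fun i j : 'I_N.+1 => wa * wb * sin (pa i) * F (sph_pt 3 (pa i) (pb j))))/=.
  by apply: eq_bigr => i _; rewrite mulr_sumr; apply: eq_bigr => j _; ring.
rewrite sphere_int3.
pose h a := int 0 (2 * pi) (fun b => F (sph_pt 3 a b) * sin a).
have A1 : `|int 0 pi h - \sum_(i < N.+1) wa * h (pa i)| <= (2 * e * (2 * pi)) * (pi - 0).
  apply: riemann => //; first exact: cont_sph_out.
  move=> s t _ _ st; rewrite /h -intB; try exact: cont_sph_in.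
  apply: le_trans (@int_abs _ _ _ _ (2 * e) pi2 _ _) _.
  - by apply: contB; exact: cont_sph_in.
  - move=> b _.
    have -> : F (sph_pt 3 s b) * sin s - F (sph_pt 3 t b) * sin t =
      (F (sph_pt 3 s b) - F (sph_pt 3 t b)) * sin s + F (sph_pt 3 t b) * (sin s - sin t) by ring.
    have st' : `|s - t| < d' by apply: le_lt_trans st _; rewrite subr0.
    move: st'; rewrite lt_min => /andP[st1 st2].
    rewrite [2 * e]mulr_natl mulr2n; apply: le_trans (ler_normD _ _) _; rewrite !normrM; apply: lerD.
      rewrite -[leRHS]mulr1; apply: ler_pM => //; last exact: sin_max.
      apply: hd; [exact: sph_sph|exact: sph_sph|].
      by apply: le_lt_trans (sph_lip _ _ _ _) _; rewrite subrr normr0 addr0.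
    apply: (@le_trans _ _ (M * (e / M))); last by rewrite mulrC divfK// gt_eqF.
    apply: ler_pM => //; first by apply: hM; exact: sph_sph.
    by apply: le_trans (sin_lip _ _) _; exact: ltW.
  - by rewrite subr0.
have A2 i : `|h (pa i) - \sum_(j < N.+1) wb * (F (sph_pt 3 (pa i) (pb j)) * sin (pa i))| <= e * (2 * pi).
  have := @riemann R 0 (2 * pi) (fun b => F (sph_pt 3 (pa i) b) * sin (pa i)) e N pi2 (cont_sph_in hF).
  rewrite subr0 /wb; rewrite /pb /wb ?subr0; apply => s t _ _ st.
  rewrite -mulrBl normrM -[leRHS]mulr1; apply: ler_pM => //; last exact: sin_max.
  apply: hd; [exact: sph_sph|exact: sph_sph|].
  apply: le_lt_trans (sph_lip _ _ _ _) _; rewrite subrr normr0 add0r.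
  by apply: le_lt_trans st _; apply: lt_le_trans hN _; rewrite ge_min lexx.
rewrite -[_ - _](subrKA (\sum_(i < N.+1) wa * h (pa i))).
apply: le_trans (ler_normD _ _) _.
have wa0 : 0 <= wa by rewrite divr_ge0// subr0.
have A3 : `|\sum_(i < N.+1) wa * h (pa i) - \sum_(i < N.+1) wa * \sum_(j < N.+1) wb * (F (sph_pt 3 (pa i) (pb j)) * sin (pa i))| <= pi * (e * (2 * pi)).
  rewrite -sumrB; apply: le_trans (ler_norm_sum _ _ _) _.
  apply: (@le_trans _ _ (\sum_(i < N.+1) wa * (e * (2 * pi)))).
    by apply: ler_sum => i _; rewrite -mulrBr normrM ger0_norm// ler_wpM2l.
  have wE : N.+1%:R * wa = pi by rewrite /wa subr0 mulrC divfK// pnatr_eq0.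
  by rewrite sumr_const card_ord -[_ *+ _]mulr_natl mulrA wE.
apply: le_trans (lerD A1 A3) _.
by rewrite le_eqVlt; apply/orP; left; apply/eqP; ring.
Qed.
End SigPos.

Section Unif.
Variable R : realType.
Lemma unif_compact (T U : topologicalType) (K : set U) (f : T -> U -> R) x (e : R) :
  compact K -> 0 < e ->
  (forall u, K u -> ctat (fun p : T * U => f p.1 p.2) (x, u)) ->
  \forall y \near x, forall u, K u -> `|f y u - f x u| <= e.
Proof.
move=> cK e0 jf.
have := (compact_near_coveringP K).1 cK.
move=> /(_ T (nbhs x) (fun y t => `|f y t - f x t| <= e) _) H.
apply: filterS (H _) => [y hy t tab|]; first exact: hy.
move=> t Kt.
have e20 : 0 < e / 2 by rewrite divr_gt0.
have : \forall q \near (x, t), `|f x t - f q.1 q.2| < e / 2.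
  have := jf t Kt; rewrite /ctat/prop_for/continuous_at => /cvgrPdist_lt; exact.
move=> [[U1 U2]/= [hU1 hU2] hU].
exists (U2, U1) => //= -[s y]/= [us uy].
have h1 := hU (y, s) (conj uy us).
have h2 := hU (x, s) (conj (nbhs_singleton hU1) us).
rewrite -[_ - _](subrKA (f x t)); apply: le_trans (ler_normD _ _) _.
rewrite distrC; move: h1 h2 => /=; lra.
Qed.

Lemma ctv_comp (T : topologicalType) m (F : 'rV[R]_m -> R) (g : T -> 'rV[R]_m) t :
  ctat F (g t) -> {for t, continuous g} -> ctat (fun s => F (g s)) t.
Proof. by move=> hF hg; exact: (continuous_comp hg hF). Qed.

Lemma compact_enorm_closed m (A : set 'rV[R]_m) L : closed A ->
  (forall x, A x -> enorm x <= L) -> compact A.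
Proof.
move=> cA hA; apply: bounded_closed_compact => //.
exists L; split; first exact: num_real.
move=> M LM x /hA xL; apply: le_trans (norm_enorm x) _; exact: le_trans xL (ltW LM).
Qed.

Lemma sph_compact m : compact (@sph R m).
Proof.
apply: (@compact_enorm_closed _ _ 1); last by move=> x ->.
have -> : @sph R m = @enorm R m @^-1` [set 1] by [].
by apply: closed_comp; [move=> x _; exact: enorm_cont|exact: closed_eq].
Qed.
Lemma ball_compact m (L : R) : compact [set x : 'rV[R]_m | enorm x <= L].
Proof.
apply: (@compact_enorm_closed _ _ L); last by [].
have -> : [set x : 'rV[R]_m | enorm x <= L] = @enorm R m @^-1` [set t | t <= L] by [].
by apply: closed_comp; [move=> x _; exact: enorm_cont|exact: closed_le].
Qed.
End Unif.

(** * Integration in polar coordinates and integration by parts *)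

Section Vol.
Variables (R : realType) (m : nat).
Hypothesis hm : m = 2%N \/ m = 3%N.
Notation vec := 'rV[R]_m.
Implicit Types (F : vec -> R) (L : R).

(** The integral over the ball of radius [L] about the origin, in polar coordinates. Translation
    invariance is not visible in this form and is proved separately in [vint_shift]. *)
Definition vint L F : R := int 0 L (fun r => r ^+ m.-1 * sphere_int (fun y => F (r *: y))).
Definition Ct F : Prop := forall x, ctat F x.

Lemma CtD F G : Ct F -> Ct G -> Ct (fun x => F x + G x).
Proof. by move=> hF hG x; exact: ctD. Qed.
Lemma CtM F G : Ct F -> Ct G -> Ct (fun x => F x * G x).
Proof. by move=> hF hG x; exact: ctM. Qed.
Lemma CtB F G : Ct F -> Ct G -> Ct (fun x => F x - G x).
Proof. by move=> hF hG x; exact: ctB. Qed.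
Lemma CtC (c : R) : Ct (fun x => c).
Proof. by move=> x; exact: ctC. Qed.
Lemma CtZ c F : Ct F -> Ct (fun x => c * F x).
Proof. by move=> hF; apply: CtM => //; exact: CtC. Qed.
Lemma Ct_sum (I : Type) (r : seq I) (f : I -> vec -> R) : (forall i, Ct (f i)) ->
  Ct (fun y => \sum_(i <- r) f i y).
Proof. by move=> h x; apply: ct_sum => i; exact: h. Qed.
Lemma scale_ct (r : R) (y : vec) : {for (r, y), continuous (fun p : R * vec => p.1 *: p.2)}.
Proof.
by apply: ct_row => i; under eq_fun do rewrite mxE; apply: ctM;
  [apply: (ct_fst (f := fun t : R => t)); exact: cvg_id|
   apply: (ct_snd (f := fun y : vec => y 0 i)); exact: coord_continuous].
Qed.

Lemma Ct_ray F r : Ct F -> scont (fun y => F (r *: y)).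
Proof.
move=> hF; apply: cont_scont => y; apply: ctv_comp; first exact: hF.
by apply: ct_scale; [exact: ctC|exact: cvg_id].
Qed.

Lemma ray_cont F : Ct F -> cont (fun r => sphere_int (fun y => F (r *: y))).
Proof.
move=> hF r; apply: (sig_ct hm); first by move=> s; exact: Ct_ray.
move=> e e0; apply: (@unif_compact R R 'rV[R]_m (@sph R m) (fun r y => F (r *: y)) r e) => //.
  exact: sph_compact.
move=> y _; apply: (ctv_comp (g := fun p : R * vec => p.1 *: p.2)); first exact: hF.
exact: scale_ct.
Qed.
Lemma vcont F : Ct F -> cont (fun r => r ^+ m.-1 * sphere_int (fun y => F (r *: y))).
Proof.
by move=> hF; apply: contM; [apply: contX; exact: contI|exact: ray_cont].
Qed.

Lemma vintD L F G : Ct F -> Ct G -> vint L (fun x => F x + G x) = vint L F + vint L G.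
Proof.
move=> hF hG; rewrite /vint -(intD 0 L (vcont hF) (vcont hG)); apply: int_ext => r _.
by rewrite -mulrDr -(sigD hm (@Ct_ray _ r hF) (@Ct_ray _ r hG)).
Qed.
Lemma vintZ L c F : Ct F -> vint L (fun x => c * F x) = c * vint L F.
Proof.
move=> hF; rewrite /vint -(intZ 0 L c (vcont hF)); apply: int_ext => r _.
by rewrite (sigZ hm c (@Ct_ray _ r hF)) mulrCA.
Qed.
Lemma vint_ext L F G : (forall x, enorm x <= L -> F x = G x) -> vint L F = vint L G.
Proof.
move=> h; apply: int_ext => r /andP[r0 rL]; congr (_ * _); apply: (sig_ext hm) => y sy.
by apply: h; rewrite enormZ sy mulr1 ger0_norm.
Qed.
Lemma vintB L F G : Ct F -> Ct G -> vint L (fun x => F x - G x) = vint L F - vint L G.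
Proof.
move=> hF hG; have E : vint L (fun x => F x - G x) = vint L (fun x => F x + -1 * G x).
  by apply: vint_ext => x _; rewrite mulN1r.
by rewrite E (vintD L hF (@CtZ (-1) _ hG)) (vintZ L (-1) hG) mulN1r.
Qed.
Lemma vint_le L F G : Ct F -> Ct G -> (forall x, enorm x <= L -> F x <= G x) ->
  vint L F <= vint L G.
Proof.
move=> hF hG h; apply: int_le; [exact: vcont|exact: vcont|] => r /andP[r0 rL].
rewrite ler_wpM2l ?exprn_ge0//; apply: (sig_le hm); [exact: Ct_ray|exact: Ct_ray|].
by move=> y sy; apply: h; rewrite enormZ sy mulr1 ger0_norm.
Qed.
(** The volume of the ball times [m], a convenient upper bound. *)
Definition volb L : R := L ^+ m.-1 * sig1 R m * L.
Lemma vint_abs L F c : 0 <= L -> 0 <= c -> Ct F ->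
  (forall x, enorm x <= L -> `|F x| <= c) -> `|vint L F| <= c * volb L.
Proof.
move=> L0 c0 hF h.
have -> : c * volb L = (L ^+ m.-1 * (c * sig1 R m)) * (L - 0) by rewrite /volb; ring.
apply: int_abs => //; first exact: vcont.
move=> r /andP[r0 rL]; rewrite normrM ger0_norm ?exprn_ge0//; apply: ler_pM => //.
- by rewrite exprn_ge0.
- by rewrite lerXn2r// nnegrE.
- apply: (sig_abs hm); first exact: Ct_ray.
  by move=> y sy; apply: h; rewrite enormZ sy mulr1 ger0_norm.
Qed.
Lemma vint_sum L (I : Type) (r : seq I) (f : I -> vec -> R) : (forall i, Ct (f i)) ->
  vint L (fun x => \sum_(i <- r) f i x) = \sum_(i <- r) vint L (f i).
Proof.
move=> h; elim: r => [|i r IH].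
  rewrite big_nil; transitivity (vint L (fun _ => 0 * 0)).
    by apply: vint_ext => x _; rewrite big_nil mulr0.
  by rewrite (@vintZ L 0 (fun _ => 0) (@CtC 0)) mul0r.
rewrite big_cons -IH -(vintD L (h i) (@Ct_sum _ r _ h)).
by apply: vint_ext => x _; rewrite big_cons.
Qed.
Lemma vint_supp L L' F : 0 <= L -> L <= L' -> Ct F ->
  (forall x, L <= enorm x -> F x = 0) -> vint L' F = vint L F.
Proof.
move=> L0 LL hF h; rewrite /vint (int_chasles L0 LL (vcont hF)).
rewrite [X in _ + X](_ : _ = 0) ?addr0//.
rewrite (int_ext (g := fun _ => 0)); first by rewrite int_cst// mul0r.
move=> r /andP[rL _]; rewrite (@sig_ext _ _ hm _ (fun _ => 0)) ?(sig_cst hm) ?mul0r ?mulr0//.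
move=> y sy; apply: h; rewrite enormZ sy mulr1 ger0_norm//; exact: le_trans rL.
Qed.

Definition C1 F (G : 'I_m -> vec -> R) : Prop :=
  (forall i x, isp i F x (G i x)) /\ (forall i, Ct (G i)).
Lemma C1_Ct F G : C1 F G -> Ct F.
Proof.
move=> [h1 h2] x; apply: (C1_ct (G := G)); last by move=> i; exact: h2.
by apply/nbhs_vec; exists 1 => // y _ i; exact: h1.
Qed.
Lemma C1_chain F G (g : R -> vec) g' t : C1 F G ->
  (forall i, der (fun s => g s 0 i) t (g' i)) ->
  der (fun s => F (g s)) t (\sum_i G i (g t) * g' i).
Proof.
move=> [h1 h2] hg; apply: chain_rule => //; last by move=> i; exact: h2.
by apply/nbhs_vec; exists 1 => // y _ i; exact: h1.
Qed.
End Vol.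

(** * Integration by parts in the plane, in polar coordinates *)

Section IBP2.
Variables (R : realType).
Variables (F : 'rV[R]_2 -> R) (G : 'I_2 -> 'rV[R]_2 -> R) (L : R).
Hypotheses (L0 : 0 <= L) (FG : C1 F G) (supp : forall x, L <= enorm x -> F x = 0).
Let hm : 2%N = 2%N \/ 2%N = 3%N :> nat. Proof. by left. Qed.

Let fr r t := \sum_i G i (r *: circ_pt 2 t) * circ_pt 2 t 0 i.
Let ft r t := \sum_(i < 2) G i (r *: circ_pt 2 t) * (r * (if (i : nat) == 0%N then - sin t else cos t)).

Lemma ibp2_circ_ct (p : R * R) : {for p, continuous (fun p : R * R => p.1 *: circ_pt 2 p.2)}.
Proof.
apply: ct_scale; first by apply: (ct_fst (f := fun t : R => t)); exact: cvg_id.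
apply: ct_row => i; case: (ord2P i) => ->.
  by under eq_fun do rewrite circ0; apply: (ct_snd (f := @cos R)); exact: cont_cos.
by under eq_fun do rewrite circ1; apply: (ct_snd (f := @sin R)); exact: cont_sin.
Qed.

Lemma ibp2_der_r r t : der (fun r => F (r *: circ_pt 2 t)) r (fr r t).
Proof.
apply: (C1_chain (g := fun r => r *: circ_pt 2 t)) => // i.
under eq_fun do rewrite mxE.
by apply: der_eq (derM (derI r) (derC _ r)) _; rewrite mulr0 addr0 mul1r.
Qed.
Lemma ibp2_der_t r t : der (fun t => F (r *: circ_pt 2 t)) t (ft r t).
Proof.
apply: (C1_chain (g := fun t => r *: circ_pt 2 t)) => // i.
under eq_fun do rewrite mxE.
apply: derZ; case: (ord2P i) => ->/=.
  by under eq_fun do rewrite circ0; exact: is_derive_cos.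
by under eq_fun do rewrite circ1; exact: is_derive_sin.
Qed.
Lemma ibp2_cF r : cont (fun t => F (r *: circ_pt 2 t)).
Proof. by move=> t; exact: der_cont (ibp2_der_t r t). Qed.
Lemma ibp2_cft r : cont (ft r).
Proof.
move=> t; apply: ct_sum => i; apply: ctM.
  apply: ctv_comp; first exact: FG.2.
  by apply: ct_scale; [exact: ctC|exact: circ_ct].
by apply: ctM; [exact: ctC|case: (ord2P i) => ->/=; [apply: ctN; exact: cont_sin|exact: cont_cos]].
Qed.
Lemma ibp2_jfr : jcont fr.
Proof.
move=> p; apply: ct_sum => i; apply: ctM.
  by apply: (ctv_comp (g := fun p : R * R => p.1 *: circ_pt 2 p.2)); [exact: FG.2|exact: ibp2_circ_ct].
apply: (ct_snd (f := fun t => circ_pt 2 t 0 i)); case: (ord2P i) => ->.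
  by under eq_fun do rewrite circ0; exact: cont_cos.
by under eq_fun do rewrite circ1; exact: cont_sin.
Qed.

(** For w = cos or sin, r d_i F = r w F_r + w' F_t. Since w'' = -w, the periodic angular integration
    turns the integral of w' F_t into that of w F. What remains is the r-derivative of r times the
    angular mean of w F, which vanishes at both ends. *)
Lemma ibp2_w (w w' : R -> R) (i : 'I_2) :
  (forall t, der w t (w' t)) -> (forall t, der w' t (- w t)) ->
  w' 0 = w' (2 * pi) ->
  (forall r t, r * G i (r *: circ_pt 2 t) = r * (w t * fr r t) + w' t * ft r t) ->
  vint L (G i) = 0.
Proof.
move=> dw dw' wper H.
have cw : cont w by move=> t; exact: der_cont (dw t).
have cw' : cont w' by move=> t; exact: der_cont (dw' t).
have jf : jcont (fun r t => w t * fr r t).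
  by move=> p; apply: ctM; [apply: (ct_snd (f := w)); exact: cw|exact: ibp2_jfr].
have cwf r : cont (fun t => w t * fr r t) by exact: (jcont_cont (f := fun r t => w t * fr r t)).
pose mm r := int 0 (2 * pi) (fun t => w t * F (r *: circ_pt 2 t)).
have dm r : der mm r (int 0 (2 * pi) (fun t => w t * fr r t)).
  apply: (@int_param_der _ (fun r t => w t * F (r *: circ_pt 2 t)) (fun r t => w t * fr r t)) => //.
  - exact: pi2_ge0.
  - by move=> s t; apply: derZ; exact: ibp2_der_r.
  - by move=> s; apply: contM => //; exact: ibp2_cF.
have E r : r ^+ 1 * sphere_int (fun y => G i (r *: y)) =
    1 * mm r + r * int 0 (2 * pi) (fun t => w t * fr r t).
  have cG : cont (fun t => G i (r *: circ_pt 2 t)).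
    apply: (@cont_circ _ (fun y => G i (r *: y))); apply: Ct_ray => //; exact: FG.2.
  rewrite expr1 sphere_int2 -intZ//.
  rewrite (int_ext (g := fun t => r * (w t * fr r t) + w' t * ft r t)); last by move=> t _; exact: H.
  rewrite intD; [|exact: contZ|by apply: contM => //; exact: ibp2_cft].
  rewrite intZ// addrC mul1r; congr (_ + _).
  apply/eqP; rewrite -subr_eq0 -intB; [|by apply: contM => //; exact: ibp2_cft|by apply: contM => //; exact: ibp2_cF].
  rewrite (int_FTC (F := fun t => w' t * F (r *: circ_pt 2 t))) ?pi2_ge0//.
  - have -> : circ_pt 2 (2 * pi) = circ_pt 2 0 :> 'rV[R]_2.
      by apply/rowP => j; rewrite !mxE [2 * pi]mulr_natl cos2pi sin2pi cos0 sin0.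
    by rewrite wper subrr.
  - move=> t; apply: der_eq (derM (dw' t) (ibp2_der_t r t)) _; rewrite mulNr addrC; done.
  - by apply: contB; apply: contM => //; [exact: ibp2_cft|exact: ibp2_cF].
rewrite /vint (int_ext (g := fun r => 1 * mm r + r * int 0 (2 * pi) (fun t => w t * fr r t))); last by move=> r _; exact: E.
rewrite (int_FTC (F := fun r => r * mm r))//.
- rewrite mul0r subr0 /mm (int_ext (g := fun _ => 0)) ?int_cst ?pi2_ge0// ?mul0r ?mulr0//.
  move=> t _; rewrite supp ?mulr0// enormZ (circ_sph t) mulr1 ger0_norm//.
- by move=> t; exact: (derM (derI t) (dm t)).
- apply: contD; first by apply: contZ => t; exact: der_cont (dm t).
  apply: contM; first exact: contI.
  by move=> t; apply: int_param_cont => //; exact: pi2_ge0.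
Qed.

Lemma ibp2 i : vint L (G i) = 0.
Proof.
have frE r t : fr r t = G 0 (r *: circ_pt 2 t) * cos t + G 1 (r *: circ_pt 2 t) * sin t.
  rewrite /fr !big_ord_recl big_ord0 addr0 -circ0 -circ1.
  by congr (_ + G _ _ * circ_pt 2 t 0 _); apply/val_inj.
have ftE r t : ft r t = G 0 (r *: circ_pt 2 t) * (r * - sin t) + G 1 (r *: circ_pt 2 t) * (r * cos t).
  rewrite /ft !big_ord_recl big_ord0 addr0/=.
  by congr (_ + G _ _ * _); apply/val_inj.
case: (ord2P i) => ->.
  apply: (@ibp2_w (@cos R) (fun t => - sin t)).
  - exact: is_derive_cos.
  - by move=> t; apply: derN; exact: is_derive_sin.
  - by rewrite [2 * pi]mulr_natl sin2pi sin0.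
  - move=> r t; rewrite frE ftE -{1}[r]mulr1 -(cos2Dsin2 t); ring.
apply: (@ibp2_w (@sin R) (@cos R)).
- exact: is_derive_sin.
- exact: is_derive_cos.
- by rewrite [2 * pi]mulr_natl cos2pi cos0.
- move=> r t; rewrite frE ftE -{1}[r]mulr1 -(cos2Dsin2 t); ring.
Qed.
End IBP2.

Section Pairs.
Variables (T U V : topologicalType).
Lemma ct_pair (f : T -> U) (g : T -> V) t : {for t, continuous f} -> {for t, continuous g} ->
  {for t, continuous (fun s => (f s, g s))}.
Proof.
move=> hf hg A [[B C]/= [hB hC] hBC].
have h1 : \forall s \near t, B (f s) by exact: hf.
have h2 : \forall s \near t, C (g s) by exact: hg.
by apply: filterS2 h1 h2 => s sB sC; exact: (hBC (f s, g s)).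
Qed.
Lemma for_fst (p : U * V) : {for p, continuous (fun q : U * V => q.1)}.
Proof. exact: cvg_fst. Qed.
Lemma for_snd (p : U * V) : {for p, continuous (fun q : U * V => q.2)}.
Proof. exact: cvg_snd. Qed.
Lemma for_cst (u : U) (t : T) : {for t, continuous (fun _ : T => u)}.
Proof. exact: cvg_cst. Qed.
End Pairs.

(** * Integration by parts in space, in spherical coordinates *)

Section IBP3.
Variables (R : realType).
Variables (F : 'rV[R]_3 -> R) (G : 'I_3 -> 'rV[R]_3 -> R) (L : R).
Hypotheses (L0 : 0 <= L) (FG : C1 F G) (supp : forall x, L <= enorm x -> F x = 0).
Let hm : 3%N = 2%N \/ 3%N = 3%N :> nat. Proof. by right. Qed.
Let P (r a b : R) : 'rV[R]_3 := r *: sph_pt 3 a b.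
Let pi2 := pi2_ge0 R.
Let pi0 := pi_ge0 R.

Let fr r a b := G 0 (P r a b) * (sin a * cos b) + G 1 (P r a b) * (sin a * sin b) + G 2 (P r a b) * cos a.
Let fa r a b := r * (G 0 (P r a b) * (cos a * cos b) + G 1 (P r a b) * (cos a * sin b) - G 2 (P r a b) * sin a).
Let fb r a b := r * (- G 0 (P r a b) * (sin a * sin b) + G 1 (P r a b) * (sin a * cos b)).

Lemma sum3 (f : 'I_3 -> R) : \sum_i f i = f 0 + f 1 + f 2.
Proof.
rewrite !big_ord_recl big_ord0 addr0 addrA.
by congr (_ + f _ + f _); apply/val_inj.
Qed.

Lemma ibp3_der_r r a b : der (fun r => F (P r a b)) r (fr r a b).
Proof.
have := @C1_chain R 3 F G (fun r => P r a b) (fun i => sph_pt 3 a b 0 i) r FG.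
rewrite sum3 sph0 sph1 sph2; apply => i.
under eq_fun do rewrite mxE.
by apply: der_eq (derM (derI r) (derC _ r)) _; rewrite mulr0 addr0 mul1r.
Qed.
Lemma ibp3_der_a r a b : der (fun a => F (P r a b)) a (fa r a b).
Proof.
pose g' (i : 'I_3) := r * (if i == 0 then cos a * cos b else if i == 1 then cos a * sin b else - sin a).
have := @C1_chain R 3 F G (fun a => P r a b) g' a FG.
rewrite sum3 /g' /= => H; apply: der_eq (H _) _; last by rewrite /fa; ring.
move=> i; under eq_fun do rewrite mxE; apply: derZ; case: (ord3P i) => ->/=.
- under eq_fun do rewrite sph0.
  by apply: der_eq (derM (is_derive_sin a) (derC _ a)) _; rewrite mulr0 addr0.
- under eq_fun do rewrite sph1.
  by apply: der_eq (derM (is_derive_sin a) (derC _ a)) _; rewrite mulr0 addr0.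
- by under eq_fun do rewrite sph2; exact: is_derive_cos.
Qed.
Lemma ibp3_der_b r a b : der (fun b => F (P r a b)) b (fb r a b).
Proof.
pose g' (i : 'I_3) := r * (if i == 0 then sin a * - sin b else if i == 1 then sin a * cos b else 0).
have := @C1_chain R 3 F G (fun b => P r a b) g' b FG.
rewrite sum3 /g' /= => H; apply: der_eq (H _) _; last by rewrite /fb; ring.
move=> i; under eq_fun do rewrite mxE; apply: derZ; case: (ord3P i) => ->/=.
- by under eq_fun do rewrite sph0; apply: derZ; exact: is_derive_cos.
- by under eq_fun do rewrite sph1; apply: derZ; exact: is_derive_sin.
- by under eq_fun do rewrite sph2; exact: derC.
Qed.

(** Joint continuity with the variables grouped as ((r, a), b), the shape that integration over the
    azimuth [b] requires. *)
Definition JC3 (f : R -> R -> R -> R) : Prop := jcont (fun (q : R * R) b => f q.1 q.2 b).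
Lemma JC3D f g : JC3 f -> JC3 g -> JC3 (fun r a b => f r a b + g r a b).
Proof. by move=> hf hg p; apply: ctD; [exact: hf|exact: hg]. Qed.
Lemma JC3M f g : JC3 f -> JC3 g -> JC3 (fun r a b => f r a b * g r a b).
Proof. by move=> hf hg p; apply: ctM; [exact: hf|exact: hg]. Qed.
Lemma JC3N f : JC3 f -> JC3 (fun r a b => - f r a b).
Proof. by move=> hf p; apply: ctN; exact: hf. Qed.
Lemma JC3_r f : cont f -> JC3 (fun r a b => f r).
Proof.
move=> hf p; apply: (ct_fst (f := fun q : R * R => f q.1)).
by apply: (ct_fst (f := f)); exact: hf.
Qed.
Lemma JC3_a f : cont f -> JC3 (fun r a b => f a).
Proof.
move=> hf p; apply: (ct_fst (f := fun q : R * R => f q.2)).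
by apply: (ct_snd (f := f)); exact: hf.
Qed.
Lemma JC3_b f : cont f -> JC3 (fun r a b => f b).
Proof. by move=> hf p; apply: (ct_snd (f := f)); exact: hf. Qed.
Lemma JC3_P (f : 'rV[R]_3 -> R) : Ct f -> JC3 (fun r a b => f (P r a b)).
Proof.
move=> hf p; apply: (ctv_comp (g := fun p : R * R * R => P p.1.1 p.1.2 p.2)); first exact: hf.
apply: ct_row => i.
rewrite (_ : (fun s : R * R * R => _) = fun p : R * R * R => p.1.1 * sph_pt 3 p.1.2 p.2 0 i); last first.
  by apply/funext => q; rewrite /P mxE.
apply: ctM; first exact: (JC3_r (@contI R)).
case: (ord3P i) => ->.
- by under eq_fun do rewrite sph0; apply: ctM; [exact: (JC3_a (@cont_sin R))|exact: (JC3_b (@cont_cos R))].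
- by under eq_fun do rewrite sph1; apply: ctM; [exact: (JC3_a (@cont_sin R))|exact: (JC3_b (@cont_sin R))].
- by under eq_fun do rewrite sph2; exact: (JC3_a (@cont_cos R)).
Qed.
Let cs := @cont_sin R.
Let cc := @cont_cos R.
Lemma ibp3_JG i : JC3 (fun r a b => G i (P r a b)).
Proof. by apply: JC3_P; exact: FG.2. Qed.
Lemma ibp3_Jfr : JC3 fr.
Proof.
by apply: JC3D; [apply: JC3D|]; (apply: JC3M; [exact: ibp3_JG|]);
  [apply: JC3M; [exact: JC3_a|exact: JC3_b]|apply: JC3M; [exact: JC3_a|exact: JC3_b]|exact: JC3_a].
Qed.
Lemma ibp3_Jfa : JC3 fa.
Proof.
apply: JC3M; first exact: (JC3_r (@contI R)).
apply: JC3D; last by apply: JC3N; apply: JC3M; [exact: ibp3_JG|exact: JC3_a].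
by apply: JC3D; (apply: JC3M; [exact: ibp3_JG|apply: JC3M; [exact: JC3_a|exact: JC3_b]]).
Qed.
Lemma ibp3_Jfb : JC3 fb.
Proof.
apply: JC3M; first exact: (JC3_r (@contI R)).
apply: JC3D; (apply: JC3M; [|apply: JC3M; [exact: JC3_a|exact: JC3_b]]).
  by apply: JC3N; exact: ibp3_JG.
exact: ibp3_JG.
Qed.
Lemma ibp3_JF : JC3 (fun r a b => F (P r a b)).
Proof. by apply: JC3_P; exact: C1_Ct FG. Qed.
Lemma JC3_cont f r a : JC3 f -> cont (f r a).
Proof. by move=> hf; exact: (jcont_cont (f := fun (q : R * R) b => f q.1 q.2 b) (x := (r, a))). Qed.
Lemma JC3_int f c d : c <= d -> JC3 f -> jcont (fun r a => int c d (f r a)).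
Proof.
move=> cd hf p.
by apply: (int_param_cont (f := fun (q : R * R) b => f q.1 q.2 b)).
Qed.
Lemma JC3_jb f r : JC3 f -> jcont (fun a b => f r a b).
Proof.
move=> hf [a b].
have c : {for (a, b), continuous (fun q : R * R => ((r, q.1), q.2))}.
  by apply: ct_pair; [apply: ct_pair; [exact: for_cst|exact: for_fst]|exact: for_snd].
exact: (continuous_comp c (hf ((r, a), b))).
Qed.
(** After integration over the azimuth, [u] and [v] weight the radial and polar derivatives. The
    polar part integrates to zero because [v] vanishes at both poles, and the rest is the
    r-derivative of r^2 times the integral of u p. *)
Lemma ibp3_core (w u v v1 : R -> R) (i : 'I_3) :
  cont w -> cont u -> cont v1 -> (forall t, der v t (v1 t)) -> v 0 = 0 -> v pi = 0 ->
  (forall r a, r ^+ 2 * int 0 (2 * pi) (fun b => G i (P r a b) * sin a) =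
    r ^+ 2 * (u a * int 0 (2 * pi) (fun b => w b * fr r a b))
    + r * (v a * int 0 (2 * pi) (fun b => w b * fa r a b))
    + r * ((2 * u a + v1 a) * int 0 (2 * pi) (fun b => w b * F (P r a b)))) ->
  vint L (G i) = 0.
Proof.
move=> cw cu cv1 dv v0 vpi H.
have cv : cont v by move=> t; exact: der_cont (dv t).
have Jr : JC3 (fun r a b => w b * fr r a b) by apply: JC3M; [exact: JC3_b|exact: ibp3_Jfr].
have Ja : JC3 (fun r a b => w b * fa r a b) by apply: JC3M; [exact: JC3_b|exact: ibp3_Jfa].
have JF : JC3 (fun r a b => w b * F (P r a b)) by apply: JC3M; [exact: JC3_b|exact: ibp3_JF].
pose p r a := int 0 (2 * pi) (fun b => w b * F (P r a b)).
pose pr r a := int 0 (2 * pi) (fun b => w b * fr r a b).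
pose pa r a := int 0 (2 * pi) (fun b => w b * fa r a b).
have jp : jcont p by exact: JC3_int.
have jpr : jcont pr by exact: JC3_int.
have jpa : jcont pa by exact: JC3_int.
have dpr r a : der (fun r => p r a) r (pr r a).
  apply: (@int_param_der _ (fun r b => w b * F (P r a b)) (fun r b => w b * fr r a b)) => //.
  - by move=> s t; apply: derZ; exact: ibp3_der_r.
  - move=> [r0 b0].
    have c : {for (r0, b0), continuous (fun q : R * R => ((q.1, a), q.2))}.
      by apply: ct_pair; [apply: ct_pair; [exact: for_fst|exact: for_cst]|exact: for_snd].
    exact: (continuous_comp c (Jr ((r0, a), b0))).
  - by move=> s; exact: (JC3_cont JF).
have dpa r a : der (fun a => p r a) a (pa r a).
  apply: (@int_param_der _ (fun a b => w b * F (P r a b)) (fun a b => w b * fa r a b)) => //.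
  - by move=> s t; apply: derZ; exact: ibp3_der_a.
  - exact: (JC3_jb Ja).
  - by move=> s; exact: (JC3_cont JF).
pose mm r := int 0 pi (fun a => u a * p r a).
have jup : jcont (fun r a => u a * pr r a).
  by move=> q; apply: ctM; [apply: (ct_snd (f := u)); exact: cu|exact: jpr].
have cp r : cont (p r) by exact: jcont_cont.
have cpr r : cont (pr r) by exact: jcont_cont.
have cpa r : cont (pa r) by exact: jcont_cont.
have dm r : der mm r (int 0 pi (fun a => u a * pr r a)).
  apply: (@int_param_der _ (fun r a => u a * p r a) (fun r a => u a * pr r a)) => //.
  - by move=> s t; apply: derZ; exact: dpr.
  - by move=> s; apply: contM.
have E r : r ^+ 2 * sphere_int (fun y => G i (r *: y)) =
    (2%:R * r ^+ 1 * 1) * mm r + r ^+ 2 * int 0 pi (fun a => u a * pr r a).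
  have sG : scont (fun y => G i (r *: y)) by apply: Ct_ray => //; exact: FG.2.
  rewrite sphere_int3 -intZ; last exact: (cont_sph_out sG).
  rewrite (int_ext (g := fun a => r ^+ 2 * (u a * pr r a) + (r * (2 * (u a * p r a)) + r * (v a * pa r a + v1 a * p r a)))); last first.
    by move=> a _; rewrite H -/(p r a) -/(pr r a) -/(pa r a); ring.
  have c1 : cont (fun a => v a * pa r a + v1 a * p r a) by apply: contD; apply: contM.
  have c2 : cont (fun a => u a * p r a) by apply: contM.
  have c3 : cont (fun a => u a * pr r a) by apply: contM.
  rewrite intD; [|exact: contZ|by apply: contD; apply: contZ => //; exact: contZ].
  rewrite intD; [|by apply: contZ; exact: contZ|exact: contZ].
  rewrite !intZ//; last exact: contZ.
  rewrite (int_FTC (f := fun a => v a * pa r a + v1 a * p r a) (F := fun a => v a * p r a))//.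
    rewrite vpi v0 !mul0r subrr mulr0 addr0 /mm addrC; ring.
  by move=> t; apply: der_eq (derM (dv t) (dpa r t)) _; rewrite addrC.
rewrite /vint (int_ext (g := fun r => (2%:R * r ^+ 1 * 1) * mm r + r ^+ 2 * int 0 pi (fun a => u a * pr r a))); last by move=> r _; exact: E.
rewrite (int_FTC (F := fun r => r ^+ 2 * mm r))//.
- rewrite expr0n mul0r subr0 /mm (int_ext (g := fun _ => 0)) ?int_cst// ?mul0r ?mulr0//.
  move=> a _; rewrite /p (int_ext (g := fun _ => 0)) ?int_cst// ?mul0r ?mulr0//.
  move=> t _; rewrite supp ?mulr0// /P enormZ (sph_sph a t) mulr1 ger0_norm//.
- by move=> t; exact: (derM (derX 2 (derI t)) (dm t)).
- apply: contD; apply: contM.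
  + by apply: contM; [apply: contZ; apply: contX; exact: contI|exact: contC].
  + by move=> t; exact: der_cont (dm t).
  + by apply: contX; exact: contI.
  + by move=> t; apply: int_param_cont.
Qed.

(** Periodic integration by parts in the azimuth, with w'' = -w. *)
Lemma ibp3_phi (w w' : R -> R) r a : (forall t, der w' t (- w t)) -> cont w -> w' 0 = w' (2 * pi) ->
  int 0 (2 * pi) (fun b => w' b * fb r a b) = int 0 (2 * pi) (fun b => w b * F (P r a b)).
Proof.
move=> dw' cw wper.
have cw' : cont w' by move=> t; exact: der_cont (dw' t).
have c1 : cont (fun b => w' b * fb r a b) by apply: contM => //; exact: (JC3_cont ibp3_Jfb).
have c2 : cont (fun b => w b * F (P r a b)) by apply: contM => //; exact: (JC3_cont ibp3_JF).
apply/eqP; rewrite -subr_eq0 -intB//.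
rewrite (int_FTC (F := fun b => w' b * F (P r a b)))//.
- have -> : P r a (2 * pi) = P r a 0.
    by congr (_ *: _); apply/rowP => j; rewrite !mxE [2 * pi]mulr_natl cos2pi sin2pi cos0 sin0.
  by rewrite wper subrr.
- by move=> t; apply: der_eq (derM (dw' t) (ibp3_der_b r a t)) _; rewrite mulNr addrC.
- exact: contB.
Qed.

(** The two horizontal coordinates differ only in the azimuthal factor w = cos or sin. The azimuthal
    term of [ibp3_phi] has coefficient 1, which equals the 2u + v1 = 2 sin^2 + cos^2 - sin^2 that
    [ibp3_core] asks for. *)
Lemma ibp3_horiz (w w' : R -> R) (i : 'I_3) : cont w -> (forall t, der w' t (- w t)) ->
  w' 0 = w' (2 * pi) ->
  (forall r a b, r ^+ 2 * (G i (P r a b) * sin a) = r ^+ 2 * sin a ^+ 2 * (w b * fr r a b)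
     + r * (sin a * cos a) * (w b * fa r a b) + r * (w' b * fb r a b)) ->
  vint L (G i) = 0.
Proof.
move=> cw dw' wper H.
have cw' : cont w' by move=> t; exact: der_cont (dw' t).
apply: (@ibp3_core w (fun a => sin a ^+ 2) (fun a => sin a * cos a)
   (fun a => cos a * cos a + sin a * - sin a)) => //.
- exact: contX.
- by apply: contD; apply: contM => //; apply: contN.
- by move=> t; apply: derM; [exact: is_derive_sin|exact: is_derive_cos].
- by rewrite sin0 mul0r.
- by rewrite sinpi mul0r.
move=> r a.
have c1 : cont (fun b => w b * fr r a b) by apply: contM => //; exact: (JC3_cont ibp3_Jfr).
have c2 : cont (fun b => w b * fa r a b) by apply: contM => //; exact: (JC3_cont ibp3_Jfa).
have c3 : cont (fun b => w' b * fb r a b) by apply: contM => //; exact: (JC3_cont ibp3_Jfb).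
have c4 : cont (fun b => G i (P r a b) * sin a).
  by apply: contM; [have := JC3_cont (r := r) (a := a) (@ibp3_JG i)|exact: contC].
rewrite -intZ// (int_ext (g := fun b => r ^+ 2 * sin a ^+ 2 * (w b * fr r a b)
     + r * (sin a * cos a) * (w b * fa r a b) + r * (w' b * fb r a b))); last by move=> b _; exact: H.
rewrite intD; [|by apply: contD; exact: contZ|exact: contZ].
rewrite intD; [|exact: contZ|exact: contZ].
rewrite !intZ// (ibp3_phi r a dw' cw wper).
have -> : 2 * sin a ^+ 2 + (cos a * cos a + sin a * - sin a) = 1.
  by transitivity (cos a ^+ 2 + sin a ^+ 2); [ring|exact: cos2Dsin2].
by rewrite mul1r !mulrA.
Qed.

Lemma ibp3 i : vint L (G i) = 0.
Proof.
case: (ord3P i) => ->.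
- apply: (@ibp3_horiz (@cos R) (fun t => - sin t)) => //.
  + by move=> t; apply: derN; exact: is_derive_sin.
  + by rewrite [2 * pi]mulr_natl sin2pi sin0.
  + move=> r a b; rewrite /fr /fa /fb.
    transitivity (r ^+ 2 * G 0 (P r a b) * sin a * (cos b ^+ 2 * (cos a ^+ 2 + sin a ^+ 2) + sin b ^+ 2)).
      by rewrite cos2Dsin2 mulr1 cos2Dsin2; ring.
    transitivity (r ^+ 2 * G 0 (P r a b) * sin a * (cos b ^+ 2 * (cos a ^+ 2 + sin a ^+ 2) + sin b ^+ 2)
      + r ^+ 2 * G 1 (P r a b) * sin a * sin b * cos b * (cos a ^+ 2 + sin a ^+ 2 - 1)).
      by rewrite (cos2Dsin2 a) subrr mulr0 addr0.
    by ring.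
- apply: (@ibp3_horiz (@sin R) (@cos R)) => //.
  + exact: is_derive_cos.
  + by rewrite [2 * pi]mulr_natl cos2pi cos0.
  + move=> r a b; rewrite /fr /fa /fb.
    transitivity (r ^+ 2 * G 1 (P r a b) * sin a * (sin b ^+ 2 * (cos a ^+ 2 + sin a ^+ 2) + cos b ^+ 2)
      + r ^+ 2 * G 0 (P r a b) * sin a * sin b * cos b * (cos a ^+ 2 + sin a ^+ 2 - 1)).
      rewrite (cos2Dsin2 a) subrr mulr0 addr0 mulr1 [sin b ^+ 2 + _]addrC (cos2Dsin2 b); ring.
    by ring.
(* The vertical derivative has no azimuthal component, and 2u + v1 = 0 for u = sin cos, v =
   -sin^2. *)
- apply: (@ibp3_core (fun _ => 1) (fun a => sin a * cos a) (fun a => - sin a ^+ 2)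
    (fun a => - (2%:R * sin a ^+ 1 * cos a))) => //.
  + exact: contC.
  + by apply: contM.
  + by apply: contN; apply: contM => //; apply: contZ; exact: contX.
  + by move=> t; apply: derN; apply: (derX 2); exact: is_derive_sin.
  + by rewrite sin0 expr0n oppr0.
  + by rewrite sinpi expr0n oppr0.
  move=> r a.
  have c1 : cont (fun b => 1 * fr r a b) by apply: contZ; exact: (JC3_cont ibp3_Jfr).
  have c2 : cont (fun b => 1 * fa r a b) by apply: contZ; exact: (JC3_cont ibp3_Jfa).
  have c4 : cont (fun b => G 2 (P r a b) * sin a).
    by apply: contM; [have := JC3_cont (r := r) (a := a) (@ibp3_JG 2)|exact: contC].
  have -> : 2 * (sin a * cos a) - 2 * sin a ^+ 1 * cos a = 0 by rewrite expr1; ring.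
  rewrite mul0r mulr0 addr0 -!intZ//; try exact: contZ.
  rewrite -intD; try (apply: contZ; exact: contZ).
  apply: int_ext => b _; rewrite /fr /fa.
  transitivity (r ^+ 2 * (G 2 (P r a b) * sin a * (cos a ^+ 2 + sin a ^+ 2))).
    by rewrite cos2Dsin2 mulr1.
  ring.
Qed.
End IBP3.

Section IBP.
Variables (R : realType) (m : nat).
Hypothesis hm : m = 2%N \/ m = 3%N.
Lemma ibp (F : 'rV[R]_m -> R) (G : 'I_m -> 'rV[R]_m -> R) (L : R) i :
  0 <= L -> C1 F G -> (forall x, L <= enorm x -> F x = 0) -> vint L (G i) = 0.
Proof.
case: hm F G i => -> F G i L0 FG supp.
  exact: (ibp2 L0 FG supp).
exact: (ibp3 L0 FG supp).
Qed.
End IBP.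

(** * Cutoffs and the Helmholtz equation *)

Section Cutoff.
Variable R : realType.
Implicit Types u v : R.
Definition posp u : R := Num.max 0 u.
(** A quadratic spline rising from 0 to 1 on [0, 1]: 2u^2 up to 1/2, then 1 - 2(1 - u)^2. It is only
    C^1, which suffices because the arguments differentiate a cutoff once. *)
Definition step u : R := 2 * (posp u ^+ 2 - 2 * posp (u - 1/2) ^+ 2 + posp (u - 1) ^+ 2).
Definition step' u : R := 4 * (posp u - 2 * posp (u - 1/2) + posp (u - 1)).
Variant posp_spec u : R -> Type :=
  | PospNeg of u <= 0 : posp_spec u 0
  | PospPos of 0 <= u : posp_spec u u.
Lemma pospP u : posp_spec u (posp u).
Proof. by rewrite /posp; have [u0|u0] := leP 0 u; constructor => //; exact: ltW. Qed.
Lemma posp_sq_der u : der (fun u => posp u ^+ 2) u (2 * posp u).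
Proof.
apply/derP => e e0; exists e => // h hh.
apply: (@le_trans _ _ (`|h| ^+ 2)); last by rewrite expr2 ler_wpM2r// ltW.
rewrite real_normK ?num_real// ler_norml.
by case: (pospP (u + h)) => u1; case: (pospP u) => u2; apply/andP; split; nra.
Qed.
Lemma posp_cont : cont posp.
Proof.
move=> u; apply/ctP => e e0; exists e => // v.
rewrite !ltr_norml => /andP[h1 h2].
by case: (pospP u) => u1; case: (pospP v) => u2; apply/andP; split; lra.
Qed.
Lemma step_der u : der step u (step' u).
Proof.
have H c : der (fun u => posp (u + c) ^+ 2) u (2 * posp (u + c)).
  by apply: (@der_shift _ (fun u => posp u ^+ 2)); exact: posp_sq_der.
have := derZ 2 (derD (derB (posp_sq_der u) (derZ 2 (H (- (1/2))))) (H (- 1))).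
by move/der_eq; apply; rewrite /step'; ring.
Qed.
Lemma step'_cont : cont step'.
Proof.
have H c : cont (fun u => posp (u + c)).
  move=> u; apply: (ct_comp (f := fun u => u + c) (g := posp)); last exact: posp_cont.
  by apply: ctD; [exact: cvg_id|exact: ctC].
apply: contZ; apply: contD; last exact: H.
by apply: contB; [exact: posp_cont|apply: contZ; exact: H].
Qed.
Lemma step_itv u : 0 <= step u <= 1.
Proof.
by rewrite /step; case: (pospP u) => u1; case: (pospP (u - 1/2)) => u2;
  case: (pospP (u - 1)) => u3; apply/andP; split; nra.
Qed.
Lemma step'_itv u : 0 <= step' u <= 2.
Proof.
by rewrite /step'; case: (pospP u) => u1; case: (pospP (u - 1/2)) => u2;
  case: (pospP (u - 1)) => u3; apply/andP; split; lra.
Qed.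
Lemma step_le0 u : u <= 0 -> step u = 0.
Proof.
by move=> u0; rewrite /step; case: (pospP u) => u1; case: (pospP (u - 1/2)) => u2;
  case: (pospP (u - 1)) => u3; nra.
Qed.
Lemma step_ge1 u : 1 <= u -> step u = 1.
Proof.
by move=> u0; rewrite /step; case: (pospP u) => u1; case: (pospP (u - 1/2)) => u2;
  case: (pospP (u - 1)) => u3; nra.
Qed.
Lemma step'_le0 u : u <= 0 -> step' u = 0.
Proof.
by move=> u0; rewrite /step'; case: (pospP u) => u1; case: (pospP (u - 1/2)) => u2;
  case: (pospP (u - 1)) => u3; lra.
Qed.
Lemma step'_ge1 u : 1 <= u -> step' u = 0.
Proof.
by move=> u0; rewrite /step'; case: (pospP u) => u1; case: (pospP (u - 1/2)) => u2;
  case: (pospP (u - 1)) => u3; lra.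
Qed.
End Cutoff.

(** * Calculus of C^1 functions with explicit gradients *)

Section C1U.
Variables (R : realType) (m : nat).
Notation vec := 'rV[R]_m.
Implicit Types (F : vec -> R) (G : 'I_m -> vec -> R) (U : set vec).

Definition C1U U F G : Prop := forall x, U x ->
  ctat F x /\ forall i, isp i F x (G i x) /\ ctat (G i) x.

Lemma C1UD U F G F' G' : C1U U F G -> C1U U F' G' ->
  C1U U (fun x => F x + F' x) (fun i x => G i x + G' i x).
Proof.
move=> h h' x Ux; have [c H] := h x Ux; have [c' H'] := h' x Ux; split; first exact: ctD.
by move=> i; split; [apply: derD; [exact: (H i).1|exact: (H' i).1]|apply: ctD; [exact: (H i).2|exact: (H' i).2]].
Qed.
Lemma C1UZ U a F G : C1U U F G -> C1U U (fun x => a * F x) (fun i x => a * G i x).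
Proof.
move=> h x Ux; have [c H] := h x Ux; split; first by apply: ctM => //; exact: ctC.
by move=> i; split; [apply: derZ; exact: (H i).1|apply: ctM; [exact: ctC|exact: (H i).2]].
Qed.
Lemma C1UB U F G F' G' : C1U U F G -> C1U U F' G' ->
  C1U U (fun x => F x - F' x) (fun i x => G i x - G' i x).
Proof.
move=> h h' x Ux; have [c H] := h x Ux; have [c' H'] := h' x Ux; split; first exact: ctB.
by move=> i; split; [apply: derB; [exact: (H i).1|exact: (H' i).1]|apply: ctB; [exact: (H i).2|exact: (H' i).2]].
Qed.
Lemma C1UM U F G F' G' : C1U U F G -> C1U U F' G' ->
  C1U U (fun x => F x * F' x) (fun i x => G i x * F' x + F x * G' i x).
Proof.
move=> h h' x Ux; have [c H] := h x Ux; have [c' H'] := h' x Ux; split; first exact: ctM.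
move=> i; split.
  by have := derM (H i).1 (H' i).1; rewrite /isp/= scale0r addr0.
by apply: ctD; apply: ctM => //; [exact: (H i).2|exact: (H' i).2].
Qed.
Lemma C1UC U (a : R) : C1U U (fun _ => a) (fun _ _ => 0).
Proof. by move=> x _; split; [exact: ctC|move=> i; split; [exact: derC|exact: ctC]]. Qed.
Lemma C1U_comp U F G (f f' : R -> R) : C1U U F G ->
  (forall x, U x -> der f (F x) (f' (F x)) /\ ctat f' (F x)) ->
  C1U U (fun x => f (F x)) (fun i x => f' (F x) * G i x).
Proof.
move=> h hf x Ux; have [c H] := h x Ux; have [df cf] := hf x Ux; split.
  by apply: ct_comp => //; exact: der_cont df.
move=> i; split.
  apply: (der_comp (f := f) (g := fun t => F (x + t *: unitv R i))); first exact: (H i).1.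
  by rewrite scale0r addr0.
by apply: ctM; [exact: ct_comp|exact: (H i).2].
Qed.
Lemma C1_C1U U F G : C1 F G -> C1U U F G.
Proof.
move=> h x _; split; first exact: (C1_Ct h).
by move=> i; split; [exact: h.1|exact: h.2].
Qed.
Lemma C1U_C1 F G : C1U setT F G -> C1 F G.
Proof. by move=> h; split=> [i x|i x]; have [_ H] := h x I; [exact: (H i).1|exact: (H i).2]. Qed.
Lemma C1U_sub U U' F G : U' `<=` U -> C1U U F G -> C1U U' F G.
Proof. by move=> UU h x /UU; exact: h. Qed.
Lemma isp0_near i F x : (\forall y \near x, F y = 0) -> isp i F x 0.
Proof.
move=> /nbhs_vec[d d0 hd]; apply: (der_near (f := fun _ => 0)); last exact: derC.
apply/nbhs_normP; exists d => //= t; rewrite /ball_/= sub0r normrN => td.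
rewrite hd// (addrC x) addrK mx_normZ; apply: le_lt_trans td.
rewrite -[leRHS]mulr1 ler_wpM2l//; apply: le_trans (norm_enorm _) _; by rewrite enorm_unit.
Qed.
(** A field that lives on [U], multiplied by a cutoff that dies near every point outside [U],
    becomes a C^1 function on the whole space, to which [ibp] applies. *)
Lemma C1_glue U F G : C1U U F G ->
  (forall x, ~ U x -> \forall y \near x, F y = 0 /\ forall i, G i y = 0) -> C1 F G.
Proof.
move=> h hz; split=> [i x|i x]; have [Ux|/hz nx] := pselect (U x).
- by have [_ H] := h x Ux; exact: (H i).1.
- have [_ ->] := nbhs_singleton nx; apply: isp0_near.
  by apply: filterS nx => y [].
- by have [_ H] := h x Ux; exact: (H i).2.
- apply: (ct_near (f := fun _ => 0)); last exact: ctC.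
  by apply: filterS nx => y [_ ->].
Qed.
Lemma C1_coord (j : 'I_m) : C1 (fun x : vec => x 0 j) (fun i _ => (i == j)%:R).
Proof.
split=> [i x|i x]; last exact: ctC.
rewrite /isp; under eq_fun do rewrite coordD1.
case: eqP => _ /=; last by under eq_fun do rewrite addr0; exact: derC.
by apply: der_eq (derD (derC _ _) (derI _)) _; rewrite add0r.
Qed.
Lemma C1_q (c : vec) : C1 (fun x : vec => dotv (x - c) (x - c)) (fun i x => 2 * (x 0 i - c 0 i)).
Proof.
split=> [i x|i].
  rewrite /isp.
  have E (t : R) : dotv (x + t *: unitv R i - c) (x + t *: unitv R i - c) =
      dotv (x - c) (x - c) + 2 * (x 0 i - c 0 i) * t + t * t.
    have -> : x + t *: unitv R i - c = (x - c) + t *: unitv R i by rewrite addrAC.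
    have U1 : dotv (unitv R i) (unitv R i) = 1 by rewrite dotv_unit mxE eqxx.
    have U2 : dotv (x - c) (unitv R i) = x 0 i - c 0 i by rewrite dotv_unit !mxE.
    move: (x - c) U2 => w U2.
    rewrite dotvDl !dotvDr !dotvZl !dotvZr (dotvC (unitv R i) w) U1 U2; ring.
  under eq_fun do rewrite E.
  have := derD (derD (derC (dotv (x - c) (x - c)) 0) (derZ (2 * (x 0 i - c 0 i)) (derI 0))) (derM (derI 0) (derI (0 : R))).
  by move/der_eq; apply; ring.
by move=> x; apply: ctM; [exact: ctC|apply: ctB; [exact: coord_continuous|exact: ctC]].
Qed.
Lemma C1_shift F G (v : vec) : C1 F G -> C1 (fun y => F (y + v)) (fun i y => G i (y + v)).
Proof.
move=> h; split=> [i x|i x].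
  by have := h.1 i (x + v); rewrite /isp; under eq_fun do rewrite addrAC.
apply: (ctv_comp (g := fun y : vec => y + v)); first exact: h.2.
apply: ct_row => j; under eq_fun do rewrite mxE.
by apply: ctD; [exact: coord_continuous|exact: ctC].
Qed.
End C1U.

Section Shift.
Variables (R : realType) (m : nat).
Hypothesis hm : m = 2%N \/ m = 3%N.
Notation vec := 'rV[R]_m.

Lemma vint_der (f f1 : R -> vec -> R) (L s : R) : 0 <= L ->
  (forall s y, der (f ^~ y) s (f1 s y)) ->
  (forall p : R * vec, ctat (fun p : R * vec => f1 p.1 p.2) p) -> (forall s, Ct (f s)) ->
  (forall s, Ct (f1 s)) ->
  der (fun s => vint L (f s)) s (vint L (f1 s)).
Proof.
move=> L0 df jf1 cf cf1; apply/derP => e e0.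
have vb : 0 <= volb m L by rewrite /volb !mulr_ge0// ?exprn_ge0// ltW// sig1_gt0.
pose e' := e / (volb m L + 1).
have ba0 : 0 < volb m L + 1 by rewrite ltr_wpDl.
have e'0 : 0 < e' by rewrite divr_gt0.
have /nbhs_normP[d/= d0 hd] := @unif_compact R R vec [set x | enorm x <= L] f1 s e' (@ball_compact R m L) e'0 (fun u _ => jf1 (s, u)).
exists d => // h hh.
have c1 : Ct (fun x => h * f1 s x) by exact: CtZ.
have c2 : Ct (fun x => f (s + h) x - f s x) by exact: CtB.
rewrite -(vintB hm L (cf (s + h)) (cf s)) mulrC -(vintZ hm L h (cf1 s)) -(vintB hm L c2 c1).
apply: (@le_trans _ _ (e' * `|h| * volb m L)).
  apply: (vint_abs hm) => // [||t tab]; first by rewrite mulr_ge0// ltW.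
    exact: CtB.
  pose g u := f u t - u * f1 s t.
  have -> : f (s + h) t - f s t - h * f1 s t = g (s + h) - g s by rewrite /g; ring.
  have -> : `|h| = `|s + h - s| by rewrite (addrC s) addrK.
  apply: (@mvt_abs _ g (fun u => f1 u t - 1 * f1 s t)).
    by move=> u _; apply: derB => //; apply: der_eq (derM (derI u) (derC (f1 s t) u)) _; ring.
  move=> u hu; rewrite mul1r; apply: hd => //; rewrite /ball_/=.
  apply: le_lt_trans hh.
  move: hu; case: (leP s (s + h)) => h0 /andP[u1 u2].
    rewrite ler0_norm ?subr_le0// ger0_norm; lra.
  rewrite ger0_norm ?subr_ge0// ler0_norm; lra.
rewrite mulrAC ler_wpM2r// /e' mulrAC ler_pdivrMr// ler_wpM2l ?(ltW e0)//; lra.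
Qed.

(** The t-derivative of the integral of F(y + t v) is a sum of integrals of partial derivatives,
    zero by [ibp]; this replaces a change of variables. The condition on [L'] keeps every translate
    for 0 <= t <= 1 supported in the ball. *)
Lemma vint_shift F G (L L' : R) (v : vec) : 0 <= L -> L + enorm v <= L' -> C1 F G ->
  (forall x, L <= enorm x -> F x = 0) -> vint L' (fun y => F (y + v)) = vint L' F.
Proof.
move=> L0 LL FG supp.
have L'0 : 0 <= L' by apply: le_trans LL; rewrite addr_ge0 ?enorm_ge0.
have tl (p : R * vec) : {for p, continuous (fun p : R * vec => p.2 + p.1 *: v)}.
  apply: ct_row => j.
  rewrite (_ : (fun s : R * vec => _) = fun p : R * vec => p.2 0 j + p.1 * v 0 j); last by apply/funext => q; rewrite !mxE.
  apply: ctD; first by apply: (ct_snd (f := fun y : vec => y 0 j)); exact: coord_continuous.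
  by apply: ctM; [exact: for_fst|exact: ctC].
have H t : 0 <= t <= 1 -> der (fun t => vint L' (fun y => F (y + t *: v))) t 0.
  move=> /andP[t0 t1].
  pose f1 (t : R) (y : vec) := \sum_i G i (y + t *: v) * v 0 i.
  have cG s i : Ct (fun y => G i (y + s *: v)) by exact: (C1_shift (s *: v) FG).2.
  have D : der (fun t => vint L' (fun y => F (y + t *: v))) t (vint L' (f1 t)).
    apply: (@vint_der (fun t y => F (y + t *: v)) f1) => //.
  - move=> s y; apply: (C1_chain (g := fun s => y + s *: v)) => // i.
    under eq_fun do rewrite !mxE.
    by apply: der_eq (derD (derC _ _) (derM (derI s) (derC _ s))) _; rewrite mulr0 addr0 add0r mul1r.
  - move=> p; apply: ct_sum => i; apply: ctM; last exact: ctC.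
    by apply: (ctv_comp (g := fun p : R * vec => p.2 + p.1 *: v)); [exact: FG.2|exact: tl].
  - by move=> s; exact: C1_Ct (C1_shift (s *: v) FG).
  - by move=> s; apply: Ct_sum => i; apply: CtM; [exact: cG|exact: CtC].
  apply: der_eq D _; rewrite /f1 (vint_sum hm); last by move=> i; apply: CtM; [exact: cG|exact: CtC].
  apply: big1 => i _.
  rewrite (vint_ext hm (G := fun y => v 0 i * G i (y + t *: v))); last by move=> x _; rewrite mulrC.
  rewrite (vintZ hm L' _ (cG t i)).
  rewrite (ibp hm (F := fun y => F (y + t *: v)) (G := fun i y => G i (y + t *: v)))// ?mulr0//.
    exact: C1_shift.
  move=> x xL; apply: supp.
  have : enorm x - enorm (- (t *: v)) <= enorm (x + t *: v) by have := enorm_leB x (- (t *: v)); rewrite opprK.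
  rewrite enormN enormZ ger0_norm//.
  have : t * enorm v <= enorm v by rewrite -[leRHS]mul1r ler_wpM2r// enorm_ge0.
  lra.
pose H0 (t : R) := vint L' (fun y => F (y + t *: v)).
have E : H0 1 = H0 0.
  apply: (@der0_const R H0 1 0) => t; rewrite (min_r (@ler01 R)) (max_l (@ler01 R)); exact: H.
move: E; rewrite /H0 scale1r scale0r => ->; apply: (vint_ext hm) => x _; by rewrite addr0.
Qed.
End Shift.

(** * Helmholtz solutions and Green's second identity with a cutoff *)

Section Helm.
Variables (R : realType) (m : nat).
Notation vec := 'rV[R]_m.
Implicit Types (u w : vec -> R) (g : 'I_m -> vec -> R) (U : set vec).

Definition helm U (k : R) u g (h : 'I_m -> 'I_m -> vec -> R) : Prop :=
  [/\ C1U U u g, (forall i, C1U U (g i) (h i)) & forall x, U x -> \sum_i h i i x = - (k ^+ 2 * u x)].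

Lemma open_ctat U u x : open U -> {within U, continuous u} -> U x -> ctat u x.
Proof.
move=> oU cu Ux; have := continuous_open_subspace u oU => E.
move: cu; rewrite E => H; exact: (H x (mem_set Ux)).
Qed.

Lemma C2_helm U k u : open U -> C2_on U u ->
  (forall x, U x -> laplacian u x + k ^+ 2 * u x = 0) ->
  helm U k u (fun i => partial i u) (fun i j => partial j (partial i u)).
Proof.
move=> oU [c0 [p1 [c1 [p2 c2]]]] hl; split.
- move=> x Ux; split; first exact: open_ctat oU c0 Ux.
  by move=> i; split; [apply: has_partial_isp; exact: p1|exact: open_ctat oU (c1 i) Ux].
- move=> i x Ux; split; first exact: open_ctat oU (c1 i) Ux.
  by move=> j; split; [apply: has_partial_isp; exact: p2|exact: open_ctat oU (c2 i j) Ux].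
- by move=> x /hl/eqP; rewrite addr_eq0 => /eqP.
Qed.

Lemma helm_lin U k a u g h u' g' h' : helm U k u g h -> helm U k u' g' h' ->
  helm U k (fun x => a * u x + u' x) (fun i x => a * g i x + g' i x)
    (fun i j x => a * h i j x + h' i j x).
Proof.
move=> [h1 h2 h3] [h1' h2' h3']; split.
- by apply: C1UD => //; exact: C1UZ.
- by move=> i; apply: C1UD => //; exact: C1UZ.
- by move=> x Ux; rewrite big_split/= -mulr_sumr h3// h3'//; ring.
Qed.
Lemma helm_sub U U' k u g h : U' `<=` U -> helm U k u g h -> helm U' k u g h.
Proof.
move=> UU [h1 h2 h3]; split; [exact: C1U_sub h1|by move=> i; exact: C1U_sub (h2 i)|].
by move=> x /UU; exact: h3.
Qed.

Hypothesis hm : m = 2%N \/ m = 3%N.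

Lemma grad_near0 (F : vec -> R) (G : 'I_m -> vec -> R) (x : vec) : C1 F G -> (\forall y \near x, F y = 0) ->
  \forall y \near x, F y = 0 /\ forall i, G i y = 0.
Proof.
move=> h hF; have := near_join hF; apply: filterS => y hy.
split; first exact: nbhs_singleton hy.
by move=> i; apply: der_uniq (h.1 i y) _; exact: isp0_near.
Qed.

Lemma div_zero (V : 'I_m -> vec -> R) (dV : 'I_m -> 'I_m -> vec -> R) (L : R) :
  0 <= L -> (forall i, C1 (V i) (dV i)) -> (forall i x, L <= enorm x -> V i x = 0) ->
  vint L (fun x => \sum_i dV i i x) = 0.
Proof.
move=> L0 h hs; rewrite (vint_sum hm); last by move=> i; exact: (h i).2.
by apply: big1 => i _; exact: (ibp hm i L0 (h i) (hs i)).
Qed.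

(** Both functions solve the same equation, so the divergence of Th (u grad w - w grad u) keeps only
    the term with grad Th. The shells where the cutoff varies play the part of boundary surfaces. *)
Lemma green U k u gu hu w gw hw Th gT (L : R) :
  helm U k u gu hu -> helm U k w gw hw -> C1 Th gT ->
  (forall x, ~ U x -> \forall y \near x, Th y = 0) -> 0 <= L ->
  (forall x, L <= enorm x -> Th x = 0) ->
  Ct (fun x => \sum_i gT i x * (u x * gw i x - w x * gu i x)) /\
  vint L (fun x => \sum_i gT i x * (u x * gw i x - w x * gu i x)) = 0.
Proof.
move=> [u1 u2 u3] [w1 w2 w3] T1 Tz L0 Ts.
pose V i x := Th x * (u x * gw i x - w x * gu i x).
pose dV i j x := gT j x * (u x * gw i x - w x * gu i x) +
  Th x * ((gu j x * gw i x + u x * hw i j x) - (gw j x * gu i x + w x * hu i j x)).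
have CV i : C1 (V i) (dV i).
  apply: (@C1_glue _ _ U).
    by apply: C1UM; [exact: C1_C1U|apply: C1UB; apply: C1UM].
  move=> x nU; have := grad_near0 T1 (Tz x nU); apply: filterS => y [e1 e2].
  by rewrite /V /dV e1; split=> [|j]; rewrite ?mul0r// e2 !mul0r addr0.
have E x : \sum_i dV i i x = \sum_i gT i x * (u x * gw i x - w x * gu i x).
  rewrite /dV big_split/= [X in _ + X](_ : _ = 0) ?addr0//.
  have [Ux|nU] := pselect (U x); last first.
    by rewrite big1// => i _; rewrite (nbhs_singleton (Tz x nU)) mul0r.
  rewrite -mulr_sumr (eq_bigr (fun i => u x * hw i i x - w x * hu i i x)); last by move=> i _; ring.
  by rewrite sumrB -!mulr_sumr u3// w3//; ring.
have -> : (fun x => \sum_i gT i x * (u x * gw i x - w x * gu i x)) = (fun x => \sum_i dV i i x).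
  by apply/funext => x; rewrite E.
split; first by apply: Ct_sum => i; exact: (CV i).2.
by apply: (div_zero L0 CV) => i x /Ts; rewrite /V => ->; rewrite mul0r.
Qed.
End Helm.

(** * Comparison principle and interior gradient estimate *)

Section MaxP.
Variables (R : realType).

(** At a minimum the derivative vanishes, and a negative second derivative would make [f] decrease
    just to the right. *)
Lemma second_test (f f1 : R -> R) (l d : R) : 0 < d ->
  (forall t, `|t| < d -> der f t (f1 t)) -> der f1 0 l ->
  (forall t, `|t| < d -> f 0 <= f t) -> 0 <= l.
Proof.
move=> d0 h1 h2 h3.
have d00 : `|0 : R| < d by rewrite normr0.
(* A nonzero slope contradicts minimality at q or at -q, according to its sign. *)
have f10 : f1 0 = 0.
  apply/eqP/negPn/negP => n0.
  have a0 : 0 < `|f1 0| / 2 by rewrite divr_gt0// normr_gt0.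
  have [d' d'0 hd] := (derP _ _ _).1 (h1 0 d00) _ a0.
  pose q := Num.min (d / 2) (d' / 2).
  have q0 : 0 < q by rewrite lt_min !divr_gt0.
  have qd : q < d by apply: (@le_lt_trans _ _ (d / 2)); [rewrite /q ge_min lexx|lra].
  have qd' : q < d' by apply: (@le_lt_trans _ _ (d' / 2)); [rewrite /q ge_min lexx orbT|lra].
  have nq : `|q| = q by rewrite gtr0_norm.
  have H1 := hd q; have H2 := hd (- q).
  rewrite normrN nq in H2; rewrite nq in H1.
  have {H1}:= H1 qd'; have {H2}:= H2 qd'.
  have := h3 q; rewrite nq => /(_ qd); have := h3 (- q); rewrite normrN nq => /(_ qd).
  rewrite !add0r !ler_norml => g1 g2 /andP[b1 b2] /andP[b3 b4].
  case: (ltrgt0P (f1 0)) => s0; last by rewrite s0 eqxx in n0.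
    rewrite gtr0_norm// in b1 b2 b3 b4; nra.
  rewrite ltr0_norm// in b1 b2 b3 b4; nra.
rewrite leNgt; apply/negP => l0.
have a0 : 0 < - l / 2 by rewrite divr_gt0// oppr_gt0.
have [d' d'0 hd] := (derP _ _ _).1 h2 _ a0.
pose q := Num.min (d / 2) (d' / 2).
have q0 : 0 < q by rewrite lt_min !divr_gt0.
have qd : q < d by apply: (@le_lt_trans _ _ (d / 2)); [rewrite /q ge_min lexx|lra].
have qd' : q < d' by apply: (@le_lt_trans _ _ (d' / 2)); [rewrite /q ge_min lexx orbT|lra].
have [x|c [c0 cq e]] := mvt q0 (f := f) (df := f1).
  by move=> /andP[x0 xq]; apply: h1; rewrite ger0_norm//; exact: le_lt_trans xq qd.
have := h3 q; rewrite gtr0_norm// => /(_ qd) h.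
have := hd c; rewrite gtr0_norm// => /(_ (lt_trans cq qd')).
rewrite add0r f10 subr0 ler_norml => /andP[_ hc].
have : f1 c < 0 by nra.
have : f1 c * (q - 0) >= 0 by rewrite -e subr_ge0.
rewrite subr0 => ? ?; nra.
Qed.

Variable m : nat.
Notation vec := 'rV[R]_m.

Lemma line_near (x : vec) (P : set vec) i : nbhs x P ->
  exists2 d : R, 0 < d & forall t : R, `|t| < d -> P (x + t *: unitv R i).
Proof.
move=> /nbhs_vec[d d0 hd]; exists d => // t td; apply: hd.
rewrite (addrC x) addrK mx_normZ; apply: le_lt_trans td.
rewrite -[leRHS]mulr1 ler_wpM2l//; apply: le_trans (norm_enorm _) _; by rewrite enorm_unit.
Qed.

(** The Laplacian is strictly negative on [O], so one second derivative test per coordinate already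
    excludes a minimum there. *)
Lemma maxpr (K O : set vec) (w : vec -> R) (gw hw : 'I_m -> vec -> R) :
  compact K -> K !=set0 -> {within K, continuous w} -> open O -> O `<=` K ->
  (forall x i, O x -> isp i w x (gw i x) /\ isp i (gw i) x (hw i x)) ->
  (forall x, O x -> \sum_i hw i x < 0) ->
  exists x0, [/\ K x0, ~ O x0 & forall x, K x -> w x0 <= w x].
Proof.
move=> cK K0 cw oO OK h1 h2.
have [x0 Kx0 hx0] := compact_EVT_min K0 cK cw.
exists x0; split; [exact: set_mem| |by move=> x /mem_set; exact: hx0].
move=> Ox0; have : 0 <= \sum_i hw i x0.
  apply: sumr_ge0 => i _.
  have [d d0 hd] := line_near i (open_nbhs_nbhs (conj oO Ox0)).
  apply: (@second_test (fun t => w (x0 + t *: unitv R i)) (fun t => gw i (x0 + t *: unitv R i)) _ d) => //.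
  - by move=> t /hd /(h1 _ i) [/isp_line].
  - by have [] := h1 _ i Ox0.
  - by move=> t /hd/OK Kt; rewrite scale0r addr0; apply: hx0; exact: mem_set.
by rewrite leNgt h2.
Qed.

Lemma ctat_within (K : set vec) (w : vec -> R) : (forall x, K x -> ctat w x) ->
  {within K, continuous w}.
Proof. by move=> h; apply: continuous_in_subspaceT => x /set_mem; exact: h. Qed.

Lemma comparison (K O : set vec) (w : vec -> R) (gw hw : 'I_m -> vec -> R) :
  compact K -> {within K, continuous w} -> open O -> O `<=` K ->
  (forall x i, O x -> isp i w x (gw i x) /\ isp i (gw i) x (hw i x)) ->
  (forall x, O x -> \sum_i hw i x < 0) ->
  (forall x, K x -> ~ O x -> 0 <= w x) -> forall x, K x -> 0 <= w x.
Proof.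
move=> cK cw oO OK h1 h2 hb x Kx.
have [x0 [K0 nO hx0]] := maxpr cK (ex_intro _ x Kx) cw oO OK h1 h2.
exact: le_trans (hb _ K0 nO) (hx0 _ Kx).
Qed.
End MaxP.

Section Lip.
Variables (R : realType) (m : nat).
Notation vec := 'rV[R]_m.
Variables (k : R).

Definition refl (x : vec) (i : 'I_m) (y : vec) : vec := y + (2 * (x 0 i - y 0 i)) *: unitv R i.
Lemma refl_coord (x y : vec) i j : refl x i y 0 j = if i == j then 2 * x 0 i - y 0 i else y 0 j.
Proof. by rewrite /refl coordD1; case: eqP => [->|_]; [ring|rewrite addr0]. Qed.
Lemma refl_line (x y : vec) i j (t : R) :
  refl x i (y + t *: unitv R j) = refl x i y + (if i == j then - t else t) *: unitv R j.
Proof.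
apply/rowP => l; rewrite /refl !coordD1.
case: (eqVneq i j) => [<-|ij]; first by case: eqP => _; ring.
by case: eqP => _; case: eqP => _; ring.
Qed.
Lemma isp_refl (x y : vec) i j (u : vec -> R) (l : R) : isp j u (refl x i y) l ->
  isp j (fun y => u (refl x i y)) y (if i == j then - l else l).
Proof.
move=> h; rewrite /isp; under eq_fun do rewrite refl_line.
case: eqP => // _.
have := @der_comp R (fun t => u (refl x i y + t *: unitv R j)) (fun t => - t) 0 l (- 1).
rewrite oppr0 => H; apply: der_eq (H _ h) _; last by rewrite mulrN1.
by apply: derN; exact: derI.
Qed.
Lemma refl_cont (x y : vec) i : {for y, continuous (refl x i)}.
Proof.
apply: ct_row => j.
rewrite (_ : (fun s => _) = fun y : vec => if i == j then 2 * x 0 i - y 0 i else y 0 j); last first.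
  by apply/funext => z; rewrite refl_coord.
case: eqP => _; last exact: coord_continuous.
by apply: ctB; [exact: ctC|exact: coord_continuous].
Qed.

Lemma normB_ct (x y : vec) : ctat (fun y : vec => `|y - x|) y.
Proof.
apply/ctP => e e0; exists e => // z zy; apply: le_lt_trans zy.
by apply: le_trans (ler_dist_dist _ _) _; rewrite opprB addrA subrK.
Qed.

(** This is 2 d A + B d for M = 1, with the coefficients [A] and [B] of the barrier in
    [lip_axis]. *)
Definition Clip (d : R) : R := 2 * d * (2 * m%:R / d ^+ 2 + k ^+ 2 + 1) + 2 / d.

Lemma Clip_ge0 (d : R) : 0 < d -> 0 <= Clip d.
Proof.
move=> d0; rewrite /Clip addr_ge0 ?divr_ge0 ?(ltW d0)// mulr_ge0 ?mulr_ge0 ?(ltW d0)//.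
by rewrite addr_ge0// addr_ge0 ?sqr_ge0// divr_ge0 ?sqr_ge0// mulr_ge0.
Qed.

(* Compares [u] minus its reflection in [y 0 i = x 0 i], which vanishes on the mirror, with a quadratic barrier. *)
Lemma lip_axis U (u : vec -> R) g h (x : vec) i (d M s : R) : open U -> helm U k u g h -> 0 < d -> 0 < M ->
  (forall y : vec, `|y - x| <= d -> U y /\ `|u y| <= M) -> 0 <= s <= d ->
  `|u (x + s *: unitv R i) - u (x - s *: unitv R i)| <= Clip d * M * s.
Proof.
move=> oU [h1 h2 h3] d0 M0 hb /andP[s0 sd].
(* B d^2 = 2M dominates the reflected difference on the outer faces of the half cube. The Laplacian
   of the barrier is -2A + 2mB = -2k^2 M - 2M, which beats the contribution 2 k^2 M of the
   difference. *)
pose B := 2 * M / d ^+ 2; pose A := m%:R * B + k ^+ 2 * M + M.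
have B0 : 0 < B by rewrite divr_gt0 ?mulr_gt0// exprn_gt0.
have A0 : 0 <= A by rewrite /A addr_ge0 ?(ltW M0)// addr_ge0// mulr_ge0 ?sqr_ge0 ?(ltW M0)// ltW.
pose K : set vec := [set y | `|y - x| <= d /\ x 0 i <= y 0 i].
pose O : set vec := [set y | `|y - x| < d /\ x 0 i < y 0 i].
have cK : compact K.
  apply: bounded_closed_compact.
    exists (d + `|x|); split; first exact: num_real.
    move=> T dT y [yx _]; apply: le_trans (ltW dT).
    by rewrite -{1}(subrK x y); apply: le_trans (ler_normD _ _) _; rewrite lerD2r.
  have -> : K = (fun y : vec => `|y - x|) @^-1` [set t | t <= d] `&`
                (fun y : vec => y 0 i) @^-1` [set t | x 0 i <= t] by [].
  apply: closedI; apply: closed_comp.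
  - by move=> y _; exact: normB_ct.
  - exact: closed_le.
  - by move=> y _; exact: coord_continuous.
  - exact: closed_ge.
have oO : open O.
  have -> : O = (fun y : vec => `|y - x|) @^-1` [set t | t < d] `&`
                (fun y : vec => y 0 i) @^-1` [set t | x 0 i < t] by [].
  apply: openI; apply: open_comp.
  - by move=> y _; exact: normB_ct.
  - exact: open_lt.
  - by move=> y _; exact: coord_continuous.
  - exact: open_gt.
have OK : O `<=` K by move=> y [/ltW ? /ltW ?].
have rb (y : vec) : `|y - x| <= d -> `|refl x i y - x| <= d.
  move=> yx; apply/normv_leP; first exact: ltW.
  move=> j; rewrite mxE [X in _ + X]mxE refl_coord.
  have := coord_norm (y - x) j; rewrite mxE [X in _ + X]mxE => yj.
  apply: le_trans yx; case: eqP => [->|//].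
  by rewrite (_ : _ - _ = - (y 0 j - x 0 j)) ?normrN//; ring.
pose psi (y : vec) := A * ((y 0 i - x 0 i) * (2 * d - (y 0 i - x 0 i))) + B * dotv (y - x) (y - x).
pose gpsi (j : 'I_m) (y : vec) := A * ((j == i)%:R * (2 * d - 2 * (y 0 i - x 0 i))) + B * (2 * (y 0 j - x 0 j)).
pose hpsi (j : 'I_m) (y : vec) := A * ((j == i)%:R * (- 2)) + B * 2.
have ispl (j : 'I_m) (y : vec) : isp j (fun y : vec => y 0 i - x 0 i) y (j == i)%:R.
  have := derB ((@C1_coord R m i).1 j y) (derC (x 0 i) 0).
  by rewrite /isp subr0.
have p1 j y : isp j psi y (gpsi j y).
  have := derD (derZ A (derM (ispl j y) (derB (derC (2 * d) 0) (ispl j y)))) (derZ B ((C1_q x).1 j y)).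
  rewrite /isp => /der_eq; apply; rewrite /gpsi scale0r addr0; ring.
have p2 j y : isp j (gpsi j) y (hpsi j y).
  have q1 : isp j (fun y : vec => y 0 j - x 0 j) y 1.
    have := derB ((@C1_coord R m j).1 j y) (derC (x 0 j) 0).
    by rewrite /isp subr0 eqxx.
  have := derD (derZ A (derZ ((j == i)%:R) (derB (derC (2 * d) 0) (derZ 2 (ispl j y))))) (derZ B (derZ 2 q1)).
  rewrite /isp => /der_eq; apply; rewrite /hpsi; case: eqP => _ /=; ring.
have psi_ct y : ctat psi y.
  apply: ctD; apply: ctM; try exact: ctC.
    by apply: ctM; [|apply: ctB; [exact: ctC|]]; apply: ctB; (exact: coord_continuous || exact: ctC).
  exact: C1_Ct (C1_q x) y.
have sgn (e : R) : `|e| = 1 -> forall y, K y -> 0 <= psi y + e * (u y - u (refl x i y)).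
  move=> e1.
  pose gw j y := gpsi j y + e * (g j y - (if i == j then - g j (refl x i y) else g j (refl x i y))).
  pose hw j y := hpsi j y + e * (h j j y - h j j (refl x i y)).
  apply: (@comparison R m K O (fun y => psi y + e * (u y - u (refl x i y))) gw hw cK _ oO OK).
  - apply: ctat_within => y [yx _]; apply: ctD; first exact: psi_ct.
    apply: ctM; first exact: ctC.
    apply: ctB; first by have [] := h1 y (hb y yx).1.
    by apply: ctv_comp; [have [] := h1 _ (hb _ (rb _ yx)).1|exact: refl_cont].
  - move=> y j [/ltW yx _].
    have [_ a1] := h1 y (hb y yx).1; have [_ a2] := h1 _ (hb _ (rb _ yx)).1.
    have [_ b1] := h2 j y (hb y yx).1; have [_ b2] := h2 j _ (hb _ (rb _ yx)).1.
    split.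
      apply: derD; first exact: p1.
      apply: derZ; apply: derB; first exact: (a1 j).1.
      exact: (isp_refl (a2 j).1).
    apply: derD; first exact: p2.
    apply: derZ; apply: derB; first exact: (b1 j).1.
    have := isp_refl (b2 j).1; case: eqP => [_|_ //] H.
    by have := derN H; rewrite opprK.
  - move=> y [/ltW yx _].
    rewrite /hw big_split/= -mulr_sumr sumrB h3 ?h3; [|exact: (hb _ (rb _ yx)).1|exact: (hb _ yx).1].
    rewrite big_split/= sumr_const card_ord.
    rewrite -mulr_sumr -mulr_suml (bigD1 i)//= eqxx big1 => [|j /negPf ->//].
    have u1 := (hb _ yx).2; have u2 := (hb _ (rb _ yx)).2.
    have E : `|e * (- (k ^+ 2 * u y) - - (k ^+ 2 * u (refl x i y)))| <= k ^+ 2 * (2 * M).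
      rewrite normrM e1 mul1r -opprD normrN -mulrBr normrM ger0_norm ?sqr_ge0//.
      rewrite ler_wpM2l ?sqr_ge0//; apply: le_trans (ler_normB _ _) _; lra.
    have := ler_normlW E; rewrite -[(B * 2) *+ m]mulr_natr /A; move: (e * _) => q.
    move: M0 (B * m%:R) (mulrC m%:R B); move=> M0 bm bmE; rewrite bmE.
    rewrite addr0 mul1r; lra.
  - move=> y [yx yi] nO.
    have u1 := (hb _ yx).2; have u2 := (hb _ (rb _ yx)).2.
    have yi0 : 0 <= y 0 i - x 0 i by rewrite subr_ge0.
    have yid : y 0 i - x 0 i <= d.
      by have := coord_norm (y - x) i; rewrite !mxE => H; exact: le_trans (ler_normlW H) yx.
    have P1 : 0 <= A * ((y 0 i - x 0 i) * (2 * d - (y 0 i - x 0 i))).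
      by rewrite !mulr_ge0//; lra.
    have [yd|yd] := ltP (`|y - x|) d.
      have yi' : y 0 i = x 0 i.
        by apply/eqP; rewrite eq_le yi andbT leNgt; apply/negP => ?; apply: nO.
      have -> : refl x i y = y.
        by apply/rowP => j; rewrite refl_coord; case: eqP => [<-|//]; rewrite -yi'; ring.
      by rewrite subrr mulr0 addr0 addr_ge0// mulr_ge0 ?(ltW B0)// dotvv_ge0.
    have dq : d ^+ 2 <= dotv (y - x) (y - x).
      rewrite -enorm_sqr lerXn2r ?nnegrE ?enorm_ge0 ?(ltW d0)//.
      exact: le_trans yd (norm_enorm _).
    have P2 : 2 * M <= B * dotv (y - x) (y - x).
      apply: (@le_trans _ _ (B * d ^+ 2)); last by rewrite ler_wpM2l// ltW.
      by rewrite /B divfK// gt_eqF// exprn_gt0.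
    have E : `|e * (u y - u (refl x i y))| <= 2 * M.
      by rewrite normrM e1 mul1r; apply: le_trans (ler_normB _ _) _; lra.
    by move: E; rewrite ler_norml => /andP[E _]; rewrite /psi; lra.
have Ks : K (x + s *: unitv R i).
  split; last by rewrite coordD1 eqxx lerDl.
  rewrite (addrC x) addrK mx_normZ ger0_norm//; apply: le_trans sd.
  rewrite -[leRHS]mulr1 ler_wpM2l//; apply: le_trans (norm_enorm _) _; by rewrite enorm_unit.
have rs : refl x i (x + s *: unitv R i) = x - s *: unitv R i.
  apply/rowP => j; rewrite refl_coord -scaleNr !coordD1; case: eqP => [<-|//]; rewrite eqxx; ring.
have psis : psi (x + s *: unitv R i) <= Clip d * M * s.
  rewrite /psi coordD1 eqxx (_ : x + s *: _ - x = s *: unitv R i); last by rewrite (addrC x) addrK.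
  rewrite dotvZl dotvZr dotv_unit mxE eqxx/=.
  rewrite (_ : x 0 i + s - x 0 i = s); last by ring.
  have dn0 : d != 0 by rewrite gt_eqF.
  have -> : Clip d * M * s = (2 * d * A + B * d) * s.
    by rewrite /Clip /A /B; field.
  rewrite mulr1.
  have : A * (s * (2 * d - s)) <= 2 * d * A * s by have := mulr_ge0 A0 (sqr_ge0 s); nra.
  have : B * (s * s) <= B * d * s by rewrite -mulrA ler_wpM2l ?(ltW B0)// ler_wpM2r.
  lra.
have q1 := @sgn 1 (normr1 _) _ Ks; have q2 := @sgn (-1) (normrN1 _) _ Ks.
rewrite rs in q1 q2; rewrite ler_norml; apply/andP; split; lra.
Qed.

(** The estimate of [lip_axis] divided by s bounds the symmetric difference quotient, which tends to
    twice the partial derivative. *)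
Lemma grad_bound U (u : vec -> R) g h (x : vec) i (d M : R) : open U -> helm U k u g h -> 0 < d -> 0 < M ->
  (forall y : vec, `|y - x| <= d -> U y /\ `|u y| <= M) -> `|g i x| <= Clip d * M.
Proof.
move=> oU H d0 M0 hb; apply/ler_addgt0Pr => e e0.
have Ux : U x by apply: (hb x _).1; rewrite subrr normr0 ltW.
have [h1 _ _] := H; have [_ /(_ i) [dx _]] := h1 x Ux.
have [d' d'0 hd] := (derP _ _ _).1 dx e e0.
pose s := Num.min d (d' / 2).
have s0 : 0 < s by rewrite lt_min d0 divr_gt0.
have sd : s <= d by rewrite ge_min lexx.
have sd' : s < d' by apply: (@le_lt_trans _ _ (d' / 2)); [rewrite /s ge_min lexx orbT|lra].
have L := lip_axis i oU H d0 M0 hb (s := s).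
have {}L := L _; rewrite (ltW s0) sd in L; have {}L := L isT.
have h3 := hd s; rewrite gtr0_norm// in h3; have {}h3 := h3 sd'.
have h4 := hd (- s); rewrite normrN gtr0_norm// in h4; have {}h4 := h4 sd'.
rewrite !add0r scale0r addr0 scaleNr in h3 h4.
move: L h3 h4; set a := u (x + _); set b := u (x - _); set c := u x.
rewrite !ler_norml => /andP[a1 a2] /andP[b1 b2] /andP[c1 c2].
have C0 := mulr_ge0 (Clip_ge0 d0) (ltW M0).
apply/andP; split; nra.
Qed.
End Lip.

(** * Radial solutions *)

Section Amp.
Variables (R : realType).

(** P + B/s decreases and P - B/s increases, so both squeeze one limit, obtained as the supremum of
    P - B/s. *)
Lemma osc_lim (P P1 : R -> R) (s0 B : R) : 0 < s0 -> 0 <= B ->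
  (forall s, s0 <= s -> der P s (P1 s)) -> (forall s, s0 <= s -> `|P1 s| <= B / s ^+ 2) ->
  exists A, forall s, s0 <= s -> `|P s - A| <= B / s.
Proof.
move=> s00 B0 dP hP.
have dI s : s0 <= s -> der (fun s => B / s) s (- (B / s ^+ 2)).
  move=> ss; have sn : s != 0 by rewrite gt_eqF//; exact: lt_le_trans ss.
  apply: der_eq (derZ B (derV sn (derI s))) _; field; done.
have up s t : s0 <= s -> s <= t -> P t + B / t <= P s + B / s.
  move=> ss st; rewrite -lerN2.
  apply: (@der_ge0_le _ (fun s => - (P s + B / s)) (fun s => - (P1 s - B / s ^+ 2))) => //.
    move=> x /andP[sx _]; apply: derN; apply: derD; first by apply: dP; exact: le_trans sx.
    by apply: dI; exact: le_trans sx.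
  move=> x /andP[sx _]; have := hP x (le_trans ss sx); rewrite ler_norml => /andP[_]; lra.
have dn s t : s0 <= s -> s <= t -> P s - B / s <= P t - B / t.
  move=> ss st.
  apply: (@der_ge0_le _ (fun s => (P s - B / s)) (fun s => (P1 s - - (B / s ^+ 2)))) => //.
    move=> x /andP[sx _]; apply: derB; first by apply: dP; exact: le_trans sx.
    by apply: dI; exact: le_trans sx.
  move=> x /andP[sx _]; have := hP x (le_trans ss sx); rewrite ler_norml => /andP[]; lra.
have mix s t : s0 <= s -> s0 <= t -> P s - B / s <= P t + B / t.
  move=> ss tt; pose u := Num.max s t.
  have su : s <= u by rewrite le_max lexx.
  have tu : t <= u by rewrite le_max lexx orbT.
  apply: le_trans (dn _ _ ss su) _; apply: le_trans (up _ _ tt tu).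
  have : 0 <= B / u by rewrite divr_ge0// (le_trans _ su)// (le_trans _ ss)// ltW.
  lra.
pose S := [set P s - B / s | s in [set s | s0 <= s]].
have S0 : S !=set0 by exists (P s0 - B / s0); exists s0 => /=.
exists (sup S) => s ss; rewrite ler_norml; apply/andP; split.
  rewrite lerBrDl -lerBrDr; apply: ge_sup => // _ [t tt <-]; rewrite opprK; exact: mix.
rewrite lerBlDl -lerBlDr; apply: ub_le_sup; last by exists s.
by exists (P s + B / s) => _ [t tt <-]; exact: mix.
Qed.

Variables (m : nat) (k : R).
Hypothesis hm : m = 2%N \/ m = 3%N.
Hypothesis k0 : 0 < k.
Definition cm : R := (m%:R - 1) / 2.
Definition nu (s : R) : R := s `^ cm.

Lemma nu_gt0 s : 0 < s -> 0 < nu s.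
Proof. exact: powR_gt0. Qed.
Lemma nu_der s : 0 < s -> der nu s (cm * nu s / s).
Proof.
move=> s0.
have E (t : R) : 0 < t -> nu t = expR (cm * ln t) by move=> t0; rewrite /nu /powR gt_eqF.
apply: (der_near (f := fun t => expR (cm * ln t))).
  near=> t; rewrite E//; near: t; exact: lt_nbhsr.
apply: der_eq (der_comp (f := expR) (derZ cm (is_derive1_ln s0)) (is_derive_expR _)) _.
by rewrite E//; ring.
Unshelve. all: by end_near. Qed.

Definition radode (s0 : R) (f f1 : R -> R) : Prop := forall s, s0 <= s ->
  der f s (f1 s) /\ der f1 s (- ((m%:R - 1) / s * f1 s) - k ^+ 2 * f s).

Lemma cm_itv : `|cm * (cm - 1)| <= 1.
Proof.
by rewrite /cm; case: hm => ->; rewrite ler_norml; apply/andP; split; lra.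
Qed.

Section Sol.
Variables (s0 : R) (f f1 : R -> R).
Hypothesis s00 : 0 < s0.
Hypothesis ode : radode s0 f f1.
Let kap : R := cm * (cm - 1) / k.
(** The factor s^((m-1)/2) removes the first order term: g'' = (-k^2 + cm (cm - 1) / s^2) g. *)
Let g s := nu s * f s.
Let g1 s := nu s * f1 s + cm * nu s / s * f s.
(** Variation of constants: [Pa] and [Pb] are the coefficients of [g] in the basis cos(ks), sin(ks).
    Their derivatives are g times O(s^-2), so they converge. *)
Let Pa s := g s * cos (k * s) - g1 s / k * sin (k * s).
Let Pb s := g s * sin (k * s) + g1 s / k * cos (k * s).
Let Q s := Pa s ^+ 2 + Pb s ^+ 2.
Let a : R := `|kap|.

Lemma amp_pos s : s0 <= s -> 0 < s. Proof. exact: lt_le_trans. Qed.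

Lemma amp_g s : s0 <= s -> der g s (g1 s).
Proof.
move=> ss; have [h1 _] := ode ss; have sp := amp_pos ss.
by apply: der_eq (derM (nu_der sp) h1) _; rewrite /g1 addrC.
Qed.
Lemma amp_g1 s : s0 <= s -> der g1 s (- k ^+ 2 * g s + cm * (cm - 1) / s ^+ 2 * g s).
Proof.
move=> ss; have [h1 h2] := ode ss; have sp := amp_pos ss; have sn : s != 0 by rewrite gt_eqF.
have h3 := derM (derM (derZ cm (nu_der sp)) (derV sn (derI s))) h1.
apply: der_eq (derD (derM (nu_der sp) h2) h3) _.
have m2 : m%:R - 1 = 2 * cm by rewrite /cm; field.
rewrite m2 /g; move: (nu s) (f s) (f1 s) => n F F1; field; done.
Qed.
Lemma der_trig s : der (fun s => cos (k * s)) s (- sin (k * s) * k) /\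
  der (fun s => sin (k * s)) s (cos (k * s) * k).
Proof.
have h : der (fun s => k * s) s k by apply: der_eq (derZ k (derI s)) _; rewrite mulr1.
by split; [exact: (der_comp (f := @cos R) h (is_derive_cos _))|exact: (der_comp (f := @sin R) h (is_derive_sin _))].
Qed.
Let kn : k != 0. Proof. by rewrite gt_eqF. Qed.
Lemma amp_Pa s : s0 <= s -> der Pa s (- (kap / s ^+ 2) * g s * sin (k * s)).
Proof.
move=> ss; have sp := amp_pos ss; have sn : s != 0 by rewrite gt_eqF.
have [dc ds] := der_trig s.
apply: der_eq (derB (derM (amp_g ss) dc) (derM (derM (amp_g1 ss) (derC k^-1 s)) ds)) _.
rewrite /kap; move: (g s) (g1 s) (cos _) (sin _) => G G1 c S; by field; rewrite kn sn.
Qed.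
Lemma amp_Pb s : s0 <= s -> der Pb s (kap / s ^+ 2 * g s * cos (k * s)).
Proof.
move=> ss; have sp := amp_pos ss; have sn : s != 0 by rewrite gt_eqF.
have [dc ds] := der_trig s.
apply: der_eq (derD (derM (amp_g ss) ds) (derM (derM (amp_g1 ss) (derC k^-1 s)) dc)) _.
rewrite /kap; move: (g s) (g1 s) (cos _) (sin _) => G G1 c S; by field; rewrite kn sn.
Qed.
Lemma amp_gE s : g s = Pa s * cos (k * s) + Pb s * sin (k * s).
Proof.
rewrite /Pa /Pb; transitivity (g s * (cos (k * s) ^+ 2 + sin (k * s) ^+ 2)); last by ring.
by rewrite cos2Dsin2 mulr1.
Qed.
Lemma amp_g1E s : g1 s = k * (- Pa s * sin (k * s) + Pb s * cos (k * s)).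
Proof.
rewrite /Pa /Pb; transitivity (k * (g1 s / k * (cos (k * s) ^+ 2 + sin (k * s) ^+ 2))); last by ring.
by rewrite cos2Dsin2 mulr1; field.
Qed.
Lemma amp_QE s : Q s = g s ^+ 2 + (g1 s / k) ^+ 2.
Proof.
rewrite /Q /Pa /Pb; transitivity ((g s ^+ 2 + (g1 s / k) ^+ 2) * (cos (k * s) ^+ 2 + sin (k * s) ^+ 2)); first by ring.
by rewrite cos2Dsin2 mulr1.
Qed.
Let q' s := kap / s ^+ 2 * (2 * g s * (g1 s / k)).
Lemma amp_Q s : s0 <= s -> der Q s (q' s) /\ `|q' s| <= a / s ^+ 2 * Q s.
Proof.
move=> ss; have sp := amp_pos ss; split.
  apply: der_eq (derD (derX 2 (amp_Pa ss)) (derX 2 (amp_Pb ss))) _.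
  rewrite /q' [in RHS]amp_g1E /= !expr1.
  set c := cos _; set S := sin _; move: (Pa s) (Pb s) (g s) => p r G.
  by field; rewrite kn gt_eqF.
rewrite /q' normrM [`|kap / _|]normrM -/a [`|(s ^+ 2)^-1|]ger0_norm ?invr_ge0 ?sqr_ge0//.
rewrite ler_wpM2l//; first by rewrite divr_ge0 ?sqr_ge0// /a normr_ge0.
rewrite amp_QE ler_norml.
have := sqr_ge0 (g s - g1 s / k); have := sqr_ge0 (g s + g1 s / k).
move: (g s) (g1 s / k) => x y; rewrite !sqrrD sqrrN mulrN mulNrn => ? ?; apply/andP; split; lra.
Qed.

(** Gronwall's argument: Q exp(a/s) decreases and Q exp(-a/s) increases. The upper bound gives decay
    of the solution, the lower bound keeps its amplitude from vanishing. *)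
Lemma amp_Q_bounds s : s0 <= s ->
  Q s <= Q s0 * expR (a / s0) /\ Q s0 * expR (- (a / s0)) <= Q s.
Proof.
move=> ss.
have Q0 t : 0 <= Q t by rewrite /Q addr_ge0 ?sqr_ge0.
have a0 : 0 <= a by exact: normr_ge0.
have dI (b : R) t : s0 <= t -> der (fun t => expR (b / t)) t (expR (b / t) * (- (b / t ^+ 2))).
  move=> tt; have tn : t != 0 by rewrite gt_eqF//; exact: amp_pos.
  apply: (der_comp (f := expR)); last exact: is_derive_expR.
  apply: der_eq (derZ b (derV tn (derI t))) _; field; done.
have hq' := amp_Q.
have sp := amp_pos ss.
have as0 : 0 <= a / s by rewrite divr_ge0// ltW.
split.
  have : - (Q s0 * expR (a / s0)) <= - (Q s * expR (a / s)).
    apply: (@der_ge0_le _ (fun t => - (Q t * expR (a / t)))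
      (fun t => - (q' t * expR (a / t) + Q t * (expR (a / t) * (- (a / t ^+ 2)))))) => //.
      move=> t /andP[tt _]; apply: derN; apply: derM; [exact: (hq' t tt).1|exact: dI].
    move=> t /andP[tt _]; have := (hq' t tt).2; rewrite ler_norml => /andP[_ h].
    rewrite oppr_ge0 (_ : _ + _ = expR (a / t) * (q' t - a / t ^+ 2 * Q t)); last by ring.
    by rewrite mulr_ge0_le0 ?expR_ge0// subr_le0.
  rewrite lerN2 => H; apply: le_trans H.
  by rewrite -[leLHS]mulr1 ler_wpM2l// -expR0 ler_expR.
have : Q s0 * expR (- a / s0) <= Q s * expR (- a / s).
  apply: (@der_ge0_le _ (fun t => Q t * expR (- a / t))
    (fun t => q' t * expR (- a / t) + Q t * (expR (- a / t) * (- (- a / t ^+ 2))))) => //.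
    move=> t /andP[tt _]; apply: derM; [exact: (hq' t tt).1|exact: dI].
  move=> t /andP[tt _]; have := (hq' t tt).2; rewrite ler_norml => /andP[h _].
  rewrite (_ : _ + _ = expR (- a / t) * (q' t + a / t ^+ 2 * Q t)); last by ring.
  rewrite mulr_ge0 ?expR_ge0//; lra.
rewrite !mulNr => H; apply: le_trans H _.
by rewrite -[leRHS]mulr1 ler_wpM2l// -expR0 ler_expR oppr_le0.
Qed.

Definition amp_M : R := Num.sqrt (Q s0 * expR (a / s0)).
Lemma amp_M2 : amp_M ^+ 2 = Q s0 * expR (a / s0).
Proof. by rewrite sqr_sqrtr// mulr_ge0 ?expR_ge0// /Q addr_ge0 ?sqr_ge0. Qed.
Lemma amp_small s : s0 <= s -> `|g s| <= amp_M /\ `|g1 s| <= k * amp_M.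
Proof.
move=> ss; have [h _] := amp_Q_bounds ss; rewrite -amp_M2 amp_QE in h.
have M0 : 0 <= amp_M by exact: sqrtr_ge0.
split.
  rewrite -(ler_pXn2r (n := 2)) ?nnegrE// real_normK ?num_real//.
  by apply: le_trans h; rewrite lerDl sqr_ge0.
rewrite mulrC -ler_pdivrMr// -{1}(gtr0_norm k0) -normrV ?unitfE// -normrM.
rewrite -(ler_pXn2r (n := 2)) ?nnegrE// real_normK ?num_real//.
by apply: le_trans h; rewrite lerDr sqr_ge0.
Qed.

Lemma amp_bound s : s0 <= s ->
  nu s * `|f s| <= amp_M /\ nu s * `|f1 s| <= (k + 1 / s0) * amp_M.
Proof.
move=> ss; have [h1 h2] := amp_small ss; have sp := amp_pos ss.
have n0 := nu_gt0 sp.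
have M0 : 0 <= amp_M by exact: sqrtr_ge0.
have gf : nu s * `|f s| = `|g s| by rewrite /g normrM gtr0_norm.
split; first by rewrite gf.
have -> : nu s * `|f1 s| = `|g1 s - cm / s * g s|.
  rewrite /g1 /g (_ : _ - _ = nu s * f1 s); first by rewrite normrM gtr0_norm.
  by field; rewrite gt_eqF.
apply: le_trans (ler_normB _ _) _; rewrite mulrDl lerD//.
rewrite normrM ler_pM// normrM [`|s^-1|]gtr0_norm ?invr_gt0// ler_pM//.
- by rewrite invr_ge0 ltW.
- by rewrite /cm; case: hm => ->; rewrite ler_norml; apply/andP; split; lra.
- by rewrite lef_pV2// ?posrE.
Qed.

Lemma amplitude : exists A B C : R, [/\ 0 <= C,
  (forall s, s0 <= s -> `|nu s * f s - (A * cos (k * s) + B * sin (k * s))| <= C / s),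
  (forall s, s0 <= s -> `|nu s * f1 s - k * (- A * sin (k * s) + B * cos (k * s))| <= C / s) &
  (f s0 != 0 -> A != 0 \/ B != 0)].
Proof.
pose B0 : R := a * amp_M.
have M0 : 0 <= amp_M by exact: sqrtr_ge0.
have B00 : 0 <= B0 by rewrite mulr_ge0// normr_ge0.
have bd (c : R) s : s0 <= s -> `|c| <= 1 -> `|kap / s ^+ 2 * g s * c| <= B0 / s ^+ 2.
  move=> ss c1; rewrite normrM -[leRHS]mulr1 ler_pM ?normr_ge0//.
  rewrite mulrAC normrM [`|(s ^+ 2)^-1|]ger0_norm ?invr_ge0 ?sqr_ge0// ler_wpM2r ?invr_ge0 ?sqr_ge0//.
  rewrite normrM /B0 ler_wpM2l ?normr_ge0//; exact: (amp_small ss).1.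
have [A hA] : exists A, forall s, s0 <= s -> `|Pa s - A| <= B0 / s.
  apply: osc_lim s00 B00 amp_Pa _ => s ss.
  by rewrite !mulNr normrN; apply: bd => //; exact: sin_max.
have [B hB] : exists B, forall s, s0 <= s -> `|Pb s - B| <= B0 / s.
  apply: osc_lim s00 B00 amp_Pb _ => s ss.
  by apply: bd => //; exact: cos_max.
pose C : R := 2 * B0 * (k + 1) + amp_M.
have C0 : 0 <= C by apply: addr_ge0 => //; apply: mulr_ge0; [exact: mulr_ge0|apply: addr_ge0 => //; exact: ltW].
have comb s (p q : R) : s0 <= s -> `|p| <= 1 -> `|q| <= 1 ->
    `|(Pa s - A) * p + (Pb s - B) * q| <= 2 * B0 / s.
  move=> ss p1 q1; apply: le_trans (ler_normD _ _) _; rewrite !normrM.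
  have := hA s ss; have := hB s ss => h1 h2.
  have h3 : `|Pa s - A| * `|p| <= B0 / s * 1 by exact: ler_pM.
  have h4 : `|Pb s - B| * `|q| <= B0 / s * 1 by exact: ler_pM.
  by apply: le_trans (lerD h3 h4) _; rewrite mulr1 -mulrDl; lra.
have i0 s : s0 <= s -> 0 <= s^-1 by move=> ss; rewrite invr_ge0 ltW// amp_pos.
exists A, B, C; split=> //.
- move=> s ss.
  have -> : nu s * f s - (A * cos (k * s) + B * sin (k * s)) =
     (Pa s - A) * cos (k * s) + (Pb s - B) * sin (k * s).
    by rewrite -/(g s) amp_gE; ring.
  apply: le_trans (comb _ _ _ ss (cos_max _) (sin_max _)) _.
  rewrite ler_wpM2r ?i0// /C.
  have : 0 <= 2 * B0 * k by apply: mulr_ge0; [exact: mulr_ge0|exact: ltW].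
  lra.
- move=> s ss.
  have -> : nu s * f1 s - k * (- A * sin (k * s) + B * cos (k * s)) =
     k * ((Pa s - A) * (- sin (k * s)) + (Pb s - B) * cos (k * s)) - cm / s * g s.
    have -> : nu s * f1 s = g1 s - cm / s * g s by rewrite /g1 /g; field; rewrite gt_eqF// amp_pos.
    by rewrite amp_g1E; ring.
  apply: le_trans (ler_normB _ _) _; rewrite normrM gtr0_norm//.
  have sm : `|- sin (k * s)| <= 1 by rewrite normrN; exact: sin_max.
  have h1 := ler_wpM2l (ltW k0) (comb _ _ _ ss sm (cos_max (k * s))).
  have h2 : `|cm / s * g s| <= amp_M / s.
    rewrite mulrAC normrM [`|s^-1|]ger0_norm ?i0// ler_wpM2r ?i0// normrM -[leRHS]mul1r ler_pM//.
      by rewrite /cm; case: hm => ->; rewrite ler_norml; apply/andP; split; lra.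
    exact: (amp_small ss).1.
  apply: le_trans (lerD h1 h2) _; rewrite mulrA -mulrDl ler_wpM2r ?i0// /C.
  by rewrite mulrDr mulr1 (mulrC k); lra.
- move=> f0; apply/orP; rewrite -negb_and; apply/negP => /andP[/eqP A0 /eqP Bz].
  have Q0 : 0 < Q s0 * expR (- (a / s0)).
    rewrite mulr_gt0 ?expR_gt0// amp_QE ltr_pwDl ?sqr_ge0// exprn_even_gt0//=.
    by rewrite mulf_neq0// gt_eqF// nu_gt0.
  (* If both limits were zero, Pa^2 + Pb^2 <= 2 e^2 far out, which is half of the positive lower
     bound of [amp_Q_bounds]. *)
  pose e : R := Num.sqrt (Q s0 * expR (- (a / s0)) / 4).
  have e0 : 0 < e by rewrite sqrtr_gt0 divr_gt0.
  pose s := Num.max s0 (B0 / e + 1).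
  have ss : s0 <= s by rewrite le_max lexx.
  have sB : B0 / s <= e.
    rewrite ler_pdivrMr ?amp_pos// mulrC -ler_pdivrMr//.
    by apply: (@le_trans _ _ (B0 / e + 1)); [rewrite lerDl|rewrite le_max lexx orbT].
  have [_ hQ] := amp_Q_bounds ss.
  have := hA s ss; have := hB s ss; rewrite A0 Bz !subr0 => hb ha.
  have sq (x : R) : `|x| <= B0 / s -> x ^+ 2 <= e ^+ 2.
    move=> hx; rewrite -(real_normK (num_real x)) lerXn2r ?nnegrE// ?(ltW e0)//.
    exact: le_trans hx sB.
  have := sq _ hb; have := sq _ ha.
  have -> : e ^+ 2 = Q s0 * expR (- (a / s0)) / 4 by rewrite sqr_sqrtr// divr_ge0// ltW.
  have : Q s0 * expR (- (a / s0)) <= Pa s ^+ 2 + Pb s ^+ 2 := hQ; lra.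
Qed.
End Sol.
End Amp.

(** * Entire power series *)

Section PowerSeries.
Variable R : realType.
Implicit Types (c d : nat -> R) (x : R).

(** Domination by an exponential series: it forces convergence everywhere and survives termwise
    differentiation, sums and the shifts used below. *)
Definition eb c := exists A K : R, [/\ 0 <= A, 0 <= K & forall n, `|c n| <= A * (K ^+ n / n`!%:R)].
Definition ps c x : R := limn (pseries c x).

Lemma eb_cvg c x : eb c -> cvgn (pseries c x).
Proof.
move=> [A [K [A0 K0 h]]]; apply: normed_cvg.
apply: (@series_le_cvg _ _ (fun n => A * exp_coeff (K * `|x|) n)).
- by move=> n; rewrite normr_ge0.
- by move=> n; rewrite mulr_ge0// /exp_coeff /= divr_ge0// exprn_ge0// mulr_ge0.
- move=> n; rewrite /= normrM normrX /exp_coeff /= exprMn.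
  rewrite -mulrA (mulrC (`|x| ^+ n)) !mulrA ler_wpM2r ?exprn_ge0//.
  by rewrite -mulrA; exact: h.
- have -> : series (fun n => A * exp_coeff (K * `|x|) n) = A *: series (exp_coeff (K * `|x|)).
    apply/funext => n; rewrite /series /= -[RHS]/(A * _) mulr_sumr; exact: eq_bigr.
  apply: is_cvgZr; exact: is_cvg_series_exp_coeff.
Qed.

Lemma eb_diffs c : eb c -> eb (pseries_diffs c).
Proof.
move=> [A [K [A0 K0 h]]]; exists (A * K), K; split=> //; first exact: mulr_ge0.
move=> n; rewrite /pseries_diffs normrM ger0_norm//.
have := h n.+1; rewrite exprS factS natrM invfM => H.
apply: le_trans (ler_wpM2l _ H) _ => //; rewrite le_eqVlt; apply/orP; left; apply/eqP.
have n1 : n.+1%:R != 0 :> R by [].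
have n2 : n`!%:R != 0 :> R by rewrite pnatr_eq0 -lt0n fact_gt0.
by move: (n.+1%:R) (n`!%:R) n1 n2 => N1 N2 n1 n2; field; rewrite n1 n2.
Qed.

Lemma ps_der c x : eb c -> der (ps c) x (ps (pseries_diffs c) x).
Proof.
move=> h; have h1 := eb_diffs h; have h2 := eb_diffs h1.
apply: (@pseries_snd_diffs _ c (`|x| + 1)); try exact: eb_cvg.
by rewrite [ltRHS]ger0_norm ?addr_ge0// ltrDl.
Qed.
Lemma ps_cont c x : eb c -> {for x, continuous (ps c)}.
Proof. by move=> h; exact: der_cont (ps_der x h). Qed.

Lemma ps_cvg c x : eb c -> pseries c x @ \oo --> ps c x.
Proof. exact: eb_cvg. Qed.
Lemma ps_eq c x (l : R) : pseries c x @ \oo --> l -> ps c x = l.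
Proof. exact: cvg_lim. Qed.
Lemma ps_lin c d (a b x : R) : eb c -> eb d ->
  ps (fun n => a * c n + b * d n) x = a * ps c x + b * ps d x.
Proof.
move=> hc hd; apply: ps_eq.
rewrite (_ : pseries _ x = fun n => a * pseries c x n + b * pseries d x n).
  by apply: cvgD; apply: cvgM; try exact: cvg_cst; exact: ps_cvg.
apply/funext => n; rewrite /pseries /series /= !mulr_sumr -big_split /=.
by apply: eq_bigr => i _; ring.
Qed.
Definition sh c n := if n is p.+1 then c p else 0.
Lemma ps_sh c x : eb c -> ps (sh c) x = x * ps c x.
Proof.
move=> h; apply: ps_eq; rewrite -(cvg_shiftS (pseries (sh c) x)).
rewrite (_ : [sequence _]_n = fun n => x * pseries c x n).
  apply: cvgM; [exact: cvg_cst|exact: ps_cvg].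
apply/funext => n; rewrite /pseries /series /= big_nat_recl//= mul0r add0r mulr_sumr.
by apply: eq_bigr => i _; rewrite exprS; ring.
Qed.
Lemma eb_lin c d (a b : R) : eb c -> eb d -> eb (fun n => a * c n + b * d n).
Proof.
move=> [A [K [A0 K0 h]]] [B [L [B0 L0 h']]].
exists (`|a| * A + `|b| * B), (Num.max K L); split.
- by rewrite addr_ge0// mulr_ge0.
- by rewrite le_max K0.
move=> n; apply: le_trans (ler_normD _ _) _; rewrite mulrDl !normrM -!mulrA lerD//.
  rewrite ler_wpM2l//; apply: le_trans (h n) _; rewrite ler_wpM2l// ler_wpM2r ?invr_ge0//.
  by rewrite lerXn2r ?nnegrE ?le_max ?K0// lexx.
rewrite ler_wpM2l//; apply: le_trans (h' n) _; rewrite ler_wpM2l// ler_wpM2r ?invr_ge0//.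
by rewrite lerXn2r ?nnegrE ?le_max ?K0// lexx orbT.
Qed.
(** The factor n + 1 from differentiation is absorbed by 2^(n + 1), at the price of doubling [K]. *)
Lemma eb_sh c : eb c -> eb (sh (pseries_diffs c)).
Proof.
move=> [A [K [A0 K0 h]]]; exists A, (K * 2); split=> //; first exact: mulr_ge0.
case=> [|n]; rewrite /= ?normr0 ?mulr_ge0 ?divr_ge0 ?exprn_ge0 ?mulr_ge0//.
rewrite /pseries_diffs normrM ger0_norm//.
apply: le_trans (ler_wpM2l _ (h n.+1)) _ => //.
rewrite mulrCA ler_wpM2l// exprMn mulrA ler_wpM2r ?invr_ge0// mulrC ler_wpM2l ?exprn_ge0//.
by rewrite -natrX ler_nat ltnW// ltn_expl.
Qed.
Lemma ps0 c : ps c 0 = c 0%N.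
Proof.
apply: ps_eq; rewrite -(cvg_shiftS (pseries c 0)).
rewrite (_ : [sequence _]_n = fun n => c 0%N); first exact: cvg_cst.
apply/funext => n; rewrite /pseries /series /= big_nat_recl//= expr0 mulr1.
by rewrite big1 ?addr0// => i _; rewrite expr0n mulr0.
Qed.
Lemma ps_zero c x : (forall n, c n = 0) -> ps c x = 0.
Proof.
move=> h; apply: ps_eq; rewrite (_ : pseries c x = fun n => 0); first exact: cvg_cst.
by apply/funext => n; rewrite /pseries /series /= big1// => i _; rewrite h mul0r.
Qed.
End PowerSeries.

Section Profiles.
Variables (R : realType) (m : nat) (k : R).
Hypothesis hm : m = 2%N \/ m = 3%N.
Hypothesis k0 : 0 < k.

(* The radial Helmholtz equation in the variable [q = s ^+ 2], in which it has an entire solution. *)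
Definition profile (P : set R) (p p1 p2 : R -> R) : Prop := forall q, P q ->
  [/\ der p q (p1 q), der p1 q (p2 q), {for q, continuous p2} &
      4 * q * p2 q + 2 * m%:R * p1 q + k ^+ 2 * p q = 0].

Lemma profile_sub (P P' : set R) p p1 p2 : P' `<=` P -> profile P p p1 p2 -> profile P' p p1 p2.
Proof. by move=> h hp q /h; exact: hp. Qed.

Lemma profile_lin (P : set R) (a b : R) p p1 p2 r r1 r2 : profile P p p1 p2 -> profile P r r1 r2 ->
  profile P (fun q => a * p q + b * r q) (fun q => a * p1 q + b * r1 q) (fun q => a * p2 q + b * r2 q).
Proof.
move=> h h' q Pq; have [h1 h2 h3 h4] := h q Pq; have [g1 g2 g3 g4] := h' q Pq; split.
- by apply: derD; apply: derZ.
- by apply: derD; apply: derZ.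
- by apply: cvgD; apply: cvgM => //; exact: cvg_cst.
- have : a * (4 * q * p2 q + 2 * m%:R * p1 q + k ^+ 2 * p q) + b * (4 * q * r2 q + 2 * m%:R * r1 q + k ^+ 2 * r q) = 0.
    by rewrite h4 g4 !mulr0 addr0.
  by move=> <-; ring.
Qed.

Lemma profile_radode (P : set R) (s0 : R) p p1 p2 : profile P p p1 p2 -> 0 < s0 ->
  (forall s, s0 <= s -> P (s ^+ 2)) -> radode m k s0 (fun s => p (s ^+ 2)) (fun s => 2 * s * p1 (s ^+ 2)).
Proof.
move=> h s00 hP s ss; have [h1 h2 _ h4] := h _ (hP s ss).
have sn : s != 0 by rewrite gt_eqF// (lt_le_trans s00).
have dq : der (fun s => s ^+ 2) s (2 * s) by apply: der_eq (derX 2 (derI s)) _; ring.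
split; first by apply: der_eq (der_comp dq h1) _; ring.
apply: der_eq (derM (derZ 2 (derI s)) (der_comp dq h2)) _.
have -> : k ^+ 2 * p (s ^+ 2) = - (4 * s ^+ 2 * p2 (s ^+ 2) + 2 * m%:R * p1 (s ^+ 2)).
  by apply/eqP; rewrite -addr_eq0 addrC h4.
by field.
Qed.

(** The recurrence read off from 4 q p'' + 2 m p' + k^2 p = 0. The series in q = s^2 is J_0(k s) for
    m = 2 and sin(k s)/(k s) for m = 3. *)
Fixpoint cJ (n : nat) : R := if n is p.+1 then - (k ^+ 2) * cJ p / (2 * (p.+1)%:R * (2 * p%:R + m%:R)) else 1.

Lemma m_ge2 : 2 <= m%:R :> R.
Proof. by case: hm => ->; rewrite ler_nat. Qed.

Lemma cJ_bound n : `|cJ n| <= (k ^+ 2) ^+ n / n`!%:R.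
Proof.
elim: n => [|n IH]; first by rewrite /= normr1 expr0 fact0 divr1.
have m2 := m_ge2; have n0 : 0 <= n%:R :> R by [].
have n1 : 0 < n.+1%:R :> R by [].
rewrite [cJ _]/= normrM normrM normrN [`|k ^+ 2|]ger0_norm ?sqr_ge0//.
rewrite normrV ?unitfE ?mulf_neq0// ?gt_eqF//; last by lra.
rewrite [`|2 * _ * _|]ger0_norm; last by rewrite !mulr_ge0//; lra.
have n2 : n`!%:R != 0 :> R by rewrite pnatr_eq0 -lt0n fact_gt0.
have D1 : 1 <= 2 * (2 * n%:R + m%:R) :> R by lra.
rewrite ler_pdivrMr; last by rewrite !mulr_gt0//; lra.
rewrite [(k ^+ 2) ^+ _]exprS factS natrM.
rewrite (_ : _ / (_ * n`!%:R) * _ = (2 * (2 * n%:R + m%:R)) * (k ^+ 2 * ((k ^+ 2) ^+ n / n`!%:R))); last first.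
  move: (n.+1%:R) (n`!%:R) (2 * n%:R + m%:R) n1 n2 => N1 N2 N3 n1 n2.
  by field; rewrite n2 gt_eqF.
apply: (@le_trans _ _ (k ^+ 2 * ((k ^+ 2) ^+ n / n`!%:R))); first by rewrite ler_wpM2l ?sqr_ge0.
rewrite -[leLHS]mul1r; apply: ler_wpM2r => //; apply: mulr_ge0; first exact: sqr_ge0.
by rewrite divr_ge0// exprn_ge0// sqr_ge0.
Qed.

Lemma eb_cJ : eb cJ.
Proof. by exists 1, (k ^+ 2); split; rewrite ?sqr_ge0// => n; rewrite mul1r cJ_bound. Qed.

Lemma J_profile : profile setT (ps cJ) (ps (pseries_diffs cJ)) (ps (pseries_diffs (pseries_diffs cJ))).
Proof.
have h := eb_cJ; have h1 := eb_diffs h; have h2 := eb_diffs h1.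
move=> q _; split; [exact: ps_der|exact: ps_der|exact: ps_cont|].
have hs := eb_sh h1.
have -> : 4 * q * ps (pseries_diffs (pseries_diffs cJ)) q + 2 * m%:R * ps (pseries_diffs cJ) q + k ^+ 2 * ps cJ q =
  4 * ps (sh (pseries_diffs (pseries_diffs cJ))) q + 1 * (2 * m%:R * ps (pseries_diffs cJ) q + k ^+ 2 * ps cJ q).
  by rewrite ps_sh//; ring.
rewrite -ps_lin// -ps_lin//; last exact: eb_lin.
apply: ps_zero => n; have m2 := m_ge2.
have nn (p : nat) : 0 <= p%:R :> R by [].
have n3 (p : nat) : 2 * p%:R + m%:R != 0 :> R by rewrite gt_eqF//; have := nn p; lra.
have n4 (p : nat) : p.+1%:R != 0 :> R by [].
case: n => [|n]; rewrite /sh /pseries_diffs; [rewrite [cJ 1]/=|rewrite [cJ n.+2]/=].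
  have n30 := n3 0%N; rewrite mulr0 add0r in n30.
  by rewrite [cJ 0]/= mulr0 !add0r; field.
rewrite -[- k ^+ 2 * cJ n / _]/(cJ n.+1); move: (cJ n.+1) => c.
have := n3 n.+1; move: (n.+2%:R) (n4 n.+1) => N2 n6; move: (n.+1%:R) => N1 n5.
by field; rewrite n5 n6.
Qed.

Lemma J_profile0 : ps cJ 0 = 1.
Proof. exact: ps0. Qed.
End Profiles.

(** * Singular radial solutions in two and three dimensions *)

Section Y2.
Variables (R : realType) (k : R).
Hypothesis k0 : 0 < k.
Let cJ2 := cJ 2 k.
(** The regular part g of the second solution ln(s) J + g in the plane. Inserting this form into the
    equation leaves 4 q g'' + 4 g' + k^2 g = -4 J', whose coefficients satisfy this recurrence. *)
Fixpoint dY (n : nat) : R := if n is p.+1 then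
  - (k ^+ 2) * dY p / (4 * (p.+1)%:R ^+ 2) - cJ2 p.+1 / (p.+1)%:R else 0.
(** The rate 2 k^2 instead of k^2 lets each of the two terms of the recurrence take half of the
    bound. *)
Lemma dY_bound n : `|dY n| <= (2 * k ^+ 2) ^+ n / n`!%:R.
Proof.
elim: n => [|n IH]; first by rewrite /= normr0 expr0 fact0 divr1.
have n1 : 1 <= n.+1%:R :> R by rewrite ler1n.
have n0 : 0 < n.+1%:R :> R by [].
have n2 : 0 < n`!%:R :> R by rewrite ltr0n fact_gt0.
set T := (2 * k ^+ 2) ^+ n.+1 / (n.+1)`!%:R.
have T0 : 0 <= T by rewrite divr_ge0// exprn_ge0// mulr_ge0 ?sqr_ge0.
have -> : dY n.+1 = - (k ^+ 2) * dY n / (4 * n.+1%:R ^+ 2) - cJ2 n.+1 / n.+1%:R by [].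
apply: le_trans (ler_normB _ _) _.
have h1 : `|- (k ^+ 2) * dY n / (4 * n.+1%:R ^+ 2)| <= T / 2.
  rewrite normrM normrM normrN [`|k ^+ 2|]ger0_norm ?sqr_ge0//.
  rewrite [X in _ * X]ger0_norm ?invr_ge0 ?mulr_ge0 ?sqr_ge0//.
  rewrite ler_pdivrMr ?mulr_gt0 ?exprn_gt0//.
  have -> : T / 2 * (4 * n.+1%:R ^+ 2) = 4 * n.+1%:R * (k ^+ 2 * ((2 * k ^+ 2) ^+ n / n`!%:R)).
    rewrite /T [(2 * k ^+ 2) ^+ _]exprS factS natrM.
    by move: (n.+1%:R) (n`!%:R) n0 n2 => N1 N2 n0 n2; field; rewrite !gt_eqF.
  apply: (@le_trans _ _ (k ^+ 2 * ((2 * k ^+ 2) ^+ n / n`!%:R))); first by rewrite ler_wpM2l ?sqr_ge0.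
  rewrite -[leLHS]mul1r ler_wpM2r//; last by lra.
  by rewrite mulr_ge0 ?sqr_ge0// divr_ge0 ?exprn_ge0// mulr_ge0 ?sqr_ge0.
have h2 : `|cJ2 n.+1 / n.+1%:R| <= T / 2.
  rewrite normrM [X in _ * X]ger0_norm ?invr_ge0//.
  have hm2 : 2%N = 2%N \/ 2%N = 3%N by left.
  have := cJ_bound k hm2 n.+1; rewrite -/cJ2 => h.
  rewrite ler_pdivrMr//; apply: le_trans h _.
  have -> : T / 2 = 2 ^+ n * ((k ^+ 2) ^+ n.+1 / (n.+1)`!%:R).
    by rewrite /T exprMn [2 ^+ n.+1]exprS; field; rewrite pnatr_eq0 -lt0n fact_gt0.
  rewrite mulrAC -[leLHS]mul1r ler_wpM2r//.
    by rewrite divr_ge0// exprn_ge0// sqr_ge0.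
  have : 1 <= 2 ^+ n :> R by rewrite exprn_ege1// ler1n.
  move=> h2; rewrite -[leLHS]mulr1 ler_pM//.
lra.
Qed.
Lemma eb_dY : eb dY.
Proof. by exists 1, (2 * k ^+ 2); split=> [//||n]; [by rewrite mulr_ge0 ?sqr_ge0|by rewrite mul1r dY_bound]. Qed.

Let J := ps cJ2.
Let J1 := ps (pseries_diffs cJ2).
Let J2 := ps (pseries_diffs (pseries_diffs cJ2)).
Let g := ps dY.
Let g1 := ps (pseries_diffs dY).
Let g2 := ps (pseries_diffs (pseries_diffs dY)).

Lemma dY_eq q : 4 * q * g2 q + 4 * g1 q + k ^+ 2 * g q = - 4 * J1 q.
Proof.
have h := eb_dY; have h1 := eb_diffs h; have h2 := eb_diffs h1; have hs := eb_sh h1.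
have hJ : eb (pseries_diffs cJ2) by apply/eb_diffs/eb_cJ => //; left.
apply/eqP; rewrite mulNr -addr_eq0; apply/eqP.
have -> : 4 * q * g2 q + 4 * g1 q + k ^+ 2 * g q + 4 * J1 q =
  1 * (4 * ps (sh (pseries_diffs (pseries_diffs dY))) q + 4 * g1 q) + 1 * (k ^+ 2 * g q + 4 * J1 q).
  by rewrite ps_sh// /g2; ring.
rewrite -!ps_lin//; try exact: eb_lin.
apply: ps_zero => n.
have n4 (p : nat) : p.+1%:R != 0 :> R by [].
have dS (p : nat) : dY p.+1 = - (k ^+ 2) * dY p / (4 * p.+1%:R ^+ 2) - cJ2 p.+1 / p.+1%:R by [].
case: n => [|n]; rewrite /sh /pseries_diffs !dS; first by field.
rewrite -dS; move: (dY n.+1) (cJ2 n.+2) => c e.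
have -> : n.+1%:R = n.+2%:R - 1 :> R by rewrite -[n.+2%:R]natr1 addrK.
by move: (n.+2%:R) (n4 n.+1) => N2 n6; field.
Qed.

Lemma Y2_profile : profile 2 k [set q | 0 < q]
  (fun q => ln q / 2 * J q + g q)
  (fun q => J q / (2 * q) + ln q / 2 * J1 q + g1 q)
  (fun q => - J q / (2 * q ^+ 2) + J1 q / q + ln q / 2 * J2 q + g2 q).
Proof.
move=> q /= q0; have qn : q != 0 by rewrite gt_eqF.
have hm2 : 2%N = 2%N \/ 2%N = 3%N by left.
have [dJ dJ1 cJ' eJ] := @J_profile R 2 k hm2 q I.
have h := eb_dY; have h1 := eb_diffs h; have h2 := eb_diffs h1.
have dg : der g q (g1 q) := ps_der q h.
have dg1 : der g1 q (g2 q) := ps_der q h1.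
have dl : der (fun q => ln q / 2) q (q^-1 / 2).
  by apply: der_eq (derM (is_derive1_ln q0) (derC (2^-1) q)) _; ring.
have dV : der (fun q => (2 * q)^-1) q (- 2 / (2 * q) ^+ 2).
  have d2 : der (fun q => 2 * q) q 2 by apply: der_eq (derZ 2 (derI q)) _; rewrite mulr1.
  by apply: (derV _ d2); rewrite mulf_neq0.
split.
- by apply: der_eq (derD (derM dl dJ) dg) _; rewrite -/J -/J1; field.
- apply: der_eq (derD (derD (derM dJ dV) (derM dl dJ1)) dg1) _.
  by rewrite -/J -/J1 -/J2; move: (J q) (J1 q) (J2 q) (g2 q) (ln q) => a b c d e; field.
- apply: cvgD; first apply: cvgD; first apply: cvgD.
  + apply: cvgM; first by apply: cvgN; exact: der_cont dJ.
    apply: cvgV; first by rewrite mulf_neq0 ?expf_neq0.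
    by apply: (der_cont (derZ 2 (derX 2 (derI q)))).
  + by apply: cvgM; [exact: der_cont dJ1|exact: (der_cont (derV qn (derI q)))].
  + by apply: cvgM; [exact: der_cont dl|exact: cJ'].
  + exact: ps_cont.
- have := dY_eq q; move: eJ; rewrite -/cJ2 -/J -/J1 -/J2.
  move: (J q) (J1 q) (J2 q) (g q) (g1 q) (g2 q) (ln q) => a b c d e f l hj hg.
  have -> : 4 * q * (- a / (2 * q ^+ 2) + b / q + l / 2 * c + f) + 2 * 2 * (a / (2 * q) + l / 2 * b + e) + k ^+ 2 * (l / 2 * a + d)
    = l / 2 * (4 * q * c + 2 * 2 * b + k ^+ 2 * a) + (4 * q * f + 4 * e + k ^+ 2 * d) + 4 * b by field.
  by rewrite hj hg; ring.
Qed.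

Lemma sq_at0 (p : R -> R) : {for 0, continuous p} -> p (s ^+ 2) @[s --> 0^'+] --> p 0.
Proof.
move=> h; apply: cvg_at_right_filter.
have e : (fun s : R => s ^+ 2) 0 = 0 by rewrite /= expr0n.
have : {for 0, continuous (p \o (fun s : R => s ^+ 2))}.
  apply: continuous_comp; first exact: (der_cont (derX 2 (derI 0))).
  by rewrite /= expr0n.
by rewrite /prop_for /continuous_at /= expr0n.
Qed.

Lemma sln_at0 : s * ln s @[s --> (0:R)^'+] --> 0.
Proof.
apply/cvgrPdist_le => e e0.
have e2 : 0 < (e / 2) ^+ 2 by rewrite exprn_gt0// divr_gt0.
near=> s.
have s0 : 0 < s by near: s; exact: nbhs_right_gt.
have s1 : s <= 1 by near: s; apply: nbhs_right_le.
have se : s <= (e / 2) ^+ 2 by near: s; apply: nbhs_right_le.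
pose r : R := Num.sqrt s.
have r0 : 0 < r by rewrite sqrtr_gt0.
have rs : r ^+ 2 = s by rewrite sqr_sqrtr// ltW.
have l1 : ln s <= 0 by apply: ln_le0.
have l2 : ln s = 2 * ln r by rewrite -rs lnXn// mulr_natl.
(* Halving the exponent first, s |ln s| = 2 s |ln r| <= 2 s / r = 2 r with r = sqrt s. *)
have l3 : - ln r <= r^-1.
  by rewrite -lnV ?posrE//; apply: ltW; apply: ln_sublinear; rewrite invr_gt0.
have re : r <= e / 2.
  by rewrite -(ler_pXn2r (n := 2)) ?nnegrE ?(ltW r0) ?divr_ge0 ?(ltW e0)// rs.
rewrite sub0r normrN ler0_norm; last by rewrite mulr_ge0_le0// ltW.
rewrite -mulrN l2 -mulrN -rs.
have : r ^+ 2 * (2 * - ln r) <= r ^+ 2 * (2 * r^-1).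
  by rewrite ler_wpM2l ?sqr_ge0// ler_wpM2l.
move=> H; apply: le_trans H _.
by rewrite (_ : r ^+ 2 * (2 * r^-1) = 2 * r); [lra|field; rewrite gt_eqF].
Unshelve. all: by end_near. Qed.

Lemma Y2_near0 (p p1 : R -> R) : p = (fun q => ln q / 2 * J q + g q) ->
  p1 = (fun q => J q / (2 * q) + ln q / 2 * J1 q + g1 q) ->
  (s ^+ 1 * (2 * s * p1 (s ^+ 2)) @[s --> 0^'+] --> (1:R)) /\
  (s ^+ 1 * p (s ^+ 2) @[s --> 0^'+] --> (0:R)).
Proof.
move=> -> ->.
have hJ : eb cJ2 by apply: eb_cJ => //; left.
have h := eb_dY; have h1 := eb_diffs h.
have cs : s @[s --> (0:R)^'+] --> (0:R) by apply: cvg_at_right_filter.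
have lJ := sq_at0 (@ps_cont _ _ 0 hJ); have lJ1 := sq_at0 (@ps_cont _ _ 0 (eb_diffs hJ)).
have lg := sq_at0 (@ps_cont _ _ 0 h); have lg1 := sq_at0 (@ps_cont _ _ 0 h1).
have sl := sln_at0.
have J0 : ps cJ2 0 = 1 by exact: ps0.
split.
  have H : J (s ^+ 2) + 2 * (s * (s * ln s) * J1 (s ^+ 2)) + 2 * (s * s * g1 (s ^+ 2)) @[s --> 0^'+] -->
      1 + 2 * (0 * 0 * J1 0) + 2 * (0 * 0 * g1 0).
    apply: cvgD; first apply: cvgD.
    - by rewrite -J0; exact: lJ.
    - by apply: cvgM; [exact: cvg_cst|apply: cvgM => //; exact: cvgM].
    - by apply: cvgM; [exact: cvg_cst|apply: cvgM => //; exact: cvgM].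
  rewrite !mul0r !mulr0 !addr0 in H.
  apply: cvg_trans H; apply: near_eq_cvg; near=> s.
  have s0 : 0 < s by near: s; exact: nbhs_right_gt.
  by rewrite lnXn// -mulr_natl; field; rewrite gt_eqF.
have H : s * ln s * J (s ^+ 2) + s * g (s ^+ 2) @[s --> 0^'+] --> 0 * J 0 + 0 * g 0.
  by apply: cvgD; apply: cvgM.
rewrite !mul0r addr0 in H.
apply: cvg_trans H; apply: near_eq_cvg; near=> s.
have s0 : 0 < s by near: s; exact: nbhs_right_gt.
by rewrite lnXn// -mulr_natl; field.
Unshelve. all: by end_near. Qed.
End Y2.

Section Y3.
Variables (R : realType) (k : R).
(** The square root written through exp and ln, a form that differentiates directly. *)
Let r (q : R) : R := expR (ln q / 2).
Lemma Y3_r q : 0 < q -> [/\ 0 < r q, r q ^+ 2 = q & der r q (r q / (2 * q))].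
Proof.
move=> q0; split; first exact: expR_gt0.
  by rewrite /r -expRM_natl mulrC divfK// lnK.
apply: der_eq (der_comp (f := expR) (derM (is_derive1_ln q0) (derC 2^-1 q)) (is_derive_expR _)) _.
by rewrite -/(r q); field; rewrite gt_eqF.
Qed.
Lemma Y3_rs (s : R) : 0 < s -> r (s ^+ 2) = s.
Proof. by move=> s0; rewrite /r lnXn// (_ : _ / 2 = ln s) ?lnK//; field. Qed.

Let p q := cos (k * r q) / r q.
Let p1 q := - (k * sin (k * r q) / (2 * q)) - cos (k * r q) / (2 * q * r q).
Let p2 q := - (k ^+ 2 * cos (k * r q) * r q / (4 * q ^+ 2)) + 3 * k * sin (k * r q) / (4 * q ^+ 2)
   + 3 * cos (k * r q) / (4 * q ^+ 2 * r q).

Lemma Y3_profile : profile 3 k [set q | 0 < q] p p1 p2.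
Proof.
move=> q /= q0; have qn : q != 0 by rewrite gt_eqF.
have [rp r2 dr] := Y3_r q0; have rn : r q != 0 by rewrite gt_eqF.
have dk : der (fun q => k * r q) q (k * (r q / (2 * q))) by exact: derZ.
have dc : der (fun q => cos (k * r q)) q (- sin (k * r q) * (k * (r q / (2 * q)))).
  exact: (der_comp (f := @cos R) dk (is_derive_cos _)).
have ds : der (fun q => sin (k * r q)) q (cos (k * r q) * (k * (r q / (2 * q)))).
  exact: (der_comp (f := @sin R) dk (is_derive_sin _)).
have d2 : der (fun q => 2 * q) q 2 by apply: der_eq (derZ 2 (derI q)) _; rewrite mulr1.
have q2n : 2 * q != 0 by rewrite mulf_neq0.
have q2r : 2 * q * r q != 0 by rewrite mulf_neq0.
have dq4 := derZ 4 (derX 2 (derI q)).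
have q4n : 4 * q ^+ 2 != 0 by rewrite mulf_neq0 ?expf_neq0.
split.
- apply: der_eq (derM dc (derV rn dr)) _; rewrite /p1.
  by move: (cos _) (sin _) => c S; field; rewrite qn rn.
- apply: der_eq (derB (derN (derM (derZ k ds) (derV (f := fun q => 2 * q) q2n d2))) (derM dc (derV (f := fun q => 2 * q * r q) q2r (derM d2 dr)))) _.
  by rewrite /p2; move: (cos _) (sin _) => c S; field; rewrite qn rn.
- have cV := der_cont (derV (f := fun q => 4 * q ^+ 2) q4n dq4).
  apply: cvgD; first apply: cvgD.
  + apply: cvgN; apply: cvgM; last exact: cV.
    by apply: cvgM; [exact: (der_cont (derZ (k ^+ 2) dc))|exact: (der_cont dr)].
  + by apply: cvgM; [exact: (der_cont (derZ (3 * k) ds))|exact: cV].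
  + apply: cvgM; first exact: (der_cont (derZ 3 dc)).
    by apply: (der_cont (derV _ (derM dq4 dr))); rewrite mulf_neq0.
- rewrite /p /p1 /p2; move: (cos _) (sin _) => c S.
  by move: (r q) rn r2 => t tn <-; field.
Qed.

Lemma Y3_near0 : (s ^+ 2 * (2 * s * p1 (s ^+ 2)) @[s --> 0^'+] --> (-1:R)) /\
  (s ^+ 2 * p (s ^+ 2) @[s --> 0^'+] --> (0:R)).
Proof.
have cs : s @[s --> (0:R)^'+] --> (0:R) by apply: cvg_at_right_filter.
have dk : der (fun s => k * s) 0 (k * 1) by apply: derZ; exact: derI.
have cc : cos (k * s) @[s --> (0:R)^'+] --> (1:R).
  have h := der_cont (der_comp (f := @cos R) dk (is_derive_cos _)).
  by rewrite /prop_for /continuous_at /= mulr0 cos0 in h; exact: cvg_at_right_filter h.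
have cS : sin (k * s) @[s --> (0:R)^'+] --> (0:R).
  have h := der_cont (der_comp (f := @sin R) dk (is_derive_sin _)).
  by rewrite /prop_for /continuous_at /= mulr0 sin0 in h; exact: cvg_at_right_filter h.
split.
  have H : - (k * (s * sin (k * s))) - cos (k * s) @[s --> (0:R)^'+] --> - (k * (0 * 0)) - (1:R).
    apply: cvgB => //; apply: cvgN; apply: cvgM; [exact: cvg_cst|exact: cvgM].
  rewrite !mulr0 oppr0 add0r in H.
  apply: cvg_trans H; apply: near_eq_cvg; near=> s.
  have s0 : 0 < s by near: s; exact: nbhs_right_gt.
  by rewrite /p1 Y3_rs//; field; rewrite gt_eqF.
have H : s * cos (k * s) @[s --> (0:R)^'+] --> 0 * (1:R) by exact: cvgM.
rewrite mul0r in H.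
apply: cvg_trans H; apply: near_eq_cvg; near=> s.
have s0 : 0 < s by near: s; exact: nbhs_right_gt.
by rewrite /p Y3_rs//; field; rewrite gt_eqF.
Unshelve. all: by end_near. Qed.
End Y3.

(** * The outgoing radial solution *)

Section Outgoing.
Variables (R : realType) (m : nat) (k : R).
Hypothesis hm : m = 2%N \/ m = 3%N.
Hypothesis k0 : 0 < k.

(** [al] is the limiting flux of the singularity through small spheres. Being nonzero, it lets
    Green's formula recover the value of a field at the centre. *)
Lemma exists_Y : exists (p p1 p2 : R -> R) (al : R), [/\ profile m k [set q | 0 < q] p p1 p2, al != 0,
  s ^+ m.-1 * (2 * s * p1 (s ^+ 2)) @[s --> 0^'+] --> al &
  s ^+ m.-1 * p (s ^+ 2) @[s --> 0^'+] --> (0:R)].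
Proof.
case: hm => ->.
  have [h1 h2] := @Y2_near0 R k _ _ erefl erefl.
  by do 3 eexists; exists 1; split; [exact: Y2_profile|exact: oner_neq0|exact: h1|exact: h2].
have [h1 h2] := Y3_near0 k.
by do 3 eexists; exists (-1); split; [exact: Y3_profile|rewrite oppr_eq0 oner_neq0|exact: h1|exact: h2].
Qed.

Definition ampl (s0 A B C : R) (f f1 : R -> R) := [/\ 0 <= C,
  (forall s, s0 <= s -> `|nu m s * f s - (A * cos (k * s) + B * sin (k * s))| <= C / s) &
  (forall s, s0 <= s -> `|nu m s * f1 s - k * (- A * sin (k * s) + B * cos (k * s))| <= C / s)].

Lemma ampl_lin s0 A B C A' B' C' (f f1 g g1 : R -> R) (a b : R) : 0 < s0 -> ampl s0 A B C f f1 -> ampl s0 A' B' C' g g1 ->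
  ampl s0 (a * A + b * A') (a * B + b * B') (`|a| * C + `|b| * C')
    (fun s => a * f s + b * g s) (fun s => a * f1 s + b * g1 s).
Proof.
move=> s00 [C0 h1 h2] [C0' h1' h2']; split; first by rewrite addr_ge0// mulr_ge0.
  move=> s ss; have := h1 s ss; have := h1' s ss => H' H.
  rewrite (_ : _ - _ = a * (nu m s * f s - (A * cos (k * s) + B * sin (k * s))) +
     b * (nu m s * g s - (A' * cos (k * s) + B' * sin (k * s)))); last by move: (cos _) (sin _) (nu m s) (f s) (g s) (f1 s) (g1 s) => c S n x y z w; ring.
  apply: le_trans (ler_normD _ _) _; rewrite !normrM mulrDl -!mulrA.
  by apply: lerD; apply: ler_wpM2l.
move=> s ss; have := h2 s ss; have := h2' s ss => H' H.
rewrite (_ : _ - _ = a * (nu m s * f1 s - k * (- A * sin (k * s) + B * cos (k * s))) +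
   b * (nu m s * g1 s - k * (- A' * sin (k * s) + B' * cos (k * s)))); last by move: (cos _) (sin _) (nu m s) (f s) (g s) (f1 s) (g1 s) => c S n x y z w; ring.
apply: le_trans (ler_normD _ _) _; rewrite !normrM mulrDl -!mulrA.
by apply: lerD; apply: ler_wpM2l.
Qed.

Lemma ampl_weak s0 A B C C' (f f1 g g1 : R -> R) : 0 < s0 -> ampl s0 A B C f f1 -> C <= C' ->
  f =1 g -> f1 =1 g1 -> ampl s0 A B C' g g1.
Proof.
move=> s00 [C0 h1 h2] CC /funext <- /funext <-; split; first exact: le_trans CC.
  move=> s ss; apply: le_trans (h1 s ss) _; rewrite ler_wpM2r// invr_ge0 (le_trans (ltW s00))//.
move=> s ss; apply: le_trans (h2 s ss) _; rewrite ler_wpM2r// invr_ge0 (le_trans (ltW s00))//.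
Qed.

Lemma profile_ampl (P : set R) (s0 : R) p p1 p2 : profile m k P p p1 p2 -> 0 < s0 ->
  (forall s, s0 <= s -> P (s ^+ 2)) ->
  exists A B C, ampl s0 A B C (fun s => p (s ^+ 2)) (fun s => 2 * s * p1 (s ^+ 2)) /\
     (p (s0 ^+ 2) != 0 -> A != 0 \/ B != 0).
Proof.
move=> h s00 hP; have := amplitude hm k0 s00 (profile_radode h s00 hP).
by move=> [A [B [C [h1 h2 h3 h4]]]]; exists A, B, C.
Qed.

Lemma exists_J : exists (p p1 p2 : R -> R) (s0 A B C : R), [/\ profile m k setT p p1 p2, 0 < s0 <= 1,
  ampl s0 A B C (fun s => p (s ^+ 2)) (fun s => 2 * s * p1 (s ^+ 2)) & A != 0 \/ B != 0].
Proof.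
have hJ := J_profile k hm; have [d _ _ _] := hJ 0 I.
(* J(0) = 1, so some small s0 <= 1 has J(s0^2) nonzero, and the amplitude of J cannot vanish. *)
have lJ := sq_at0 (der_cont d); rewrite J_profile0 in lJ.
move/cvgrPdist_lt : lJ => /(_ (2^-1)) H.
have {H}H : \forall s \near (0:R)^'+, `|1 - ps (cJ m k) (s ^+ 2)| < 2^-1 by apply: H; rewrite invr_gt0.
have [s [s0 s1 hs]] : exists s : R, [/\ 0 < s, s <= 1 & `|1 - ps (cJ m k) (s ^+ 2)| < 2^-1].
  near (0:R)^'+ => s; exists s; split; near: s => //; [exact: nbhs_right_gt|exact: nbhs_right_le].
have [A [B [C [h1 h2]]]] := profile_ampl hJ s0 (fun _ _ => I).
do 3 eexists; exists s, A, B, C; split; [exact: hJ|by rewrite s0|exact: h1|apply: h2].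
apply/eqP => e; move: hs; rewrite e subr0 normr1; lra.
Unshelve. all: by end_near. Qed.

(** With amplitudes (A, B) for p and (-B, A) for q, the function p + i q behaves like (A - i B)
    exp(i k s), hence is outgoing. The imaginary part q is regular at the centre, so the singularity
    sits in the real part. *)
Lemma exists_outgoing : exists (p p1 p2 q q1 q2 : R -> R) (s0 A B C al : R),
  [/\ profile m k [set t | 0 < t] p p1 p2, profile m k setT q q1 q2, 0 < s0 <= 1, al != 0 &
   [/\ ampl s0 A B C (fun s => p (s ^+ 2)) (fun s => 2 * s * p1 (s ^+ 2)),
     ampl s0 (- B) A C (fun s => q (s ^+ 2)) (fun s => 2 * s * q1 (s ^+ 2)),
     s ^+ m.-1 * (2 * s * p1 (s ^+ 2)) @[s --> 0^'+] --> al &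
     s ^+ m.-1 * p (s ^+ 2) @[s --> 0^'+] --> (0:R)]].
Proof.
have [J [J1 [J2 [s0 [A [B [C [hJ s01 aJ AB]]]]]]]] := exists_J.
have [Y [Y1 [Y2 [al [hY al0 l1 l2]]]]] := exists_Y.
have s00 : 0 < s0 by case/andP: s01.
have [A' [B' [C' [aY _]]]] : exists A B C, ampl s0 A B C (fun s => Y (s ^+ 2)) (fun s => 2 * s * Y1 (s ^+ 2)) /\
     (Y (s0 ^+ 2) != 0 -> A != 0 \/ B != 0).
  by apply: (profile_ampl hY) => // s ss /=; rewrite exprn_gt0// (lt_le_trans s00).
have N0 : A ^+ 2 + B ^+ 2 != 0.
  rewrite paddr_eq0 ?sqr_ge0// !sqrf_eq0 negb_and; exact/orP.
(* With p = Y + mu1 J and q = mu2 J, matching the two amplitudes is a linear system for mu1 and mu2,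
   whose determinant is up to sign the squared amplitude of J. *)
pose mu1 : R := - (B * B' + A * A') / (A ^+ 2 + B ^+ 2).
pose mu2 : R := (B * A' - A * B') / (A ^+ 2 + B ^+ 2).
have e1 : 1 * A' + mu1 * A = mu2 * B + 0 * B by rewrite /mu1 /mu2; field.
have e2 : - (1 * B' + mu1 * B) = mu2 * A + 0 * A by rewrite /mu1 /mu2; field.
have a1 := ampl_lin 1 mu1 s00 aY aJ.
have a2 := ampl_lin mu2 0 s00 aJ aJ.
have [dJ dJ1 _ _] := hJ 0 I.
have cs : s @[s --> (0:R)^'+] --> (0:R) by apply: cvg_at_right_filter.
have cm1 : s ^+ m.-1 @[s --> (0:R)^'+] --> (0:R).
  have h := der_cont (derX m.-1 (derI (0:R))).
  rewrite /prop_for /continuous_at /= expr0n in h.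
  have e : m.-1 == 0%N = false by case: hm => ->.
  by rewrite e in h; exact: cvg_at_right_filter h.
do 6 eexists; exists s0, (1 * A' + mu1 * A), (1 * B' + mu1 * B), (`|1 : R| * C' + `|mu1| * C + (`|mu2| * C + `|0 : R| * C)), al.
have hm1 : 0 <= `|1 : R| * C' + `|mu1| * C by case: a1.
have hm2 : 0 <= `|mu2| * C + `|0 : R| * C by case: a2.
split.
- exact: (profile_lin 1 mu1 hY (profile_sub (fun _ _ => I) hJ)).
- exact: (profile_lin mu2 0 hJ hJ).
- by [].
- exact: al0.
- split.
  + by apply: (ampl_weak s00 a1) => //; [rewrite lerDl|move=> s /=; ring].
  + rewrite e2 e1.
    by apply: (ampl_weak s00 a2) => //; [rewrite lerDr|move=> s /=; ring].
  + have lJ1 : s ^+ m.-1 * (2 * s) * J1 (s ^+ 2) @[s --> (0:R)^'+] --> 0 * (2 * 0) * J1 0.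
      by apply: cvgM; [apply: cvgM => //; apply: cvgM => //; exact: cvg_cst|exact: (sq_at0 (der_cont dJ1))].
    have : s ^+ m.-1 * (2 * s * Y1 (s ^+ 2)) + mu1 * (s ^+ m.-1 * (2 * s) * J1 (s ^+ 2)) @[s --> (0:R)^'+] --> al + mu1 * (0 * (2 * 0) * J1 0).
      by apply: cvgD => //; apply: cvgM => //; exact: cvg_cst.
    rewrite mulr0 mulr0 mul0r mulr0 addr0; apply: cvg_trans.
    by apply: near_eq_cvg; apply: nearW => s /=; ring.
  + have : s ^+ m.-1 * Y (s ^+ 2) + mu1 * (s ^+ m.-1 * J (s ^+ 2)) @[s --> (0:R)^'+] --> 0 + mu1 * (0 * J 0).
      apply: cvgD => //; apply: cvgM => //; [exact: cvg_cst|apply: cvgM => //].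
      exact: (sq_at0 (der_cont dJ)).
    rewrite mul0r mulr0 addr0; apply: cvg_trans.
    by apply: near_eq_cvg; apply: nearW => s /=; ring.
Qed.
End Outgoing.

Section Nu.
Variables (R : realType) (m : nat).
Hypothesis hm : m = 2%N \/ m = 3%N.
Notation nu := (@nu R m).
Lemma nu_sqr (r : R) : 0 < r -> nu r * nu r = r ^+ m.-1.
Proof.
move=> r0; rewrite /nu -powRD; last by rewrite (gt_eqF r0) implybT.
rewrite -powR_mulrn ?ltW//; congr (_ `^ _).
by rewrite /cm; case: hm => -> /=; lra.
Qed.
Lemma cm_pos : 0 < cm R m <= 1.
Proof. by rewrite /cm; case: hm => ->; apply/andP; split; lra. Qed.
Lemma nu_le (r s : R) : 0 <= r -> r <= s -> nu r <= nu s.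
Proof.
move=> r0 rs; have /andP[c0 _] := cm_pos.
have s0 := le_trans r0 rs.
by rewrite /nu; apply: ge0_ler_powR => //; rewrite ?nnegrE//; exact: ltW.
Qed.
Lemma nu_mul (r s : R) : 0 <= r -> 0 <= s -> nu (r * s) = nu r * nu s.
Proof. by move=> r0 s0; exact: powRM. Qed.
Lemma nu_1 : nu 1 = 1.
Proof. by rewrite /nu powR1. Qed.
Lemma nu_le_id (r : R) : 1 <= r -> nu r <= r.
Proof.
move=> r1; have /andP[_ c1] := cm_pos.
by have := ler_powR r1 c1; rewrite powRr1// (le_trans _ r1).
Qed.
End Nu.

(** * Green's formula on shells *)

Section Shell.
Variables (R : realType) (m : nat).
Hypothesis hm : m = 2%N \/ m = 3%N.
Notation vec := 'rV[R]_m.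

(** The squared distance is a polynomial, so the cutoff is C^1 at the centre too. The choice al =
    t^2, be = 3 t^2 makes it vary exactly between the radii t and 2t. *)
Definition stp (al be : R) (c : vec) (y : vec) : R := step ((dotv (y - c) (y - c) - al) / be).
Definition gstp (al be : R) (c : vec) (i : 'I_m) (y : vec) : R :=
  step' ((dotv (y - c) (y - c) - al) / be) / be * (2 * (y 0 i - c 0 i)).

Lemma C1_stp (al be : R) (c : vec) : C1 (stp al be c) (gstp al be c).
Proof.
apply: C1U_C1.
have h := @C1U_comp R m setT _ _ (fun q => step ((q - al) / be)) (fun q => step' ((q - al) / be) / be)
   (@C1_C1U R m setT _ _ (C1_q c)).
apply: h => x _; set q := dotv _ _; split.
  have d : der (fun q => (q - al) / be) q (be^-1).
    by apply: der_eq (derM (derB (derI q) (derC al q)) (derC be^-1 q)) _; rewrite subr0 mul1r mulr0 addr0.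
  exact: (der_comp (f := @step R) d (step_der _)).
apply: ctM; last exact: ctC.
apply: (ct_comp (f := fun q => (q - al) / be) (g := @step' R)); last exact: step'_cont.
by apply: ctM; [apply: ctB; [exact: cvg_id|exact: ctC]|exact: ctC].
Qed.

Lemma stp0 (al be : R) (c y : vec) : 0 < be -> dotv (y - c) (y - c) <= al -> stp al be c y = 0.
Proof. by move=> b0 h; rewrite /stp step_le0// mulr_le0_ge0 ?subr_le0// invr_ge0 ltW. Qed.
Lemma stp1 (al be : R) (c y : vec) : 0 < be -> al + be <= dotv (y - c) (y - c) -> stp al be c y = 1.
Proof. by move=> b0 h; rewrite /stp step_ge1// ler_pdivlMr// mul1r; lra. Qed.
Lemma gstp0 (al be : R) (c y : vec) i : 0 < be ->
  dotv (y - c) (y - c) <= al \/ al + be <= dotv (y - c) (y - c) -> gstp al be c i y = 0.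
Proof.
move=> b0 [h|h]; rewrite /gstp.
  by rewrite step'_le0 ?mul0r// mulr_le0_ge0 ?subr_le0// invr_ge0 ltW.
by rewrite step'_ge1 ?mul0r// ler_pdivlMr// mul1r; lra.
Qed.
Lemma q_near_lt (c x : vec) (al : R) : dotv (x - c) (x - c) < al ->
  \forall y \near x, dotv (y - c) (y - c) < al.
Proof.
move=> h; have := @C1_Ct R m _ _ (C1_q c); move=> /(_ x)/ctP/(_ (al - dotv (x - c) (x - c))).
rewrite subr_gt0 => /(_ h)[d d0 hd]; apply/nbhs_vec; exists d => // y /hd.
by rewrite ltr_norml => /andP[_]; lra.
Qed.
Lemma q_near_gt (c x : vec) (al : R) : al < dotv (x - c) (x - c) ->
  \forall y \near x, al < dotv (y - c) (y - c).
Proof.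
move=> h; have := @C1_Ct R m _ _ (C1_q c); move=> /(_ x)/ctP/(_ (dotv (x - c) (x - c) - al)).
rewrite subr_gt0 => /(_ h)[d d0 hd]; apply/nbhs_vec; exists d => // y /hd.
by rewrite ltr_norml => /andP[]; lra.
Qed.

Definition GI (gT : 'I_m -> vec -> R) u (gu : 'I_m -> vec -> R) w (gw : 'I_m -> vec -> R) (y : vec) : R :=
  \sum_i gT i y * (u y * gw i y - w y * gu i y).

Lemma GI_ct U gT u gu w gw : C1U U u gu -> C1U U w gw -> (forall i, Ct (gT i)) ->
  (forall x : vec, ~ U x -> \forall y \near x, forall i, gT i y = 0) -> Ct (GI gT u gu w gw).
Proof.
move=> hu hw hT hz x; have [Ux|/hz nz] := pselect (U x).
  have [cu du] := hu x Ux; have [cw dw] := hw x Ux.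
  apply: ct_sum => i; apply: ctM; first exact: hT.
  by apply: ctB; apply: ctM => //; [exact: (dw i).2|exact: (du i).2].
apply: (ct_near (f := fun _ => 0)); last exact: ctC.
by apply: filterS nz => y hy; rewrite /GI big1// => i _; rewrite hy mul0r.
Qed.

(** One Green identity split over three shells, such as around the obstacle, around a singularity
    and near infinity. The constant [c] makes the total cutoff vanish off [U] and far out. *)
Lemma green3 U k u gu hu w gw hw T1 g1 T2 g2 T3 g3 (c L : R) :
  helm U k u gu hu -> helm U k w gw hw -> C1 T1 g1 -> C1 T2 g2 -> C1 T3 g3 -> 0 <= L ->
  (forall x : vec, ~ U x -> \forall y \near x,
     [/\ forall i, g1 i y = 0, forall i, g2 i y = 0, forall i, g3 i y = 0 & T1 y + T2 y - T3 y + c = 0]) ->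
  (forall x : vec, L <= enorm x -> T1 x + T2 x - T3 x + c = 0) ->
  vint L (GI g1 u gu w gw) + vint L (GI g2 u gu w gw) = vint L (GI g3 u gu w gw).
Proof.
move=> Hu Hw h1 h2 h3 L0 hz hL.
have cT : C1 (fun x => T1 x + T2 x - T3 x + c) (fun i x => g1 i x + g2 i x - g3 i x + 0).
  apply: C1U_C1; apply: C1UD; last exact: C1UC.
  by apply: C1UB; [apply: C1UD|]; exact: C1_C1U.
have [_ ] := @green R m hm U k u gu hu w gw hw _ _ L Hu Hw cT (fun x nx => filterS (fun y h => let: And4 _ _ _ e := h in e) (hz x nx)) L0 hL.
have [cu _ _] := Hu; have [cw _ _] := Hw.
have k1 : Ct (GI g1 u gu w gw).
  by apply: GI_ct cu cw h1.2 _ => x /hz; apply: filterS => y [].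
have k2 : Ct (GI g2 u gu w gw).
  by apply: GI_ct cu cw h2.2 _ => x /hz; apply: filterS => y [].
have k3 : Ct (GI g3 u gu w gw).
  by apply: GI_ct cu cw h3.2 _ => x /hz; apply: filterS => y [].
move=> e; apply/eqP; rewrite -subr_eq0; apply/eqP; rewrite -[RHS]e.
rewrite -(vintD hm L k1 k2) -(vintB hm L (CtD k1 k2) k3).
apply: (vint_ext hm) => y _; rewrite /GI -big_split /= -sumrB; apply: eq_bigr => i _; ring.
Qed.

(* The radial weight [S] of the cutoff has total mass one, so the integral is an average over the shell. *)
Lemma shell_avg (V : 'I_m -> vec -> R) (Fl : vec -> R) (e eps L : R) : 0 < eps -> 2 * eps <= L -> scont Fl ->
  Ct (fun y => \sum_i gstp (eps ^+ 2) (3 * eps ^+ 2) 0 i y * V i y) ->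
  (forall r (y : vec), eps <= r <= 2 * eps -> sph y ->
    `|r ^+ m.-1 * (\sum_i y 0 i * V i (r *: y)) - Fl y| <= e) ->
  `|vint L (fun y => \sum_i gstp (eps ^+ 2) (3 * eps ^+ 2) 0 i y * V i y) - sphere_int Fl| <= e * sig1 R m.
Proof.
move=> e0 eL cF cG h; have en : eps != 0 by rewrite gt_eqF.
set F := (fun y => \sum_i gstp _ _ _ i y * _) in cG *.
pose S (r : R) := step' ((r ^+ 2 - eps ^+ 2) / (3 * eps ^+ 2)) / (3 * eps ^+ 2) * (2 * r).
pose s (r : R) := step ((r ^+ 2 - eps ^+ 2) / (3 * eps ^+ 2)).
have ep2 : 0 < 3 * eps ^+ 2 by rewrite mulr_gt0// exprn_gt0.
have dq r : der (fun r => (r ^+ 2 - eps ^+ 2) / (3 * eps ^+ 2)) r (2 * r / (3 * eps ^+ 2)).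
  apply: der_eq (derM (derB (derX 2 (derI r)) (derC (eps ^+ 2) r)) (derC (3 * eps ^+ 2)^-1 r)) _.
  by rewrite mulr0 addr0 subr0 mulr1 expr1.
have ds r : der s r (S r).
  by apply: der_eq (der_comp (f := @step R) (dq r) (step_der _)) _; rewrite /S; ring.
have cS : cont S.
  move=> r; apply: ctM; last exact: (der_cont (derZ 2 (derI r))).
  apply: ctM; last exact: ctC.
  apply: (ct_comp (g := @step' R)); last exact: step'_cont.
  exact: der_cont (dq r).
have L0 : 0 <= L by lra.
have iS : int 0 L S = 1.
  rewrite (int_FTC L0 ds cS) /s step_ge1; last first.
    rewrite ler_pdivlMr// mul1r; nra.
  rewrite step_le0 ?subr0// expr0n sub0r mulNr oppr_le0 divr_ge0 ?sqr_ge0// ltW//.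
have S0 (r : R) : 0 <= r -> 0 <= S r.
  move=> r0; apply: mulr_ge0; last by rewrite mulr_ge0.
  apply: mulr_ge0; last by rewrite invr_ge0 ltW.
  by have /andP[] := step'_itv ((r ^+ 2 - eps ^+ 2) / (3 * eps ^+ 2)).
have FE r (y : vec) : sph y -> F (r *: y) =
   S r * (\sum_i y 0 i * V i (r *: y)).
  move=> sy; rewrite /F mulr_sumr; apply: eq_bigr => i _.
  rewrite /gstp subr0 dotvZl dotvZr -enorm_sqr sy expr1n mulr1 !mxE -expr2 /S; ring.
have sup r : 0 <= r -> ~~ (eps <= r <= 2 * eps) -> S r = 0.
  move=> r0; rewrite negb_and -!ltNge => /orP[lt|gt]; rewrite /S.
    by rewrite step'_le0 ?mul0r// mulr_le0_ge0 ?invr_ge0 ?(ltW ep2)// subr_le0 lerXn2r ?nnegrE// ltW.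
  rewrite step'_ge1 ?mul0r// ler_pdivlMr// mul1r; nra.
have cv := vcont hm cG.
have cSF : cont (fun r => sphere_int Fl * S r) by apply: contZ.
have -> : sphere_int Fl = int 0 L (fun r => sphere_int Fl * S r) by rewrite intZ// iS mulr1.
rewrite /vint -(intB 0 L cv cSF).
have bnd (r : R) : 0 <= r <= L -> `|r ^+ m.-1 * sphere_int (fun y => F (r *: y)) - sphere_int Fl * S r| <= e * sig1 R m * S r.
  move=> /andP[r0 rL]; have [hr|nr] := boolP (eps <= r <= 2 * eps); last first.
    rewrite (sup _ r0 nr) !mulr0 subr0 (sig_ext hm (G := fun _ => 0)).
      by rewrite (sig_cst hm) mul0r mulr0 normr0.
    by move=> y sy; rewrite FE// (sup _ r0 nr) mul0r.
  have cr := @Ct_ray _ _ _ r cG.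
  have c1 : scont (fun y => r ^+ m.-1 * F (r *: y)) by apply: scontZ.
  have c2 : scont (fun y => S r * Fl y) by apply: scontZ.
  rewrite -(sigZ hm _ cr) (mulrC _ (S r)) -(sigZ hm _ cF) -(sigB hm c1 c2).
  rewrite mulrAC; apply: (sig_abs hm); first exact: scontB c1 c2.
  move=> y sy; rewrite FE// mulrCA -mulrBr normrM ger0_norm ?S0// mulrC ler_wpM2r ?S0//.
  exact: h.
have cd : cont (fun r => r ^+ m.-1 * sphere_int (fun y => F (r *: y)) - sphere_int Fl * S r) by apply: contB.
have cE : cont (fun r => e * sig1 R m * S r) by apply: contZ.
have -> : e * sig1 R m = int 0 L (fun r => e * sig1 R m * S r) by rewrite intZ// iS mulr1.
rewrite ler_norml -[X in X <= _]mulN1r -(intZ 0 L (-1) cE); apply/andP; split; apply: int_le => //.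
- by apply: contZ.
- by move=> t /bnd; rewrite ler_norml mulN1r => /andP[].
- by move=> t /bnd; rewrite ler_norml => /andP[].
Qed.

Lemma helm_shift U k u g h (x : vec) : helm U k u g h ->
  helm (fun y => U (y + x)) k (fun y => u (y + x)) (fun i y => g i (y + x)) (fun i j y => h i j (y + x)).
Proof.
move=> [h1 h2 h3].
have sc F G : C1U U F G -> C1U (fun y => U (y + x)) (fun y => F (y + x)) (fun i y => G i (y + x)).
  move=> H y Uy; have [c d] := H _ Uy.
  have ct (Z : vec -> R) : ctat Z (y + x) -> ctat (fun y : vec => Z (y + x)) y.
    move=> hZ; apply: (ctv_comp (g := fun y : vec => y + x)) => //.
    by apply: ct_row => i; under eq_fun do rewrite mxE; apply: ctD; [exact: coord_continuous|exact: ctC].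
  split; first exact: ct.
  move=> i; split; last by apply: ct; exact: (d i).2.
  by have := (d i).1; rewrite /isp; under eq_fun do rewrite addrAC.
by split; [exact: sc|move=> i; exact: sc|move=> y /h3].
Qed.

Lemma radial_helm (P : set R) k p p1 p2 (x : vec) (U : set vec) : profile m k P p p1 p2 ->
  (forall y, U y -> P (dotv (y - x) (y - x))) ->
  helm U k (fun y => p (dotv (y - x) (y - x))) (fun i y => p1 (dotv (y - x) (y - x)) * (2 * (y 0 i - x 0 i)))
   (fun i j y => p2 (dotv (y - x) (y - x)) * (2 * (y 0 j - x 0 j)) * (2 * (y 0 i - x 0 i))
      + p1 (dotv (y - x) (y - x)) * (2 * ((j == i)%:R - 0))).
Proof.
move=> hp hU; have hq := @C1_C1U R m U _ _ (C1_q x); split.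
- apply: (C1U_comp hq) => y /hU/hp [d1 d2 _ _]; split=> //; exact: der_cont d2.
- move=> i; apply: C1UM.
    by apply: (C1U_comp hq) => y /hU/hp [_ d2 c _]; split.
  by apply: C1UZ; apply: C1UB; [exact: C1_C1U (C1_coord R i)|exact: C1UC].
- move=> y /hU/hp [_ _ _ e]; set q := dotv _ _ in e *.
  have -> : \sum_i (p2 q * (2 * (y 0 i - x 0 i)) * (2 * (y 0 i - x 0 i)) + p1 q * (2 * ((i == i)%:R - 0)))
     = 4 * q * p2 q + 2 * m%:R * p1 q.
    rewrite big_split /=; congr (_ + _).
      rewrite /q /dotv mulr_sumr mulr_suml; apply: eq_bigr => i _; rewrite !mxE; ring.
    under eq_bigr do rewrite eqxx subr0 mulr1.
    by rewrite sumr_const card_ord -mulr_natr; ring.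
  by apply/eqP; rewrite -addr_eq0 e.
Qed.

Lemma scont_bnd (F : vec -> R) : scont F -> exists2 M : R, 0 <= M & forall y, sph y -> `|F y| <= M.
Proof.
move=> cF.
have K : compact (F @` @sph R m) by apply: continuous_compact => //; exact: sph_compact.
have [M [_ hM]] := compact_bounded K.
exists (`|M| + 1); first by rewrite addr_ge0.
move=> y sy; apply: (hM (`|M| + 1)); last by exists y.
by rewrite (le_lt_trans (ler_norm M))// ltrDl.
Qed.

Lemma sum_sph (y : vec) : sph y -> \sum_i y 0 i * y 0 i = 1.
Proof. by move=> sy; rewrite -/(dotv y y) -enorm_sqr sy expr1n. Qed.
Lemma sph_coord (y : vec) i : sph y -> `|y 0 i| <= 1.
Proof. by move=> <-; exact: coord_enorm. Qed.
Lemma sum_le_m (f : 'I_m -> R) (M : R) : (forall i, `|f i| <= M) -> `|\sum_i f i| <= m%:R * M.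
Proof.
move=> h; apply: le_trans (ler_norm_sum _ _ _) _.
apply: le_trans (ler_sum _ (fun i _ => h i)) _.
by rewrite sumr_const card_ord mulr_natl.
Qed.

Lemma right_lim (F : R -> R) (l e : R) : F s @[s --> 0^'+] --> l -> 0 < e ->
  exists2 d : R, 0 < d & forall s : R, 0 < s -> s < d -> `|F s - l| <= e.
Proof.
move/cvgrPdist_le => H e0; have [d /= d0 hd] := H _ e0; exists d => // s s0 sd.
by rewrite distrC; apply: hd => //=; rewrite sub0r normrN gtr0_norm.
Qed.

(** On small spheres r^(m-1) p' tends to [al] while r^(m-1) p tends to 0. The flux through the
    shrinking shell thus retains only al u(0). *)
Lemma green_center U (u : vec -> R) gu (P : set R) k p p1 p2 (al d : R) : 0 < d ->
  (forall y : vec, enorm y < d -> U y) -> C1U U u gu ->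
  profile m k P p p1 p2 -> (forall q, 0 < q -> P q) ->
  s ^+ m.-1 * (2 * s * p1 (s ^+ 2)) @[s --> 0^'+] --> al ->
  s ^+ m.-1 * p (s ^+ 2) @[s --> 0^'+] --> (0:R) ->
  forall e : R, 0 < e -> exists2 e0 : R, 0 < e0 & forall eps L : R, 0 < eps -> eps < e0 -> 2 * eps <= L ->
   `|vint L (GI (gstp (eps ^+ 2) (3 * eps ^+ 2) 0) u gu
     (fun y => p (dotv (y - 0) (y - 0))) (fun i y => p1 (dotv (y - 0) (y - 0)) * (2 * (y 0 i - (0 : vec) 0 i))))
     - al * u 0 * sig1 R m| <= e * sig1 R m.
Proof.
move=> d0 dU hu hp hP l1 l2 e e0.
have U0 : U 0 by apply: dU; rewrite enorm0.
have [c0 dc] := hu 0 U0.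
pose G : R := \sum_i `|gu i 0| + 1.
have G0 : 0 < G by rewrite ltr_wpDl// sumr_ge0.
(* The coefficients of the three error terms: convergence to [al], continuity of u at 0, and p
   against the gradient of u. *)
pose D : R := (`|u 0| + 1) + m%:R * G + `|al|.
have D0 : 0 < D by rewrite ltr_pwDl// addr_gt0// ?mulr_ge0 ?ltr_wpDl//; rewrite ?mulr_gt0// ltr0n; case: hm => ->.
pose eta : R := Num.min 1 (e / D).
have eta0 : 0 < eta by rewrite lt_min ltr01 divr_gt0.
have eta1 : eta <= 1 by rewrite ge_min lexx.
have etaD : eta * D <= e by rewrite -ler_pdivlMr// ge_min lexx orbT.
have [d1 d10 h1] : exists2 d1 : R, 0 < d1 & forall s, 0 < s -> s < d1 -> `|s ^+ m.-1 * (2 * s * p1 (s ^+ 2)) - al| <= eta.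
  exact: right_lim l1 eta0.
have [d2 d20 h2] : exists2 d1 : R, 0 < d1 & forall s, 0 < s -> s < d1 -> `|s ^+ m.-1 * p (s ^+ 2)| <= eta.
  have [d1' ? h] := right_lim l2 eta0; exists d1' => // s s0 sd.
  by have := h s s0 sd; rewrite subr0.
have [d3 d30 h3] : exists2 d1 : R, 0 < d1 & forall y : vec, `|y - 0| < d1 -> `|u y - u 0| < eta.
  by have /ctP/(_ _ eta0) := c0.
have [d4 d40 h4] : exists2 d1 : R, 0 < d1 & forall i (y : vec), `|y - 0| < d1 -> `|gu i y - gu i 0| < 1.
  apply: fin_eps => [i|i a b b0 ba h y yb]; last by apply: h; exact: lt_le_trans yb ba.
  by have /ctP/(_ _ ltr01) := (dc i).2.
pose dd : R := Num.min (Num.min d1 d2) (Num.min (Num.min d3 d4) d).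
have dd0 : 0 < dd by rewrite !lt_min d10 d20 d30 d40 d0.
exists (dd / 2); first by rewrite divr_gt0.
move=> eps L eps0 epd eL.
have r2 r : r <= 2 * eps -> r < dd by lra.
rewrite -(sig_cst hm); apply: (@shell_avg _ (fun _ => al * u 0)) => //; first exact: scontC.
- apply: (@GI_ct (fun y => enorm y < d /\ 0 < dotv y y)).
  + by apply: C1U_sub hu => y [/dU].
  + have := @radial_helm P k p p1 p2 0 (fun y => enorm y < d /\ 0 < dotv y y) hp.
    case; first by move=> y [_ ?]; apply: hP; rewrite subr0.
    by [].
  + exact: (C1_stp _ _ _).2.
  + move=> x nx.
    have [xd|xd] := ltP (enorm x) d.
      have q0 : dotv (x - 0) (x - 0) < eps ^+ 2.
        rewrite subr0; have [//|h] := ltP (dotv x x) (eps ^+ 2).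
        by exfalso; apply: nx; split=> //; apply: lt_le_trans h; rewrite exprn_gt0.
      have := q_near_lt q0; apply: filterS => y hy i; apply: gstp0; first by rewrite mulr_gt0 ?exprn_gt0.
      by left; exact: ltW.
    have q0 : eps ^+ 2 + 3 * eps ^+ 2 < dotv (x - 0) (x - 0).
      rewrite subr0 -enorm_sqr.
      have : 2 * eps < enorm x by apply: lt_le_trans xd; apply: lt_le_trans (r2 _ (lexx _)) _; rewrite !ge_min lexx !orbT.
      by have := enorm_ge0 x; nra.
    have := q_near_gt q0; apply: filterS => y hy i; apply: gstp0; first by rewrite mulr_gt0 ?exprn_gt0.
    by right; exact: ltW.
- move=> r y /andP[r1 r2'] sy.
  have r0 : 0 < r by exact: lt_le_trans r1.
  have rd := r2 _ r2'.
  have ry : `|r *: y - 0| < dd.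
    by rewrite subr0; apply: le_lt_trans (norm_enorm _) _; rewrite enormZ sy mulr1 gtr0_norm.
  have q : dotv (r *: y - 0) (r *: y - 0) = r ^+ 2.
    by rewrite subr0 -enorm_sqr enormZ sy mulr1 gtr0_norm.
  have lt4 := ry; rewrite !lt_min in lt4; case/andP: lt4 => /andP[ry1 ry2] /andP[/andP[ry3 ry4] ry5].
  have ltr := rd; rewrite !lt_min in ltr; case/andP: ltr => /andP[rd1 rd2] _.
  have k1 := h1 r r0 rd1; have k2 := h2 r r0 rd2.
  have k3 := h3 _ ry3; have k4 i := h4 i _ ry4.
  have -> : \sum_i y 0 i * (u (r *: y) * (p1 (dotv (r *: y - 0) (r *: y - 0)) * (2 * ((r *: y) 0 i - (0 : vec) 0 i))) -
        p (dotv (r *: y - 0) (r *: y - 0)) * gu i (r *: y)) =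
     u (r *: y) * (2 * r * p1 (r ^+ 2)) - p (r ^+ 2) * \sum_i y 0 i * gu i (r *: y).
    transitivity (u (r *: y) * (2 * r * p1 (r ^+ 2)) * (\sum_i y 0 i * y 0 i) - p (r ^+ 2) * \sum_i y 0 i * gu i (r *: y)).
      rewrite q !mulr_sumr -sumrB; apply: eq_bigr => i _.
      by rewrite !mxE subr0; ring.
    by rewrite (sum_sph sy) mulr1.
  set A := _ ^+ _ * (2 * r * _) in k1; set B := _ * p _ in k2.
  have -> : r ^+ m.-1 * (u (r *: y) * (2 * r * p1 (r ^+ 2)) - p (r ^+ 2) * (\sum_i y 0 i * gu i (r *: y))) - al * u 0
    = (A - al) * u (r *: y) + al * (u (r *: y) - u 0) - B * (\sum_i y 0 i * gu i (r *: y)).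
    by rewrite /A /B; ring.
  have uB : `|u (r *: y)| <= `|u 0| + 1.
    rewrite -[u _](subrK (u 0)); apply: le_trans (ler_normD _ _) _; rewrite addrC lerD2l.
    by apply: le_trans (ltW k3) eta1.
  have gB : `|\sum_i y 0 i * gu i (r *: y)| <= m%:R * G.
    apply: sum_le_m => i; rewrite normrM -[leRHS]mul1r ler_pM ?sph_coord//.
    rewrite -[gu i _](subrK (gu i 0)); apply: le_trans (ler_normD _ _) _.
    rewrite addrC /G lerD// ?(ltW (k4 i))// (bigD1 i)//= lerDl sumr_ge0//.
  apply: le_trans etaD.
  apply: le_trans (ler_normB _ _) _; apply: le_trans (lerD (ler_normD _ _) (lexx _)) _; rewrite 3!normrM.
  have z1 : `|A - al| * `|u (r *: y)| <= eta * (`|u 0| + 1) by apply: ler_pM.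
  have z2 : `|al| * `|u (r *: y) - u 0| <= eta * `|al| by rewrite mulrC ler_wpM2r// ltW.
  have z3 : `|B| * `|\sum_i y 0 i * gu i (r *: y)| <= eta * (m%:R * G) by apply: ler_pM.
  apply: le_trans (lerD (lerD z1 z2) z3) _; rewrite /D.
  by rewrite le_eqVlt; apply/orP; left; apply/eqP; ring.
Qed.
End Shell.

Section Outgoing2.
Variables (R : realType) (m : nat) (k : R).
Hypothesis hm : m = 2%N \/ m = 3%N.
Hypothesis k0 : 0 < k.
Notation nu := (@nu R m).

Lemma trig_bound (A B t : R) : `|A * cos t + B * sin t| <= `|A| + `|B|.
Proof.
apply: le_trans (ler_normD _ _) _; rewrite !normrM.
by apply: lerD; rewrite -[leRHS]mulr1; apply: ler_wpM2l => //; [exact: cos_max|exact: sin_max].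
Qed.

Lemma ampl_bound s0 A B C f f1 (s : R) : 0 < s0 <= 1 -> ampl m k s0 A B C f f1 -> 1 <= s ->
  nu s * `|f s| <= `|A| + `|B| + C /\ nu s * `|f1 s| <= k * (`|A| + `|B|) + C.
Proof.
move=> /andP[s00 s01] [C0 h1 h2] s1; have ss : s0 <= s by exact: le_trans s1.
have sp : 0 < s by exact: lt_le_trans s1.
have n0 := nu_gt0 m sp.
have Cs : C / s <= C by rewrite ler_pdivrMr// ler_peMr.
rewrite -{1 2}(gtr0_norm n0) -!normrM; split.
  have := le_trans (h1 s ss) Cs; have := trig_bound A B (k * s).
  set X := _ * f s; set Y := _ + _ * sin _ => hY hX.
  rewrite -[X](subrK Y); apply: le_trans (ler_normD _ _) _; lra.
have := le_trans (h2 s ss) Cs; have := trig_bound B (- A) (k * s).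
have -> : - A * sin (k * s) + B * cos (k * s) = B * cos (k * s) + - A * sin (k * s) by rewrite addrC.
set X := _ * f1 s; set Y := _ + _ * sin _; rewrite normrN => hY hX.
rewrite -[X](subrK (k * Y)); apply: le_trans (ler_normD _ _) _; rewrite normrM (gtr0_norm k0).
by rewrite addrC lerD// addrC ler_wpM2l// ?(ltW k0)// addrC.
Qed.

(** The last two bounds say that p + i q satisfies the radiation condition: p' + k q and q' - k p
    gain a factor 1/s. *)
Definition outg (p p1 p2 q q1 q2 : R -> R) (K al : R) : Prop :=
  [/\ profile m k [set t | 0 < t] p p1 p2, profile m k setT q q1 q2,
   al != 0 /\ 0 <= K,
   (s ^+ m.-1 * (2 * s * p1 (s ^+ 2)) @[s --> 0^'+] --> al) /\
   (s ^+ m.-1 * p (s ^+ 2) @[s --> 0^'+] --> (0:R)) &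
   forall s, 1 <= s -> [/\ nu s * `|p (s ^+ 2)| <= K, nu s * `|2 * s * p1 (s ^+ 2)| <= K,
     nu s * `|q (s ^+ 2)| <= K, nu s * `|2 * s * q1 (s ^+ 2)| <= K &
     nu s * `|2 * s * p1 (s ^+ 2) + k * q (s ^+ 2)| <= K / s /\
     nu s * `|2 * s * q1 (s ^+ 2) - k * p (s ^+ 2)| <= K / s]].

Lemma exists_outg : exists p p1 p2 q q1 q2 K al, outg p p1 p2 q q1 q2 K al.
Proof.
have [p [p1 [p2 [q [q1 [q2 [s0 [A [B [C [al [hp hq s01 al0 [h1 h2 l1 l2]]]]]]]]]]]]] := exists_outgoing hm k0.
pose K : R := (1 + k) * (`|A| + `|B| + C).
exists p, p1, p2, q, q1, q2, K, al.
have C0 : 0 <= C by case: h1.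
have AB0 : 0 <= `|A| + `|B| by rewrite addr_ge0.
have K1 : `|A| + `|B| + C <= K by rewrite /K mulrDl mul1r lerDl mulr_ge0 ?(ltW k0)// addr_ge0.
have K2 : k * (`|A| + `|B|) + C <= K.
  rewrite /K; have := mulr_ge0 (ltW k0) C0; lra.
have K3 : (1 + k) * C <= K by rewrite /K ler_wpM2l// ?lerDr// addr_ge0// ltW.
have K0 : 0 <= K by rewrite /K mulr_ge0// addr_ge0// ltW.
split=> // s s1.
have [a1 a2] := ampl_bound s01 h1 s1; have [a3 a4] := ampl_bound s01 h2 s1.
rewrite normrN (addrC `|B|) in a3 a4.
have ss : s0 <= s by case/andP: s01 => _ ?; exact: le_trans s1.
have sp : 0 < s by exact: lt_le_trans s1.
have n0 := nu_gt0 m sp.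
have e1 := h1.
split; [exact: le_trans K1|exact: le_trans K2|exact: le_trans K1|exact: le_trans K2|].
have [_ b1 b2] := h1; have [_ b3 b4] := h2.
have x1 := b1 s ss; have x2 := b2 s ss; have x3 := b3 s ss; have x4 := b4 s ss.
have Ks : (1 + k) * (C / s) <= K / s by rewrite mulrA ler_wpM2r// invr_ge0 ltW.
have nE (Z : R) : nu s * `|Z| = `|nu s * Z| by rewrite normrM gtr0_norm.
rewrite !nE; split; apply: le_trans Ks.
  set X := nu s * (_) in x2; set Y := nu s * q _ in x3.
  rewrite (_ : nu s * _ = (X - k * (- A * sin (k * s) + B * cos (k * s))) + k * (Y - (- B * cos (k * s) + A * sin (k * s)))).
    apply: le_trans (ler_normD _ _) _; rewrite normrM (gtr0_norm k0) mulrDl mul1r lerD//.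
    by rewrite ler_wpM2l// ltW.
  by rewrite /X /Y; ring.
set X := nu s * (_) in x4; set Y := nu s * p _ in x1.
rewrite (_ : nu s * _ = (X - k * (- - B * sin (k * s) + A * cos (k * s))) - k * (Y - (A * cos (k * s) + B * sin (k * s)))).
  apply: le_trans (ler_normB _ _) _; rewrite normrM (gtr0_norm k0) mulrDl mul1r lerD//.
  by rewrite ler_wpM2l// ltW.
by rewrite /X /Y; ring.
Qed.
End Outgoing2.

Lemma sum3_ge (R : realType) (x y z : R) : 0 <= x -> 0 <= y -> 0 <= z ->
  [/\ x <= x + y + z, y <= x + y + z & z <= x + y + z].
Proof. by move=> *; split; lra. Qed.
Lemma far_arith (R : realType) (s ex eX t n : R) : 2 * ex + 2 * t + n + 1 <= s -> 0 <= n -> 1 <= t -> 0 <= ex ->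
  - ex <= eX - s -> [/\ s <= 2 * eX, t <= eX, 0 < eX & n <= s].
Proof. by move=> *; split; lra. Qed.

(** * Outgoing solutions *)

Section Rad.
Variables (R : realType) (m : nat) (k : R) (E : set 'rV[R]_m) (rho0 : R).
Hypothesis hm : m = 2%N \/ m = 3%N.
Hypothesis k0 : 0 < k.
Hypothesis oE : open E.
Hypothesis rho1 : 1 <= rho0.
Notation vec := 'rV[R]_m.
Hypothesis farE : forall y : vec, rho0 <= enorm y -> E y.
Notation nu := (@nu R m).
Implicit Types (a b fa fb : vec -> R) (ga gb : 'I_m -> vec -> R).

(* [(a, b)] and [(fa, fb)] are the real and imaginary parts of an outgoing solution and of its far field;
   [ga], [ha], [gb], [hb] are the first and second partial derivatives. *)
Definition radG a ga ha b gb hb fa fb : Prop :=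
  [/\ helm E k a ga ha, helm E k b gb hb & exists C r0 : R, [/\ 0 <= C, rho0 <= r0 &
   forall x : vec, r0 <= enorm x ->
    [/\ `|\sum_i x 0 i / enorm x * ga i x + k * b x| <= C / (enorm x * nu (enorm x)),
        `|\sum_i x 0 i / enorm x * gb i x - k * a x| <= C / (enorm x * nu (enorm x)),
        `|nu (enorm x) * a x - (cos (k * enorm x) * fa ((enorm x)^-1 *: x) - sin (k * enorm x) * fb ((enorm x)^-1 *: x))|
           <= C / enorm x &
        `|nu (enorm x) * b x - (sin (k * enorm x) * fa ((enorm x)^-1 *: x) + cos (k * enorm x) * fb ((enorm x)^-1 *: x))|
           <= C / enorm x]]].

Lemma helmN U u g h : helm U k u g h ->
  helm U k (fun x : vec => - u x) (fun i x => - g i x) (fun i j x => - h i j x).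
Proof.
move=> H; have := helm_lin (-2) H H.
rewrite (_ : (fun x => -2 * u x + u x) = (fun x => - u x)); last by apply/funext => x; ring.
rewrite (_ : (fun i x => -2 * g i x + g i x) = (fun i x => - g i x)); last by apply/funext => i; apply/funext => x; ring.
rewrite (_ : (fun i j x => -2 * h i j x + h i j x) = (fun i j x => - h i j x)) //.
by apply/funext => i; apply/funext => j; apply/funext => x; ring.
Qed.

(** Multiplication by -i preserves outgoing fields, so a statement about real parts applies to
    imaginary parts. *)
Lemma rad_rot a ga ha b gb hb fa fb : radG a ga ha b gb hb fa fb ->
  radG b gb hb (fun x => - a x) (fun i x => - ga i x) (fun i j x => - ha i j x) fb (fun x => - fa x).
Proof.
move=> [h1 h2 [C [r0 [C0 r00 h]]]]; split=> //; first exact: helmN.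
exists C, r0; split=> // x xr; have [a1 a2 a3 a4] := h x xr; split.
- by rewrite mulrN.
- rewrite (_ : _ - _ = - (\sum_i x 0 i / enorm x * ga i x + k * b x)); first by rewrite normrN.
  by rewrite opprD -sumrN; congr (_ + _); apply: eq_bigr => i _; rewrite mulrN.
- by rewrite mulrN opprK [_ + sin _ * _]addrC.
- rewrite (_ : _ - _ = - (nu (enorm x) * a x - (cos (k * enorm x) * fa ((enorm x)^-1 *: x) - sin (k * enorm x) * fb ((enorm x)^-1 *: x)))).
    by rewrite normrN.
  ring.
Qed.

Lemma enorm_sph (r : R) (y : vec) : 0 < r -> sph y -> enorm (r *: y) = r /\ (enorm (r *: y))^-1 *: (r *: y) = y.
Proof.
move=> r0 sy; have e : enorm (r *: y) = r by rewrite enormZ sy mulr1 gtr0_norm.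
by rewrite e scalerA mulVf ?scale1r// gt_eqF.
Qed.

(** On the sphere of radius r, undoing the phase exp(i k r) in the scaled field gives [fa] up to
    2C/r. The far field is thus a uniform limit of continuous functions. *)
Lemma rad_scont a ga ha b gb hb fa fb : radG a ga ha b gb hb fa fb -> scont fa.
Proof.
move=> [[h1 _ _] [h2 _ _] [C [r0 [C0 r00 h]]]]; apply: scont_lim => e e0.
pose r : R := Num.max r0 (2 * C / e).
have rr0 : r0 <= r by rewrite le_max lexx.
have rp : 0 < r by apply: lt_le_trans rr0; apply: lt_le_trans r00; exact: lt_le_trans rho1.
have Cr : 2 * C / r <= e.
  by rewrite ler_pdivrMr// [leRHS]mulrC -ler_pdivrMr// le_max lexx orbT.
exists (fun y => cos (k * r) * (nu r * a (r *: y)) + sin (k * r) * (nu r * b (r *: y))).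
  have sc (u : vec -> R) gu : C1U E u gu -> scont (fun y => u (r *: y)).
    move=> hu; apply/scontP => y sy d d0.
    have Ey : E (r *: y).
      apply: farE; rewrite (enorm_sph rp sy).1; exact: le_trans rr0.
    have [cu _] := hu _ Ey; have /ctP/(_ _ d0)[t t0 ht] := cu.
    exists (t / r); first by rewrite divr_gt0.
    move=> z sz zy; apply: ht; rewrite -scalerBr mx_normZ gtr0_norm// mulrC -ltr_pdivlMr//.
  by apply: scontD; do 2 apply: scontZ; apply: sc; [exact: h1|exact: h2].
move=> y sy; have [e1 e2] := enorm_sph rp sy.
have [|_ _] := h (r *: y); first by rewrite e1.
rewrite e2 e1; set A := nu r * _; set B := nu r * b _; set c := cos _; set s := sin _.
move=> hA hB; apply: le_trans Cr.
have -> : fa y - (c * A + s * B) = - (c * (A - (c * fa y - s * fb y)) + s * (B - (s * fa y + c * fb y))).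
  transitivity (fa y * (c ^+ 2 + s ^+ 2) - (c * A + s * B)); first by rewrite cos2Dsin2 mulr1.
  by ring.
rewrite normrN; apply: le_trans (ler_normD _ _) _; rewrite !normrM.
have c1 : `|c| <= 1 by exact: cos_max.
have s1 : `|s| <= 1 by exact: sin_max.
have : `|c| * `|A - (c * fa y - s * fb y)| <= 1 * (C / r) by apply: ler_pM.
have : `|s| * `|B - (s * fa y + c * fb y)| <= 1 * (C / r) by apply: ler_pM.
by rewrite !mul1r -mulrA; lra.
Qed.

Lemma rad_bnd a ga ha b gb hb fa fb : radG a ga ha b gb hb fa fb ->
  exists C r1 : R, [/\ 0 < C, rho0 <= r1 & forall x : vec, r1 <= enorm x -> nu (enorm x) * `|a x| <= C].
Proof.
move=> H; have sa := rad_scont H; have sb := rad_scont (rad_rot H).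
have [M M0 hM] := scont_bnd sa; have [N N0 hN] := scont_bnd sb.
have [h1 h2 [C [r0 [C0 r00 h]]]] := H.
exists (M + N + C + 1), r0; split=> //; first by rewrite ltr_wpDl// !addr_ge0.
move=> x xr; have [_ _ h3 _] := h x xr.
have r1 : 1 <= enorm x by apply: le_trans xr; apply: le_trans r00.
have rp : 0 < enorm x by exact: lt_le_trans r1.
have n0 := nu_gt0 m rp.
have sx : sph ((enorm x)^-1 *: x) by rewrite /sph /= enormZ ger0_norm ?invr_ge0 ?enorm_ge0// mulVf// gt_eqF.
have Cr : C / enorm x <= C by rewrite ler_pdivrMr// ler_peMr.
rewrite -{1}(gtr0_norm n0) -normrM.
move: h3; set X := _ * a x; set c := cos _; set s := sin _ => h3.
have c1 : `|c| <= 1 by exact: cos_max.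
have s1 : `|s| <= 1 by exact: sin_max.
rewrite -[X](subrK (c * fa ((enorm x)^-1 *: x) - s * fb ((enorm x)^-1 *: x))).
apply: le_trans (ler_normD _ _) _.
have : `|c * fa ((enorm x)^-1 *: x) - s * fb ((enorm x)^-1 *: x)| <= M + N.
  apply: le_trans (ler_normB _ _) _; rewrite !normrM -[M]mul1r -[N]mul1r.
  by apply: lerD; apply: ler_pM => //; [exact: hM|exact: hN].
lra.
Qed.

(** In at most three dimensions a cube of half side 1/4 lies in a ball of radius 3/4 < 1. Gradient
    estimates on such cubes stay within unit distance. *)
Lemma box_enorm (x y : vec) : `|y - x| <= 1 / 4 -> enorm (y - x) <= 3 / 4.
Proof.
move=> h; apply: le_trans (enorm_norm _) _; apply: (@le_trans _ _ (m%:R * (1 / 4))).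
  by rewrite ler_wpM2l.
by case: hm => ->; lra.
Qed.

(** The radiation condition controls only radial derivatives; the interior gradient estimate on
    cubes of fixed size carries the decay of the field over to every partial derivative. *)
Lemma rad_decay a ga ha b gb hb fa fb : radG a ga ha b gb hb fa fb ->
  exists C r1 : R, [/\ 0 < C, rho0 <= r1 & forall x : vec, r1 <= enorm x ->
    nu (enorm x) * `|a x| <= C /\ forall i, nu (enorm x) * `|ga i x| <= C].
Proof.
move=> H; have [C [r1 [C0 r10 h]]] := rad_bnd H.
have [Ha _ _] := H.
have cl : 0 <= Clip m k (1 / 4) by apply: Clip_ge0.
exists (C + Clip m k (1 / 4) * (2 * C)), (r1 + 1); split.
- by rewrite ltr_pwDl// mulr_ge0// mulr_ge0// ltW.
- by apply: le_trans r10 _; rewrite lerDl.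
move=> x xr; have x1 : r1 <= enorm x by apply: le_trans xr; rewrite lerDl.
have r1p : 1 <= r1 by exact: le_trans r10.
have xp : 0 < enorm x by apply: lt_le_trans x1; exact: lt_le_trans r1p.
have n0 := nu_gt0 m xp; split.
  by apply: le_trans (h x x1) _; rewrite lerDl mulr_ge0// mulr_ge0// ltW.
move=> i; have M0 : 0 < 2 * C / nu (enorm x) by rewrite divr_gt0// mulr_gt0.
have d0 : 0 < 1 / 4 :> R by [].
have G := @grad_bound R m k E a ga ha x i (1 / 4) (2 * C / nu (enorm x)) oE Ha d0 M0.
have : `|ga i x| <= Clip m k (1 / 4) * (2 * C / nu (enorm x)).
  apply: G => y yx; have h1 := box_enorm yx; have := enorm_dist y x; rewrite ler_norml => /andP[h2 _].
  have yr : r1 <= enorm y by lra.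
  have y2 : enorm x <= 2 * enorm y by lra.
  have yp : 0 < enorm y by lra.
  split; first by apply: farE; exact: le_trans yr.
  have hy := h y yr; rewrite ler_pdivlMr// mulrC.
  apply: (@le_trans _ _ (2 * nu (enorm y) * `|a y|)); last by rewrite -mulrA ler_wpM2l.
  rewrite ler_wpM2r//; apply: le_trans (nu_le hm (enorm_ge0 _) y2) _.
  by rewrite nu_mul ?enorm_ge0// ler_wpM2r ?(ltW (nu_gt0 m yp))//; apply: (nu_le_id hm); rewrite ler1n.
move=> hg; apply: (@le_trans _ _ (Clip m k (1 / 4) * (2 * C))); last by rewrite lerDr ltW.
by rewrite mulrC -ler_pdivlMr// -mulrA.
Qed.

(** A - B is the real part of the Green integrand of a + i b with p + i q. Neither part need vanish
    at infinity alone; the radiation conditions cancel the leading terms of the difference. *)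
Lemma green_infinity a ga ha b gb hb fa fb p p1 p2 q q1 q2 K al (x : vec) : radG a ga ha b gb hb fa fb ->
  outg m k p p1 p2 q q1 q2 K al ->
  forall e : R, 0 < e -> exists2 R0 : R, 1 <= R0 & forall r L : R, R0 <= r -> 2 * r <= L ->
   let P i y := p1 (dotv (y - 0) (y - 0)) * (2 * (y 0 i - (0 : vec) 0 i)) in
   let Q i y := q1 (dotv (y - 0) (y - 0)) * (2 * (y 0 i - (0 : vec) 0 i)) in
   let A := GI (gstp (r ^+ 2) (3 * r ^+ 2) 0) (fun y => a (y + x)) (fun i y => ga i (y + x))
     (fun y => p (dotv (y - 0) (y - 0))) P in
   let B := GI (gstp (r ^+ 2) (3 * r ^+ 2) 0) (fun y => b (y + x)) (fun i y => gb i (y + x))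
     (fun y => q (dotv (y - 0) (y - 0))) Q in
   [/\ Ct A, Ct B & `|vint L A - vint L B| <= e].
Proof.
move=> H O e e0.
have [Ha Hb [C1 [t1 [C10 t10 hr]]]] := H.
have [C2 [t2 [C20 t20 da]]] := rad_decay H.
have [C3 [t3 [C30 t30 db]]] := rad_decay (rad_rot H).
have [hp hq [al0 K0] _ hb0] := O.
pose C : R := C1 + C2 + C3.
have C0 : 0 < C by rewrite /C; lra.
have [C1C C2C C3C] : [/\ C1 <= C, C2 <= C & C3 <= C] by exact: sum3_ge C10 (ltW C20) (ltW C30).
have s1p := sig1_gt0 R hm.
pose N : R := 4 * C * K + 2 * K * (4 * C + m%:R * (8 * C * enorm x)).
have N0 : 0 <= N.
  have CK : 0 <= C * K by exact: mulr_ge0 (ltW C0) K0.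
  have mx : 0 <= m%:R * enorm x by rewrite mulr_ge0 ?enorm_ge0.
  by have := mulr_ge0 CK mx; rewrite /N; lra.
(* Beyond [R0] one has |X| >= s/2 and |X| above the three thresholds, and the total error N/r times
   the area of the sphere is at most [e]. *)
pose R0 : R := 2 * enorm x + 2 * (t1 + t2 + t3) + N * sig1 R m / e + 1.
have ex0 := enorm_ge0 x.
have [t1p t2p t3p] : [/\ 1 <= t1, 1 <= t2 & 1 <= t3] by split; exact: le_trans rho1 _.
have Ne : 0 <= N * sig1 R m / e by rewrite divr_ge0 ?(ltW e0)// mulr_ge0// ltW.
have [T1 T2 T3] := sum3_ge (le_trans ler01 t1p) (le_trans ler01 t2p) (le_trans ler01 t3p).
have tp : 1 <= t1 + t2 + t3 by exact: le_trans T1.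
have R01 : 1 <= R0 by rewrite /R0 lerDr !addr_ge0// mulr_ge0// (le_trans _ tp).
exists R0; first exact: R01.
move=> r L rR rL P Q A B.
have r1 : 1 <= r by exact: le_trans R01 rR.
have rp : 0 < r by exact: lt_le_trans r1.
have be0 : 0 < 3 * r ^+ 2 by rewrite mulr_gt0// exprn_gt0.
pose U := [set y : vec | E (y + x) /\ 0 < dotv y y].
have gz (y : vec) : ~ U y -> \forall z \near y, forall i, gstp (r ^+ 2) (3 * r ^+ 2) 0 i z = 0.
  move=> nU; have q0 : dotv (y - 0) (y - 0) < r ^+ 2.
    rewrite subr0; have [//|h] := ltP (dotv y y) (r ^+ 2); exfalso; apply: nU; split; last first.
      by apply: lt_le_trans h; rewrite exprn_gt0.
    apply: farE; rewrite -enorm_sqr ler_pXn2r ?nnegrE ?enorm_ge0 ?(ltW rp)// in h.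
    have := enorm_leB y (- x); rewrite opprK enormN => hh.
    have : R0 <= enorm y := le_trans rR h; move=> hR0.
    have hd : - enorm x <= (enorm y - enorm x) - enorm y by rewrite addrAC subrr add0r.
    have [_ h1 _ _] := far_arith hR0 Ne tp ex0 hd.
    by apply: le_trans hh; apply: le_trans h1; apply: le_trans T1.
  have := q_near_lt q0; apply: filterS => z hz i; apply: gstp0 => //; left; exact: ltW.
have cA : C1U U (fun y => a (y + x)) (fun i y => ga i (y + x)).
  by have [h _ _] := helm_shift x Ha; apply: C1U_sub h => y [].
have cB : C1U U (fun y => b (y + x)) (fun i y => gb i (y + x)).
  by have [h _ _] := helm_shift x Hb; apply: C1U_sub h => y [].
have cP : C1U U (fun y => p (dotv (y - 0) (y - 0))) P.
  have hU (y : vec) : U y -> [set t | 0 < t] (dotv (y - 0) (y - 0)) by move=> [_ /=]; rewrite subr0.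
  by have [h _ _] := radial_helm hp hU.
have cQ : C1U U (fun y => q (dotv (y - 0) (y - 0))) Q.
  have hU (y : vec) : U y -> [set: R] (dotv (y - 0) (y - 0)) by [].
  by have [h _ _] := radial_helm hq hU.
have gC i : Ct (gstp (r ^+ 2) (3 * r ^+ 2) (0 : vec) i) by exact: (C1_stp _ _ _).2.
have ctA : Ct A by exact: (GI_ct cA cP gC gz).
have ctB : Ct B by exact: (GI_ct cB cQ gC gz).
split=> //; rewrite -(vintB hm L ctA ctB).
pose V i (y : vec) := (a (y + x) * P i y - p (dotv (y - 0) (y - 0)) * ga i (y + x)) -
   (b (y + x) * Q i y - q (dotv (y - 0) (y - 0)) * gb i (y + x)).
have EV : (fun y => A y - B y) = fun y => \sum_i gstp (r ^+ 2) (3 * r ^+ 2) 0 i y * V i y.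
  apply/funext => y; rewrite /A /B /GI -sumrB; apply: eq_bigr => i _; rewrite /V.
  move: (gstp _ _ _ _ _) (a _) (b _) (ga _ _) (gb _ _) (P _ _) (Q _ _) (p _) (q _) => ? ? ? ? ? ? ? ? ?; ring.
have cV : Ct (fun y => A y - B y) by exact: CtB.
rewrite EV in cV *.
have Z : @sphere_int R m (fun _ => 0) = 0 by rewrite (sig_cst hm) mul0r.
apply: (@le_trans _ _ (N / r * sig1 R m)); last first.
  rewrite mulrAC ler_pdivrMr// [leRHS]mulrC -ler_pdivrMr//; apply: le_trans rR.
  by apply: ler_wpDr => //; apply: ler_wpDl => //; rewrite addr_ge0// mulr_ge0// (le_trans _ tp).
have key := @shell_avg R m hm V (fun _ => 0) (N / r) r L rp rL (@scontC R m 0) cV.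
rewrite Z subr0 in key; apply: key.
move=> s y /andP[rs _] sy; rewrite subr0.
have s1 : 1 <= s by exact: le_trans rs.
have sp : 0 < s by exact: lt_le_trans s1.
have sR : R0 <= s by exact: le_trans rs.
have [es _] := enorm_sph sp sy.
set X := s *: y + x.
have near_bound : `|enorm X - s| <= enorm x.
  by rewrite -es; apply: le_trans (enorm_dist _ _) _; rewrite /X addrAC subrr add0r.
move: (near_bound); rewrite ler_norml => /andP[dX1 dX2].
have [Xs Xt Xp] : [/\ s <= 2 * enorm X, t1 + t2 + t3 <= enorm X & 0 < enorm X].
  by have [] := far_arith sR Ne tp ex0 dX1.
have nX := nu_gt0 m Xp; have ns := nu_gt0 m sp.
have nn : nu s <= 2 * nu (enorm X).
  apply: le_trans (nu_le hm (ltW sp) Xs) _; rewrite nu_mul ?(ltW Xp)// ler_wpM2r ?(ltW nX)//.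
  by apply: (nu_le_id hm); rewrite ler1n.
have tn (z : R) M : nu (enorm X) * `|z| <= M -> nu s * `|z| <= 2 * M.
  move=> hz; apply: (@le_trans _ _ (2 * nu (enorm X) * `|z|)); first by rewrite ler_wpM2r.
  by rewrite -mulrA ler_wpM2l.
have [X1 X2 X3] : [/\ t1 <= enorm X, t2 <= enorm X & t3 <= enorm X] by split; exact: le_trans Xt.
have [ra rb _ _] := hr X X1.
have [aX gaX] := da X X2; have [bX gbX] := db X X3.
have [k1 k2 k3 k4 [k5 k6]] := hb0 s s1.
have ya : nu s * `|a X| <= 2 * C by apply: tn; exact: le_trans aX _.
have yb : nu s * `|b X| <= 2 * C.
  by apply: tn; exact: le_trans bX _.
have yga i : nu s * `|ga i X| <= 2 * C by apply: tn; exact: le_trans (gaX i) _.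
have ygb i : nu s * `|gb i X| <= 2 * C by apply: tn; exact: le_trans (gbX i) _.
have isX : (enorm X)^-1 <= 2 / s by rewrite ler_pdivlMr// mulrC ler_pdivrMr.
have rr (z : R) : `|z| <= C1 / (enorm X * nu (enorm X)) -> nu s * `|z| <= 4 * C / s.
  move=> hz; have : nu (enorm X) * `|z| <= C * (2 / s).
    apply: (@le_trans _ _ (C1 / enorm X)); last by apply: ler_pM => //; rewrite invr_ge0 ltW.
    rewrite mulrC -ler_pdivlMr//; apply: le_trans hz _; rewrite invfM mulrA lexx//.
  by move/tn; rewrite (_ : 2 * (C * (2 / s)) = 4 * C / s)//; ring.
have yra := rr _ ra; have yrb := rr _ rb.
(* The radiation condition holds in the direction of X seen from the origin, while the shell is
   centred at [x]; the two directions differ by O(1/s). *)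
have yd i : `|y 0 i - X 0 i / enorm X| <= 4 * enorm x / s.
  have -> : y 0 i - X 0 i / enorm X = ((enorm X - s) * y 0 i - x 0 i) / enorm X.
    by rewrite /X !mxE; field; rewrite gt_eqF.
  rewrite normrM [`|_^-1|]gtr0_norm ?invr_gt0//.
  have : `|(enorm X - s) * y 0 i - x 0 i| <= 2 * enorm x.
    apply: le_trans (ler_normB _ _) _; rewrite normrM.
    have : `|enorm X - s| * `|y 0 i| <= enorm x * 1 by apply: ler_pM => //; exact: sph_coord.
    rewrite mulr1.
    by move=> h; rewrite mulrDl mul1r lerD ?coord_enorm// -[leRHS]mulr1.
  move=> hz; apply: (@le_trans _ _ (2 * enorm x * (2 / s))); last by rewrite le_eqVlt; apply/orP; left; apply/eqP; ring.
  by apply: ler_pM => //; rewrite invr_ge0 ltW.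
have sdot (g : 'I_m -> R) : (forall i, nu s * `|g i| <= 2 * C) ->
    nu s * `|\sum_i (y 0 i - X 0 i / enorm X) * g i| <= m%:R * (8 * C * enorm x) / s.
  move=> hg; rewrite -{1}(gtr0_norm ns) -normrM mulr_sumr -mulrA.
  apply: sum_le_m => i; rewrite mulrCA normrM [`|nu s * _|]normrM (gtr0_norm ns).
  apply: (@le_trans _ _ (4 * enorm x / s * (2 * C))); last by rewrite le_eqVlt; apply/orP; left; apply/eqP; ring.
  by apply: ler_pM => //; rewrite mulr_ge0// ltW.
have wa := sdot _ yga; have wb := sdot _ ygb.
set za := \sum_i X 0 i / enorm X * ga i X + k * b X in ra yra.
set zb := \sum_i X 0 i / enorm X * gb i X - k * a X in rb yrb.
set da' := \sum_i _ * ga i X in wa; set db' := \sum_i _ * gb i X in wb.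
set p1s := 2 * s * p1 (s ^+ 2) in k2 k5 *.
set q1s := 2 * s * q1 (s ^+ 2) in k4 k6 *.
(* Rewritten so that each of the four products contains a radiation defect or a direction error,
   hence a factor 1/s beyond the decay of both fields. *)
have -> : \sum_i y 0 i * V i (s *: y) =
   a X * (p1s + k * q (s ^+ 2)) - b X * (q1s - k * p (s ^+ 2))
   - p (s ^+ 2) * (za + da') + q (s ^+ 2) * (zb + db').
  have qs : dotv (s *: y - 0) (s *: y - 0) = s ^+ 2 by rewrite subr0 -enorm_sqr es.
  have -> : za + da' = k * b X + \sum_i y 0 i * ga i X.
    rewrite /za /da' addrAC addrC; congr (_ + _); rewrite -big_split; apply: eq_bigr => i _ /=; ring.
  have -> : zb + db' = - (k * a X) + \sum_i y 0 i * gb i X.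
    rewrite /zb /db' addrAC addrC; congr (_ + _); rewrite -big_split; apply: eq_bigr => i _ /=; ring.
  transitivity ((a X * p1s - b X * q1s) * (\sum_i y 0 i * y 0 i)
      - p (s ^+ 2) * (\sum_i y 0 i * ga i X) + q (s ^+ 2) * (\sum_i y 0 i * gb i X)).
    rewrite !mulr_sumr -sumrB -big_split; apply: eq_bigr => i _ /=.
    by rewrite /V /P /Q qs -/X !mxE subr0 /p1s /q1s; ring.
  by rewrite (sum_sph sy) mulr1; ring.
rewrite -(nu_sqr hm sp).
set z1 := p1s + _ in k5 *; set z2 := q1s - _ in k6 *.
have -> : nu s * nu s * (a X * z1 - b X * z2 - p (s ^+ 2) * (za + da') + q (s ^+ 2) * (zb + db')) =
   (nu s * a X) * (nu s * z1) - (nu s * b X) * (nu s * z2)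
   - (nu s * p (s ^+ 2)) * (nu s * za + nu s * da') + (nu s * q (s ^+ 2)) * (nu s * zb + nu s * db') by ring.
have nE (z : R) : nu s * `|z| = `|nu s * z| by rewrite normrM gtr0_norm.
rewrite !nE in ya yb k1 k3 k5 k6 yra yrb wa wb.
have Ks : 0 <= K / s by rewrite divr_ge0// ltW.
have v1 : `|nu s * a X * (nu s * z1)| <= 2 * C * (K / s) by rewrite normrM ler_pM.
have v2 : `|nu s * b X * (nu s * z2)| <= 2 * C * (K / s) by rewrite normrM ler_pM.
have v3 : `|nu s * p (s ^+ 2) * (nu s * za + nu s * da')| <= K * (4 * C / s + m%:R * (8 * C * enorm x) / s).
  rewrite normrM ler_pM//; apply: le_trans (ler_normD _ _) _; exact: lerD.
have v4 : `|nu s * q (s ^+ 2) * (nu s * zb + nu s * db')| <= K * (4 * C / s + m%:R * (8 * C * enorm x) / s).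
  rewrite normrM ler_pM//; apply: le_trans (ler_normD _ _) _; exact: lerD.
apply: (@le_trans _ _ (N / s)); last by rewrite ler_wpM2l// lef_pV2 ?posrE.
apply: le_trans (ler_normD _ _) _.
apply: le_trans (lerD (ler_normB _ _) (lexx _)) _.
apply: le_trans (lerD (lerD (ler_normB _ _) (lexx _)) (lexx _)) _.
apply: le_trans (lerD (lerD (lerD v1 v2) v3) v4) _.
by rewrite le_eqVlt; apply/orP; left; apply/eqP; rewrite /N; ring.
Qed.
End Rad.

Lemma final_arith (R : realType) (X1 X2 X3 Y1 Y2 Y3 Z e B : R) : X1 + X2 = X3 -> Y1 + Y2 = Y3 ->
  `|X2 - Z| <= e / 3 -> `|Y2| <= e / 3 -> `|X3 - Y3| <= e / 3 -> `|X1| <= B -> `|Y1| <= B ->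
  `|Z| <= 2 * B + e.
Proof. by move=> <- <-; rewrite !ler_norml => /andP[? ?] /andP[? ?] /andP[? ?] /andP[? ?] /andP[? ?]; apply/andP; split; lra. Qed.

(** * Exterior bounds from a fixed shell around the obstacle *)

Section ExteriorBound.
Variables (R : realType) (m : nat) (k : R) (E : set 'rV[R]_m) (rho0 : R).
Hypothesis hm : m = 2%N \/ m = 3%N.
Hypothesis k0 : 0 < k.
Hypothesis oE : open E.
Hypothesis rho1 : 1 <= rho0.
Notation vec := 'rV[R]_m.
Hypothesis farE : forall y : vec, rho0 <= enorm y -> E y.
Notation nu := (@nu R m).

(** It varies between the radii rho0 + 1 and rho0 + 2, and 2 rho0 + 3 is the difference of their
    squares. The margin on both sides holds the cubes of the gradient estimate. *)
Definition chi : vec -> R := stp ((rho0 + 1) ^+ 2) (2 * rho0 + 3) 0.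
Definition gchi : 'I_m -> vec -> R := gstp ((rho0 + 1) ^+ 2) (2 * rho0 + 3) 0.
Definition env (y : vec) : R := 1 - stp ((rho0 + 2) ^+ 2) (2 * rho0 + 5) 0 y.

Lemma enorm_geD (x y : vec) : enorm x - enorm y <= enorm (y + x).
Proof. by have := enorm_leB x (- y); rewrite opprK enormN (addrC x). Qed.
Lemma rho_pos : [/\ 0 < rho0, 0 < 2 * rho0 + 3 & 0 < 2 * rho0 + 5].
Proof. by have := rho1; move=> ?; split; lra. Qed.
Lemma chi_C1 : C1 chi gchi.
Proof. exact: C1_stp. Qed.
Lemma sq_le_enorm (y : vec) (r : R) : 0 <= r -> (dotv (y - 0) (y - 0) <= r ^+ 2) = (enorm y <= r).
Proof. by move=> r0; rewrite subr0 -enorm_sqr ler_pXn2r ?nnegrE ?enorm_ge0. Qed.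
Lemma sq_ge_enorm (y : vec) (r : R) : 0 <= r -> (r ^+ 2 <= dotv (y - 0) (y - 0)) = (r <= enorm y).
Proof. by move=> r0; rewrite subr0 -enorm_sqr ler_pXn2r ?nnegrE ?enorm_ge0. Qed.
Lemma chi0 (y : vec) : enorm y <= rho0 + 1 -> chi y = 0 /\ forall i, gchi i y = 0.
Proof.
have [r0 b0 _] := rho_pos; have r1 : 0 <= rho0 + 1 by rewrite addr_ge0// ltW.
by rewrite -sq_le_enorm// => h; split=> [|i]; [exact: stp0|apply: gstp0 => //; left].
Qed.
Lemma chi_sq : (rho0 + 1) ^+ 2 + (2 * rho0 + 3) = (rho0 + 2) ^+ 2.
Proof. by ring. Qed.
Lemma chi1 (y : vec) : rho0 + 2 <= enorm y -> chi y = 1 /\ forall i, gchi i y = 0.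
Proof.
have [r0 b0 _] := rho_pos; have r1 : 0 <= rho0 + 2 by rewrite addr_ge0// ltW.
rewrite -sq_ge_enorm// -chi_sq => h; split=> [|i]; [exact: stp1|apply: gstp0 => //; by right].
Qed.
Lemma gchi_bound (y : vec) i : `|gchi i y| <= 4 * (rho0 + 2).
Proof.
have [r0 b0 _] := rho_pos; have r1 : 0 <= rho0 + 2 by rewrite addr_ge0// ltW.
have [/ltW/chi1[_ ->]|hy] := ltP (rho0 + 2) (enorm y); first by rewrite normr0 mulr_ge0.
rewrite /gchi /gstp mxE subr0 normrM; set t := (dotv _ _ - _) / _; rewrite subr0.
have /andP[s0 s2] := step'_itv t.
have a1 : `|step' t / (2 * rho0 + 3)| <= 2.
  rewrite normrM ger0_norm// gtr0_norm ?invr_gt0// ler_pdivrMr//; apply: le_trans s2 _.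
  by rewrite ler_peMr//; have := rho1; lra.
have a2 : `|2 * y 0 i| <= 2 * (rho0 + 2).
  by rewrite normrM ger0_norm// ler_wpM2l//; apply: le_trans (coord_enorm _ _) hy.
by apply: le_trans (ler_pM _ _ a1 a2) _ => //; rewrite mulrA; lra.
Qed.
Lemma env_C1 : C1 env (fun i y => 0 - gstp ((rho0 + 2) ^+ 2) (2 * rho0 + 5) 0 i y).
Proof. by apply: C1U_C1; apply: C1UB; [exact: C1UC|apply: C1_C1U; exact: C1_stp]. Qed.
Lemma env_itv y : 0 <= env y <= 1.
Proof.
rewrite /env /stp; set t := _ / _; have /andP[? ?] := step_itv t; apply/andP; split; lra.
Qed.
Lemma env1 (y : vec) : enorm y <= rho0 + 2 -> env y = 1.
Proof.
have [r0 _ b0] := rho_pos; have r1 : 0 <= rho0 + 2 by rewrite addr_ge0// ltW.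
by rewrite -sq_le_enorm// => h; rewrite /env stp0// subr0.
Qed.
Lemma env0 (y : vec) : rho0 + 3 <= enorm y -> env y = 0.
Proof.
have [r0 _ b0] := rho_pos; have r1 : 0 <= rho0 + 3 by rewrite addr_ge0// ltW.
rewrite -sq_ge_enorm// => h; rewrite /env stp1 ?subrr//; apply: le_trans h.
by rewrite le_eqVlt; apply/orP; left; apply/eqP; ring.
Qed.
(** [vint] is tied to the origin, while the shell around the obstacle appears translated by [x]. The
    C^1 envelope has an integral bounded independently of that translation. *)
Lemma vint_env (x : vec) (L : R) : rho0 + 3 + enorm x <= L ->
  0 <= vint L (fun y => env (y + x)) <= volb m (rho0 + 3).
Proof.
have [r0 _ _] := rho_pos; have r3 : 0 <= rho0 + 3 by rewrite addr_ge0// ltW.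
move=> xL; rewrite (vint_shift hm r3 xL env_C1 env0).
have L3 : rho0 + 3 <= L by apply: le_trans xL; rewrite lerDl enorm_ge0.
have cE : Ct env by exact: C1_Ct env_C1.
rewrite (vint_supp hm r3 L3 cE env0); apply/andP; split.
  have <- : vint (rho0 + 3) (fun _ : vec => 0 * 0) = 0 :> R by rewrite (vintZ hm _ 0 (@CtC _ _ 0)) mul0r.
  apply: (vint_le hm) => //; first by apply: CtZ; exact: CtC.
  by move=> y _; rewrite mul0r; case/andP: (env_itv y).
apply: le_trans (ler_norm _) _; rewrite -[leRHS]mul1r; apply: (vint_abs hm) => // y _.
by case/andP: (env_itv y) => ? ?; rewrite ger0_norm.
Qed.
Lemma vint_env_abs F (B L : R) (x : vec) : Ct F -> 0 <= B -> rho0 + 3 + enorm x <= L ->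
  (forall y, `|F y| <= B * env (y + x)) -> `|vint L F| <= B * volb m (rho0 + 3).
Proof.
move=> cF B0 xL h.
have cE : Ct (fun y => env (y + x)) by exact: C1_Ct (C1_shift x env_C1).
have := vint_env xL => /andP[e0 e1].
apply: (@le_trans _ _ (B * vint L (fun y => env (y + x)))); last by rewrite ler_wpM2l.
rewrite -(vintZ hm L B cE) ler_norml -mulN1r -(vintZ hm L (-1) (@CtZ _ _ B _ cE)).
apply/andP; split; apply: (vint_le hm) => //; try by do ?apply: CtZ.
  by move=> y _; have := h y; rewrite ler_norml mulN1r => /andP[].
by move=> y _; have := h y; rewrite ler_norml => /andP[].
Qed.

Definition bndX (u : vec -> R) (M : R) := forall y : vec, E y -> enorm y <= rho0 + 3 -> `|u y| <= M.

Lemma shell_grad a ga ha (M : R) (y : vec) i : helm E k a ga ha -> 0 < M -> bndX a M ->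
  rho0 + 1 <= enorm y <= rho0 + 2 -> `|ga i y| <= Clip m k (1 / 4) * M.
Proof.
move=> H M0 hM /andP[y1 y2].
have d0 : 0 < 1 / 4 :> R by [].
apply: (@grad_bound R m k E a ga ha y i (1 / 4) M oE H d0 M0) => z zy.
have h1 := box_enorm hm zy; have := enorm_dist z y; rewrite ler_norml => /andP[h2 h3].
have Ez : E z by apply: farE; lra.
by split=> //; apply: hM => //; lra.
Qed.

Definition dec (K : R) (p p1 : R -> R) := forall s, 1 <= s ->
  nu s * `|p (s ^+ 2)| <= K /\ nu s * `|2 * s * p1 (s ^+ 2)| <= K.

Definition CG (K : R) : R := m%:R * (4 * (rho0 + 2) * (nu (rho0 + 3) * (1 + Clip m k (1 / 4)) * K)).
Lemma CG_ge0 K : 0 <= K -> 0 <= CG K.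
Proof.
have [r0 _ _] := rho_pos.
move=> K0; rewrite /CG mulr_ge0// mulr_ge0//; first by rewrite mulr_ge0// addr_ge0// ltW.
rewrite mulr_ge0// mulr_ge0//; first by rewrite ltW// nu_gt0// addr_gt0.
by rewrite addr_ge0// Clip_ge0.
Qed.

(** For y in the shell, |x| <= (rho0 + 3)|x - y|. The decay of the radial solution in |x - y|
    therefore becomes decay in |x|. *)
Lemma shell_green_bound a ga ha p p1 (K M : R) (x y : vec) : helm E k a ga ha -> dec K p p1 -> 0 <= K -> 0 < M ->
  bndX a M -> rho0 + 3 <= enorm x ->
  `|GI gchi a ga (fun y => p (dotv (y - x) (y - x))) (fun i y => p1 (dotv (y - x) (y - x)) * (2 * (y 0 i - x 0 i))) y|
   <= CG K * M / nu (enorm x) * env y.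
Proof.
move=> H dp K0 M0 hM xr; have [r0 _ _] := rho_pos.
have xp : 0 < enorm x by apply: lt_le_trans xr; rewrite addr_gt0.
have nx := nu_gt0 m xp.
have rhs0 : 0 <= CG K * M / nu (enorm x) * env y.
  rewrite mulr_ge0//; last by case/andP: (env_itv y).
  by rewrite divr_ge0 ?(ltW nx)// mulr_ge0 ?(ltW M0)// CG_ge0.
have [y1|y1] := leP (enorm y) (rho0 + 1).
  by rewrite /GI big1 ?normr0// => i _; rewrite (chi0 y1).2 mul0r.
have [y2|y2] := leP (rho0 + 2) (enorm y).
  by rewrite /GI big1 ?normr0// => i _; rewrite (chi1 y2).2 mul0r.
have -> : CG K * M / nu (enorm x) * env y = m%:R * (4 * (rho0 + 2) * (nu (rho0 + 3) * (1 + Clip m k (1 / 4)) * K * M / nu (enorm x))).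
  by rewrite env1 ?(ltW y2)// mulr1 /CG !mulrA.
apply: sum_le_m => i.
rewrite normrM.
set s := enorm (y - x).
have sx : enorm x <= enorm y + s.
  have := enorm_leB x y; rewrite enormB -/s; lra.
have s1 : 1 <= s by lra.
have sp : 0 < s by lra.
have ns := nu_gt0 m sp.
have Ey : E y by apply: farE; lra.
have ay : `|a y| <= M by apply: hM => //; lra.
have gy : `|ga i y| <= Clip m k (1 / 4) * M.
  by apply: (shell_grad i H M0 hM); rewrite !ltW.
have qs : dotv (y - x) (y - x) = s ^+ 2 by rewrite -enorm_sqr.
have [d1 d2] := dp s s1.
have ratio : nu (enorm x) <= nu (rho0 + 3) * nu s.
  rewrite -nu_mul ?(ltW sp) ?addr_ge0 ?(ltW r0)//; apply: nu_le => //; first exact: ltW.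
  by apply: le_trans sx _; nra.
have n3 : 0 < nu (rho0 + 3) by rewrite nu_gt0// addr_gt0.
have tr (z : R) : nu s * z <= K -> 0 <= z -> z <= nu (rho0 + 3) * K / nu (enorm x).
  move=> hz z0; rewrite ler_pdivlMr// mulrC; apply: (@le_trans _ _ (nu (rho0 + 3) * nu s * z)).
    by rewrite ler_wpM2r.
  by rewrite -mulrA ler_wpM2l// ltW.
have pS := tr _ d1 (normr_ge0 _); have gS := tr _ d2 (normr_ge0 _).
have gI : `|p1 (s ^+ 2) * (2 * (y 0 i - x 0 i))| <= nu (rho0 + 3) * K / nu (enorm x).
  apply: le_trans gS.
  have -> : p1 (s ^+ 2) * (2 * (y 0 i - x 0 i)) = 2 * p1 (s ^+ 2) * (y 0 i - x 0 i) by ring.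
  have -> : 2 * s * p1 (s ^+ 2) = 2 * p1 (s ^+ 2) * s by ring.
  rewrite normrM [leRHS]normrM ler_wpM2l// (gtr0_norm sp).
  have -> : y 0 i - x 0 i = (y - x) 0 i by rewrite !mxE.
  exact: coord_enorm.
apply: ler_pM => //; first exact: gchi_bound.
rewrite qs; apply: le_trans (ler_normB _ _) _; rewrite [`|a y * _|]normrM [`|p _ * _|]normrM.
set T := nu (rho0 + 3) * K / nu (enorm x) in pS gI.
have T1 := ler_pM (normr_ge0 _) (normr_ge0 _) ay gI.
have T2 := ler_pM (normr_ge0 _) (normr_ge0 _) pS gy.
apply: le_trans (lerD T1 T2) _; rewrite /T le_eqVlt; apply/orP; left; apply/eqP; ring.
Qed.

Lemma dec_P p p1 p2 q q1 q2 K al : outg m k p p1 p2 q q1 q2 K al -> dec K p p1 /\ dec K q q1.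
Proof. by move=> [_ _ _ _ h]; split=> s s1; have [? ? ? ? _] := h s s1. Qed.

Lemma sq_four (t : R) (z : vec) : 0 < t -> 2 * t <= enorm z -> t ^+ 2 + 3 * t ^+ 2 <= dotv (z - 0) (z - 0).
Proof.
move=> t0 h; have -> : t ^+ 2 + 3 * t ^+ 2 = (2 * t) ^+ 2 by ring.
by rewrite sq_ge_enorm// mulr_ge0// ltW.
Qed.

(** There are two ways to leave the domain. At the singularity the cutoffs are 1, 0, 0; over the
    obstacle they are 0, 1, 0; either way the constant -1 cancels them. In [cutoff_far] all three
    are 1. *)
Lemma cutoff_off (x y : vec) (eps r : R) : 0 < eps -> eps < 1 -> rho0 + 3 <= enorm x -> enorm x + rho0 + 2 <= r ->
  ~ (E (y + x) /\ 0 < dotv y y) -> \forall z \near y, [/\ forall i, gchi i (z + x) = 0,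
    forall i, gstp (eps ^+ 2) (3 * eps ^+ 2) 0 i z = 0, forall i, gstp (r ^+ 2) (3 * r ^+ 2) 0 i z = 0
    & chi (z + x) + stp (eps ^+ 2) (3 * eps ^+ 2) 0 z - stp (r ^+ 2) (3 * r ^+ 2) 0 z + -1 = 0].
Proof.
  move=> ep0 ep3 xr rx nU; have [r0 _ _] := rho_pos.
  have be1 : 0 < 3 * eps ^+ 2 by rewrite mulr_gt0// exprn_gt0.
  have be2 : 0 < 3 * r ^+ 2 by rewrite mulr_gt0// exprn_gt0//; lra.
  have [y0|y0] := leP (dotv y y) 0.
    have q0 : dotv (y - 0) (y - 0) < eps ^+ 2 by rewrite subr0; apply: le_lt_trans y0 _; rewrite exprn_gt0.
    have := q_near_lt q0; apply: filterS => z hz.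
    have ze : enorm z <= eps by rewrite -sq_le_enorm ?(ltW ep0)// ltW.
    have zx : rho0 + 2 <= enorm (z + x).
      by have := enorm_geD x z; lra.
    have zr : dotv (z - 0) (z - 0) <= r ^+ 2 by rewrite sq_le_enorm; lra.
    have [h1 h2] := chi1 zx; split=> //.
    - by move=> i; apply: gstp0 => //; left; exact: ltW.
    - by move=> i; apply: gstp0 => //; left.
    - by rewrite h1 !stp0// ?(ltW hz)// addr0 subr0 subrr.
  have yx : enorm (y + x) < rho0.
    by rewrite ltNge; apply/negP => h; apply: nU; split=> //; exact: farE.
  have q0 : dotv (y - - x) (y - - x) < rho0 ^+ 2.
    by rewrite opprK -enorm_sqr ltr_pXn2r ?nnegrE ?enorm_ge0 ?(ltW r0).
  have := q_near_lt q0; apply: filterS => z; rewrite opprK -enorm_sqr ltr_pXn2r ?nnegrE ?enorm_ge0 ?(ltW r0)// => hz.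
  have [h1 h2] : chi (z + x) = 0 /\ forall i, gchi i (z + x) = 0 by apply: chi0; lra.
  have z3 : 2 * eps <= enorm z.
    by have := enorm_leB x (x + z); rewrite opprD addrA subrr add0r enormN (addrC x); lra.
  have zr : dotv (z - 0) (z - 0) <= r ^+ 2.
    rewrite sq_le_enorm; last by lra.
    by have := enorm_leB z (- x); rewrite opprK enormN; lra.
  have ze := sq_four ep0 z3.
  split=> //.
  - by move=> i; apply: gstp0 => //; right.
  - by move=> i; apply: gstp0 => //; left.
  - by rewrite h1 stp1// stp0// add0r subr0 subrr.
Qed.
Lemma cutoff_far (x y : vec) (eps r : R) : 0 < eps -> eps < 1 -> rho0 + 3 <= enorm x -> enorm x + rho0 + 2 <= r ->
  2 * r <= enorm y ->
    chi (y + x) + stp (eps ^+ 2) (3 * eps ^+ 2) 0 y - stp (r ^+ 2) (3 * r ^+ 2) 0 y + -1 = 0.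
Proof.
  move=> ep0 ep3 xr rx yL; have [r0 _ _] := rho_pos.
  have be1 : 0 < 3 * eps ^+ 2 by rewrite mulr_gt0// exprn_gt0.
  have be2 : 0 < 3 * r ^+ 2 by rewrite mulr_gt0// exprn_gt0//; lra.
  have y2 : 2 * eps <= enorm y by lra.
  have [h1 _] : chi (y + x) = 1 /\ forall i, gchi i (y + x) = 0.
    by apply: chi1; have := enorm_leB y (- x); rewrite opprK enormN; lra.
  have ze := sq_four ep0 y2.
  have zr : r ^+ 2 + 3 * r ^+ 2 <= dotv (y - 0) (y - 0) by apply: sq_four => //; lra.
  by rewrite h1 !stp1// addrK subrr.
Qed.

Lemma ball_E (x y : vec) : rho0 + 3 <= enorm x -> enorm y < 3 -> E (y + x).
Proof. by move=> xr y3; apply: farE; have := enorm_geD x y; lra. Qed.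
Lemma choose_r (R0 ex eps : R) : 1 <= R0 -> 0 <= ex -> eps < 1 -> exists r : R,
  [/\ R0 <= r, ex + rho0 + 2 <= r, 0 <= 2 * r, 2 * eps <= 2 * r & rho0 + 3 + ex <= 2 * r].
Proof. by move=> *; have := rho1; exists (R0 + ex + rho0 + 3); split; lra. Qed.

(** The regular companion [q] has zero flux at the centre, so the imaginary part of the field leaves
    no point value. *)
Lemma green_center_reg U (u : vec -> R) gu q q1 q2 (d : R) : 0 < d ->
  (forall y : vec, enorm y < d -> U y) -> C1U U u gu -> profile m k setT q q1 q2 ->
  forall e : R, 0 < e -> exists2 e0 : R, 0 < e0 & forall eps L : R, 0 < eps -> eps < e0 -> 2 * eps <= L ->
   `|vint L (GI (gstp (eps ^+ 2) (3 * eps ^+ 2) 0) u gu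
     (fun y => q (dotv (y - 0) (y - 0))) (fun i y => q1 (dotv (y - 0) (y - 0)) * (2 * (y 0 i - (0 : vec) 0 i))))|
     <= e * sig1 R m.
Proof.
move=> d0 dU hu hq e e0.
have [dq dq1 _ _] := hq 0 I.
have cs : s @[s --> (0:R)^'+] --> (0:R) by apply: cvg_at_right_filter.
have cm1 : s ^+ m.-1 @[s --> (0:R)^'+] --> (0:R).
  have h := der_cont (derX m.-1 (derI (0:R))).
  rewrite /prop_for /continuous_at /= expr0n in h.
  have e' : m.-1 == 0%N = false by case: hm => ->.
  by rewrite e' in h; exact: cvg_at_right_filter h.
have l1 : s ^+ m.-1 * (2 * s * q1 (s ^+ 2)) @[s --> (0:R)^'+] --> (0 * (2 * 0 * q1 0) : R).
  apply: cvgM => //; apply: cvgM; first by apply: cvgM => //; exact: cvg_cst.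
  exact: (sq_at0 (der_cont dq1)).
have l2 : s ^+ m.-1 * q (s ^+ 2) @[s --> (0:R)^'+] --> (0 * q 0 : R).
  by apply: cvgM => //; exact: (sq_at0 (der_cont dq)).
rewrite !mul0r in l1 l2.
have [e1 e10 h] := green_center hm d0 dU hu hq (fun _ _ => I) l1 l2 e0.
exists e1 => // eps L h1 h2 h3; have := h eps L h1 h2 h3.
by rewrite !mul0r subr0.
Qed.

(* Green's formula on [E] with the outgoing radial solution centred at [x]: the singularity at [x] reproduces
   [a x], the radiation condition kills infinity, and only a fixed shell around the obstacle remains. *)
Lemma exterior_bound : exists2 CP : R, 0 <= CP & forall a ga ha b gb hb fa fb (M : R),
  radG k E rho0 a ga ha b gb hb fa fb -> 0 < M -> bndX a M -> bndX b M ->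
  forall x : vec, rho0 + 3 <= enorm x -> nu (enorm x) * `|a x| <= CP * M.
Proof.
have [p [p1 [p2 [q [q1 [q2 [K [al O]]]]]]]] := exists_outg hm k0.
have [hp hq [al0 K0] [l1 l2] _] := O; have [dp dq] := dec_P O.
have [r0 _ _] := rho_pos.
have s1p := sig1_gt0 R hm.
have ap : 0 < `|al| by rewrite normr_gt0.
have r30 : 0 <= rho0 + 3 by rewrite addr_ge0// ltW.
have vb0 : 0 <= volb m (rho0 + 3) by rewrite /volb !mulr_ge0 ?exprn_ge0 ?(ltW s1p).
have CG0 := CG_ge0 K0.
exists (2 * (CG K * volb m (rho0 + 3)) / (`|al| * sig1 R m)).
  by rewrite divr_ge0//; apply: mulr_ge0 => //; [exact: mulr_ge0|exact: ltW].
move=> a ga ha b gb hb fa fb M H M0 hA hB x xr.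
have [Ha Hb _] := H.
have xp : 0 < enorm x by apply: lt_le_trans xr; rewrite addr_gt0.
have nx := nu_gt0 m xp.
pose B : R := CG K * M / nu (enorm x) * volb m (rho0 + 3).
suff fin : `|al * a x * sig1 R m| <= 2 * B.
  rewrite mulrAC ler_pdivlMr ?mulr_gt0//.
  have -> : nu (enorm x) * `|a x| * (`|al| * sig1 R m) = nu (enorm x) * `|al * a x * sig1 R m|.
    by rewrite !normrM (gtr0_norm s1p); ring.
  rewrite mulrC -ler_pdivlMr//; apply: le_trans fin _.
  by rewrite /B le_eqVlt; apply/orP; left; apply/eqP; ring.
apply/ler_addgt0Pr => e e0.
pose e3 : R := e / 3; have e30 : 0 < e3 by rewrite divr_gt0.
pose es : R := e3 / sig1 R m; have es0 : 0 < es by rewrite divr_gt0.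
have ees : es * sig1 R m = e3 by rewrite /es divfK// gt_eqF.
pose U0 := [set y : vec | E (y + x)].
have Uball (y : vec) : enorm y < 3 -> U0 y := @ball_E x y xr.
have HaU := helm_shift x Ha; have HbU := helm_shift x Hb.
have [cA _ _] := HaU; have [cB _ _] := HbU.
have [d1 d10 c1] := green_center hm (ltr0n R 3) Uball cA hp (fun _ h => h) l1 l2 es0.
have [d2 d20 c2] := green_center_reg (ltr0n R 3) Uball cB hq es0.
have [R0 R01 c3] := green_infinity hm oE rho1 farE x H O e30.
pose eps : R := Num.min (Num.min d1 d2) 1 / 2.
have mp : 0 < Num.min (Num.min d1 d2) 1 by rewrite !lt_min d10 d20 ltr01.
have ep0 : 0 < eps by rewrite divr_gt0.
have epm : eps < Num.min (Num.min d1 d2) 1 by rewrite ltr_pdivrMr// ltr_pMr// ltr1n.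
have [ep1 ep2 ep3] : [/\ eps < d1, eps < d2 & eps < 1] by move: epm; rewrite !lt_min => /andP[/andP[]].
have [r [rR rx L0 eL xL]] := choose_r R01 (enorm_ge0 x) ep3.
pose L : R := 2 * r.
have rL : 2 * r <= L by [].
have k1 := c1 eps L ep0 ep1 eL; have k2 := c2 eps L ep0 ep2 eL.
have [_ _ k3] := c3 r L rR rL.
pose U := [set y : vec | E (y + x) /\ 0 < dotv y y].
pose P i (y : vec) := p1 (dotv (y - 0) (y - 0)) * (2 * (y 0 i - (0 : vec) 0 i)).
pose Q i (y : vec) := q1 (dotv (y - 0) (y - 0)) * (2 * (y 0 i - (0 : vec) 0 i)).
have UU : U `<=` U0 by move=> y [].
have hPU : helm U k (fun y => p (dotv (y - 0) (y - 0))) P _ :=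
  radial_helm (U := U) hp (fun y h => let: conj _ h := h in eq_ind_r (fun z => 0 < z) h (congr1 (fun z => dotv z z) (subr0 y))).
have hQU : helm U k (fun y => q (dotv (y - 0) (y - 0))) Q _ := radial_helm (U := U) hq (fun y _ => I).
have T1 : C1 (fun y => chi (y + x)) (fun i y => gchi i (y + x)) by exact: C1_shift chi_C1.
have T2 : C1 (stp (eps ^+ 2) (3 * eps ^+ 2) (0 : vec)) (gstp (eps ^+ 2) (3 * eps ^+ 2) 0) by exact: C1_stp.
have T3 : C1 (stp (r ^+ 2) (3 * r ^+ 2) (0 : vec)) (gstp (r ^+ 2) (3 * r ^+ 2) 0) by exact: C1_stp.
have offU (y : vec) : ~ U y -> _ := @cutoff_off x y eps r ep0 ep3 xr rx.
have farU (y : vec) (h : L <= enorm y) := @cutoff_far x y eps r ep0 ep3 xr rx h.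
have g1 := green3 hm (helm_sub UU HaU) hPU T1 T2 T3 L0 offU farU.
have g2 := green3 hm (helm_sub UU HbU) hQU T1 T2 T3 L0 offU farU.
have G1 a' ga' ha' p' p1' : helm E k a' ga' ha' -> dec K p' p1' -> bndX a' M ->
   C1U U (fun y => p' (dotv (y - 0) (y - 0))) (fun i y => p1' (dotv (y - 0) (y - 0)) * (2 * (y 0 i - (0 : vec) 0 i))) ->
   `|vint L (GI (fun i y => gchi i (y + x)) (fun y => a' (y + x)) (fun i y => ga' i (y + x))
     (fun y => p' (dotv (y - 0) (y - 0))) (fun i y => p1' (dotv (y - 0) (y - 0)) * (2 * (y 0 i - (0 : vec) 0 i))))|
   <= CG K * M / nu (enorm x) * volb m (rho0 + 3).
  move=> H' d' b' cP; apply: (@vint_env_abs _ _ _ x) => //.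
  - apply: (GI_ct _ cP T1.2).
      by have [h _ _] := helm_shift x H'; exact: C1U_sub UU h.
    by move=> y /offU; apply: filterS => z [].
  - by rewrite divr_ge0 ?(ltW nx)// mulr_ge0// ltW.
  - move=> y; have := shell_green_bound (y + x) H' d' K0 M0 b' xr.
    congr (`|_| <= _); rewrite /GI; apply: eq_bigr => i _.
    by rewrite addrK subr0 !mxE addrK subr0.
have b1 := G1 _ _ _ _ _ Ha dp hA (let: And3 h _ _ := hPU in h).
have b2 := G1 _ _ _ _ _ Hb dq hB (let: And3 h _ _ := hQU in h).
rewrite add0r ees in k1; rewrite ees in k2.
(* X pairs a with p and Y pairs b with q. X2 produces al a(x), Y2 is negligible, only the difference
   X3 - Y3 is small, and X1, Y1 over the fixed shell carry the bound. *)
move: g1 g2 k1 k2 k3 b1 b2; rewrite -/B.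
set X1 := vint L _; set X2 := vint L _; set X3 := vint L _.
set Y1 := vint L _; set Y2 := vint L _; set Y3 := vint L _.
move: X1 X2 X3 Y1 Y2 Y3 (al * _ * _) => X1 X2 X3 Y1 Y2 Y3 Z g1 g2 k1 k2 k3 b1 b2.
exact: (final_arith g1 g2 k1 k2 k3 b1 b2).
Qed.
End ExteriorBound.

Lemma prod_err (R : realType) (x y x0 y0 e N : R) : `|x - x0| <= e -> `|y - y0| <= e -> e <= 1 -> `|x0| <= N -> `|y0| <= N ->
  `|x * y - x0 * y0| <= (2 * N + 1) * e.
Proof.
move=> hx hy e1 hx0 hy0; have e0 : 0 <= e by exact: le_trans hx.
have -> : x * y - x0 * y0 = (x - x0) * (y - y0) + (x - x0) * y0 + x0 * (y - y0) by ring.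
apply: le_trans (ler_normD _ _) _; apply: le_trans (lerD (ler_normD _ _) (lexx _)) _; rewrite !normrM.
have a1 : `|x - x0| * `|y - y0| <= e * 1 by apply: ler_pM => //; exact: le_trans e1.
have a2 : `|x - x0| * `|y0| <= e * N by apply: ler_pM.
have a3 : `|x0| * `|y - y0| <= N * e by apply: ler_pM.
by apply: le_trans (lerD (lerD a1 a2) a3) _; rewrite le_eqVlt; apply/orP; left; apply/eqP; ring.
Qed.

Lemma quarter (R : realType) (z r : R) : 0 <= z -> 4 * z + 1 <= r -> z <= r / 2.
Proof. by move=> *; lra. Qed.

(** * Exact identities for the far field *)

Section Far.
Variables (R : realType) (m : nat) (k : R) (E : set 'rV[R]_m) (rho0 : R).
Hypothesis hm : m = 2%N \/ m = 3%N.
Hypothesis k0 : 0 < k.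
Hypothesis oE : open E.
Hypothesis rho1 : 1 <= rho0.
Notation vec := 'rV[R]_m.
Hypothesis farE : forall y : vec, rho0 <= enorm y -> E y.
Notation nu := (@nu R m).
Notation radG := (radG k E rho0).
Notation gchi := (gchi rho0).
Notation chi := (@chi R m rho0).

(** Green's formula moves the shell around the obstacle out to radius r without changing the
    integral. The value is therefore exactly that of the limiting flux. *)
Lemma chi_limit u gu hu w gw hw (Fl : vec -> R) : helm E k u gu hu -> helm E k w gw hw -> scont Fl ->
  (forall e : R, 0 < e -> exists r0 : R, forall r (y : vec), r0 <= r -> sph y ->
    `|r ^+ m.-1 * (\sum_i y 0 i * (u (r *: y) * gw i (r *: y) - w (r *: y) * gu i (r *: y))) - Fl y| <= e) ->
  Ct (GI gchi u gu w gw) /\ vint (rho0 + 2) (GI gchi u gu w gw) = sphere_int Fl.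
Proof.
move=> Hu Hw cF h; have [r0 _ _] := rho_pos rho1.
have r2 : 0 <= rho0 + 2 by rewrite addr_ge0// ltW.
have [cu _ _] := Hu; have [cw _ _] := Hw.
have nE (y : vec) : ~ E y -> enorm y < rho0 by move=> ny; rewrite ltNge; apply/negP => /farE.
have sqn (y : vec) : enorm y < rho0 -> dotv (y - 0) (y - 0) < rho0 ^+ 2.
  by move=> h'; rewrite subr0 -enorm_sqr ltr_pXn2r ?nnegrE ?enorm_ge0 ?(ltW r0).
have sqr (y : vec) : dotv (y - 0) (y - 0) < rho0 ^+ 2 -> enorm y <= rho0.
  by move/ltW; rewrite sq_le_enorm// ltW.
have cG : Ct (GI gchi u gu w gw).
  apply: (GI_ct cu cw (C1_stp _ _ _).2) => y /nE/sqn/q_near_lt; apply: filterS => z /sqr hz i.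
  by apply: (chi0 rho1 _).2; apply: le_trans hz _; rewrite lerDl.
split=> //; apply/eqP; rewrite -subr_eq0 -normr_eq0 eq_le normr_ge0 andbT.
have s1p := sig1_gt0 R hm.
apply/ler_addgt0Pr => e e0; rewrite add0r; apply: ltW.
have half_sig : e / (2 * sig1 R m) * sig1 R m < e.
  by rewrite invfM mulrA divfK ?gt_eqF// ltr_pdivrMr// ltr_pMr// ltr1n.
have e20 : 0 < e / (2 * sig1 R m) by rewrite divr_gt0// mulr_gt0.
have [t ht] := h _ e20.
pose r : R := Num.max t (rho0 + 3).
have rt : t <= r by rewrite le_max lexx.
have r3 : rho0 + 3 <= r by rewrite le_max lexx orbT.
have rp : 0 < r by apply: lt_le_trans r3; rewrite addr_gt0.
have be2 : 0 < 3 * r ^+ 2 by rewrite mulr_gt0// exprn_gt0.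
pose L : R := 2 * r.
have L0 : 0 <= L by rewrite mulr_ge0// ltW.
have rL : r <= L by rewrite /L mulr_natl mulr2n lerDl ltW.
have rho3r : rho0 + 2 <= r by apply: le_trans r3; rewrite lerD2l ler_nat.
have off (y : vec) : ~ E y -> \forall z \near y, [/\ forall i, gchi i z = 0, forall i, (fun (i : 'I_m) (z : vec) => 0 : R) i z = 0,
    forall i, gstp (r ^+ 2) (3 * r ^+ 2) 0 i z = 0 & chi z + 1 - stp (r ^+ 2) (3 * r ^+ 2) 0 z + -1 = 0].
  move=> /nE/sqn/q_near_lt; apply: filterS => z /sqr hz.
  have [h1 h2] : chi z = 0 /\ forall i, gchi i z = 0 by apply: chi0 => //; apply: le_trans hz _; rewrite lerDl.
  have zr : dotv (z - 0) (z - 0) <= r ^+ 2.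
    by rewrite sq_le_enorm ?(ltW rp)//; apply: le_trans hz _; apply: le_trans rho3r; rewrite lerDl.
  by split=> //; [move=> i; apply: gstp0 => //; left|rewrite h1 stp0// add0r subr0 subrr].
have far (y : vec) : L <= enorm y -> chi y + 1 - stp (r ^+ 2) (3 * r ^+ 2) 0 y + -1 = 0.
  move=> yL; have [h1 _] : chi y = 1 /\ forall i, gchi i y = 0.
    by apply: chi1 => //; apply: le_trans yL; exact: le_trans rho3r rL.
  by rewrite h1 stp1//; [rewrite addrK subrr|exact: sq_four].
have T1 : C1 chi gchi by exact: C1_stp.
(* No singularity is present here; a constant takes the place of the middle cutoff. *)
have T2 : C1 (fun _ : vec => 1 : R) (fun (i : 'I_m) (z : vec) => 0 : R) by apply: C1U_C1; exact: C1UC.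
have T3 : C1 (stp (r ^+ 2) (3 * r ^+ 2) (0 : vec)) (gstp (r ^+ 2) (3 * r ^+ 2) 0) by exact: C1_stp.
have g := green3 hm Hu Hw T1 T2 T3 L0 off far.
have z0 : vint L (GI (fun (i : 'I_m) (z : vec) => 0 : R) u gu w gw) = 0.
  rewrite (_ : GI _ _ _ _ _ = fun _ => 0 * 0); first by rewrite (vintZ hm _ 0 (@CtC _ _ 0)) mul0r.
  by apply/funext => z; rewrite /GI big1 ?mul0r// => i _; rewrite mul0r.
rewrite z0 addr0 in g.
have sup (z : vec) : rho0 + 2 <= enorm z -> GI gchi u gu w gw z = 0.
  by move=> hz; have [_ gz] := chi1 rho1 hz; apply: big1 => i _; rewrite gz mul0r.
rewrite -(vint_supp hm r2 (le_trans rho3r rL) cG sup) g.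
have cG3 : Ct (GI (gstp (r ^+ 2) (3 * r ^+ 2) 0) u gu w gw).
  by apply: (GI_ct cu cw T3.2) => y /off; apply: filterS => z [].
have key := @shell_avg R m hm (fun i y => u y * gw i y - w y * gu i y) Fl (e / (2 * sig1 R m)) r L rp (lexx _) cF cG3.
apply: (le_lt_trans (key _)).
  move=> s y /andP[rs _] sy; exact: (ht s y (le_trans rt rs) sy).
exact: half_sig.
Qed.

(** [fw] and [fw'] are the real and imaginary parts of exp(i t)(fa + i fb). *)
Definition fw (fa fb : vec -> R) (t : R) (y : vec) := cos t * fa y - sin t * fb y.
Definition fw' (fa fb : vec -> R) (t : R) (y : vec) := sin t * fa y + cos t * fb y.

Lemma rad_asym a ga ha b gb hb fa fb : radG a ga ha b gb hb fa fb ->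
  exists C r1 : R, [/\ 0 <= C, 1 <= r1 & forall r (y : vec), r1 <= r -> sph y ->
   [/\ `|nu r * a (r *: y) - fw fa fb (k * r) y| <= C / r, `|nu r * b (r *: y) - fw' fa fb (k * r) y| <= C / r,
       `|nu r * (\sum_i y 0 i * ga i (r *: y)) - - (k * fw' fa fb (k * r) y)| <= C / r &
       `|nu r * (\sum_i y 0 i * gb i (r *: y)) - k * fw fa fb (k * r) y| <= C / r]].
Proof.
move=> [_ _ [C [r0 [C0 r00 h]]]]; exists (C * (1 + k)), r0; split.
- by rewrite mulr_ge0// addr_ge0// ltW.
- exact: le_trans rho1 _.
move=> r y rr sy.
have r1 : 1 <= r by apply: le_trans rr; exact: le_trans rho1 _.
have rp : 0 < r by exact: lt_le_trans r1.
have [e1 e2] := enorm_sph rp sy.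
have [|h1 h2 h3 h4] := h (r *: y); first by rewrite e1.
rewrite e2 e1 in h3 h4; rewrite e1 in h1 h2.
have n0 := nu_gt0 m rp.
have CC : C / r <= C * (1 + k) / r by rewrite ler_wpM2r ?invr_ge0 ?(ltW rp)// ler_peMr// lerDl ltW.
have sE (g : 'I_m -> vec -> R) : \sum_i (r *: y) 0 i / r * g i (r *: y) = \sum_i y 0 i * g i (r *: y).
  by apply: eq_bigr => i _; rewrite mxE; congr (_ * _); field; rewrite gt_eqF.
rewrite !sE in h1 h2.
have tr (z : R) : `|z| <= C / (r * nu r) -> `|nu r * z| <= C / r.
  move=> hz; rewrite normrM gtr0_norm// mulrC -ler_pdivlMr//; apply: le_trans hz _.
  by rewrite invfM mulrA.
split; [exact: le_trans CC|exact: le_trans CC| |].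
- rewrite (_ : _ - _ = nu r * (\sum_i y 0 i * ga i (r *: y) + k * b (r *: y)) - k * (nu r * b (r *: y) - fw' fa fb (k * r) y)); last by ring.
  apply: le_trans (ler_normB _ _) _; rewrite [`|k * _|]normrM (gtr0_norm k0) [C * (1 + k)]mulrDr mulr1 [(C + _) / r]mulrDl.
  by apply: lerD; [exact: tr|rewrite (mulrC C) -mulrA ler_wpM2l// ltW].
- rewrite (_ : _ - _ = nu r * (\sum_i y 0 i * gb i (r *: y) - k * a (r *: y)) + k * (nu r * a (r *: y) - fw fa fb (k * r) y)); last by ring.
  apply: le_trans (ler_normD _ _) _; rewrite [`|k * _|]normrM (gtr0_norm k0) [C * (1 + k)]mulrDr mulr1 [(C + _) / r]mulrDl.
  by apply: lerD; [exact: tr|rewrite (mulrC C) -mulrA ler_wpM2l// ltW].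
Qed.

Lemma fw_bnd fa fb (M : R) t (y : vec) : (forall y : vec, sph y -> `|fa y| <= M) -> (forall y : vec, sph y -> `|fb y| <= M) ->
  sph y -> `|fw fa fb t y| <= 2 * M /\ `|fw' fa fb t y| <= 2 * M.
Proof.
move=> h1 h2 sy; have M0 : 0 <= M by exact: le_trans (h1 y sy).
have c1 : `|cos t| <= 1 by exact: cos_max.
have s1 : `|sin t| <= 1 by exact: sin_max.
have H (x z : R) : `|x| <= 1 -> `|z| <= M -> `|x * z| <= M by move=> hx hz; rewrite normrM -[leRHS]mul1r ler_pM.
rewrite mulr_natl mulr2n; split.
  by apply: le_trans (ler_normB _ _) _; apply: lerD; apply: H => //; [exact: h1|exact: h2].
by apply: le_trans (ler_normD _ _) _; apply: lerD; apply: H => //; [exact: h1|exact: h2].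
Qed.

Lemma fw_sq fa fb t (y : vec) : fw fa fb t y ^+ 2 + fw' fa fb t y ^+ 2 = fa y ^+ 2 + fb y ^+ 2.
Proof.
transitivity ((fa y ^+ 2 + fb y ^+ 2) * (cos t ^+ 2 + sin t ^+ 2)); first by rewrite /fw /fw'; ring.
by rewrite cos2Dsin2 mulr1.
Qed.

(** The flux a grad b - b grad a is divergence free, and at infinity it equals k |far field|^2
    because the oscillating phase cancels in fw^2 + fw'^2. *)
Lemma energy_id a ga ha b gb hb fa fb : radG a ga ha b gb hb fa fb ->
  Ct (GI gchi a ga b gb) /\
  vint (rho0 + 2) (GI gchi a ga b gb) = k * sphere_int (fun y => fa y ^+ 2 + fb y ^+ 2).
Proof.
move=> H; have [Ha Hb _] := H.
have sa := rad_scont rho1 farE H; have sb := rad_scont rho1 farE (rad_rot H).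
have cF : scont (fun y => fa y ^+ 2 + fb y ^+ 2) by apply: scontD; apply: scontX.
rewrite -(sigZ hm k cF); apply: chi_limit Ha Hb _ _; first exact: scontZ.
have [M1 M10 b1] := scont_bnd sa; have [M2 M20 b2] := scont_bnd sb.
pose M : R := M1 + M2.
have B1 (y : vec) : sph y -> `|fa y| <= M by move=> sy; apply: le_trans (b1 y sy) _; rewrite lerDl.
have B2 (y : vec) : sph y -> `|fb y| <= M by move=> sy; apply: le_trans (b2 y sy) _; rewrite lerDr.
have M0 : 0 <= M by rewrite addr_ge0.
have [C [r1 [C0 r11 h]]] := rad_asym H.
move=> e e0; pose N : R := 2 * M * (1 + k).
have N0 : 0 <= N by rewrite mulr_ge0 ?addr_ge0 ?(ltW k0)// mulr_ge0.
have N1 : 2 * M <= N by rewrite /N ler_peMr ?mulr_ge0// lerDl ltW.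
have N2 : k * (2 * M) <= N by rewrite /N mulrC ler_wpM2l ?mulr_ge0// lerDr.
pose D : R := 2 * ((2 * N + 1) * C).
have D0 : 0 <= D by rewrite /D mulr_ge0// mulr_ge0// addr_ge0// mulr_ge0.
exists (r1 + C + D / e) => r y rr sy.
have De : 0 <= D / e by rewrite divr_ge0// ltW.
have [rr1 rC rD] := sum3_ge (le_trans ler01 r11) C0 De.
have r1r := le_trans rr1 rr.
have rp : 0 < r by apply: lt_le_trans r1r; exact: lt_le_trans r11.
have eC : C / r <= 1 by rewrite ler_pdivrMr// mul1r; exact: le_trans rC rr.
have [h1 h2 h3 h4] := h r y r1r sy.
have [f1 f2] := fw_bnd (k * r) B1 B2 sy.
rewrite -(nu_sqr hm rp).
set A := nu r * a _ in h1; set B := nu r * b _ in h2; set dA := nu r * _ in h3; set dB := nu r * _ in h4.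
have -> : nu r * nu r * (\sum_i y 0 i * (a (r *: y) * gb i (r *: y) - b (r *: y) * ga i (r *: y))) = A * dB - B * dA.
  rewrite /A /B /dA /dB.
  have -> : \sum_i y 0 i * (a (r *: y) * gb i (r *: y) - b (r *: y) * ga i (r *: y)) =
     a (r *: y) * (\sum_i y 0 i * gb i (r *: y)) - b (r *: y) * (\sum_i y 0 i * ga i (r *: y)).
    by rewrite !mulr_sumr -sumrB; apply: eq_bigr => i _; ring.
  ring.
rewrite -(fw_sq fa fb (k * r) y); move: h1 h2 h3 h4 f1 f2.
set p := fw _ _ _ _; set q := fw' _ _ _ _ => h1 h2 h3 h4 f1 f2.
have kf (z : R) : `|z| <= 2 * M -> `|k * z| <= N.
  by move=> hz; apply: le_trans N2; rewrite normrM gtr0_norm// ler_wpM2l// ltW.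
have nf (z : R) : `|z| <= 2 * M -> `|z| <= N by move=> hz; exact: le_trans N1.
have kq : `|- (k * q)| <= N by rewrite normrN; exact: kf.
have P1 := prod_err h1 h4 eC (nf _ f1) (kf _ f1).
have P2 := prod_err h2 h3 eC (nf _ f2) kq.
have -> : A * dB - B * dA - k * (p ^+ 2 + q ^+ 2) = (A * dB - p * (k * p)) - (B * dA - q * (- (k * q))) by ring.
apply: le_trans (ler_normB _ _) _; apply: le_trans (lerD P1 P2) _.
apply: (@le_trans _ _ (D / r)); first by rewrite /D le_eqVlt; apply/orP; left; apply/eqP; ring.
by rewrite ler_pdivrMr// [leRHS]mulrC -ler_pdivrMr//; exact: le_trans rD rr.
Qed.

(** The exterior bound holds at every large radius with the same constant, so it passes to the limit
    that defines the far field. *)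
Lemma far_field_sup_bound : exists2 CF : R, 0 <= CF & forall a ga ha b gb hb fa fb (M : R),
  radG a ga ha b gb hb fa fb -> 0 < M -> bndX E rho0 a M -> bndX E rho0 b M ->
  forall y : vec, sph y -> `|fa y| <= CF * M.
Proof.
have [CP CP0 hP] := exterior_bound hm k0 oE rho1 farE.
exists (2 * CP); first exact: mulr_ge0.
move=> a ga ha b gb hb fa fb M H M0 hA hB y sy.
have hN : bndX E rho0 (fun x => - a x) M by move=> z Ez zr; rewrite normrN; exact: hA.
have h1 := hP _ _ _ _ _ _ _ _ _ H M0 hA hB.
have h2 := hP _ _ _ _ _ _ _ _ _ (rad_rot H) M0 hB hN.
have [C [r1 [C0 r11 h]]] := rad_asym H.
apply/ler_addgt0Pr => e e0.
pose r : R := Num.max r1 (Num.max (rho0 + 3) (2 * C / e)).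
have [ra rb rc] : [/\ r1 <= r, rho0 + 3 <= r & 2 * C / e <= r] by rewrite /r; split; rewrite !le_max lexx ?orbT.
have rp : 0 < r by apply: lt_le_trans ra; exact: lt_le_trans r11.
have [g1 g2 _ _] := h r y ra sy.
have [e1 _] := enorm_sph rp sy.
have n0 := nu_gt0 m rp.
have k1 := h1 (r *: y); have k2 := h2 (r *: y); rewrite e1 in k1 k2.
have {}k1 := k1 rb; have {}k2 := k2 rb.
have nE (z : R) : nu r * `|z| = `|nu r * z| by rewrite normrM gtr0_norm.
rewrite !nE in k1 k2.
set A := nu r * a _ in g1 k1; set B := nu r * b _ in g2 k2.
set c := cos (k * r); set s := sin (k * r).
have c1 : `|c| <= 1 by exact: cos_max.
have s1 : `|s| <= 1 by exact: sin_max.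
have -> : fa y = c * A + s * B - (c * (A - fw fa fb (k * r) y) + s * (B - fw' fa fb (k * r) y)).
  rewrite /fw /fw' -/c -/s.
  transitivity (fa y * (c ^+ 2 + s ^+ 2)); first by rewrite cos2Dsin2 mulr1.
  by ring.
have P (x z M' : R) : `|x| <= 1 -> `|z| <= M' -> `|x * z| <= M' by move=> hx hz; rewrite normrM -[leRHS]mul1r ler_pM.
apply: le_trans (ler_normB _ _) _; apply: lerD.
  by apply: le_trans (ler_normD _ _) _; rewrite -mulrA mulr_natl mulr2n; apply: lerD; apply: P.
apply: (@le_trans _ _ (C / r + C / r)); first by apply: le_trans (ler_normD _ _) _; apply: lerD; apply: P.
rewrite -mulr2n -mulr_natl mulrA ler_pdivrMr// [leRHS]mulrC -ler_pdivrMr//.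
Qed.

Lemma dist_shift (r : R) (y z : vec) : 0 < r -> 4 * enorm z + 1 <= r -> sph y ->
  let s := enorm (r *: y - z) in let d := dotv z y in
  [/\ r / 2 <= s, `|r - s| <= enorm z & `|r - d - s| <= 2 * enorm z ^+ 2 / r].
Proof.
move=> rp rz sy s d; have [e1 _] := enorm_sph rp sy; have z0 := enorm_ge0 z.
have h1 : `|r - s| <= enorm z.
  have := enorm_dist (r *: y) (r *: y - z); rewrite e1 -/s.
  by rewrite opprB addrCA subrr addr0.
have dz : `|d| <= enorm z by have := dotv_CS z y; rewrite sy mulr1.
have s2 : s ^+ 2 = (r - d) ^+ 2 + (enorm z ^+ 2 - d ^+ 2).
  have sq : dotv y y = 1 by rewrite -enorm_sqr sy expr1n.
  rewrite /s enorm_sqr dotvBl !dotvBr dotvZl !dotvZr dotvZl sq (dotvC y z) enorm_sqr -/d; ring.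
have /andP[h1' h2'] : - enorm z <= r - s <= enorm z by rewrite -ler_norml.
have /andP[d1 d2] : - enorm z <= d <= enorm z by rewrite -ler_norml.
have sr : r / 2 <= s by lra.
split=> //.
have d3 : d ^+ 2 <= enorm z ^+ 2 by nra.
have pos : r <= s + (r - d) by lra.
(* The difference of squares s^2 - (r - d)^2 = |z|^2 - d^2 stays bounded, and the sum s + (r - d) is
   at least r. *)
have Es : s - (r - d) = (enorm z ^+ 2 - d ^+ 2) / (s + (r - d)).
  have n : s + (r - d) != 0 by rewrite gt_eqF// (lt_le_trans rp).
  apply: (mulIf n); rewrite divfK//.
  by transitivity (s ^+ 2 - (r - d) ^+ 2); [ring|rewrite s2; ring].
rewrite distrC Es ger0_norm; last by rewrite divr_ge0 ?subr_ge0// (le_trans (ltW rp)).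
apply: ler_pM => //; first by rewrite subr_ge0.
- by rewrite invr_ge0 (le_trans (ltW rp)).
- by have := sqr_ge0 d; have := sqr_ge0 (enorm z); lra.
- by rewrite lef_pV2 ?posrE// (lt_le_trans rp).
Qed.

(** For an exponent in (0, 1] the power of t = r/s lies between 1 and t. *)
Lemma nu_ratio (r s : R) : 0 < r -> 0 < s -> `|nu r - nu s| <= nu s * (`|r - s| / s).
Proof.
move=> rp sp; have /andP[c0 c1] := cm_pos R hm.
have t0 : 0 < r / s by rewrite divr_gt0.
have -> : nu r = nu s * nu (r / s).
  by rewrite -nu_mul ?(ltW sp) ?(ltW t0)// mulrC divfK// gt_eqF.
rewrite -{2}[nu s]mulr1 -mulrBr normrM gtr0_norm ?nu_gt0// ler_wpM2l ?(ltW (nu_gt0 m sp))//.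
have -> : `|r - s| / s = `|r / s - 1|.
  by rewrite -{2}(gtr0_norm sp) -normfV -normrM mulrBl divff// gt_eqF.
move: (r / s) t0 => t t0; have [t1|t1] := leP 1 t.
  have n1 : 1 <= nu t by rewrite -(nu_1 R m); apply: nu_le.
  by rewrite ger0_norm ?subr_ge0// ger0_norm ?subr_ge0// lerD2r (nu_le_id hm).
have n1 : nu t <= 1 by rewrite -[leRHS](nu_1 R m); apply: nu_le => //; exact: ltW.
have n2 : t <= nu t.
  have := nu_le_id hm (_ : 1 <= t^-1); rewrite invf_ge1// (ltW t1) => /(_ isT) h.
  have nt : nu t * nu t^-1 = 1 by rewrite -nu_mul ?invr_ge0 ?(ltW t0)// divff ?nu_1// gt_eqF.
  have np := nu_gt0 m t0.
  have : nu t * nu t^-1 <= nu t * t^-1 by rewrite ler_wpM2l// ltW.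
  by rewrite nt ler_pdivlMr// mul1r.
rewrite ler0_norm ?subr_le0// ler0_norm ?subr_le0 ?(ltW t1)//; lra.
Qed.

Lemma trig_lip (A B t u : R) : `|(A * cos t + B * sin t) - (A * cos u + B * sin u)| <= (`|A| + `|B|) * `|t - u|.
Proof.
rewrite (_ : _ - _ = A * (cos t - cos u) + B * (sin t - sin u)); last by ring.
apply: le_trans (ler_normD _ _) _; rewrite !normrM mulrDl; apply: lerD; apply: ler_wpM2l => //.
  exact: cos_lip.
exact: sin_lip.
Qed.

(** Seen from far away, the radial wave centred at [z] has the phase k(r - z.y), by the expansion of
    |r y - z| in [dist_shift]. *)
Lemma J_asym j j1 s0 A B C (z : vec) : 0 < s0 <= 1 ->
  ampl m k s0 A B C (fun s => j (s ^+ 2)) (fun s => 2 * s * j1 (s ^+ 2)) ->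
  exists C' r1 : R, [/\ 0 <= C', 1 <= r1 & forall r (y : vec), r1 <= r -> sph y ->
    let q := dotv (r *: y - z) (r *: y - z) in let t := k * (r - dotv z y) in
    `|nu r * j q - (A * cos t + B * sin t)| <= C' / r /\
    `|nu r * (\sum_i y 0 i * (j1 q * (2 * ((r *: y) 0 i - z 0 i)))) - k * (- A * sin t + B * cos t)| <= C' / r].
Proof.
move=> s01 am; have [C0 h1 h2] := am.
pose K : R := `|A| + `|B| + C + (k * (`|A| + `|B|) + C).
have AB0 : 0 <= `|A| + `|B| by rewrite addr_ge0.
have kAB : 0 <= k * (`|A| + `|B|) by rewrite mulr_ge0// ltW.
have K0 : 0 <= K by rewrite /K !addr_ge0.
pose Z : R := 2 * enorm z ^+ 2.
have Z0 : 0 <= Z by rewrite mulr_ge0// sqr_ge0.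
have z0 := enorm_ge0 z.
pose W : R := K * (2 * enorm z) + 2 * C + (`|A| + `|B|) * (k * Z) .
have W0 : 0 <= W by rewrite /W !addr_ge0 ?mulr_ge0// ltW.
pose C' : R := W + (K * (2 * enorm z) + 2 * C + k * ((`|A| + `|B|) * (k * Z)) + K * 2 * (2 * Z)).
exists C', (4 * enorm z + 2); split.
- by rewrite /C' !addr_ge0 ?mulr_ge0// ?ltW.
- by rewrite (le_trans (ler1n R 2))// lerDr mulr_ge0.
move=> r y rr sy q t.
have r2 : 2 <= r by apply: le_trans rr; rewrite lerDr mulr_ge0.
have rp : 0 < r by exact: lt_le_trans r2.
have rz : 4 * enorm z + 1 <= r by apply: le_trans rr; rewrite lerD2l ler1n.
have [s2 rs ds] := dist_shift rp rz sy.
set s := enorm (r *: y - z) in s2 rs ds; set d := dotv z y in ds t *.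
have qs : q = s ^+ 2 by rewrite /q -enorm_sqr.
have sp : 0 < s by apply: lt_le_trans s2; rewrite divr_gt0.
have s1 : 1 <= s by apply: le_trans s2; rewrite ler_pdivlMr// mul1r.
have ss : s0 <= s by case/andP: s01 => _ h; exact: le_trans s1.
have iss : s^-1 <= 2 / r by rewrite -invf_div lef_pV2 ?posrE// divr_gt0.
have [b1 b2] := ampl_bound k0 s01 am s1.
have ns := nu_gt0 m sp; have nr := nu_gt0 m rp.
have nn := nu_ratio rp sp.
have cs (x M : R) : nu s * `|x| <= M -> M <= K -> `|nu r * x - nu s * x| <= K * (2 * enorm z) / r.
  move=> hx MK; rewrite -mulrBl normrM; apply: le_trans (ler_wpM2r (normr_ge0 x) nn) _.
  rewrite mulrAC; apply: (@le_trans _ _ (K * (enorm z * (2 / r)))).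
    apply: ler_pM => //; [by rewrite mulr_ge0// ltW|by rewrite divr_ge0// ltW|exact: le_trans MK|].
    by apply: ler_pM => //; rewrite invr_ge0 ltW.
  by rewrite le_eqVlt; apply/orP; left; apply/eqP; ring.
have Cs : C / s <= 2 * C / r by rewrite (mulrC 2) -mulrA ler_wpM2l.
have ph : `|k * s - t| <= k * Z / r.
  by rewrite /t -mulrBr normrM gtr0_norm// -mulrA ler_wpM2l ?(ltW k0)// distrC.
have tl (A' B' : R) : `|A'| + `|B'| = `|A| + `|B| -> 
   `|(A' * cos (k * s) + B' * sin (k * s)) - (A' * cos t + B' * sin t)| <= (`|A| + `|B|) * (k * Z) / r.
  by move=> <-; apply: le_trans (trig_lip _ _ _ _) _; rewrite -[leRHS]mulrA ler_wpM2l// addr_ge0.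
have K1 : `|A| + `|B| + C <= K by rewrite /K lerDl addr_ge0.
have K2 : k * (`|A| + `|B|) + C <= K by rewrite /K lerDr !addr_ge0.
rewrite qs; set f := j _; set f1 := 2 * s * j1 (s ^+ 2).
split.
  have -> : nu r * f - (A * cos t + B * sin t) = (nu r * f - nu s * f) + (nu s * f - (A * cos (k * s) + B * sin (k * s)))
      + ((A * cos (k * s) + B * sin (k * s)) - (A * cos t + B * sin t)) by ring.
  apply: le_trans (ler_normD _ _) _; apply: le_trans (lerD (ler_normD _ _) (lexx _)) _.
  apply: (@le_trans _ _ (W / r)); last first.
    rewrite ler_wpM2r ?invr_ge0 ?(ltW rp)// /C' lerDl !addr_ge0 ?mulr_ge0// ?ltW//.
  have -> : W / r = K * (2 * enorm z) / r + 2 * C / r + (`|A| + `|B|) * (k * Z) / r by rewrite /W; ring.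
  apply: lerD; last exact: tl.
  apply: lerD; [exact: cs b1 K1|exact: le_trans (h1 s ss) Cs].
(* The derivative of |r y - z| in the direction y is (r - z.y)/s, which tends to 1. *)
have -> : \sum_i y 0 i * (j1 (s ^+ 2) * (2 * ((r *: y) 0 i - z 0 i))) = (r - d) / s * f1.
  transitivity (2 * j1 (s ^+ 2) * (r * (\sum_i y 0 i * y 0 i) - d)).
    rewrite /d /dotv mulr_sumr -sumrB mulr_sumr; apply: eq_bigr => i _; rewrite mxE; ring.
  by rewrite (sum_sph sy) /f1; field; rewrite gt_eqF.
have -> : nu r * ((r - d) / s * f1) - k * (- A * sin t + B * cos t) =
   (nu r * f1 - nu s * f1) + (nu s * f1 - k * (- A * sin (k * s) + B * cos (k * s)))
   + k * ((B * cos (k * s) + - A * sin (k * s)) - (B * cos t + - A * sin t)) + nu r * f1 * ((r - d - s) / s).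
  by field; rewrite gt_eqF.
apply: le_trans (ler_normD _ _) _; apply: le_trans (lerD (ler_normD _ _) (lexx _)) _.
apply: le_trans (lerD (lerD (ler_normD _ _) (lexx _)) (lexx _)) _.
have nrf : `|nu r * f1| <= K * 2.
  rewrite normrM gtr0_norm//.
  have : nu r <= nu s * 2.
    have := le_trans (ler_norm _) nn; rewrite lerBlDr => h; apply: le_trans h _.
    rewrite [nu s * 2]mulrDr mulr1 lerD2r -[leRHS]mulr1 ler_wpM2l ?(ltW ns)// ler_pdivrMr// mul1r.
    by apply: le_trans rs _; apply: le_trans s2; exact: quarter z0 rz.
  move=> h; apply: le_trans (ler_wpM2r (normr_ge0 f1) h) _; rewrite mulrAC ler_wpM2r//; exact: le_trans b2 K2.
apply: (@le_trans _ _ ((K * (2 * enorm z) + 2 * C + k * ((`|A| + `|B|) * (k * Z)) + K * 2 * (2 * Z)) / r)); last first.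
  by rewrite ler_wpM2r ?invr_ge0 ?(ltW rp)// /C' lerDr.
set X1 := K * (2 * enorm z); set X2 := 2 * C; set X3 := k * (_ * (k * Z)); set X4 := K * 2 * (2 * Z).
have -> : (X1 + X2 + X3 + X4) / r = X1 / r + X2 / r + X3 / r + X4 / r by ring.
apply: lerD; first apply: lerD; first apply: lerD.
- exact: cs b2 K2.
- exact: le_trans (h2 s ss) Cs.
- rewrite normrM gtr0_norm// -mulrA ler_wpM2l ?(ltW k0)//; apply: tl; by rewrite normrN addrC.
- rewrite normrM -mulrA; apply: ler_pM => //; rewrite normrM [`|s^-1|]gtr0_norm ?invr_gt0//.
  apply: (@le_trans _ _ (Z / r * 1)); last first.
    rewrite mulr1 ler_wpM2r ?invr_ge0 ?(ltW rp)// ler_peMl//; by rewrite ler1n.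
  by apply: ler_pM => //; rewrite ?invr_ge0 ?(ltW sp)// invf_le1.
Qed.

(** In the flux of an outgoing field against the regular wave centred at [z], the phase k r cancels
    and exp(i k z.y) remains. The shell integral thus computes the pairing of the far field with
    [phi_z]. *)
Lemma pairing_id a ga ha b gb hb fa fb j j1 j2 s0 A B C (z : vec) : radG a ga ha b gb hb fa fb ->
  profile m k setT j j1 j2 -> 0 < s0 <= 1 ->
  ampl m k s0 A B C (fun s => j (s ^+ 2)) (fun s => 2 * s * j1 (s ^+ 2)) ->
  let G := GI gchi a ga (fun y => j (dotv (y - z) (y - z))) (fun i y => j1 (dotv (y - z) (y - z)) * (2 * (y 0 i - z 0 i))) in
  Ct G /\ vint (rho0 + 2) G =
    k * (A * sphere_int (fun y => fw' fa fb (k * dotv z y) y) + B * sphere_int (fun y => fw fa fb (k * dotv z y) y)).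
Proof.
move=> H hj s01 am G; have [Ha Hb _] := H.
have HJ := radial_helm hj (fun (y : vec) (_ : E y) => I : setT (dotv (y - z) (y - z))).
have sa := rad_scont rho1 farE H; have sb := rad_scont rho1 farE (rad_rot H).
have cz : scont (fun y : vec => k * dotv z y).
  apply: scontZ; apply: cont_scont => y; have := @dotv_cont R m z y.
  by under eq_fun do rewrite dotvC.
have ccs : scont (fun y : vec => cos (k * dotv z y)) by apply: (scont_fun (f := @cos R)) => // t; exact: (der_cont (is_derive_cos t)).
have csn : scont (fun y : vec => sin (k * dotv z y)) by apply: (scont_fun (f := @sin R)) => // t; exact: (der_cont (is_derive_sin t)).
have c1 : scont (fun y => fw fa fb (k * dotv z y) y) by apply: scontB; apply: scontM.
have c2 : scont (fun y => fw' fa fb (k * dotv z y) y) by apply: scontD; apply: scontM.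
have cA := @scontZ _ _ A _ c2; have cB := @scontZ _ _ B _ c1; have cAB := scontD cA cB.
rewrite -(sigZ hm A c2) -(sigZ hm B c1) -(sigD hm cA cB) -(sigZ hm k cAB).
apply: chi_limit Ha HJ _ _; first exact: scontZ.
have [M1 M10 b1] := scont_bnd sa; have [M2 M20 b2] := scont_bnd sb.
pose M : R := M1 + M2.
have B1 (y : vec) : sph y -> `|fa y| <= M by move=> sy; apply: le_trans (b1 y sy) _; rewrite lerDl.
have B2 (y : vec) : sph y -> `|fb y| <= M by move=> sy; apply: le_trans (b2 y sy) _; rewrite lerDr.
have M0 : 0 <= M by rewrite addr_ge0.
have [C1 [r1 [C10 r11 h]]] := rad_asym H.
have [C2 [r2 [C20 r21 g]]] := J_asym z s01 am.
move=> e e0.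
pose AB : R := `|A| + `|B|.
have AB0 : 0 <= AB by rewrite addr_ge0.
pose N : R := (2 * M + AB) * (1 + k).
have k1 : 0 <= 1 + k by rewrite addr_ge0// ltW.
have MA : 0 <= 2 * M + AB by rewrite addr_ge0// mulr_ge0.
have N0 : 0 <= N by rewrite mulr_ge0.
have N1 (x : R) : `|x| <= 2 * M -> `|x| <= N.
  move=> hx; apply: le_trans hx _; apply: (@le_trans _ _ (2 * M + AB)); first by rewrite lerDl.
  by rewrite /N ler_peMr// lerDl ltW.
have N2 (x : R) : `|x| <= AB -> `|x| <= N.
  move=> hx; apply: le_trans hx _; apply: (@le_trans _ _ (2 * M + AB)); first by rewrite lerDr mulr_ge0.
  by rewrite /N ler_peMr// lerDl ltW.
have N3 (x : R) : `|x| <= 2 * M \/ `|x| <= AB -> `|k * x| <= N.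
  move=> hx; rewrite normrM gtr0_norm//; apply: (@le_trans _ _ (k * (2 * M + AB))).
    rewrite ler_wpM2l ?(ltW k0)//; case: hx => hx; apply: le_trans hx _; rewrite ?lerDl// lerDr mulr_ge0//.
  by rewrite /N mulrC ler_wpM2l// lerDr.
pose C3 : R := C1 + C2.
pose D : R := 2 * ((2 * N + 1) * C3).
have C30 : 0 <= C3 by rewrite addr_ge0.
have D0 : 0 <= D by rewrite /D mulr_ge0// mulr_ge0// addr_ge0// mulr_ge0.
exists (r1 + r2 + (C3 + D / e)) => r y rr sy.
have De : 0 <= D / e by rewrite divr_ge0// ltW.
have [rr1 rr2 rC] := sum3_ge (le_trans ler01 r11) (le_trans ler01 r21) (addr_ge0 C30 De).
have r1r := le_trans rr1 rr; have r2r := le_trans rr2 rr.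
have rp : 0 < r by apply: lt_le_trans r1r; exact: lt_le_trans r11.
have eC : C3 / r <= 1.
  by rewrite ler_pdivrMr// mul1r; apply: le_trans rr; apply: le_trans rC; rewrite lerDl.
have up1 (x : R) : `|x| <= C1 / r -> `|x| <= C3 / r.
  by move=> hx; apply: le_trans hx _; rewrite ler_wpM2r ?invr_ge0 ?(ltW rp)// lerDl.
have up2 (x : R) : `|x| <= C2 / r -> `|x| <= C3 / r.
  by move=> hx; apply: le_trans hx _; rewrite ler_wpM2r ?invr_ge0 ?(ltW rp)// lerDr.
have [h1 _ h3 _] := h r y r1r sy; have [g1 g2] := g r y r2r sy.
have {}h1 := up1 _ h1; have {}h3 := up1 _ h3; have {}g1 := up2 _ g1; have {}g2 := up2 _ g2.
have [f1 f2] := fw_bnd (k * r) B1 B2 sy.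
rewrite -(nu_sqr hm rp).
set q := dotv _ _ in g1 g2 *; set d := dotv z y in g1 g2 *.
set a' := nu r * a _ in h1; set da := nu r * _ in h3; set w := nu r * j q in g1; set dw := nu r * _ in g2.
have -> : nu r * nu r * (\sum_i y 0 i * (a (r *: y) * (j1 q * (2 * ((r *: y) 0 i - z 0 i))) - j q * ga i (r *: y))) = a' * dw - w * da.
  rewrite /a' /da /w /dw.
  have -> : \sum_i y 0 i * (a (r *: y) * (j1 q * (2 * ((r *: y) 0 i - z 0 i))) - j q * ga i (r *: y)) =
     a (r *: y) * (\sum_i y 0 i * (j1 q * (2 * ((r *: y) 0 i - z 0 i)))) - j q * (\sum_i y 0 i * ga i (r *: y)).
    by rewrite !mulr_sumr -sumrB; apply: eq_bigr => i _; ring.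
  ring.
have t1 := trig_bound A B (k * (r - d)).
have t2 := trig_bound B (- A) (k * (r - d)).
rewrite normrN (addrC `|B|) in t2.
have P1 : `|a' * dw - fw fa fb (k * r) y * (k * (- A * sin (k * (r - d)) + B * cos (k * (r - d))))| <= (2 * N + 1) * (C3 / r).
  by apply: prod_err h1 g2 eC (N1 _ f1) (N3 _ _); right; rewrite addrC.
have P2 : `|w * da - (A * cos (k * (r - d)) + B * sin (k * (r - d))) * (- (k * fw' fa fb (k * r) y))| <= (2 * N + 1) * (C3 / r).
  by apply: prod_err g1 h3 eC (N2 _ t1) _; rewrite normrN; apply: N3; left.
(* The addition formulas for k d = k r - k (r - d). *)
have id : k * (A * fw' fa fb (k * d) y + B * fw fa fb (k * d) y) =
   fw fa fb (k * r) y * (k * (- A * sin (k * (r - d)) + B * cos (k * (r - d))))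
   - (A * cos (k * (r - d)) + B * sin (k * (r - d))) * (- (k * fw' fa fb (k * r) y)).
  have -> : k * d = k * r - k * (r - d) by ring.
  by rewrite /fw /fw' cosB sinB; ring.
rewrite id.
set X := a' * dw in P1 *; set Y := w * da in P2 *; move: P1 P2; set X0 := fw _ _ _ _ * _; set Y0 := _ * - _ => P1 P2.
have -> : X - Y - (X0 - Y0) = (X - X0) - (Y - Y0) by ring.
apply: le_trans (ler_normB _ _) _; apply: le_trans (lerD P1 P2) _.
apply: (@le_trans _ _ (D / r)); first by rewrite /D le_eqVlt; apply/orP; left; apply/eqP; ring.
rewrite ler_pdivrMr// [leRHS]mulrC -ler_pdivrMr//; apply: le_trans rr; apply: le_trans rC; by rewrite lerDr.
Qed.
End Far.

(** * Energy of the far field *)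

Section LogCut.
Variable R : realType.
(* The point is [t * et' t <= 2 / Lg]: the cutoff costs arbitrarily little in the energy identity. *)
Lemma log_cut (t0 Lg : R) : 0 < t0 -> 0 < Lg -> exists et et' : R -> R,
  [/\ forall t, der et t (et' t), cont et', forall t, t <= t0 -> et t = 0 /\ et' t = 0,
      forall t, t0 * expR Lg <= t -> et t = 1 &
      forall t, 0 <= et t <= 1 /\ (0 < t -> 0 <= et' t <= 2 / (Lg * t))].
Proof.
move=> t00 L0; have tn : t0 != 0 by rewrite gt_eqF.
(* A linear ramp in ln t over a range of length [Lg], so its derivative is 1/(Lg t). *)
pose z (t : R) := ln (t / t0) / Lg.
pose et t := step (z t); pose et' t := step' (z t) / (Lg * t).
have z0 t : t <= t0 -> z t <= 0.
  move=> h; rewrite /z mulr_le0_ge0 ?invr_ge0 ?(ltW L0)// ln_le0// ler_pdivrMr// mul1r//.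
have e0 t : t <= t0 -> et t = 0 /\ et' t = 0.
  by move=> /z0 h; rewrite /et /et' step_le0// step'_le0// mul0r.
have near0 t : t < t0 -> \forall s \near t, s <= t0.
  by move=> h; near=> s; apply: ltW; near: s; exact: lt_nbhsl.
have dz t : 0 < t -> der z t ((Lg * t)^-1).
  move=> tp; have h1 : der (fun t => t / t0) t (t0^-1).
    by apply: der_eq (derM (derI t) (derC t0^-1 t)) _; rewrite mul1r mulr0 addr0.
  have tt : 0 < t / t0 by rewrite divr_gt0.
  apply: der_eq (derM (der_comp (f := @ln R) h1 (is_derive1_ln tt)) (derC Lg^-1 t)) _.
  by field; rewrite tn !gt_eqF.
exists et, et'; split; [ | |exact: e0| | ].
- move=> t; have [tp|tp] := leP t 0.
    have lt : t < t0 by exact: le_lt_trans t00.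
    rewrite (e0 t (ltW lt)).2; apply: (der_near (f := fun _ => 0)); last exact: derC.
    by have := near0 t lt; apply: filterS => s /e0[].
  by apply: der_eq (der_comp (f := @step R) (dz t tp) (step_der _)) _.
- move=> t; have [tp|tp] := leP t 0.
    have lt : t < t0 by exact: le_lt_trans t00.
    apply: (ct_near (f := fun _ => 0)); last exact: ctC.
    by have := near0 t lt; apply: filterS => s /e0[].
  apply: ctM; first by apply: (ct_comp (g := @step' R)); [exact: der_cont (dz t tp)|exact: step'_cont].
  apply: (ctV (f := fun t => Lg * t)); first by rewrite mulf_neq0// gt_eqF.
  exact: der_cont (derZ Lg (derI t)).
- move=> t ht; have tp : 0 < t by apply: lt_le_trans ht; rewrite mulr_gt0// expR_gt0.
  rewrite /et step_ge1// ler_pdivlMr// mul1r -[Lg]expRK ler_ln ?posrE ?expR_gt0 ?divr_gt0//.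
  by rewrite ler_pdivlMr// mulrC.
- move=> t; split; first exact: step_itv.
  move=> tp; have /andP[s0 s2] := step'_itv (z t).
  have Lt : 0 < Lg * t by rewrite mulr_gt0.
  by rewrite /et' divr_ge0 ?(ltW Lt)//= ler_wpM2r// invr_ge0 ltW.
Unshelve. all: by end_near. Qed.
End LogCut.

Section Glue.
Variables (R : realType) (m : nat) (E : set 'rV[R]_m).
Notation vec := 'rV[R]_m.
Hypothesis oE : open E.
Definition onE (F : vec -> R) : vec -> R := fun x => if pselect (E x) is left _ then F x else 0.
Lemma onE1 F x : E x -> onE F x = F x.
Proof. by rewrite /onE; case: pselect. Qed.
Lemma onE0 F x : ~ E x -> onE F x = 0.
Proof. by rewrite /onE; case: pselect. Qed.
Lemma near_onE F x : E x -> \forall y \near x, F y = onE F y.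
Proof.
by move=> Ex; have : nbhs x E := open_nbhs_nbhs (conj oE Ex); apply: filterS => y /(onE1 F).
Qed.
Lemma C1U_onE F G : C1U E F G -> C1U E (onE F) (fun i => onE (G i)).
Proof.
move=> h x Ex; have [c d] := h x Ex; split; first by apply: ct_near c; exact: near_onE.
move=> i; split; last by apply: ct_near (d i).2; exact: near_onE.
rewrite onE1//; have [t t0 ht] := line_near i (near_onE F Ex).
apply: der_near (d i).1; apply/nbhs_normP; exists t => //= s.
by rewrite /ball_ /= sub0r normrN; exact: ht.
Qed.
Lemma C1_onE F G : C1U E F G ->
  (forall x, ~ E x -> \forall y \near x, E y -> F y = 0 /\ forall i, G i y = 0) ->
  C1 (onE F) (fun i => onE (G i)).
Proof.
move=> h hz; apply: C1_glue (C1U_onE h) _ => x /hz; apply: filterS => y hy.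
have [Ey|nE] := pselect (E y); last by split=> [|i]; rewrite onE0.
by split=> [|i]; rewrite onE1//; [exact: (hy Ey).1|exact: (hy Ey).2].
Qed.
Lemma Ct_onE F : (forall x, E x -> ctat F x) -> (forall x, ~ E x -> \forall y \near x, E y -> F y = 0) ->
  Ct (onE F).
Proof.
move=> h hz x; have [Ex|/hz nE] := pselect (E x); first by apply: ct_near (h x Ex); exact: near_onE.
apply: (ct_near (f := fun _ => 0)); last exact: ctC.
apply: filterS nE => y hy; have [Ey|nEy] := pselect (E y); last by rewrite onE0.
by rewrite onE1// hy.
Qed.
End Glue.

Lemma cac_arith (R : realType) (A B G X K S c z w : R) : A <= X -> c * z * (K * w) <= B -> 0 <= G ->
  c * z * S <= X + B + (- A + G + c * z * (S - K * w)).
Proof. by rewrite mulrBr; move: (c * z * S) (c * z * (K * w)) => u v *; lra. Qed.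
Lemma gw_F_arith (R : realType) (a b x y : R) :
  `|2 * (a * x + b * y) * (a * y - b * x)| <= 2 * (a * a + b * b) * (x ^+ 2 + y ^+ 2).
Proof.
have e : (a * a + b * b) * (x ^+ 2 + y ^+ 2) = (a * x + b * y) ^+ 2 + (a * y - b * x) ^+ 2 by ring.
rewrite -!mulrA normrM ger0_norm// ler_wpM2l// e.
move: (a * x + b * y) (a * y - b * x) => p q; rewrite ler_norml.
have := sqr_ge0 (p - q); have := sqr_ge0 (p + q); rewrite !sqrrD sqrrN mulrN mulNrn.
by move=> ? ?; apply/andP; split; lra.
Qed.

Lemma lin_comb_bound (R : realType) (A B X Y g : R) : `|X| <= g -> `|Y| <= g ->
  `|B * X - A * Y| <= (`|A| + `|B|) * g /\ `|A * X + B * Y| <= (`|A| + `|B|) * g.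
Proof.
move=> hX hY; split.
  by apply: le_trans (ler_normB _ _) _; rewrite addrC mulrDl; apply: lerD; rewrite normrM ler_wpM2l.
by apply: le_trans (ler_normD _ _) _; rewrite mulrDl; apply: lerD; rewrite normrM ler_wpM2l.
Qed.

Section Energy.
Variables (R : realType) (m : nat) (k : R) (E : set 'rV[R]_m) (rho0 : R).
Hypothesis hm : m = 2%N \/ m = 3%N.
Hypothesis k0 : 0 < k.
Hypothesis oE : open E.
Hypothesis rho1 : 1 <= rho0.
Notation vec := 'rV[R]_m.
Hypothesis farE : forall y : vec, rho0 <= enorm y -> E y.
Notation nu := (@nu R m).
Notation radG := (radG k E rho0).
Notation gchi := (gchi rho0).
Notation chi := (@chi R m rho0).
Notation bndX := (bndX E rho0).

(** Smallness is asked in a neighbourhood of every point off [E], so that a cutoff in |v|^2 vanishes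
    there identically. *)
Definition small (a b : vec -> R) (t : R) := forall x : vec, ~ E x -> \forall y \near x, E y -> a y ^+ 2 + b y ^+ 2 <= t.

Section OneField.
Variables (a b : vec -> R) (ga gb : 'I_m -> vec -> R) (ha hb : 'I_m -> 'I_m -> vec -> R) (t0 Lg M : R).
Hypothesis Ha : helm E k a ga ha.
Hypothesis Hb : helm E k b gb hb.
Hypothesis t00 : 0 < t0.
Hypothesis L0 : 0 < Lg.
Hypothesis M0 : 0 < M.
Hypothesis bA : bndX a M.
Hypothesis bB : bndX b M.
Hypothesis sm : small a b (t0 / 2).
(** For v = a + i b: [w] is |v|^2 and [gw] its gradient, [S] is |grad v|^2, and [F] is the
    divergence free flux Im(conj v grad v). *)
Let w (y : vec) : R := a y * a y + b y * b y.
Let gw i (y : vec) : R := 2 * (a y * ga i y + b y * gb i y).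
Let S (y : vec) : R := \sum_i (ga i y ^+ 2 + gb i y ^+ 2).
Let F i (y : vec) : R := a y * gb i y - b y * ga i y.
Let hF i j (y : vec) : R := (ga j y * gb i y + a y * hb i j y) - (gb j y * ga i y + b y * ha i j y).
Let hw i j (y : vec) : R := 2 * ((ga j y * ga i y + a y * ha i j y) + (gb j y * gb i y + b y * hb i j y)).

Lemma en_w : C1U E w gw.
Proof.
have [c1 _ _] := Ha; have [c2 _ _] := Hb.
have -> : gw = fun i y => (ga i y * a y + a y * ga i y) + (gb i y * b y + b y * gb i y).
  by apply/funext => i; apply/funext => y; rewrite /gw; ring.
by apply: C1UD; apply: C1UM.
Qed.
Lemma en_F i : C1U E (F i) (hF i).
Proof. by have [c1 d1 _] := Ha; have [c2 d2 _] := Hb; apply: C1UB; apply: C1UM. Qed.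
Lemma en_gw i : C1U E (gw i) (hw i).
Proof. by have [c1 d1 _] := Ha; have [c2 d2 _] := Hb; apply: C1UZ; apply: C1UD; apply: C1UM. Qed.
Lemma en_divF x : E x -> \sum_i hF i i x = 0.
Proof.
have [_ _ d1] := Ha; have [_ _ d2] := Hb => Ex.
rewrite (eq_bigr (fun i => a x * hb i i x - b x * ha i i x)); last by move=> i _; rewrite /hF; ring.
by rewrite sumrB -!mulr_sumr d1// d2//; ring.
Qed.
Lemma en_divw x : E x -> \sum_i hw i i x = 2 * (S x - k ^+ 2 * w x).
Proof.
have [_ _ d1] := Ha; have [_ _ d2] := Hb => Ex.
rewrite (eq_bigr (fun i => 2 * (ga i x ^+ 2 + gb i x ^+ 2) + 2 * (a x * ha i i x + b x * hb i i x))); last by move=> i _; rewrite /hw; ring.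
rewrite big_split -!mulr_sumr /= -/(S x) big_split -!mulr_sumr /= d1// d2// /w; ring.
Qed.
Lemma en_w_small x : ~ E x -> \forall y \near x, E y -> w y <= t0 / 2.
Proof. by move=> /sm; apply: filterS => y hy /hy; rewrite /w !expr2. Qed.

Let co (y : vec) : R := 1 - chi y.
Lemma en_co : C1U E co (fun i y => 0 - gchi i y).
Proof. by apply: C1UB; [exact: C1UC|apply: C1_C1U; exact: C1_stp]. Qed.
Lemma co_itv y : 0 <= co y <= 1.
Proof. by rewrite /co /chi /stp; set t := _ / _; have /andP[? ?] := step_itv t; apply/andP; split; lra. Qed.
Lemma co_far y : rho0 + 2 <= enorm y -> co y = 0.
Proof. by move=> h; rewrite /co (chi1 rho1 h).1 subrr. Qed.

Lemma w_ge0 y : 0 <= w y.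
Proof. by rewrite /w addr_ge0// -expr2 sqr_ge0. Qed.
Lemma w_M y : E y -> enorm y <= rho0 + 3 -> w y <= 2 * M ^+ 2.
Proof.
move=> Ey yr; have sq u : bndX u M -> u y * u y <= M ^+ 2.
  by move=> hu; rewrite -expr2 -(real_normK (num_real (u y))) lerXn2r ?nnegrE ?(ltW M0)//; exact: hu.
by have := sq _ bA; have := sq _ bB; rewrite /w; lra.
Qed.
(** Vanishing for w <= t0/2 removes a neighbourhood of the obstacle; being 1 for w >= t0 it
    dominates the region where the logarithmic cutoff of [energy_estimate] has a slope. *)
Let ze (t : R) : R := step ((t - t0 / 2) / (t0 / 2)).
Let ze' (t : R) : R := step' ((t - t0 / 2) / (t0 / 2)) / (t0 / 2).
Lemma t20 : 0 < t0 / 2. Proof. by rewrite divr_gt0. Qed.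
Lemma ze_der t : der ze t (ze' t) /\ ctat ze' t.
Proof.
have d : der (fun t => (t - t0 / 2) / (t0 / 2)) t ((t0 / 2)^-1).
  by apply: der_eq (derM (derB (derI t) (derC (t0 / 2) t)) (derC (t0 / 2)^-1 t)) _; rewrite subr0 mul1r mulr0 addr0.
split; first exact: (der_comp (f := @step R) d (step_der _)).
apply: ctM; last exact: ctC.
by apply: (ct_comp (g := @step' R)); [exact: der_cont d|exact: step'_cont].
Qed.
Lemma ze_low t : t <= t0 / 2 -> ze t = 0 /\ ze' t = 0.
Proof.
move=> h; have z : (t - t0 / 2) / (t0 / 2) <= 0 by rewrite mulr_le0_ge0 ?subr_le0// invr_ge0 ltW// t20.
by rewrite /ze /ze' step_le0// step'_le0// mul0r.
Qed.
Lemma ze_high t : t0 <= t -> ze t = 1.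
Proof. by move=> h; rewrite /ze step_ge1// ler_pdivlMr ?t20// mul1r; lra. Qed.
Lemma ze_itv t : 0 <= ze t <= 1. Proof. exact: step_itv. Qed.
Lemma ze'_ge0 t : 0 <= ze' t.
Proof. by rewrite /ze' divr_ge0 ?(ltW t20)//; case/andP: (step'_itv ((t - t0 / 2) / (t0 / 2))). Qed.

Let P := onE E (fun y => co y * ze (w y) * S y).
Definition CE : R := m%:R * (4 * (rho0 + 2) * (2 * (M * (Clip m k (1 / 4) * M)))) + 2 * (k ^+ 2 * M ^+ 2).

Lemma S_ge0 y : 0 <= S y.
Proof. by apply: sumr_ge0 => i _; rewrite addr_ge0 ?sqr_ge0. Qed.
Lemma en_ct x : E x -> [/\ ctat a x, ctat b x & forall i, ctat (ga i) x /\ ctat (gb i) x].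
Proof.
move=> Ex; have [c1 _ _] := Ha; have [c2 _ _] := Hb; have [h1 d1] := c1 x Ex; have [h2 d2] := c2 x Ex.
by split=> // i; split; [exact: (d1 i).2|exact: (d2 i).2].
Qed.
Lemma P_ct : Ct P.
Proof.
apply: (Ct_onE oE).
  move=> x Ex; have [c1 d1] := en_w Ex; have [c2 _] := en_co Ex; have [_ _ cg] := en_ct Ex.
  apply: ctM; first apply: ctM => //.
    apply: (ct_comp (g := ze)) => //; exact: der_cont (ze_der (w x)).1.
  by apply: ct_sum => i; apply: ctD; apply: ctX; [exact: (cg i).1|exact: (cg i).2].
move=> x /en_w_small; apply: filterS => y hy /hy h.
by rewrite (ze_low h).1 mulr0 mul0r.
Qed.
Let L : R := rho0 + 3.
Lemma en_L0 : 0 <= L.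
Proof. by have := rho1; rewrite /L; lra. Qed.
Lemma rhoL (x : vec) : L <= enorm x -> rho0 + 2 <= enorm x.
Proof. by apply: le_trans; rewrite lerD2l ler_nat. Qed.
Lemma CE_ge0 : 0 <= CE.
Proof.
have [r0 _ _] := rho_pos rho1; have MM := ltW M0.
rewrite /CE; apply: addr_ge0; last by rewrite mulr_ge0// mulr_ge0 ?sqr_ge0.
rewrite mulr_ge0// mulr_ge0//; first by rewrite mulr_ge0// addr_ge0// ltW.
by rewrite mulr_ge0// mulr_ge0// mulr_ge0// Clip_ge0.
Qed.
(* On the support of [grad chi] the gradients are controlled by the interior estimate. *)
Lemma gchi_dot (c d : vec -> R) (B : R) y : E y -> (forall z : vec, E z -> enorm z <= rho0 + 2 -> `|c z| <= B) ->
  (forall z : vec, E z -> enorm z <= rho0 + 2 -> `|d z| <= B) -> 0 <= B ->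
  `|\sum_i gchi i y * (c y * ga i y + d y * gb i y)| <= m%:R * (4 * (rho0 + 2) * (2 * (B * (Clip m k (1 / 4) * M)))).
Proof.
move=> Ey hc hd B0; have [r0 _ _] := rho_pos rho1; have MM := ltW M0.
have cl : 0 <= Clip m k (1 / 4) * M by rewrite mulr_ge0// Clip_ge0.
have rhs : 0 <= 4 * (rho0 + 2) * (2 * (B * (Clip m k (1 / 4) * M))).
  by rewrite mulr_ge0//; [rewrite mulr_ge0// addr_ge0// ltW|rewrite mulr_ge0// mulr_ge0].
apply: sum_le_m => i.
have [y1|y1] := leP (enorm y) (rho0 + 1); first by rewrite (chi0 rho1 y1).2 mul0r normr0.
have [y2|y2] := leP (rho0 + 2) (enorm y); first by rewrite (chi1 rho1 y2).2 mul0r normr0.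
have sh : rho0 + 1 <= enorm y <= rho0 + 2 by rewrite !ltW.
rewrite normrM; apply: ler_pM => //; first exact: gchi_bound.
have g1 := shell_grad hm oE farE i Ha M0 bA sh.
have g2 := shell_grad hm oE farE i Hb M0 bB sh.
apply: le_trans (ler_normD _ _) _; rewrite !normrM mulr_natl mulr2n.
by apply: lerD; apply: ler_pM => //; [apply: hc|apply: hd] => //; exact: ltW.
Qed.

(* Tests the equation of [w = a^2 + b^2] with [co * ze (w)]. *)
Lemma caccioppoli : vint L P <= CE * volb m L.
Proof.
pose V i y := co y * ze (w y) * gw i y / 2.
pose dV i j y := ((0 - gchi j y) * ze (w y) + co y * (ze' (w y) * gw j y)) * gw i y / 2 + co y * ze (w y) * hw i j y / 2.
have cV i : C1U E (V i) (dV i).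
  have h : C1U E (fun y => co y * ze (w y)) (fun i y => (0 - gchi i y) * ze (w y) + co y * (ze' (w y) * gw i y)).
    by apply: (C1UM en_co); apply: (C1U_comp en_w) => x _; exact: ze_der.
  have := C1UZ (2^-1) (C1UM h (en_gw i)).
  rewrite (_ : (fun x => _) = V i); last by apply/funext => x; rewrite /V; ring.
  rewrite (_ : (fun i0 x => _) = dV i)//.
  by apply/funext => j; apply/funext => x; rewrite /dV; ring.
have gV i : C1 (onE E (V i)) (fun j => onE E (dV i j)).
  apply: (C1_onE oE (cV i)) => x /en_w_small; apply: filterS => y hy /hy h.
  have [z1 z2] := ze_low h; rewrite /V /dV z1 z2; split=> [|j]; by ring.
have sV i x : L <= enorm x -> onE E (V i) x = 0.
  move=> /rhoL/co_far xr; have [Ex|nE] := pselect (E x); last by rewrite onE0.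
  by rewrite onE1// /V xr !mul0r.
have Z := div_zero hm en_L0 gV sV.
have cQ : Ct (fun x => \sum_i onE E (dV i i) x) by apply: Ct_sum => i; exact: (gV i).2.
have cC : Ct (fun x : vec => CE) by exact: CtC.
have -> : CE * volb m L = CE * volb m L + vint L (fun x => \sum_i onE E (dV i i) x) by rewrite Z addr0.
have cle : vint L (fun _ : vec => CE) <= CE * volb m L.
  apply: le_trans (ler_norm _) _; apply: (vint_abs hm) => //; [exact: en_L0|exact: CE_ge0|].
  by move=> x _; rewrite ger0_norm// CE_ge0.
apply: (@le_trans _ _ (vint L (fun _ : vec => CE) + vint L (fun x => \sum_i onE E (dV i i) x))); last by rewrite lerD2r.
rewrite -(vintD hm L cC cQ); apply: (vint_le hm) => //; [exact: P_ct|exact: CtD|] => y yL.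
have [Ey|nE] := pselect (E y); last first.
  rewrite /P onE0// big1 ?addr0 ?CE_ge0// => i _; exact: onE0.
rewrite /P onE1//.
(* The middle term is nonnegative because [ze] increases, and is discarded. The last one contains
   the integrand of [P], up to the bounded quantity k^2 w. *)
have -> : \sum_i onE E (dV i i) y = - (ze (w y) * \sum_i gchi i y * (a y * ga i y + b y * gb i y))
   + co y * ze' (w y) * (\sum_i gw i y ^+ 2) / 2 + co y * ze (w y) * (S y - k ^+ 2 * w y).
  transitivity (\sum_i (- (ze (w y) * (gchi i y * (a y * ga i y + b y * gb i y))) + co y * ze' (w y) / 2 * gw i y ^+ 2
      + co y * ze (w y) / 2 * hw i i y)).
    by apply: eq_bigr => i _; rewrite onE1// /dV /gw; field.
  have -> : S y - k ^+ 2 * w y = (\sum_i hw i i y) / 2 by rewrite (en_divw Ey); field.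
  transitivity (- (ze (w y) * \sum_i gchi i y * (a y * ga i y + b y * gb i y)) + co y * ze' (w y) / 2 * (\sum_i gw i y ^+ 2)
      + co y * ze (w y) / 2 * (\sum_i hw i i y)); last by ring.
  by rewrite 3!mulr_sumr -sumrN -!big_split.
have b1 := gchi_dot Ey (fun z Ez h => bA Ez (le_trans h _)) (fun z Ez h => bB Ez (le_trans h _)) (ltW M0).
have {}b1 : `|\sum_i gchi i y * (a y * ga i y + b y * gb i y)| <= m%:R * (4 * (rho0 + 2) * (2 * (M * (Clip m k (1 / 4) * M)))).
  by apply: b1; rewrite lerD2l ler_nat.
have /andP[z0 z1] := ze_itv (w y); have /andP[c0 c1] := co_itv y.
have zp := ze'_ge0 (w y); have wM := w_M Ey yL; have w0 := w_ge0 y.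
have g2 : 0 <= co y * ze' (w y) * (\sum_i gw i y ^+ 2) / 2.
  apply: divr_ge0 => //; apply: mulr_ge0; first exact: mulr_ge0.
  by apply: sumr_ge0 => i _; exact: sqr_ge0.
have t1 : ze (w y) * (\sum_i gchi i y * (a y * ga i y + b y * gb i y)) <= m%:R * (4 * (rho0 + 2) * (2 * (M * (Clip m k (1 / 4) * M)))).
  apply: le_trans (ler_norm _) _; rewrite normrM -[leRHS]mul1r; apply: ler_pM => //.
  by rewrite ger0_norm.
have t2 : co y * ze (w y) * (k ^+ 2 * w y) <= 2 * (k ^+ 2 * M ^+ 2).
  have -> : 2 * (k ^+ 2 * M ^+ 2) = 1 * (k ^+ 2 * (2 * M ^+ 2)) by ring.
  apply: ler_pM => //; [by rewrite mulr_ge0|by rewrite mulr_ge0// sqr_ge0|by rewrite -[1]mulr1 ler_pM|].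
  by rewrite ler_wpM2l// sqr_ge0.
exact: cac_arith t1 t2 g2.
Qed.

(** The divergence of co et(w) F integrates to zero and is added to the flux integral. On the shell
    there remains 1 - et, supported where |v| <= sqrt t1. Elsewhere et'(w) gw.F is at most 2 w
    et'(w) S <= (4/Lg) S, and [caccioppoli] bounds the integral of S. *)
Lemma energy_estimate (t1 e1 : R) (et et' : R -> R) : t1 = t0 * expR Lg ->
  (forall t, der et t (et' t)) -> cont et' -> (forall t, t <= t0 -> et t = 0 /\ et' t = 0) ->
  (forall t, t1 <= t -> et t = 1) -> (forall t, 0 <= et t <= 1 /\ (0 < t -> 0 <= et' t <= 2 / (Lg * t))) ->
  Ct (GI gchi a ga b gb) -> e1 = m%:R * (4 * (rho0 + 2) * (2 * (Num.sqrt t1 * (Clip m k (1 / 4) * M)))) ->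
  `|vint L (GI gchi a ga b gb)| <= e1 * volb m L + 4 / Lg * (CE * volb m L).
Proof.
move=> t1E det cet' elo ehi eitv cG e1E.
pose V i y := co y * et (w y) * F i y.
pose dV i j y := ((0 - gchi j y) * et (w y) + co y * (et' (w y) * gw j y)) * F i y + co y * et (w y) * hF i j y.
have cV i : C1U E (V i) (dV i).
  have h : C1U E (fun y => co y * et (w y)) (fun i y => (0 - gchi i y) * et (w y) + co y * (et' (w y) * gw i y)).
    by apply: (C1UM en_co); apply: (C1U_comp en_w) => x _; split.
  exact: C1UM h (en_F i).
have t0h : t0 / 2 <= t0 by rewrite ler_pdivrMr// ler_peMr ?(ltW t00)// ler1n.
have gV i : C1 (onE E (V i)) (fun j => onE E (dV i j)).
  apply: (C1_onE oE (cV i)) => x /en_w_small; apply: filterS => y hy /hy h.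
  have [z1 z2] := elo _ (le_trans h t0h); rewrite /V /dV z1 z2; split=> [|j]; by ring.
have sV i x : L <= enorm x -> onE E (V i) x = 0.
  move=> /rhoL/co_far xr; have [Ex|nE] := pselect (E x); last by rewrite onE0.
  by rewrite onE1// /V xr !mul0r.
have Z := div_zero hm en_L0 gV sV.
have cQ : Ct (fun x => \sum_i onE E (dV i i) x) by apply: Ct_sum => i; exact: (gV i).2.
have e10 : 0 <= e1.
  have [r0 _ _] := rho_pos rho1; rewrite e1E mulr_ge0// mulr_ge0//; first by rewrite mulr_ge0// addr_ge0// ltW.
  by rewrite mulr_ge0// mulr_ge0 ?sqrtr_ge0// mulr_ge0 ?(ltW M0)// Clip_ge0.
have pt y : enorm y <= L -> `|GI gchi a ga b gb y + \sum_i onE E (dV i i) y| <= e1 + 4 / Lg * P y.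
  move=> yL; have [Ey|nE] := pselect (E y); last first.
    have yr : enorm y < rho0 by rewrite ltNge; apply/negP => /farE.
    rewrite /P onE0// mulr0 addr0 [GI _ _ _ _ _ _]big1 ?add0r; last first.
      by move=> i _; rewrite (chi0 rho1 _).2 ?mul0r// (le_trans (ltW yr))// lerDl.
    by rewrite big1 ?normr0// => i _; exact: onE0.
  rewrite /P onE1//.
  have -> : GI gchi a ga b gb y + \sum_i onE E (dV i i) y =
     (1 - et (w y)) * (\sum_i gchi i y * (- b y * ga i y + a y * gb i y)) + co y * et' (w y) * (\sum_i gw i y * F i y).
    have -> : \sum_i onE E (dV i i) y = - (et (w y) * (\sum_i gchi i y * (- b y * ga i y + a y * gb i y))) +
        co y * et' (w y) * (\sum_i gw i y * F i y) + co y * et (w y) * (\sum_i hF i i y).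
      rewrite !mulr_sumr -sumrN -!big_split /=; apply: eq_bigr => i _; rewrite onE1// /dV /F; ring.
    rewrite en_divF// mulr0 addr0 /GI.
    have -> : \sum_i gchi i y * (a y * gb i y - b y * ga i y) = \sum_i gchi i y * (- b y * ga i y + a y * gb i y).
      by apply: eq_bigr => i _; ring.
    ring.
  apply: le_trans (ler_normD _ _) _.
  have [/andP[n0 n1] hn] := eitv (w y); have /andP[c0 c1] := co_itv y; have w0 := w_ge0 y.
  apply: lerD.
    have [hw1|hw1] := leP t1 (w y); first by rewrite ehi// subrr mul0r normr0.
    rewrite normrM -[leRHS]mul1r; apply: ler_pM => //.
      by rewrite ger0_norm ?subr_ge0// lerBlDr lerDl.
    (* [gchi_dot] asks for bounds on a whole region, but only the point [y] has |v| <= sqrt t1, so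
       the coefficients are cut down to that point. *)
    pose c' (z : vec) := if z == y then - b y else 0; pose d' (z : vec) := if z == y then a y else 0.
    have sq (u : R) : u * u <= w y -> `|u| <= Num.sqrt t1.
      move=> hu; rewrite -sqrtr_sqr ler_wsqrtr// expr2; apply: le_trans hu _; exact: ltW.
    have := @gchi_dot c' d' (Num.sqrt t1) y Ey; rewrite /c' /d' eqxx -e1E; apply; last exact: sqrtr_ge0.
      move=> z _ _; case: eqP => _; last by rewrite normr0 sqrtr_ge0.
      by rewrite normrN; apply: sq; rewrite /w lerDr -expr2 sqr_ge0.
    move=> z _ _; case: eqP => _; last by rewrite normr0 sqrtr_ge0.
    by apply: sq; rewrite /w lerDl -expr2 sqr_ge0.
  have [hw0|hw0] := leP (w y) t0.
    rewrite (elo _ hw0).2 mulr0 mul0r normr0 mulr_ge0// ?divr_ge0 ?(ltW L0)//.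
    by rewrite mulr_ge0 ?S_ge0// mulr_ge0//; case/andP: (ze_itv (w y)).
  have wp : 0 < w y by exact: lt_trans hw0.
  have /andP[m0 m1] := hn wp.
  rewrite (ze_high (ltW hw0)) mulr1 normrM [`|co y * _|]normrM (ger0_norm c0) (ger0_norm m0).
  have dot : `|\sum_i gw i y * F i y| <= 2 * w y * S y.
    apply: le_trans (ler_norm_sum _ _ _) _; rewrite /S mulr_sumr; apply: ler_sum => i _.
    exact: gw_F_arith.
  rewrite [4 / Lg * _]mulrCA -mulrA ler_wpM2l//.
  apply: le_trans (ler_pM m0 (normr_ge0 _) m1 dot) _.
  rewrite le_eqVlt; apply/orP; left; apply/eqP; field; by rewrite !gt_eqF.
have cP := P_ct.
have c4P : Ct (fun y => e1 + 4 / Lg * P y) by apply: CtD; [exact: CtC|exact: CtZ].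
have cS : Ct (fun y => GI gchi a ga b gb y + \sum_i onE E (dV i i) y) by exact: CtD.
have -> : vint L (GI gchi a ga b gb) = vint L (fun y => GI gchi a ga b gb y + \sum_i onE E (dV i i) y).
  by rewrite (vintD hm L cG cQ) Z addr0.
apply: (@le_trans _ _ (vint L (fun y => e1 + 4 / Lg * P y))).
  rewrite ler_norml -[X in X <= _]mulN1r -(vintZ hm L (-1) c4P); apply/andP; split; apply: (vint_le hm) => //.
  - exact: CtZ.
  - by move=> y /pt; rewrite ler_norml mulN1r => /andP[].
  - by move=> y /pt; rewrite ler_norml => /andP[].
have cC : Ct (fun _ : vec => e1) by exact: CtC.
rewrite (vintD hm L cC (@CtZ _ _ (4 / Lg) _ cP)) (vintZ hm L (4 / Lg) cP); apply: lerD.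
  apply: le_trans (ler_norm _) _; apply: (vint_abs hm) => //; first exact: en_L0.
  by move=> x _; rewrite ger0_norm.
by rewrite ler_wpM2l ?caccioppoli// divr_ge0// ltW.
Qed.
End OneField.

(** [Lg] is fixed first, to make the gradient term small; then the level t1, for the shell term; the
    threshold t0 = t1 exp(-Lg) follows. *)
Lemma energy_small (M e : R) : 0 < M -> 0 < e -> exists2 t : R, 0 < t &
  forall a ga ha b gb hb fa fb, radG a ga ha b gb hb fa fb -> bndX a M -> bndX b M -> small a b t ->
  sphere_int (fun y : vec => fa y ^+ 2 + fb y ^+ 2) <= e.
Proof.
move=> M0 e0; have [r0 _ _] := rho_pos rho1.
pose c : R := m%:R * (4 * (rho0 + 2) * (2 * (Clip m k (1 / 4) * M))).
have c0 : 0 <= c.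
  rewrite mulr_ge0// mulr_ge0//; first by rewrite mulr_ge0// addr_ge0// ltW.
  by rewrite mulr_ge0// mulr_ge0 ?(ltW M0)// Clip_ge0.
pose v : R := volb m (rho0 + 3).
have r3 : 0 <= rho0 + 3 by rewrite addr_ge0// ltW.
have v0 : 0 <= v by rewrite /v /volb !mulr_ge0 ?exprn_ge0// ltW// sig1_gt0.
have ke : 0 < k * e / 2 by rewrite divr_gt0// mulr_gt0.
pose s1 : R := (k * e / 2) / (c * v + 1).
have cv : 0 < c * v + 1 by rewrite ltr_wpDl// mulr_ge0.
have s10 : 0 < s1 by rewrite divr_gt0.
pose CV : R := CE M * v.
have CV0 : 0 <= CV by rewrite mulr_ge0// CE_ge0.
pose Lg : R := 4 * (CV + 1) / (k * e / 2).
have CV1 : 0 < CV + 1 by rewrite ltr_wpDl.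
have Lg0 : 0 < Lg by rewrite divr_gt0// mulr_gt0.
(* A square, because the shell term is linear in sqrt t1. *)
pose t1 : R := s1 ^+ 2; pose t0 : R := t1 / expR Lg.
have t00 : 0 < t0 by rewrite divr_gt0 ?exprn_gt0// expR_gt0.
have t1E : t1 = t0 * expR Lg by rewrite /t0 divfK// gt_eqF// expR_gt0.
exists (t0 / 2); first by rewrite divr_gt0.
move=> a ga ha b gb hb fa fb H bA bB sm; have [Ha Hb _] := H.
have [et [et' [d1 d2 d3 d4 d5]]] := log_cut t00 Lg0.
have [cG id] := energy_id hm k0 rho1 farE H.
rewrite -t1E in d4.
have := energy_estimate Ha Hb t00 Lg0 M0 bA bB sm t1E d1 d2 d3 d4 d5 cG erefl.
have sup (z : vec) : rho0 + 2 <= enorm z -> GI gchi a ga b gb z = 0.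
  by move=> hz; have [_ gz] := chi1 rho1 hz; apply: big1 => i _; rewrite gz mul0r.
have r2 : 0 <= rho0 + 2 by rewrite addr_ge0// ltW.
have r23 : rho0 + 2 <= rho0 + 3 by rewrite lerD2l ler_nat.
rewrite (vint_supp hm r2 r23 cG sup) id sqrtr_sqr (gtr0_norm s10) -/v -/CV => h.
have h2 := le_trans (ler_norm _) h.
have e1 : m%:R * (4 * (rho0 + 2) * (2 * (s1 * (Clip m k (1 / 4) * M)))) * v <= k * e / 2.
  have -> : m%:R * (4 * (rho0 + 2) * (2 * (s1 * (Clip m k (1 / 4) * M)))) * v = s1 * (c * v) by rewrite /c; ring.
  by rewrite /s1 mulrAC ler_pdivrMr// ler_wpM2l ?(ltW ke)// lerDl.
have e2 : 4 / Lg * CV <= k * e / 2.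
  rewrite mulrAC ler_pdivrMr//.
  have -> : k * e / 2 * Lg = 4 * (CV + 1) by rewrite /Lg mulrC divfK// gt_eqF.
  by rewrite ler_wpM2l// lerDl.
have h3 := le_trans h2 (lerD e1 e2).
rewrite -splitr in h3; by rewrite ler_pM2l in h3.
Qed.

Lemma fw_scont (fa fb : vec -> R) (z : vec) : scont fa -> scont fb ->
  scont (fun y => fw fa fb (k * dotv z y) y).
Proof.
move=> sa sb.
have cz : scont (fun y : vec => k * dotv z y).
  apply: scontZ; apply: cont_scont => y; have := @dotv_cont R m z y.
  by under eq_fun do rewrite dotvC.
by apply: scontB; apply: scontM => //; [apply: (scont_fun (f := @cos R)) => // t; exact: (der_cont (is_derive_cos t))|
  apply: (scont_fun (f := @sin R)) => // t; exact: (der_cont (is_derive_sin t))].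
Qed.

(** [pairing_id] for a field and for its rotation gives two linear equations for the two integrals,
    solvable because A^2 + B^2 is not zero. The factor 1/nu(|z|) is the decay on the shell of the
    wave centred at [z]. *)
Lemma pairing_bound : exists2 CL : R, 0 <= CL & forall a ga ha b gb hb fa fb (M : R),
  radG a ga ha b gb hb fa fb -> 0 < M -> bndX a M -> bndX b M ->
  forall z : vec, rho0 + 3 <= enorm z ->
  `|sphere_int (fun y => fw fa fb (k * dotv z y) y)| <= CL * M / nu (enorm z) /\
  `|sphere_int (fun y => fw' fa fb (k * dotv z y) y)| <= CL * M / nu (enorm z).
Proof.
have [j [j1 [j2 [s0 [A [B [C [hj s01 am AB]]]]]]]] := exists_J hm k0.
pose K : R := `|A| + `|B| + C + (k * (`|A| + `|B|) + C).
have C0 : 0 <= C by case: am.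
have K1 : `|A| + `|B| + C <= K by rewrite /K lerDl !addr_ge0// mulr_ge0 ?addr_ge0// ltW.
have K2 : k * (`|A| + `|B|) + C <= K by rewrite /K lerDr !addr_ge0.
have K0 : 0 <= K by apply: le_trans K1; rewrite !addr_ge0.
have dj : dec m K j j1.
  move=> s s1; have [h1 h2] := ampl_bound k0 s01 am s1.
  by split; [exact: le_trans K1|exact: le_trans K2].
have [r0 _ _] := rho_pos rho1.
have r2 : 0 <= rho0 + 2 by rewrite addr_ge0// ltW.
pose v : R := volb m (rho0 + 2).
have v0 : 0 <= v by rewrite /v /volb !mulr_ge0 ?exprn_ge0// ltW// sig1_gt0.
pose N : R := A ^+ 2 + B ^+ 2.
have N0 : 0 < N.
  rewrite lt0r; apply/andP; split; last by rewrite addr_ge0 ?sqr_ge0.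
  by rewrite paddr_eq0 ?sqr_ge0// !sqrf_eq0 negb_and; exact/orP.
pose G0 : R := CG m k rho0 K * v.
have G00 : 0 <= G0 by rewrite mulr_ge0// CG_ge0.
exists ((`|A| + `|B|) * G0 / (k * N)).
  exact: (divr_ge0 (mulr_ge0 (addr_ge0 (normr_ge0 A) (normr_ge0 B)) G00) (ltW (mulr_gt0 k0 N0))).
move=> a ga ha b gb hb fa fb M H M0 bA bB z zr.
have zp : 0 < enorm z by apply: lt_le_trans zr; rewrite addr_gt0.
have nz := nu_gt0 m zp.
have bnd u gu hu : helm E k u gu hu -> bndX u M ->
  Ct (GI gchi u gu (fun y => j (dotv (y - z) (y - z))) (fun i y => j1 (dotv (y - z) (y - z)) * (2 * (y 0 i - z 0 i)))) ->
  `|vint (rho0 + 2) (GI gchi u gu (fun y => j (dotv (y - z) (y - z))) (fun i y => j1 (dotv (y - z) (y - z)) * (2 * (y 0 i - z 0 i))))|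
   <= G0 * M / nu (enorm z).
  move=> Hu bu cG.
  have c1 : 0 <= CG m k rho0 K * M / nu (enorm z) by apply: divr_ge0; [apply: mulr_ge0; [exact: CG_ge0|exact: ltW]|exact: ltW].
  have -> : G0 * M / nu (enorm z) = CG m k rho0 K * M / nu (enorm z) * v by rewrite /G0; ring.
  apply: (vint_abs hm r2 c1 cG) => y _.
  apply: le_trans (shell_green_bound hm oE rho1 farE y Hu dj K0 M0 bu zr) _.
  by rewrite ler_piMr//; case/andP: (env_itv rho0 y).
have bN : bndX (fun x => - a x) M by move=> y Ey yr; rewrite normrN; exact: bA.
have [Ha Hb _] := H.
have [ca ida] := pairing_id hm k0 rho1 farE z H hj s01 am.
have [cb idb] := pairing_id hm k0 rho1 farE z (rad_rot H) hj s01 am.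
have ba := bnd _ _ _ Ha bA ca; have bb := bnd _ _ _ Hb bB cb.
rewrite ida in ba; rewrite idb in bb.
have sa := rad_scont rho1 farE H; have sb := rad_scont rho1 farE (rad_rot H).
have s1 : sphere_int (fun y : vec => fw' fb (fun x => - fa x) (k * dotv z y) y) = - sphere_int (fun y => fw fa fb (k * dotv z y) y).
  rewrite -mulN1r -(sigZ hm (-1)).
    by apply: (sig_ext hm) => y _; rewrite /fw /fw'; ring.
  exact: fw_scont.
have s2 : sphere_int (fun y : vec => fw fb (fun x => - fa x) (k * dotv z y) y) = sphere_int (fun y => fw' fa fb (k * dotv z y) y).
  by apply: (sig_ext hm) => y _; rewrite /fw /fw'; ring.
rewrite s1 s2 in bb.
move: ba bb; set S1 := sphere_int (fun y => fw _ _ _ y); set S2 := sphere_int (fun y => fw' _ _ _ y) => ba bb.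
have -> : (`|A| + `|B|) * G0 / (k * N) * M / nu (enorm z) = (`|A| + `|B|) * (G0 * M / nu (enorm z)) / (k * N).
  by field; rewrite !gt_eqF.
have kN : 0 < k * N by rewrite mulr_gt0.
have fin (x : R) : `|k * N * x| <= (`|A| + `|B|) * (G0 * M / nu (enorm z)) -> `|x| <= (`|A| + `|B|) * (G0 * M / nu (enorm z)) / (k * N).
  by rewrite normrM (gtr0_norm kN) ler_pdivlMr// mulrC.
split; apply: fin.
  have -> : k * N * S1 = B * (k * (A * S2 + B * S1)) - A * (k * (A * - S1 + B * S2)) by rewrite /N; ring.
  exact: (@lin_comb_bound R A B _ _ _ ba bb).1.
have -> : k * N * S2 = A * (k * (A * S2 + B * S1)) + B * (k * (A * - S1 + B * S2)) by rewrite /N; ring.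
exact: (@lin_comb_bound R A B _ _ _ ba bb).2.
Qed.
End Energy.

(** If P K failed, the sets whose complement in K satisfies P would form a proper filter containing
    K; its cluster point contradicts the local hypothesis. *)
Lemma compact_induct (T : topologicalType) (K : set T) (P : set T -> Prop) : compact K ->
  P set0 -> (forall A B, P A -> P B -> P (A `|` B)) -> (forall A B, A `<=` B -> P B -> P A) ->
  (forall x, K x -> exists2 U, nbhs x U & P U) -> P K.
Proof.
move=> cK P0 PU PS loc; apply: contrapT => nP.
pose F : set_system T := fun A => P (K `&` ~` A).
have FF : Filter F.
  split; first by rewrite /F setCT setI0.
    by move=> A B hA hB; rewrite /F setCI setIUr; exact: PU.
  by move=> A B AB; apply: PS => x [Kx nB]; split=> // /AB.
have PF : ProperFilter F.
  split=> // h; apply: nP; apply: PS h => x Kx; split=> //.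
have FK : F K by rewrite /F setICr.
have [x [Kx clx]] := cK F PF FK.
have [U Ux PUx] := loc x Kx.
have FU : F (~` U) by rewrite /F setCK; apply: PS PUx => y [].
by have [y [nUy Uy]] := clx _ _ FU Ux.
Qed.

(** * Stability up to fields with small boundary values *)

Section Stab.
Variables (R : realType) (m : nat) (k : R) (E : set 'rV[R]_m) (rho0 : R).
Hypothesis hm : m = 2%N \/ m = 3%N.
Hypothesis k0 : 0 < k.
Hypothesis oE : open E.
Hypothesis rho1 : 1 <= rho0.
Notation vec := 'rV[R]_m.
Hypothesis farE : forall y : vec, rho0 <= enorm y -> E y.
Notation radG := (radG k E rho0).
Notation bndX := (bndX E rho0).

Definition rad (a b fa fb : vec -> R) := (exists ga ha gb hb, radG a ga ha b gb hb fa fb) /\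
  {within closure E, continuous a} /\ {within closure E, continuous b}.
Definition outgoing (a b : vec -> R) := exists fa fb, rad a b fa fb.
Definition bdry_bound (a b : vec -> R) (t : R) := forall x : vec, (closure E `\` E) x -> `|a x| <= t /\ `|b x| <= t.
Definition near_bound (a b : vec -> R) (s : R) := bndX a s /\ bndX b s.

Lemma withinP (A : set vec) (u : vec -> R) : {within A, continuous u} <->
  forall x, A x -> forall e : R, 0 < e -> exists2 d : R, 0 < d & forall y : vec, A y -> `|y - x| < d -> `|u y - u x| < e.
Proof.
split.
  move=> /subspace_continuousP H x sx e e0.
  have /cvgrPdist_lt/(_ _ e0) := H x sx.
  rewrite /within/= => /nbhs_vec[d/= d0 hd]; exists d => // y sy yx.
  by rewrite distrC; apply: hd.
move=> H; apply/subspace_continuousP => x sx; apply/cvgrPdist_lt => e e0.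
have [d d0 hd] := H x sx e e0.
have : nbhs (x : vec) [set y | A y -> `|u x - u y| < e].
  by apply/nbhs_vec; exists d => //= y yx sy; rewrite distrC; exact: hd.
by [].
Qed.
Lemma within_lin (A : set vec) (u v : vec -> R) (c : R) : {within A, continuous u} -> {within A, continuous v} ->
  {within A, continuous (fun x => c * u x + v x)}.
Proof.
move=> hu hv x; apply: cvgD; last exact: hv.
by apply: cvgM; [exact: cvg_cst|exact: hu].
Qed.

Lemma radG_lin a ga ha b gb hb fa fb a' ga' ha' b' gb' hb' fa' fb' (c : R) :
  radG a ga ha b gb hb fa fb -> radG a' ga' ha' b' gb' hb' fa' fb' ->
  radG (fun x => c * a x + a' x) (fun i x => c * ga i x + ga' i x) (fun i j x => c * ha i j x + ha' i j x)
       (fun x => c * b x + b' x) (fun i x => c * gb i x + gb' i x) (fun i j x => c * hb i j x + hb' i j x)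
       (fun y => c * fa y + fa' y) (fun y => c * fb y + fb' y).
Proof.
move=> [h1 h2 [C [r0 [C0 r00 h]]]] [h1' h2' [C' [r0' [C0' r00' h']]]].
split; [exact: helm_lin|exact: helm_lin|].
exists (`|c| * C + C'), (Num.max r0 r0'); split.
- by rewrite addr_ge0// mulr_ge0.
- by rewrite le_max r00.
move=> x; rewrite ge_max => /andP[x1 x2].
have [a1 a2 a3 a4] := h x x1; have [b1 b2 b3 b4] := h' x x2.
have comb (X Y Z d : R) : `|X| <= C * d -> `|Y| <= C' * d -> Z = c * X + Y -> `|Z| <= (`|c| * C + C') * d.
  move=> hX hY ->; apply: le_trans (ler_normD _ _) _; rewrite mulrDl normrM -mulrA.
  by apply: lerD => //; rewrite ler_wpM2l.
have sE (g g' : 'I_m -> vec -> R) : \sum_i x 0 i / enorm x * (c * g i x + g' i x) =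
    c * (\sum_i x 0 i / enorm x * g i x) + \sum_i x 0 i / enorm x * g' i x.
  by rewrite mulr_sumr -big_split; apply: eq_bigr => i _ /=; ring.
split.
- by apply: comb a1 b1 _; rewrite sE; ring.
- by apply: comb a2 b2 _; rewrite sE; ring.
- by apply: comb a3 b3 _; ring.
- by apply: comb a4 b4 _; ring.
Qed.
Lemma rad_lin a b fa fb a' b' fa' fb' (c : R) : rad a b fa fb -> rad a' b' fa' fb' ->
  rad (fun x => c * a x + a' x) (fun x => c * b x + b' x) (fun y => c * fa y + fa' y) (fun y => c * fb y + fb' y).
Proof.
move=> [[ga [ha [gb [hb H]]]] [ca cb]] [[ga' [ha' [gb' [hb' H']]]] [ca' cb']]; split.
  by do 4 eexists; exact: radG_lin H H'.
by split; exact: within_lin.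
Qed.
Lemma outgoing_lin a b a' b' (c : R) : outgoing a b -> outgoing a' b' -> outgoing (fun x => c * a x + a' x) (fun x => c * b x + b' x).
Proof. by move=> [fa [fb H]] [fa' [fb' H']]; do 2 eexists; exact: rad_lin H H'. Qed.
Lemma outgoingB a b a' b' : outgoing a b -> outgoing a' b' -> outgoing (fun x => a x - a' x) (fun x => b x - b' x).
Proof.
move=> H H'; have := outgoing_lin (-1) H' H.
by congr outgoing; apply/funext => x; ring.
Qed.
Lemma outgoingZ a b (c : R) : outgoing a b -> outgoing (fun x => c * a x) (fun x => c * b x).
Proof.
move=> H; have := outgoing_lin (c - 1) H H.
by congr outgoing; apply/funext => x; ring.
Qed.
Lemma bdry_boundB a b a' b' (s t : R) : bdry_bound a b s -> bdry_bound a' b' t -> bdry_bound (fun x => a x - a' x) (fun x => b x - b' x) (s + t).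
Proof.
move=> h h' x Gx; have [? ?] := h x Gx; have [? ?] := h' x Gx.
by split; apply: le_trans (ler_normB _ _) _; exact: lerD.
Qed.
Lemma bdry_boundZ a b (c t : R) : bdry_bound a b t -> bdry_bound (fun x => c * a x) (fun x => c * b x) (`|c| * t).
Proof. by move=> h x Gx; have [? ?] := h x Gx; split; rewrite normrM ler_wpM2l. Qed.
Lemma bdry_bound_le a b (s t : R) : bdry_bound a b s -> s <= t -> bdry_bound a b t.
Proof. by move=> h st x Gx; have [? ?] := h x Gx; split; exact: le_trans st. Qed.
Lemma near_bound_le a b (s t : R) : near_bound a b s -> s <= t -> near_bound a b t.
Proof. by move=> [h1 h2] st; split=> x Ex xr; [exact: le_trans (h1 _ Ex xr) st|exact: le_trans (h2 _ Ex xr) st]. Qed.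
Lemma near_boundZ a b (c t : R) : near_bound a b t -> near_bound (fun x => c * a x) (fun x => c * b x) (`|c| * t).
Proof. by move=> [h1 h2]; split=> x Ex xr; rewrite normrM ler_wpM2l//; [exact: h1|exact: h2]. Qed.

Lemma outgoing_bounded a b : outgoing a b -> exists2 S : R, 0 < S & near_bound a b S.
Proof.
move=> [fa [fb [_ [ca cb]]]].
have K : compact (closure E `&` [set x | enorm x <= rho0 + 3]).
  apply: (@compact_enorm_closed _ _ _ (rho0 + 3)); last by move=> x [].
  apply: closedI; first exact: closed_closure.
  have -> : [set x : vec | enorm x <= rho0 + 3] = @enorm R m @^-1` [set t | t <= rho0 + 3] by [].
  by apply: closed_comp; [move=> x _; exact: enorm_cont|exact: closed_le].
have bd u : {within closure E, continuous u} -> exists2 S : R, 0 < S & bndX u S.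
  move=> cu.
  have cu' : {within closure E `&` [set x : vec | enorm x <= rho0 + 3], continuous u}.
    by apply: continuous_subspaceW cu => x [].
  have KI := continuous_compact cu' K.
  have [M [_ hM]] := compact_bounded KI.
  exists (`|M| + 1); first by rewrite ltr_wpDl.
  move=> y Ey yr; apply: (hM (`|M| + 1)).
    by rewrite (le_lt_trans (ler_norm M))// ltrDl.
  by exists y => //; split=> //; exact: subset_closure.
have [S1 S10 h1] := bd a ca; have [S2 S20 h2] := bd b cb.
exists (S1 + S2); first exact: addr_gt0.
by split=> x Ex xr; [apply: le_trans (h1 x Ex xr) _; rewrite lerDl ltW|apply: le_trans (h2 x Ex xr) _; rewrite lerDr ltW].
Qed.

(* Total boundedness at one scale: outgoing fields with small boundary data split into finitely many classes,
   with one unit of diameter when the sup norm is at most two. *)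
Definition code_compact := exists (I : finType) (eta : R) (c : (vec -> R) -> (vec -> R) -> I), 0 < eta /\
  forall a b a' b', outgoing a b -> outgoing a' b' -> bdry_bound a b eta -> bdry_bound a' b' eta -> near_bound a b 2 -> near_bound a' b' 2 ->
  c a b = c a' b' -> near_bound (fun x => a x - a' x) (fun x => b x - b' x) 1.

(** The distance C t does not depend on the target size [d], which may later be chosen as small as
    the energy estimate demands. *)
Definition stable (C : R) := forall a b (t d : R), 0 < t -> 0 < d -> outgoing a b -> bdry_bound a b t ->
  exists a' b', [/\ outgoing a' b', bdry_bound a' b' d & near_bound (fun x => a x - a' x) (fun x => b x - b' x) (C * t)].

(** Among the scales 2^n C t, approximation by fields with tiny boundary values fails at n = 0 and
    succeeds for large n. At the last failing scale s, an approximant exists within 2s but not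
    within s, and the difference divided by s is the required field. *)
Lemma unstable_step (C : R) : 0 < C -> ~ stable C -> exists a b (d : R), [/\ 0 < d, outgoing a b, bdry_bound a b (2 / C), near_bound a b 2 &
  forall a' b', outgoing a' b' -> bdry_bound a' b' d -> ~ near_bound (fun x => a x - a' x) (fun x => b x - b' x) 1].
Proof.
move=> C0 nst.
have [a [b [t [d0 [t0 d00 Vab gab nex]]]]] : exists a b t d0, [/\ 0 < t, 0 < d0, outgoing a b, bdry_bound a b t &
    forall a' b', outgoing a' b' -> bdry_bound a' b' d0 -> ~ near_bound (fun x => a x - a' x) (fun x => b x - b' x) (C * t)].
  apply: contrapT => h; apply: nst => a b t d t0 d0 Vab gab; apply: contrapT => n; apply: h.
  exists a, b, t, d; split=> // a' b' V' g' dd; apply: n; by exists a', b'.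
pose Q (s : R) := exists2 d : R, 0 < d & forall a' b', outgoing a' b' -> bdry_bound a' b' d ->
   ~ near_bound (fun x => a x - a' x) (fun x => b x - b' x) s.
have [S S0 hS] := outgoing_bounded Vab.
have Ct0 : 0 < C * t by rewrite mulr_gt0.
(* The zero field approximates (a, b) within its own bound [S], so large scales cannot fail. *)
have exn : exists n, ~~ `[< Q (2 ^+ n * (C * t)) >].
  have [n hn] : exists n : nat, S / (C * t) <= 2 ^+ n.
    have := archi_boundP (divr_ge0 (ltW S0) (ltW Ct0)); set n := Num.bound _ => hn; exists n.
    by apply: le_trans (ltW hn) _; rewrite -natrX ler_nat ltnW// ltn_expl.
  exists n; apply/asboolPn => -[d d'0 hd]; rewrite ler_pdivrMr// in hn.
  have z : outgoing (fun x => 0 * a x) (fun x => 0 * b x) by exact: outgoingZ.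
  apply: (hd _ _ z); first by move=> x _; rewrite !mul0r normr0 (ltW d'0).
  have e1 : (fun x => a x - 0 * a x) = a by apply/funext => x; rewrite mul0r subr0.
  have e2 : (fun x => b x - 0 * b x) = b by apply/funext => x; rewrite mul0r subr0.
  by rewrite e1 e2; exact: near_bound_le hS hn.
have Q0 : Q (2 ^+ 0 * (C * t)) by exists d0 => //; rewrite expr0 mul1r.
case: (ex_minnP exn) => n /asboolPn nQ mn.
case: n nQ mn => [//|n] nQ mn.
have Qn : Q (2 ^+ n * (C * t)).
  by apply: contrapT => /asboolPn/mn; rewrite ltnn.
pose s : R := 2 ^+ n * (C * t).
have s0 : 0 < s by rewrite mulr_gt0// exprn_gt0.
have sCt : C * t <= s by rewrite /s ler_peMl ?(ltW Ct0)// exprn_ege1// ler1n.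
have [d1 d10 hd1] := Qn.
(* Half of d1 leaves room for adding two fields; the bound t makes the boundary values of the
   rescaled difference at most 2t/s <= 2/C. *)
pose d : R := Num.min (d1 / 2) t.
have dp : 0 < d by rewrite lt_min divr_gt0.
have [a' [b' [V' g' D']]] : exists a' b', [/\ outgoing a' b', bdry_bound a' b' d & near_bound (fun x => a x - a' x) (fun x => b x - b' x) (2 * s)].
  apply: contrapT => h; apply: nQ; exists d => // a' b' V' g' D'; apply: h; exists a', b'; split=> //.
  by rewrite /s mulrA -exprS.
have si : 0 <= s^-1 by rewrite invr_ge0 ltW.
exists (fun x => s^-1 * (a x - a' x)), (fun x => s^-1 * (b x - b' x)), (d / s); split.
- by rewrite divr_gt0.
- by apply: outgoingZ; exact: outgoingB.
- apply: bdry_bound_le (bdry_boundZ s^-1 (bdry_boundB gab g')) _; rewrite ger0_norm// mulrC ler_pdivrMr//.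
  apply: (@le_trans _ _ (2 * t)); first by rewrite mulr_natl mulr2n lerD2l ge_min lexx orbT.
  by rewrite -mulrA ler_wpM2l// mulrC ler_pdivlMr// mulrC.
- apply: near_bound_le (near_boundZ s^-1 D') _; rewrite ger0_norm// mulrCA mulVf ?mulr1// gt_eqF//.
move=> a'' b'' V'' g'' D''.
have Vs : outgoing (fun x => s * a'' x + a' x) (fun x => s * b'' x + b' x) by exact: outgoing_lin.
apply: (hd1 _ _ Vs).
  move=> x Gx; have [x1 x2] := g'' x Gx; have [y1 y2] := g' x Gx.
  have hb (p q : R) : `|p| <= d / s -> `|q| <= d -> `|s * p + q| <= d1.
    move=> hp hq; apply: le_trans (ler_normD _ _) _; rewrite normrM (gtr0_norm s0).
    have h1 : s * `|p| <= d by rewrite mulrC -ler_pdivlMr.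
    apply: le_trans (lerD h1 hq) _; rewrite -mulr2n -mulr_natl mulrC -ler_pdivlMr// ge_min lexx//.
  by split; apply: hb.
have [D1 D2] := D''; rewrite -/s.
have key (p q r : R) : `|s^-1 * (p - q) - r| <= 1 -> `|p - (s * r + q)| <= s.
  move=> h; have -> : p - (s * r + q) = s * (s^-1 * (p - q) - r) by field; rewrite gt_eqF.
  by rewrite normrM gtr0_norm// -[leRHS]mulr1 ler_wpM2l// ltW.
by split=> x Ex xr; apply: key; [exact: D1|exact: D2].
Qed.

(* Otherwise normalised differences yield arbitrarily many fields with small boundary values that are pairwise
   separated, more than there are codes. *)
Lemma stable_of_code_compact : code_compact -> exists2 C : R, 0 < C & stable C.
Proof.
move=> [I [eta [c [eta0 hc]]]]; apply: contrapT => nst.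
have step (e : R) : 0 < e -> exists a b (d : R), [/\ 0 < d, outgoing a b, bdry_bound a b e, near_bound a b 2 &
  forall a' b', outgoing a' b' -> bdry_bound a' b' d -> ~ near_bound (fun x => a x - a' x) (fun x => b x - b' x) 1].
  move=> e0; have C0 : 0 < 2 / e by rewrite divr_gt0.
  have [|a [b [d [h1 h2 h3 h4 h5]]]] := @unstable_step (2 / e) C0.
    by move=> h; apply: nst; exists (2 / e).
  exists a, b, d; split=> //; apply: bdry_bound_le h3 _.
  by rewrite invf_div mulrCA divff ?mulr1.
(* The new field is chosen first. It comes with a threshold [d] below which no field approximates
   it, and the remaining fields are then taken with boundary values under that threshold. *)
have sep (q : nat) : forall e : R, 0 < e -> exists A B : nat -> vec -> R,
    (forall i, (i < q)%N -> [/\ outgoing (A i) (B i), bdry_bound (A i) (B i) e & near_bound (A i) (B i) 2]) /\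
    (forall i j, (i < j)%N -> (j < q)%N -> ~ near_bound (fun x => A i x - A j x) (fun x => B i x - B j x) 1).
  elim: q => [|q IH] e e0; first by exists (fun _ _ => 0), (fun _ _ => 0).
  have [a [b [d [d0 Vab gab Dab hsep]]]] := step e e0.
  have ed0 : 0 < Num.min e d by rewrite lt_min e0.
  have [A [B [h1 h2]]] := IH _ ed0.
  exists (fun n => if n is p.+1 then A p else a), (fun n => if n is p.+1 then B p else b); split.
    case=> [|i] hi; first by split.
    by have [? g ?] := h1 i hi; split=> //; apply: bdry_bound_le g _; rewrite ge_min lexx.
  case=> [|i] [|j]//= ij jq; last exact: h2.
  have [V g _] := h1 j jq; apply: hsep => //.
  by apply: bdry_bound_le g _; rewrite ge_min lexx orbT.
have [A [B [h1 h2]]] := sep #|I|.+1 eta eta0.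
pose cc (i : 'I_#|I|.+1) := c (A i) (B i).
have [inj|] := boolP (injectiveb cc).
  have := leq_card cc (injectiveP _ inj); rewrite card_ord; by rewrite ltnn.
move=> /injectivePn[i [j ij e]].
wlog lt : i j ij e / (i < j)%N.
  move=> W; have [l|l|l] := ltngtP i j; [exact: (W i j)|apply: (W j i) => //; by rewrite eq_sym|].
  by move/eqP : ij; apply; exact: val_inj.
have [V g D] := h1 i (ltn_ord i); have [V' g' D'] := h1 j (ltn_ord j).
exact: (h2 i j lt (ltn_ord j) (hc _ _ _ _ V V' g g' D D' e)).
Qed.
End Stab.

Lemma three_quarters (R : realType) (p q s t : R) : `|p - s| <= 1 / 4 -> `|q - t| <= 1 / 4 -> `|s - t| <= 1 / 4 -> `|p - q| <= 1.
Proof. by rewrite !ler_norml => /andP[? ?] /andP[? ?] /andP[? ?]; apply/andP; split; lra. Qed.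
Lemma one_half (R : realType) (p q : R) : `|p| <= 1 / 4 -> `|q| <= 1 / 4 -> `|p - q| <= 1.
Proof. by rewrite !ler_norml => /andP[? ?] /andP[? ?]; apply/andP; split; lra. Qed.

(** * Precompactness of outgoing fields near the obstacle *)

Section Local.
Variables (R : realType) (m : nat) (k : R) (E : set 'rV[R]_m) (rho0 : R).
Hypothesis hm : m = 2%N \/ m = 3%N.
Hypothesis k0 : 0 < k.
Hypothesis oE : open E.
Hypothesis rho1 : 1 <= rho0.
Notation vec := 'rV[R]_m.
Hypothesis farE : forall y : vec, rho0 <= enorm y -> E y.
Notation outgoing := (outgoing k E rho0).
Notation bdry_bound := (bdry_bound E).
Notation near_bound := (near_bound E rho0).
Hypothesis tang : forall p : vec, (closure E `\` E) p -> exists (c : vec) (r : R), [/\ 0 < enorm (p - c), 0 < r &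
  forall x : vec, closure E x -> enorm (x - p) <= r -> enorm (p - c) ^+ 2 + enorm (x - p) ^+ 2 / 2 <= enorm (x - c) ^+ 2].

Lemma bnd_all : exists2 B : R, 0 < B & forall a b, outgoing a b -> near_bound a b 2 -> forall y, E y -> `|a y| <= B /\ `|b y| <= B.
Proof.
have [CP CP0 hP] := exterior_bound hm k0 oE rho1 farE.
exists (2 + CP * 2); first by rewrite ltr_pwDl// mulr_ge0.
move=> a b [fa [fb [[ga [ha [gb [hb H]]]] _]]] [bA bB] y Ey.
have bN : bndX E rho0 (fun x => - a x) 2 by move=> z Ez zr; rewrite normrN; exact: bA.
have [yr|yr] := leP (enorm y) (rho0 + 3).
  by split; [apply: le_trans (bA y Ey yr) _|apply: le_trans (bB y Ey yr) _]; rewrite lerDl mulr_ge0.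
have y1 : 1 <= enorm y by apply: le_trans (ltW yr); apply: le_trans rho1 _; rewrite lerDl.
have n1 : 1 <= nu m (enorm y) by rewrite -(nu_1 R m); apply: nu_le.
have tr (z : R) : nu m (enorm y) * `|z| <= CP * 2 -> `|z| <= 2 + CP * 2.
  move=> h; apply: (@le_trans _ _ (CP * 2)); last by rewrite lerDr.
  by apply: le_trans h; rewrite ler_peMl.
split; apply: tr.
  exact: (hP _ _ _ _ _ _ _ _ 2 H (ltr0n _ _) bA bB y (ltW yr)).
exact: (hP _ _ _ _ _ _ _ _ 2 (rad_rot H) (ltr0n _ _) bB bN y (ltW yr)).
Qed.

(** A common gradient bound gives one neighbourhood of [x] on which all solutions bounded by [B]
    oscillate by at most 1/4. *)
Lemma interior_osc (x : vec) (B : R) : 0 < B -> E x -> exists2 d : R, 0 < d & forall u g h, helm E k u g h ->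
  (forall y, E y -> `|u y| <= B) -> forall y : vec, `|y - x| < d -> `|u y - u x| <= 1 / 4.
Proof.
move=> B0 Ex; have [e e0 he] : exists2 e : R, 0 < e & forall y : vec, `|y - x| < e -> E y.
  by apply/nbhs_vec; exact: open_nbhs_nbhs.
pose d : R := e / 4; have d0 : 0 < d by rewrite divr_gt0.
pose G : R := Clip m k d * B; have G0 : 0 <= G by rewrite mulr_ge0 ?Clip_ge0// ltW.
pose D : R := Num.min d (1 / (4 * (m%:R * G + 1))).
have mG : 0 < 4 * (m%:R * G + 1) by rewrite mulr_gt0// ltr_wpDl// mulr_ge0.
have D0 : 0 < D by rewrite lt_min d0 divr_gt0.
exists D => // u g h H hu y yx.
have yd : `|y - x| <= d by apply: ltW; apply: lt_le_trans yx _; rewrite ge_min lexx.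
have box (z : vec) : (forall j, `|z 0 j - x 0 j| <= `|(y - x) 0 j|) -> `|z - x| <= d.
  move=> hz; apply/normv_leP; first exact: ltW.
  by move=> j; rewrite !mxE; apply: le_trans (hz j) _; apply: le_trans (coord_norm _ _) yd.
have Ez (z : vec) : `|z - x| <= 2 * d -> E z.
  by move=> hz; apply: he; apply: le_lt_trans hz _; rewrite /d; lra.
have [h1 _ _] := H.
have T := @mvt_coords R m u g x (y - x) (fun _ => 0) (fun _ => G).
have {T} : `|u (x + (y - x)) - u x - \sum_i 0 * (y - x) 0 i| <= \sum_i G * `|(y - x) 0 i|.
  apply: T => i z /box hz.
    have dd : d <= 2 * d by rewrite mulr_natl mulr2n lerDl ltW.
    by have [_ dz] := h1 z (Ez z (le_trans hz dd)); exact: (dz i).1.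
  rewrite subr0; apply: (@grad_bound R m k E u g h z i d B oE H d0 B0) => t tz.
  have Et : E t.
    apply: Ez; rewrite -(subrK z t) -addrA; apply: le_trans (ler_normD _ _) _.
    by rewrite mulr_natl mulr2n; apply: lerD.
  by split=> //; exact: hu.
rewrite [x + _]addrC subrK big1 ?subr0; last by move=> i _; rewrite mul0r.
move=> T; apply: le_trans T _.
apply: (@le_trans _ _ (\sum_(i < m) G * D)).
  by apply: ler_sum => i _; rewrite ler_wpM2l//; apply: le_trans (coord_norm _ _) (ltW yx).
rewrite sumr_const card_ord -[_ *+ m]mulr_natl mulrA.
apply: (@le_trans _ _ ((m%:R * G + 1) * (1 / (4 * (m%:R * G + 1))))).
  apply: ler_pM; [by rewrite mulr_ge0|exact: ltW|by rewrite lerDl|by rewrite ge_min lexx orbT].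
rewrite le_eqVlt; apply/orP; left; apply/eqP; field.
by rewrite gt_eqF// ltr_wpDl// mulr_ge0.
Qed.

Section Barrier.
Variables (c : vec).
Let q (x : vec) : R := dotv (x - c) (x - c).
Let Up := [set x | 0 < q x].
Lemma barrier_C1 : C1U Up (fun x => - (q x)^-1) (fun i x => (q x ^+ 2)^-1 * (2 * (x 0 i - c 0 i))) /\
  forall i, C1U Up (fun x => (q x ^+ 2)^-1 * (2 * (x 0 i - c 0 i)))
    (fun j x => (- (2 / q x ^+ 3) * (2 * (x 0 j - c 0 j))) * (2 * (x 0 i - c 0 i)) + (q x ^+ 2)^-1 * (2 * ((j == i)%:R - 0))).
Proof.
have hq := @C1_C1U R m Up _ _ (C1_q c).
have d1 (t : R) : 0 < t -> der (fun t => - t^-1) t ((t ^+ 2)^-1).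
  move=> t0; have tn : t != 0 by rewrite gt_eqF.
  by apply: der_eq (derN (derV tn (derI t))) _; field.
have d2 (t : R) : 0 < t -> der (fun t => (t ^+ 2)^-1) t (- (2 / t ^+ 3)).
  move=> t0; have tn : t ^+ 2 != 0 by rewrite gt_eqF// exprn_gt0.
  apply: der_eq (derV (f := fun t => t ^+ 2) tn (derX 2 (derI t))) _.
  by field; rewrite gt_eqF.
have c2 (t : R) : 0 < t -> ctat (fun t : R => - (2 / t ^+ 3)) t.
  move=> t0; have tn : t ^+ 3 != 0 by rewrite gt_eqF// exprn_gt0.
  exact: (der_cont (derN (derM (derC 2 t) (derV (f := fun t => t ^+ 3) tn (derX 3 (derI t)))))).
split.
  apply: (C1U_comp (f := fun t => - t^-1) (f' := fun t => (t ^+ 2)^-1) hq) => x ux; split; first exact: d1.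
  exact: der_cont (d2 _ ux).
move=> i; apply: C1UM.
  apply: (C1U_comp (f := fun t => (t ^+ 2)^-1) (f' := fun t => - (2 / t ^+ 3)) hq) => x ux; split; [exact: d2|exact: c2].
by apply: C1UZ; apply: C1UB; [exact: C1_C1U (C1_coord R i)|exact: C1UC].
Qed.
(** The Laplacian of |x - c|^-2 is (8 - 2m)|x - c|^-4, positive for m = 2 and m = 3; one exponent
    serves both dimensions. *)
Lemma barrier_lap x : Up x ->
  \sum_i ((- (2 / q x ^+ 3) * (2 * (x 0 i - c 0 i))) * (2 * (x 0 i - c 0 i)) + (q x ^+ 2)^-1 * (2 * ((i == i)%:R - 0))) <= - (2 / q x ^+ 2).
Proof.
move=> ux; have qn : q x != 0 by rewrite gt_eqF.
rewrite big_split /=.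
have -> : \sum_i (- (2 / q x ^+ 3) * (2 * (x 0 i - c 0 i))) * (2 * (x 0 i - c 0 i)) = - (8 / q x ^+ 3) * q x.
  rewrite {2}/q /dotv mulr_sumr; apply: eq_bigr => i _; rewrite !mxE; ring.
under [X in _ + X]eq_bigr do rewrite eqxx subr0 mulr1.
rewrite sumr_const card_ord -[_ *+ m]mulr_natr.
have -> : - (8 / q x ^+ 3) * q x = - (8 / q x ^+ 2) by field.
have q2 : 0 < (q x ^+ 2)^-1 by rewrite invr_gt0 exprn_gt0.
by case: hm => ->; move: ((q x ^+ 2)^-1) q2 => t t0; lra.
Qed.
End Barrier.

(* Barrier [A * (|p - c|^-2 - |x - c|^-2) + 1/8]: it is superharmonic near [p] with Laplacian below [- k^2 B]. *)
Lemma barrier_above (p : vec) (B : R) : 0 < B -> (closure E `\` E) p -> exists2 d : R, 0 < d & forall u g h, helm E k u g h ->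
  {within closure E, continuous u} -> (forall y, E y -> u y <= B) ->
  (forall x : vec, (closure E `\` E) x -> u x <= 1 / 8) -> (forall y, E y -> k ^+ 2 * u y <= k ^+ 2 * B) ->
  forall y : vec, E y -> `|y - p| < d -> u y <= 1 / 4.
Proof.
move=> B0 Gp; have [c [r [pc0 r0 tg]]] := tang Gp.
pose R2 : R := enorm (p - c) ^+ 2; have R20 : 0 < R2 by rewrite exprn_gt0.
pose q (x : vec) : R := dotv (x - c) (x - c).
have qE x : q x = enorm (x - c) ^+ 2 by rewrite enorm_sqr.
pose Q1 : R := (r + enorm (p - c)) ^+ 2; have Q10 : 0 < Q1 by rewrite exprn_gt0// addr_gt0.
pose b0 : R := R2^-1 - (R2 + r ^+ 2 / 2)^-1.
have r2 : 0 < r ^+ 2 / 2 by rewrite divr_gt0// exprn_gt0.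
have b00 : 0 < b0 by rewrite subr_gt0 ltf_pV2 ?posrE ?addr_gt0// ltrDl.
(* The first term outweighs k^2 B in the Laplacian, the second lifts the barrier above [B] on the
   sphere of radius [r], where it is at least [b0], and 1 makes the Laplacian inequality strict. *)
pose A : R := k ^+ 2 * B * Q1 ^+ 2 + B / b0 + 1.
have kB : 0 <= k ^+ 2 * B * Q1 ^+ 2 by exact: (mulr_ge0 (mulr_ge0 (sqr_ge0 k) (ltW B0)) (sqr_ge0 Q1)).
have Bb : 0 <= B / b0 by rewrite divr_ge0// ltW.
have A0 : 0 < A by rewrite ltr_wpDl// addr_ge0.
pose be (x : vec) : R := R2^-1 + - (q x)^-1.
have [cb ct] := barrier_C1 c.
have up : 0 < q p by rewrite qE.
have bep : be p = 0 by rewrite /be qE subrr.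
have cbe : ctat be p by apply: ctD; [exact: ctC|exact: (cb p up).1].
have e0 : 0 < 1 / 8 / A :> R by rewrite divr_gt0.
have /ctP/(_ _ e0)[d d0 hd] := cbe.
(* Dividing by [m] passes from the maximum norm to the Euclidean ball of radius [r]. *)
pose D : R := Num.min d (r / m%:R).
have mp : 0 < m%:R :> R by rewrite ltr0n; case: hm => ->.
have D0 : 0 < D by rewrite lt_min d0 divr_gt0.
exists D => // u g h H cu hB hG hk y Ey yp.
pose K := closure E `&` [set x : vec | enorm (x - p) <= r].
pose O := E `&` [set x : vec | enorm (x - p) < r].
have cp (x : vec) : ctat (fun x : vec => enorm (x - p)) x.
  apply: (ctv_comp (F := @enorm R m) (g := fun x : vec => x - p)); first exact: enorm_cont.
  by apply: ct_row => i; under eq_fun do rewrite !mxE; apply: ctB; [exact: coord_continuous|exact: ctC].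
have cK : compact K.
  apply: (@compact_enorm_closed _ _ _ (r + enorm p)).
    apply: closedI; first exact: closed_closure.
    have -> : [set x : vec | enorm (x - p) <= r] = (fun x : vec => enorm (x - p)) @^-1` [set t | t <= r] by [].
    by apply: closed_comp; [move=> x _; exact: cp|exact: closed_le].
  move=> x [_ /= xr]; rewrite -[x](subrK p); apply: le_trans (enormD _ _) _; by rewrite lerD2r.
have oO : open O.
  apply: openI => //.
  have -> : [set x : vec | enorm (x - p) < r] = (fun x : vec => enorm (x - p)) @^-1` [set t | t < r] by [].
  by apply: open_comp; [move=> x _; exact: cp|exact: open_lt].
have OK : O `<=` K by move=> x [Ex /= xr]; split; [exact: subset_closure|exact: ltW].
have Kq x : K x -> R2 <= q x /\ R2 + enorm (x - p) ^+ 2 / 2 <= q x.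
  move=> [cx xr]; have := tg x cx xr; rewrite qE => hx; split=> //; apply: le_trans hx.
  by rewrite lerDl divr_ge0// sqr_ge0.
have Kp x : K x -> 0 < q x by move=> /Kq[hx _]; exact: lt_le_trans hx.
have be0 x : K x -> 0 <= be x.
  by move=> Kx; rewrite /be subr_ge0 lef_pV2 ?posrE//; [exact: (Kq x Kx).1|exact: Kp].
pose w (x : vec) : R := A * be x + 1 / 8 - u x.
pose gw i (x : vec) : R := A * ((q x ^+ 2)^-1 * (2 * (x 0 i - c 0 i))) - g i x.
pose hw i (x : vec) : R := A * ((- (2 / q x ^+ 3) * (2 * (x 0 i - c 0 i))) * (2 * (x 0 i - c 0 i)) + (q x ^+ 2)^-1 * (2 * ((i == i)%:R - 0))) - h i i x.
have [h1 h2 h3] := H.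
have cw : {within K, continuous w}.
  have cu' : {within K, continuous u} by apply: continuous_subspaceW cu => x [].
  have cb' : {within K, continuous (fun x => A * be x + 1 / 8)}.
    apply: ctat_within => x Kx; apply: ctD; last exact: ctC.
    by apply: ctM; [exact: ctC|apply: ctD; [exact: ctC|exact: (cb x (Kp x Kx)).1]].
  by move=> x; apply: cvgB; [exact: cb'|exact: cu'].
have iw x i : O x -> isp i w x (gw i x) /\ isp i (gw i) x (hw i x).
  move=> Ox; have ux := Kp x (OK x Ox); have [Ex _] := Ox.
  have [_ d1] := cb x ux; have [_ d2] := ct i x ux; have [_ d3] := h1 x Ex; have [_ d4] := h2 i x Ex.
  split.
    apply: der_eq (derB (derD (derZ A (derD (derC R2^-1 0) (d1 i).1)) (derC (1 / 8) 0)) (d3 i).1) _.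
    by rewrite add0r addr0.
  by apply: derB; [apply: derZ; exact: (d2 i).1|exact: (d4 i).1].
have sw x : O x -> \sum_i hw i x < 0.
  move=> Ox; have Kx := OK x Ox; have ux := Kp x Kx; have [Ex xr] := Ox.
  rewrite /hw sumrB h3// opprK -mulr_sumr.
  have q1 : q x <= Q1.
    rewrite qE lerXn2r ?nnegrE ?enorm_ge0 ?addr_ge0 ?enorm_ge0 ?(ltW r0)//.
    by rewrite -(subrK p x) -addrA; apply: le_trans (enormD _ _) _; rewrite lerD2r ltW.
  have l := barrier_lap ux.
  have l2 : - (2 / q x ^+ 2) <= - (2 / Q1 ^+ 2).
    have qq : 0 < q x ^+ 2 by apply: exprn_gt0.
    have QQ : 0 < Q1 ^+ 2 by apply: exprn_gt0.
    rewrite lerN2 ler_wpM2l// lef_pV2 ?posrE//.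
    by rewrite lerXn2r ?nnegrE ?(ltW ux) ?(ltW Q10).
  have l3 := ler_wpM2l (ltW A0) (le_trans l l2).
  apply: (le_lt_trans (lerD l3 (hk x Ex))).
  have -> : A * - (2 / Q1 ^+ 2) + k ^+ 2 * B = - (k ^+ 2 * B + (B / b0 + 1) * (2 / Q1 ^+ 2)).
    by rewrite /A; field; rewrite !gt_eqF.
  rewrite oppr_lt0; apply: ltr_wpDl; first exact: (mulr_ge0 (sqr_ge0 k) (ltW B0)).
  apply: mulr_gt0; first by apply: ltr_wpDl.
  by apply: divr_gt0 => //; apply: exprn_gt0.
have bw x : K x -> ~ O x -> 0 <= w x.
  move=> Kx nO; have [cx xr] := Kx; have hb := be0 x Kx; rewrite /w subr_ge0.
  have Ab : 0 <= A * be x by rewrite mulr_ge0// ltW.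
  have [Ex|nE] := pselect (E x); last first.
    by apply: le_trans (hG x (conj cx nE)) _; rewrite lerDr.
  have xe : enorm (x - p) = r.
    by apply/eqP; rewrite eq_le xr /= leNgt; apply/negP => lt; apply: nO; split.
  have [_ k2] := Kq x Kx; rewrite xe in k2.
  have bb : b0 <= be x.
    by rewrite /b0 /be lerD2l lerN2 lef_pV2 ?posrE ?addr_gt0//; exact: Kp.
  apply: le_trans (hB x Ex) _; apply: (@le_trans _ _ (A * b0)); last first.
    by apply: (@le_trans _ _ (A * be x)); [rewrite ler_wpM2l// ltW|rewrite lerDl].
  rewrite -ler_pdivrMr// /A -addrA; apply: ler_wpDl => //; by rewrite lerDl.
have yK : K y.
  split; first exact: subset_closure.
  apply: le_trans (enorm_norm _) _; rewrite mulrC -ler_pdivlMr//; apply: ltW.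
  by apply: lt_le_trans yp _; rewrite ge_min lexx orbT.
have := @comparison R m K O w gw hw cK cw oO OK iw sw bw y yK.
rewrite /w subr_ge0 => hy; apply: le_trans hy _.
have : `|be y - be p| < 1 / 8 / A by apply: hd; apply: lt_le_trans yp _; rewrite ge_min lexx.
rewrite bep subr0 => /ltW/(le_trans (ler_norm _)).
rewrite ler_pdivlMr// mulrC => h8.
by apply: le_trans (lerD h8 (lexx _)) _; lra.
Qed.

(** For |t| <= 2 the number 4(t + 2) lies in [0, 16], so its integer part has 17 possible values. *)
Definition grid (t : R) : 'I_17 := inord (Num.truncn (4 * (t + 2))).
Lemma gridP (s t : R) : `|s| <= 2 -> `|t| <= 2 -> grid s = grid t -> `|s - t| <= 1 / 4.
Proof.
have H (x : R) : `|x| <= 2 -> (grid x : nat)%:R <= 4 * (x + 2) < (grid x).+1%:R.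
  rewrite ler_norml => /andP[x1 x2]; have p : 0 <= 4 * (x + 2) by lra.
  have /andP[h1 h2] := truncn_itv p.
  have lt : (Num.truncn (4 * (x + 2)) < 17)%N.
    by rewrite -(ltr_nat R); apply: le_lt_trans h1 _; lra.
  by rewrite /grid inordK// h1.
move=> /H/andP[s1 s2] /H/andP[t1 t2] e; rewrite e in s1 s2.
rewrite -[(grid t).+1%:R]natr1 in s2 t2; rewrite ler_norml; apply/andP; split; lra.
Qed.

Definition code_compact_on (A : set vec) := exists (I : finType) (eta : R) (c : (vec -> R) -> (vec -> R) -> I), 0 < eta /\
  forall a b a' b', outgoing a b -> outgoing a' b' -> bdry_bound a b eta -> bdry_bound a' b' eta -> near_bound a b 2 -> near_bound a' b' 2 ->
  c a b = c a' b' -> forall y : vec, A y -> E y -> enorm y <= rho0 + 3 -> `|a y - a' y| <= 1 /\ `|b y - b' y| <= 1.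

Lemma code_compact_holds : code_compact k E rho0.
Proof.
have [B B0 hB] := bnd_all.
pose K := closure E `&` [set x : vec | enorm x <= rho0 + 3].
suff [I [eta [c [eta0 h]]]] : code_compact_on K.
  exists I, eta, c; split=> // a b a' b' V V' g g' D D' e.
  have hh := h a b a' b' V V' g g' D D' e.
  by split=> y Ey yr; [apply: (hh y _ Ey yr).1|apply: (hh y _ Ey yr).2]; split=> //; exact: subset_closure.
apply: compact_induct.
- apply: (@compact_enorm_closed _ _ _ (rho0 + 3)); last by move=> x [].
  apply: closedI; first exact: closed_closure.
  have -> : [set x : vec | enorm x <= rho0 + 3] = @enorm R m @^-1` [set t | t <= rho0 + 3] by [].
  by apply: closed_comp; [move=> x _; exact: enorm_cont|exact: closed_le].
- by exists unit, 1, (fun _ _ => tt).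
- move=> A1 A2 [I1 [e1 [c1 [e10 h1]]]] [I2 [e2 [c2 [e20 h2]]]].
  exists (I1 * I2)%type, (Num.min e1 e2), (fun a b => (c1 a b, c2 a b)); split; first by rewrite lt_min e10.
  move=> a b a' b' V V' g g' D D' [ea eb] y [Ay|Ay] Ey yr.
    apply: (h1 a b a' b' V V' _ _ D D' ea y Ay Ey yr); [apply: bdry_bound_le g _|apply: bdry_bound_le g' _]; by rewrite ge_min lexx.
  apply: (h2 a b a' b' V V' _ _ D D' eb y Ay Ey yr); [apply: bdry_bound_le g _|apply: bdry_bound_le g' _]; by rewrite ge_min lexx orbT.
- move=> A1 A2 AA [I [e [c [e0 h]]]]; exists I, e, c; split=> // a b a' b' V V' g g' D D' ee y /AA; exact: h.
move=> x [cx xr]; have [Ex|nE] := pselect (E x).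
  have [d d0 hd] := interior_osc B0 Ex.
  exists [set y : vec | `|y - x| < d]; first by apply/nbhs_vec; exists d.
  exists ('I_17 * 'I_17)%type, 1, (fun a b => (grid (a x), grid (b x))); split=> // a b a' b' V V' g g' D D' [ea eb] y /= yx Ey yr.
  have h1 := hB a b V D; have h2 := hB a' b' V' D'.
  have [fa [fb [[ga [ha [gb [hb [Ha Hb _]]]]] _]]] := V.
  have [fa' [fb' [[ga' [ha' [gb' [hb' [Ha' Hb' _]]]]] _]]] := V'.
  have o1 := hd a ga ha Ha (fun z Ez => (h1 z Ez).1) y yx.
  have o2 := hd b gb hb Hb (fun z Ez => (h1 z Ez).2) y yx.
  have o3 := hd a' ga' ha' Ha' (fun z Ez => (h2 z Ez).1) y yx.
  have o4 := hd b' gb' hb' Hb' (fun z Ez => (h2 z Ez).2) y yx.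
  have [D1 D2] := D; have [D1' D2'] := D'.
  have ga1 := gridP (D1 x Ex xr) (D1' x Ex xr) ea.
  have gb1 := gridP (D2 x Ex xr) (D2' x Ex xr) eb.
  by split; [exact: three_quarters o1 o3 ga1|exact: three_quarters o2 o4 gb1].
have Gx : (closure E `\` E) x by [].
have [d d0 hd] := barrier_above B0 Gx.
exists [set y : vec | `|y - x| < d]; first by apply/nbhs_vec; exists d.
exists unit, (1 / 8), (fun _ _ => tt); split=> // a b a' b' V V' g g' D D' _ y /= yx Ey yr.
have bd u gu hu : helm E k u gu hu -> {within closure E, continuous u} -> (forall z, E z -> `|u z| <= B) ->
    (forall z : vec, (closure E `\` E) z -> `|u z| <= 1 / 8) -> `|u y| <= 1 / 4.
  move=> Hu cu bu gu'.
  have up : u y <= 1 / 4.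
    apply: (hd u gu hu Hu cu) => //.
    - by move=> z Ez; apply: le_trans (ler_norm _) (bu z Ez).
    - by move=> z Gz; apply: le_trans (ler_norm _) (gu' z Gz).
    - by move=> z Ez; rewrite ler_wpM2l ?sqr_ge0//; apply: le_trans (ler_norm _) (bu z Ez).
  have dn : - u y <= 1 / 4.
    apply: (hd (fun z => - u z) _ _ (helmN Hu)) => //.
    - by move=> z; apply: cvgN; exact: cu.
    - by move=> z Ez; apply: le_trans (ler_norm _) _; rewrite normrN; exact: bu.
    - by move=> z Gz; apply: le_trans (ler_norm _) _; rewrite normrN; exact: gu'.
    - by move=> z Ez; rewrite ler_wpM2l ?sqr_ge0//; apply: le_trans (ler_norm _) _; rewrite normrN; exact: bu.
  by rewrite ler_norml up andbT lerNl.
have h1 := hB a b V D; have h2 := hB a' b' V' D'.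
have [fa [fb [[ga [ha [gb [hb [Ha Hb _]]]]] [ca cb]]]] := V.
have [fa' [fb' [[ga' [ha' [gb' [hb' [Ha' Hb' _]]]]] [ca' cb']]]] := V'.
have o1 := bd a ga ha Ha ca (fun z Ez => (h1 z Ez).1) (fun z Gz => (g z Gz).1).
have o2 := bd b gb hb Hb cb (fun z Ez => (h1 z Ez).2) (fun z Gz => (g z Gz).2).
have o3 := bd a' ga' ha' Ha' ca' (fun z Ez => (h2 z Ez).1) (fun z Gz => (g' z Gz).1).
have o4 := bd b' gb' hb' Hb' cb' (fun z Ez => (h2 z Ez).2) (fun z Gz => (g' z Gz).2).
by split; [exact: one_half o1 o3|exact: one_half o2 o4].
Qed.
End Local.

Lemma tangent_arith (R : realType) (L hz S dn Kf Kx : R) : - Kf <= hz - S -> dn = S - L -> Kf <= Kx -> Kx < dn -> L < hz.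
Proof. by move=> *; lra. Qed.

(** * Tangent balls of a C^2 boundary *)

Section Tangent.
Variables (R : realType) (m : nat).
Hypothesis hm : m = 2%N \/ m = 3%N.
Notation vec := 'rV[R]_m.

Lemma dotv_mx (x y : vec) : dotv x y = (x *m y^T) 0 0.
Proof. by rewrite mxE; apply: eq_bigr => i _; rewrite mxE. Qed.
Lemma dotv_orth (Q : 'M[R]_m) (x y : vec) : Q *m Q^T = 1%:M -> dotv (x *m Q) (y *m Q) = dotv x y.
Proof. by move=> h; rewrite !dotv_mx trmx_mul mulmxA -(mulmxA x) h mulmx1. Qed.
Lemma enorm_orth (Q : 'M[R]_m) (x : vec) : Q *m Q^T = 1%:M -> enorm (x *m Q) = enorm x.
Proof. by move=> h; rewrite /enorm dotv_orth. Qed.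

Lemma enorm_flat (x : vec) : enorm (flat x) <= enorm x.
Proof.
rewrite ler_wsqrtr//; apply: ler_sum => i _; rewrite mxE; case: eqP => _ //.
by rewrite mul0r -expr2 sqr_ge0.
Qed.
Lemma lastc_bound (x : vec) : `|lastc x| <= enorm x.
Proof.
have im : (m.-1 < m)%N by case: hm => ->.
rewrite /lastc (big_pred1 (Ordinal im)); first exact: coord_enorm.
by move=> i /=; rewrite -val_eqE.
Qed.
Lemma dot_normal (g : 'I_m -> R) (x : vec) :
  dotv (\row_i (if (i : nat) == m.-1 then -1 else g i)) x = \sum_i g i * flat x 0 i - lastc x.
Proof.
rewrite /dotv /lastc (bigID (fun i : 'I_m => (i : nat) == m.-1)) /=.
rewrite [X in _ = X - _](bigID (fun i : 'I_m => (i : nat) == m.-1)) /=.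
rewrite [X in _ = X + _ - _]big1 ?add0r; last by move=> i /eqP e; rewrite mxE e eqxx mulr0.
rewrite addrC; congr (_ + _).
  by apply: eq_bigr => i /negPf e; rewrite !mxE e.
by rewrite -sumrN; apply: eq_bigr => i /eqP e; rewrite mxE e eqxx mulN1r.
Qed.

Lemma C2_taylor (h : vec -> R) : C2_on setT h -> exists K d : R, [/\ 0 < K, 0 < d & forall z : vec, enorm z <= d ->
  `|h z - h 0 - \sum_i partial i h 0 * z 0 i| <= K * enorm z ^+ 2].
Proof.
move=> [c0 [p1 [c1 [p2 c2]]]].
have i1 i x : isp i h x (partial i h x) by apply: has_partial_isp; exact: p1.
have i2 i j x : isp j (partial i h) x (partial j (partial i h) x) by apply: has_partial_isp; exact: p2.
have ct (u : vec -> R) : {within setT, continuous u} -> ctat u 0.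
  by move=> hu; apply: (open_ctat openT hu).
pose B i j : R := `|partial j (partial i h) 0| + 1.
have [d d0 hd] : exists2 d : R, 0 < d & forall i j (y : vec), `|y| < d -> `|partial j (partial i h) y| <= B i j.
  have := @fin_eps R m (fun i d => forall j (y : vec), `|y| < d -> `|partial j (partial i h) y| <= B i j).
  case=> [i|i d d' d'0 dd H j y yd|d d0 H]; last by exists d.
    apply: (@fin_eps R m (fun j d => forall (y : vec), `|y| < d -> `|partial j (partial i h) y| <= B i j)).
      move=> j; have /ctP/(_ _ ltr01)[e e0 he] := ct _ (c2 i j).
      exists e => // y ye; have := he y; rewrite subr0 => /(_ ye)/ltW h1.
      rewrite -[partial j _ y](subrK (partial j (partial i h) 0)); apply: le_trans (ler_normD _ _) _.
      by rewrite /B addrC lerD2l.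
    by move=> j e e' e'0 ee H y ye; apply: H; exact: lt_le_trans ye ee.
  by apply: H; exact: lt_le_trans yd dd.
pose K1 : R := \sum_i \sum_j B i j + 1.
have B0 i j : 0 <= B i j by rewrite addr_ge0.
have K10 : 0 < K1 by rewrite ltr_wpDl// sumr_ge0// => i _; rewrite sumr_ge0.
have BK i j : B i j <= K1.
  apply: (@le_trans _ _ (\sum_j B i j)).
    rewrite (bigD1 j)//= lerDl; apply: sumr_ge0 => j' _; exact: B0.
  apply: (@le_trans _ _ (\sum_i \sum_j B i j)); last by rewrite lerDl.
  rewrite [leRHS](bigD1 i)//= lerDl; apply: sumr_ge0 => i' _; apply: sumr_ge0 => j' _; exact: B0.
have mp : 0 < m%:R :> R by rewrite ltr0n; case: hm => ->.
exists (K1 * m%:R ^+ 2), (d / 2); split; [by rewrite mulr_gt0// exprn_gt0|by rewrite divr_gt0|].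
move=> z zd; have nz : `|z| < d.
  apply: le_lt_trans (norm_enorm z) _; apply: le_lt_trans zd _; by rewrite ltr_pdivrMr// ltr_pMr// ltr1n.
have box (y : vec) : (forall j, `|y 0 j - (0 : vec) 0 j| <= `|z 0 j|) -> `|y| <= `|z|.
  move=> hy; apply/normv_leP => // j; have := hy j; rewrite mxE subr0 => h1; apply: le_trans h1 _; exact: coord_norm.
have lip i (y : vec) : `|y| <= `|z| -> `|partial i h y - partial i h 0| <= K1 * m%:R * `|z|.
  move=> yz.
  have := @mvt_coords R m (partial i h) (fun j => partial j (partial i h)) 0 y (fun _ => 0) (fun _ => K1).
  rewrite add0r big1 ?subr0; last by move=> j _; rewrite mul0r.
  move=> T; apply: le_trans (T _ _) _.
  - by move=> j x _; exact: i2.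
  - move=> j x hx; rewrite subr0; apply: le_trans (hd i j x _) (BK i j).
    apply: le_lt_trans nz; apply: le_trans yz; apply/normv_leP => // l.
    by have := hx l; rewrite mxE subr0 => h1; apply: le_trans h1 _; exact: coord_norm.
  - rewrite -mulr_sumr -mulrA ler_wpM2l ?(ltW K10)//.
    apply: (@le_trans _ _ (\sum_(j < m) `|z|)); last by rewrite sumr_const card_ord mulr_natl.
    by apply: ler_sum => j _; apply: le_trans (coord_norm _ _) yz.
have := @mvt_coords R m h (fun i => partial i h) 0 z (fun i => partial i h 0) (fun _ => K1 * m%:R * `|z|).
rewrite add0r => T; apply: le_trans (T _ _) _.
- by move=> i y _; exact: i1.
- by move=> i y /box; exact: lip.
have nze := norm_enorm z.
apply: (@le_trans _ _ (\sum_(i < m) K1 * m%:R * enorm z * enorm z)).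
  apply: ler_sum => i _; apply: ler_pM => //.
  - by rewrite !mulr_ge0// ltW.
  - by rewrite ler_wpM2l// mulr_ge0// ltW.
  - exact: coord_enorm.
rewrite sumr_const card_ord -[_ *+ m]mulr_natl le_eqVlt; apply/orP; left; apply/eqP; ring.
Qed.

Lemma disjoint_closure (D : set vec) x : open D -> closure (~` closure D) x -> ~ D x.
Proof.
move=> oD cx Dx; have [y [nDy Dy]] := cx D (open_nbhs_nbhs (conj oD Dx)).
by apply: nDy; exact: subset_closure.
Qed.

(* [c] is the centre of a ball inside [D] whose radius is small against the curvature of the graph of [h]. *)
Lemma tangent_ball (D : set vec) (p : vec) : open D -> C2_boundary D ->
  (closure (~` closure D) `\` ~` closure D) p -> exists (c : vec) (r : R), [/\ 0 < enorm (p - c), 0 < r &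
  forall x : vec, closure (~` closure D) x -> enorm (x - p) <= r ->
    enorm (p - c) ^+ 2 + enorm (x - p) ^+ 2 / 2 <= enorm (x - c) ^+ 2].
Proof.
move=> oD C2 [clp /contrapT cDp].
have nDp := disjoint_closure oD clp.
have [r [Q [h [r0 [QQ [Ch hD]]]]]] := C2 p (conj cDp nDp).
have [K [d [K0 d0 hT]]] := C2_taylor Ch.
have ch : ctat h 0 by apply: (open_ctat openT); [exact: Ch.1|].
have flat0 : flat (0 : vec) = 0 by apply/rowP => i; rewrite !mxE; case: ifP.
have lastc0 : lastc (0 : vec) = 0 by rewrite /lastc big1// => i _; rewrite mxE.
(* [p] is not in D, so h 0 <= 0; it is a limit of points of D, so h 0 >= 0. *)
have h0 : h 0 = 0.
  apply/eqP; rewrite eq_le; apply/andP; split.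
    rewrite leNgt; apply/negP => hp; apply: nDp; apply/hD; first by rewrite subrr enorm0.
    by rewrite subrr mul0mx flat0 lastc0.
  rewrite leNgt; apply/negP => hn.
  have e0 : 0 < - h 0 / 2 by rewrite divr_gt0// oppr_gt0.
  have /ctP/(_ _ e0)[e e'0 he] := ch.
  have mp : 0 < m%:R :> R by rewrite ltr0n; case: hm => ->.
  pose t : R := Num.min (Num.min r e) (- h 0 / 2) / m%:R.
  have mn : 0 < Num.min (Num.min r e) (- h 0 / 2) by rewrite !lt_min r0 e'0.
  have t0 : 0 < t by rewrite divr_gt0.
  have N : nbhs p [set x : vec | `|x - p| < t] by apply/nbhs_vec; exists t.
  have [x [Dx /= xt]] := cDp _ N.
  have xe : enorm (x - p) < Num.min (Num.min r e) (- h 0 / 2).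
    by apply: le_lt_trans (enorm_norm _) _; rewrite mulrC -ltr_pdivlMr.
  move: xe; rewrite !lt_min => /andP[/andP[xr xe] xh].
  have /(hD x xr) := Dx; set xi := (x - p) *m Q.
  have ex : enorm xi = enorm (x - p) by exact: enorm_orth.
  have l1 := lastc_bound xi; rewrite ex in l1.
  have l2 : `|h (flat xi) - h 0| < - h 0 / 2.
    apply: he; rewrite subr0; apply: le_lt_trans (norm_enorm _) _.
    by apply: le_lt_trans (enorm_flat _) _; rewrite ex.
  move: l1 l2; rewrite ler_norml ltr_norml => /andP[l1 _] /andP[_ l2] lt.
  by move: xh l1 l2 lt; move: (enorm (x - p)) (lastc xi) (h (flat xi)) => A B C *; lra.
pose g i := partial i h 0.
pose n : vec := \row_i (if (i : nat) == m.-1 then -1 else g i).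
have im : (m.-1 < m)%N by case: hm => ->.
have n1 : 1 <= enorm n.
  have := coord_enorm n (Ordinal im); by rewrite mxE /= eqxx normrN1.
(* The normal [n] points into D; K (4 s) = 1 matches the radius to the quadratic Taylor error. *)
pose s : R := 1 / (4 * K).
have s0 : 0 < s by rewrite divr_gt0// mulr_gt0.
pose c : vec := p + (s *: n) *m Q^T.
have QtQ : Q^T *m Q = 1%:M by exact: mulmx1C.
have cQ : (c - p) *m Q = s *: n by rewrite /c (addrC p) addrK -mulmxA QtQ mulmx1.
exists c, (Num.min (r / 2) d).
have r20 : 0 < r / 2 by rewrite divr_gt0.
have pc : enorm (p - c) = s * enorm n.
  by rewrite enormB -(enorm_orth _ QQ) cQ enormZ gtr0_norm.
split.
- by rewrite pc mulr_gt0// (lt_le_trans ltr01).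
- by rewrite lt_min r20 d0.
move=> x clx; rewrite le_min => /andP[xr xd].
have nD := disjoint_closure oD clx.
set xi := (x - p) *m Q.
have ex : enorm xi = enorm (x - p) by exact: enorm_orth.
have xrr : enorm (x - p) < r by apply: le_lt_trans xr _; rewrite ltr_pdivrMr// ltr_pMr// ltr1n.
(* Otherwise n.xi > K |xi|^2 would put the point below the graph, hence in D. Half of |xi|^2 then
   survives when |x - c|^2 is expanded. *)
have key : 4 * s * dotv n xi <= enorm xi ^+ 2.
  rewrite leNgt; apply/negP => lt; apply: nD; apply/(hD x xrr); rewrite -/xi.
  have fx : enorm (flat xi) <= d by apply: le_trans (enorm_flat _) _; rewrite ex.
  have := hT (flat xi) fx; rewrite h0 subr0 ler_norml => /andP[T _].
  have dn := dot_normal g xi; rewrite -/n in dn.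
  have f2 : enorm (flat xi) ^+ 2 <= enorm xi ^+ 2 by rewrite lerXn2r ?nnegrE ?enorm_ge0// enorm_flat.
  have K2 := ler_wpM2l (ltW K0) f2.
  have s4 : K * (4 * s) = 1 by rewrite /s; field; rewrite gt_eqF.
  have lt2 : K * enorm xi ^+ 2 < dotv n xi.
    by rewrite -[ltRHS]mul1r -s4 -[ltRHS]mulrA (ltr_pM2l K0).
  exact: tangent_arith T dn K2 lt2.
have -> : enorm (x - c) ^+ 2 = enorm xi ^+ 2 - 2 * s * dotv n xi + enorm (p - c) ^+ 2.
  have -> : enorm (x - c) = enorm (xi - s *: n).
    rewrite -(enorm_orth _ QQ) /xi -cQ -mulmxBl; congr enorm; congr (_ *m _).
    by rewrite opprB addrA subrK.
  rewrite pc exprMn !enorm_sqr dotvBl !dotvBr !dotvZl !dotvZr (dotvC xi n); ring.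
by rewrite -ex; move: key; move: (enorm xi ^+ 2) (enorm (p - c) ^+ 2) (dotv n xi) => A B C; lra.
Qed.
End Tangent.

Lemma taylor1_bound (R : realType) (f f1 : R -> R) (u v : R) : (forall t, der f t (f1 t)) ->
  (forall s t, `|f1 s - f1 t| <= `|s - t|) -> `|f (u + v) - f u - f1 u * v| <= `|v| * `|v|.
Proof.
move=> df lip.
have := @mvt_abs R (fun t => f (t + u) - f1 u * t) (fun t => f1 (t + u) - f1 u * 1) 0 v `|v|.
rewrite add0r mulr0 !subr0 => H.
have -> : f (u + v) - f u - f1 u * v = f (v + u) - f1 u * v - f u by rewrite (addrC v); ring.
apply: H => t ht.
  exact: (derB (der_shift (df _)) (derZ (f1 u) (derI t))).
rewrite mulr1; apply: le_trans (lip _ _) _; rewrite addrK.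
have [hv|hv] := leP 0 v.
  by move: ht; rewrite (min_idPl hv) (max_idPr hv) => /andP[h1 h2]; rewrite !ger0_norm.
by move: ht; rewrite (min_idPr (ltW hv)) (max_idPl (ltW hv)) => /andP[h1 h2]; rewrite ler0_norm// ltr0_norm// lerN2.
Qed.

Lemma sq_sum_le (R : realType) (S u v : R) : `|u| <= S -> `|v| <= 2 * S -> u ^+ 2 + v ^+ 2 <= 5 * S ^+ 2.
Proof. by rewrite !ler_norml => /andP[? ?] /andP[? ?]; nra. Qed.

(** With k = 1 the Gronwall exponent is at most 1, so the constant depends only on the size of the
    initial data at s = 1. *)
Lemma amp_M_le (R : realType) m (f f1 : R -> R) (S : R) : m = 2%N \/ m = 3%N -> `|f 1| <= S -> `|f1 1| <= S ->
  amp_M m 1 1 f f1 <= Num.sqrt (5 * S ^+ 2 * expR 1).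
Proof.
move=> hm fS f1S; rewrite /amp_M ler_wsqrtr//.
have QE := @amp_QE R m 1 f f1 1.
rewrite [X in X * _ <= _]QE nu_1 !mul1r !divr1 mulr1.
have cm1 : 0 <= cm R m <= 1 by rewrite /cm; clear -hm; case: hm => ->; apply/andP; split; lra.
have S0 : 0 <= S by exact: le_trans fS.
apply: ler_pM; [by rewrite addr_ge0 ?sqr_ge0|exact: expR_ge0| |].
  apply: sq_sum_le => //; apply: le_trans (ler_normD _ _) _; rewrite normrM (ger0_norm (andP cm1).1).
  rewrite mulr_natl mulr2n; apply: lerD => //; rewrite -[leRHS]mul1r.
  by apply: ler_pM => //; [exact: (andP cm1).1|exact: (andP cm1).2].
by rewrite ler_expR; exact: cm_itv.
Qed.

(** * Decay of Herglotz waves *)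

Section Herglotz.
Variables (R : realType) (m : nat).
Hypothesis hm : m = 2%N \/ m = 3%N.
Notation vec := 'rV[R]_m.

Lemma C1_dot (a : vec) : C1 (fun x : vec => dotv a x) (fun i _ => a 0 i).
Proof.
split=> [i x|i x]; last exact: ctC.
rewrite /isp; under eq_fun do rewrite dotvDr dotvZr dotv_unit.
by apply: der_eq (derD (derC (dotv a x) 0) (derM (derI (0 : R)) (derC (a 0 i) 0))) _; ring.
Qed.

Lemma C1_q0 : C1 (fun x : vec => dotv x x) (fun i x => 2 * x 0 i).
Proof.
have := C1_q (0 : vec).
have -> : (fun x : vec => dotv (x - 0) (x - 0)) = (fun x => dotv x x) by apply/funext => x; rewrite subr0.
by have -> : (fun (i : 'I_m) (x : vec) => 2 * (x 0 i - (0 : vec) 0 i)) = (fun i x => 2 * x 0 i)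
  by apply/funext => i; apply/funext => x; rewrite mxE subr0.
Qed.

Section Identity.
Variables (a : vec) (g g1 : R -> R).
Hypothesis a1 : sph a.
Hypothesis dg : forall t, der g t (g1 t).
Hypothesis cg1 : cont g1.

Let H (x : vec) : R := (1 - m%:R) * (dotv a x * g (dotv a x)) + g1 (dotv a x) * (dotv x x - dotv a x ^+ 2).

(* Divergence theorem for [eta (|x|^2) (|x|^2 a - (a.x) x) g (a.x)], which is tangent to the spheres. *)
Lemma rot_div_zero (eta eta1 : R -> R) (L : R) : 0 <= L -> (forall q, der eta q (eta1 q)) -> cont eta1 ->
  (forall q, L ^+ 2 <= q -> eta q = 0) -> vint L (fun x => eta (dotv x x) * H x) = 0.
Proof.
move=> L0 de ce e0.
pose A i (x : vec) : R := dotv x x * a 0 i - dotv a x * x 0 i.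
have T (F : vec -> R) G : C1 F G -> C1U setT F G by exact: C1_C1U.
have cg (t : R) : ctat g1 t by exact: cg1.
have ce' (t : R) : ctat eta1 t by exact: ce.
have CV i := C1U_C1 (C1UM (C1U_comp (f := eta) (f' := eta1) (T _ _ C1_q0) (fun x _ => conj (de _) (ce' _)))
  (C1UM (C1UB (C1UM (T _ _ C1_q0) (@C1UC R m setT (a 0 i))) (C1UM (T _ _ (C1_dot a)) (T _ _ (C1_coord R i))))
  (C1U_comp (f := g) (f' := g1) (T _ _ (C1_dot a)) (fun x _ => conj (dg _) (cg _))))).
have V0 := div_zero hm L0 CV.
rewrite -[RHS]V0.
  apply: (vint_ext hm) => x _ /=.
  have aa : \sum_i a 0 i * a 0 i = 1 by rewrite -[LHS]/(dotv a a) -enorm_sqr a1 expr1n.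
  pose q := dotv x x; pose t := dotv a x.
  rewrite (eq_bigr (fun i => (2 * eta1 q * g t * q + eta q * g t - eta q * g1 t * t) * (a 0 i * x 0 i)
     - 2 * eta1 q * g t * t * (x 0 i * x 0 i) + eta q * g1 t * q * (a 0 i * a 0 i) - eta q * g t * t)); last first.
    move=> i _; rewrite eqxx -/q -/t; move: (eta q) (eta1 q) (g t) (g1 t) (a 0 i) (x 0 i) => b1 b2 b3 b4 b5 b6.
    by rewrite /=; ring.
  rewrite !(sumrB, big_split) /= -!mulr_sumr aa -/(dotv a x) -/(dotv x x) -/q -/t sumr_const card_ord -[_ *+ m]mulr_natl.
  by rewrite /H -/q -/t; ring.
move=> i x Lx; by rewrite e0 ?mul0r// -enorm_sqr lerXn2r// nnegrE// enorm_ge0.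
Qed.

(** The volume identity holds for every radial weight. A bump concentrated where the spherical
    integral keeps its sign would give a nonzero volume integral if the integral at radius [s] were
    not zero. *)
Lemma rot_identity (s : R) : 0 < s -> sphere_int (fun y => H (s *: y)) = 0.
Proof.
move=> s0.
have cH : Ct H.
  have c1 := C1_Ct (C1_dot a); have c2 := C1_Ct C1_q0.
  apply: CtD; first apply: CtZ; apply: CtM => //.
  - by move=> x; apply: (ct_comp (g := g)) => //; exact: der_cont (dg _).
  - by move=> x; apply: (ct_comp (g := g1)) => //; exact: cg1.
  - by apply: CtB => // x; apply: ctX; exact: c1.
pose A (r : R) := r ^+ m.-1 * sphere_int (fun y => H (r *: y)).
have cA : cont A := vcont hm cH.
suff As : A s = 0.
  move/eqP: As; rewrite /A mulf_eq0 => /orP[|/eqP//].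
  by rewrite gt_eqF// exprn_gt0.
apply/eqP; apply/negP => /negP An.
have Ap : 0 < `|A s| / 2 by rewrite divr_gt0// normr_gt0.
have /ctP/(_ _ Ap)[d d0 hd] := cA s.
pose de : R := (d * s) ^+ 2.
have de0 : 0 < de by rewrite exprn_gt0// mulr_gt0.
(* A C^1 bump in q = r^2 around s^2; it vanishes when |r - s| >= d, because then |r^2 - s^2| >= d
   s. *)
pose eta q : R := posp (de - (q - s ^+ 2) ^+ 2) ^+ 2.
pose eta1 q : R := 2 * posp (de - (q - s ^+ 2) ^+ 2) * (0 - 2 * (q - s ^+ 2) * (1 - 0)).
have Deta q : der eta q (eta1 q).
  apply: (der_comp (f := fun u : R => posp u ^+ 2)); last exact: posp_sq_der.
  apply: der_eq (derB (derC de q) (derX 2 (derB (derI q) (derC (s ^+ 2) q)))) _.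
  by rewrite expr1; ring.
have c2 : cont (fun q : R => de - (q - s ^+ 2) ^+ 2).
  by apply: contB; [exact: contC|apply: contX; apply: contB; [exact: contI|exact: contC]].
have ceta : cont eta1.
  apply: contM; first apply: contZ.
    by move=> q; apply: (ct_comp (g := @posp R)); [exact: c2|exact: posp_cont].
  apply: contB; first exact: contC.
  apply: contM; last exact: contC.
  by apply: contZ; apply: contB; [exact: contI|exact: contC].
have eta0 q : 0 <= eta q by exact: sqr_ge0.
pose L : R := s + d.
have L0 : 0 < L by rewrite addr_gt0.
have far (r : R) : 0 <= r -> d <= `|r - s| -> eta (r ^+ 2) = 0.
  move=> r0 rd; rewrite /eta /posp max_l ?expr0n//.
  rewrite subr_le0 /de -[leRHS]real_normK ?num_real// lerXn2r ?nnegrE ?mulr_ge0 ?(ltW d0) ?(ltW s0)//.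
  rewrite subr_sqr normrM; apply: ler_pM => //; [exact: ltW|exact: ltW|].
  by rewrite ger0_norm ?addr_ge0 ?(ltW s0)// lerDr.
have Z : vint L (fun x => eta (dotv x x) * H x) = 0.
  apply: (rot_div_zero (ltW L0) Deta ceta) => q Lq.
  have q0 : 0 <= q by apply: le_trans Lq; exact: sqr_ge0.
  rewrite -(sqr_sqrtr q0); apply: far; first exact: sqrtr_ge0.
  have : L <= Num.sqrt q by rewrite -(ger0_norm (ltW L0)) -sqrtr_sqr ler_wsqrtr.
  by move=> h; apply: le_trans (ler_norm _); rewrite lerBrDr addrC.
have E : vint L (fun x => eta (dotv x x) * H x) = int 0 L (fun r => eta (r ^+ 2) * A r).
  apply: int_ext => r _; rewrite /A mulrCA; congr (_ * _).
  rewrite -(sigZ hm); last exact: Ct_ray.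
  apply: (sig_ext hm) => y sy; rewrite dotvZl dotvZr -enorm_sqr sy expr1n mulr1 -expr2//.
have ce : cont eta by move=> q; exact: der_cont (Deta q).
have cI : cont (fun r : R => eta (r ^+ 2) * A r).
  apply: contM => //; move=> r; apply: (ct_comp (g := eta)); last exact: ce.
  by apply: contX; exact: contI.
have cI2 : cont (fun r : R => A s * (eta (r ^+ 2) * A r)) by exact: contZ.
have I0 : int 0 L (fun r : R => A s * (eta (r ^+ 2) * A r)) = 0 by rewrite intZ// -E Z mulr0.
have P (r : R) : 0 <= r <= L -> 0 <= A s * (eta (r ^+ 2) * A r).
  move=> /andP[r0 _]; have [rd|rd] := leP d `|r - s|; first by rewrite far// mul0r mulr0.
  rewrite mulrCA mulr_ge0//; have := hd r rd; move: (A r) (A s) => u v.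
  rewrite ltr_distl => /andP[h1 h2]; have [v0|v0] := leP 0 v.
    rewrite ger0_norm in h1 => //; apply: mulr_ge0 => //; lra.
  rewrite ltr0_norm in h2 => //; apply: mulr_le0; first exact: ltW.
  lra.
have sL : 0 <= s <= L by rewrite (ltW s0) lerDl ltW.
have etas : eta (s ^+ 2) = 0.
  have /eqP := int_pos0 L0 cI2 P I0 sL; move: (A s) An (eta _) => u un v.
  by rewrite mulf_eq0 (negPf un) mulf_eq0 (negPf un) orbF => /eqP.
move: etas; rewrite /eta subrr expr0n subr0 /posp max_r ?(ltW de0)// => /eqP; rewrite expf_eq0 /= => /eqP h.
by rewrite h ltxx in de0.
Qed.
End Identity.

(** Two differentiations under the integral give the second derivative, and [rot_identity] with
    sin(t + th) expresses it through the first derivative and the value. The wave number is absorbed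
    in [s], hence k = 1. *)
Lemma herglotz_ode (a : vec) (th : R) : sph a ->
  radode m 1 1 (fun s => sphere_int (fun y : vec => cos (s * dotv a y + th)))
    (fun s => sphere_int (fun y : vec => - dotv a y * sin (s * dotv a y + th))).
Proof.
move=> sa s s1; have s0 : 0 < s by exact: lt_le_trans s1.
have sd : scont (fun y => dotv a y) by exact: scont_dot.
have su (s' : R) : scont (fun y => s' * dotv a y + th) by apply: scontD; [exact: scontZ|exact: scontC].
have sc s' : scont (fun y => cos (s' * dotv a y + th)) by apply: scont_fun => //; exact: continuous_cos.
have ss s' : scont (fun y => sin (s' * dotv a y + th)) by apply: scont_fun => //; exact: continuous_sin.
have dy1 (y : vec) : sph y -> `|dotv a y| <= 1.
  by move=> sy; apply: le_trans (dotv_CS _ _) _; rewrite sa sy mulr1.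
have dcos t : der (@cos R) t (- sin t) by exact: is_derive_cos.
have dsin t : der (@sin R) t (cos t) by exact: is_derive_sin.
have quad (h t : R) : `|t| <= 1 -> `|h * t| * `|h * t| <= `|h| * `|h|.
  by move=> t1; rewrite normrM; apply: ler_pM; rewrite ?mulr_ge0//; rewrite ler_piMr.
have small (F F1 : R -> vec -> R) : (forall (s h : R) y, sph y -> `|F (s + h) y - F s y - F1 s y * h| <= `|h| * `|h|) ->
    forall e : R, 0 < e -> exists2 d : R, 0 < d & forall h x, `|h| < d -> sph x ->
     `|F (s + h) x - F s x - F1 s x * h| <= e * `|h|.
  move=> hF e e0; exists e => // h x he sx; apply: le_trans (hF _ _ _ sx) _.
  by rewrite ler_wpM2r// ltW.
split.
  apply: (sig_der hm (F := fun s y => cos (s * dotv a y + th)) (F1 := fun s y => - dotv a y * sin (s * dotv a y + th))) => //.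
    by apply: scontM => //; exact: scontN.
  apply: (small (fun s y => cos (s * dotv a y + th)) (fun s y => - dotv a y * sin (s * dotv a y + th))) => s' h y sy.
  have -> : (s' + h) * dotv a y + th = (s' * dotv a y + th) + h * dotv a y by ring.
  have := @taylor1_bound R (@cos R) (fun t => - sin t) (s' * dotv a y + th) (h * dotv a y) dcos.
  have lip (p q : R) : `|- sin p - - sin q| <= `|p - q| by rewrite -opprD normrN; exact: sin_lip.
  move=> /(_ lip) T; have := le_trans T (quad h _ (dy1 _ sy)).
  by have -> : - sin (s' * dotv a y + th) * (h * dotv a y) = - dotv a y * sin (s' * dotv a y + th) * h by ring.
apply: der_eq.
  apply: (sig_der hm (F := fun s y => - dotv a y * sin (s * dotv a y + th))
    (F1 := fun s y => - dotv a y * (dotv a y * cos (s * dotv a y + th)))).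
  - by move=> s'; apply: scontM => //; exact: scontN.
  - by apply: scontM; [exact: scontN|exact: scontM].
  apply: (small (fun s y => - dotv a y * sin (s * dotv a y + th)) (fun s y => - dotv a y * (dotv a y * cos (s * dotv a y + th)))) => s' h y sy.
  have -> : (s' + h) * dotv a y + th = (s' * dotv a y + th) + h * dotv a y by ring.
  have T := @taylor1_bound R (@sin R) (@cos R) (s' * dotv a y + th) (h * dotv a y) dsin (@cos_lip R).
  have := le_trans T (quad h _ (dy1 _ sy)) => T2.
  set u := s' * _ + th in T2 *; move: T2 (dy1 _ sy); move: (dotv a y) => t T2 t1.
  have -> : - t * sin (u + h * t) - - t * sin u - - t * (t * cos u) * h = - t * (sin (u + h * t) - sin u - cos u * (h * t)) by ring.
  by rewrite normrM normrN; apply: le_trans T2; rewrite ler_piMl.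
have dst t : der (fun t => sin (t + th)) t (cos (t + th)) by apply: der_shift.
have cct : cont (fun t : R => cos (t + th)).
  move=> t; apply: (ct_comp (g := @cos R)); last exact: continuous_cos.
  by apply: ctD; [exact: contI|exact: ctC].
have := @rot_identity a (fun t => sin (t + th)) (fun t => cos (t + th)) sa dst cct s s0.
set c := fun y => cos (s * dotv a y + th) in sc *.
have -> : (1 ^+ 2 : R) = 1 by rewrite expr1n.
rewrite mul1r => Z.
have Z2 : sphere_int (fun y => (m%:R - 1) * s * (- dotv a y * sin (s * dotv a y + th)) +
    s ^+ 2 * (c y + - dotv a y * (dotv a y * c y))) = 0.
  rewrite -[RHS]Z; apply: (sig_ext hm) => y sy.
  rewrite !dotvZr dotvZl -enorm_sqr sy expr1n /c; ring.
have q1 : scont (fun y => - dotv a y * sin (s * dotv a y + th)) by apply: scontM; [exact: scontN|exact: ss].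
have q2 : scont (fun y => - dotv a y * (dotv a y * c y)).
  by apply: scontM; [exact: scontN|apply: scontM; [exact: scont_dot|exact: sc]].
have q3 : scont (fun y => c y + - dotv a y * (dotv a y * c y)) by apply: scontD => //; exact: sc.
rewrite (sigD hm) ?(sigZ hm) ?(sigD hm) // in Z2; try (by apply: scontZ); try exact: sc.
move: Z2; move: (sphere_int _) (sphere_int c) (sphere_int _) => x y z e.
have sn : s != 0 by rewrite gt_eqF.
have -> : x = ((m%:R - 1) * s * z + s ^+ 2 * (y + x)) / s ^+ 2 - (m%:R - 1) / s * z - y by field.
by rewrite e mul0r sub0r.
Qed.

(** The decay constant of a radial solution depends only on its data at s = 1, here at most the area
    of the sphere. The bound is therefore uniform in direction and phase. *)
Lemma herglotz_bound : exists2 C : R, 0 < C & forall (a : vec) (th s : R), sph a -> 1 <= s ->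
  nu m s * `|sphere_int (fun y : vec => cos (s * dotv a y + th))| <= C.
Proof.
pose S := sig1 R m; have S0 : 0 < S := sig1_gt0 R hm.
exists (Num.sqrt (5 * S ^+ 2 * expR 1)); first by rewrite sqrtr_gt0 !mulr_gt0 ?exprn_gt0 ?expR_gt0.
move=> a th s sa s1.
have ode := herglotz_ode th sa.
have [h _] := amp_bound hm ltr01 ltr01 ode s1; apply: le_trans h _.
apply: amp_M_le => //.
-   rewrite -[S]mul1r; apply: (sig_abs hm); last by move=> y _; rewrite ler_norml cos_geN1 cos_le1.
  apply: scont_fun; first exact: continuous_cos.
  by apply: scontD; [apply: scontZ; exact: scont_dot|exact: scontC].
-   rewrite -[S]mul1r; apply: (sig_abs hm).
    apply: scontM; first by apply: scontN; exact: scont_dot.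
    apply: scont_fun; first exact: continuous_sin.
    by apply: scontD; [apply: scontZ; exact: scont_dot|exact: scontC].
  move=> y sy; rewrite normrM normrN -[1]mulr1; apply: ler_pM => //; last by rewrite ler_norml sin_geN1 sin_le1.
  by apply: le_trans (dotv_CS _ _) _; rewrite sa sy mulr1.
Qed.
End Herglotz.

Lemma amgm_abs (R : realType) (x s : R) : 0 < s -> `|x| <= s / 2 + x ^+ 2 / (2 * s).
Proof.
move=> s0; rewrite -subr_ge0.
have -> : s / 2 + x ^+ 2 / (2 * s) - `|x| = (`|x| - s) ^+ 2 / (2 * s).
  by rewrite -[in LHS](real_normK (num_real x)); field; rewrite gt_eqF.
by rewrite divr_ge0 ?sqr_ge0// mulr_ge0// ltW.
Qed.

Lemma sq_two_le (R : realType) (d u v : R) : 0 < d -> d <= 1 -> `|u| <= 2 * d -> `|v| <= 2 * d -> u ^+ 2 + v ^+ 2 <= 8 * d.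
Proof. by rewrite !ler_norml => ? ? /andP[? ?] /andP[? ?]; nra. Qed.

(** * The far field controlled by boundary values *)

Section FarFieldBound.
Variables (R : realType) (m : nat) (k : R) (E : set 'rV[R]_m) (rho0 : R).
Hypothesis hm : m = 2%N \/ m = 3%N.
Hypothesis k0 : 0 < k.
Hypothesis oE : open E.
Hypothesis rho1 : 1 <= rho0.
Notation vec := 'rV[R]_m.
Hypothesis farE : forall y : vec, rho0 <= enorm y -> E y.
Notation rad := (rad k E rho0).
Notation outgoing := (outgoing k E rho0).
Notation bdry_bound := (bdry_bound E).
Notation near_bound := (near_bound E rho0).
Notation nu := (@nu R m).

Lemma rad_rotation a b fa fb : rad a b fa fb -> rad b (fun x => - a x) fb (fun x => - fa x).
Proof.
move=> [[ga [ha [gb [hb H]]]] [ca cb]]; split; first by do 4 eexists; exact: rad_rot H.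
by split=> // x; apply: cvgN; exact: ca.
Qed.
Lemma bdry_bound_rotation a b t : bdry_bound a b t -> bdry_bound b (fun x => - a x) t.
Proof. by move=> h x Gx; have [? ?] := h x Gx; rewrite normrN. Qed.
Lemma rad_scont1 a b fa fb : rad a b fa fb -> scont fa.
Proof. by move=> [[ga [ha [gb [hb H]]]] _]; exact: (rad_scont rho1 farE H). Qed.
Lemma rad_scont2 a b fa fb : rad a b fa fb -> scont fb.
Proof. by move=> /rad_rotation; exact: rad_scont1. Qed.
Lemma fw'E fa fb (t : R) (y : vec) : fw' fa fb t y = fw fb (fun x => - fa x) t y.
Proof. by rewrite /fw' /fw; ring. Qed.

(** By continuity a boundary bound [d] becomes 2d nearby, so |v|^2 <= 8 d^2 <= 8 d; outside the
    closure of [E] nothing has to be shown. *)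
Lemma bdry_bound_small a b (d t : R) : 0 < d -> d <= 1 -> 8 * d <= t ->
  {within closure E, continuous a} -> {within closure E, continuous b} -> bdry_bound a b d -> small E a b t.
Proof.
move=> d0 d1 dt ca cb g x nEx.
have [cx|ncx] := pselect (closure E x).
  have [ax bx] := g x (conj cx nEx).
  have [e e0 he] := (withinP _ _).1 ca x cx d d0.
  have [e' e'0 he'] := (withinP _ _).1 cb x cx d d0.
  apply/nbhs_vec; exists (Num.min e e'); first by rewrite lt_min e0.
  move=> y; rewrite lt_min => /andP[ye ye'] Ey; have cy := subset_closure Ey.
  apply: le_trans dt; apply: sq_two_le => //.
    rewrite -[a y](subrK (a x)) mulr_natl mulr2n; apply: le_trans (ler_normD _ _) _.
    by apply: lerD => //; exact: ltW (he y cy ye).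
  rewrite -[b y](subrK (b x)) mulr_natl mulr2n; apply: le_trans (ler_normD _ _) _.
  by apply: lerD => //; exact: ltW (he' y cy ye').
have : nbhs x (~` closure E) by apply: open_nbhs_nbhs; split=> //; rewrite openC; exact: closed_closure.
by apply: filterS => y ny Ey; exfalso; apply: ny; exact: subset_closure.
Qed.

Hypothesis tang : forall p : vec, (closure E `\` E) p -> exists (c : vec) (r : R), [/\ 0 < enorm (p - c), 0 < r &
  forall x : vec, closure E x -> enorm (x - p) <= r -> enorm (p - c) ^+ 2 + enorm (x - p) ^+ 2 / 2 <= enorm (x - c) ^+ 2].

Lemma far_approx : exists2 C : R, 0 < C & forall a b fa fb (t e : R), 0 < t -> 0 < e -> rad a b fa fb -> bdry_bound a b t ->
  exists fa' fb' : vec -> R, [/\ scont fa', scont fb', sphere_int (fun y : vec => fa' y ^+ 2 + fb' y ^+ 2) <= e,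
    forall y, sph y -> `|fa y - fa' y| <= C * t &
    forall z : vec, rho0 + 3 <= enorm z ->
      `|sphere_int (fun y => fw (fun y => fa y - fa' y) (fun y => fb y - fb' y) (k * dotv z y) y)| <= C * t / nu (enorm z)].
Proof.
have [C C0 st] := stable_of_code_compact (code_compact_holds hm k0 oE rho1 farE tang).
have [CF CF0 hF] := far_field_sup_bound hm k0 oE rho1 farE.
have [CL CL0 hL] := pairing_bound hm k0 oE rho1 farE.
pose CC : R := (CF + CL + 1) * C.
have CC0 : 0 < CC by rewrite mulr_gt0// ltr_wpDl// addr_ge0.
exists CC => // a b fa fb t e t0 e0 rab gab.
have [S S0 [SA SB]] := outgoing_bounded (ex_intro _ fa (ex_intro _ fb rab)).
have Ct0 : 0 < C * t by rewrite mulr_gt0.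
(* The sup bound of the approximant is known before [d] is chosen, since the distance C t of
   [stable] does not depend on [d]. The threshold of [energy_small] can thus fix [d]. *)
have M0 : 0 < S + C * t by rewrite addr_gt0.
have [t' t'0 hE] := energy_small hm k0 oE rho1 farE M0 e0.
pose d : R := Num.min 1 (t' / 8).
have d0 : 0 < d by rewrite lt_min ltr01 divr_gt0.
have d1 : d <= 1 by rewrite ge_min lexx.
have d8 : 8 * d <= t' by rewrite mulrC -ler_pdivlMr// ge_min lexx orbT.
have [a' [b' [[fa' [fb' rab']] gab' [dA dB]]]] := st a b t d t0 d0 (ex_intro _ fa (ex_intro _ fb rab)) gab.
have bnd u u' : bndX E rho0 u S -> bndX E rho0 (fun x => u x - u' x) (C * t) -> bndX E rho0 u' (S + C * t).
  move=> h1 h2 y Ey yr; have -> : u' y = u y - (u y - u' y) by ring.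
  by apply: le_trans (ler_normB _ _) _; apply: lerD; [exact: h1|exact: h2].
have A' := bnd _ _ SA dA; have B' := bnd _ _ SB dB.
have rD : rad (fun x => a x - a' x) (fun x => b x - b' x) (fun x => fa x - fa' x) (fun x => fb x - fb' x).
  have := rad_lin (-1) rab' rab.
  by congr rad; apply/funext => x; ring.
exists fa', fb'; split.
- exact: rad_scont1 rab'.
- exact: rad_scont2 rab'.
- have [[ga [ha [gb [hb H]]]] [ca cb]] := rab'.
  apply: (hE _ _ _ _ _ _ _ _ H A' B'); exact: (bdry_bound_small d0 d1 d8).
- have [[ga [ha [gb [hb H]]]] _] := rD.
  move=> y sy; apply: le_trans (hF _ _ _ _ _ _ _ _ _ H Ct0 dA dB y sy) _.
  rewrite /CC -mulrA; apply: ler_wpM2r; first exact: ltW.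
  by rewrite -addrA lerDl addr_ge0.
have [[ga [ha [gb [hb H]]]] _] := rD.
move=> z zr; have [h _] := hL _ _ _ _ _ _ _ _ _ H Ct0 dA dB z zr; apply: le_trans h _.
have z0 : 0 < enorm z by apply: lt_le_trans zr; rewrite ltr_wpDl// (le_trans _ rho1).
have n0 : 0 < nu (enorm z) by exact: nu_gt0.
rewrite ler_pM2r ?invr_gt0// /CC -mulrA; apply: ler_wpM2r; first exact: ltW.
by rewrite -addrA [CL + 1]addrC addrA lerDr addr_ge0.
Qed.

(* The correction [fa'] of [far_approx] has arbitrarily small energy, so [fa] inherits the bound of the difference. *)
Lemma far_field_bound_re : exists2 C : R, 0 < C & forall a b fa fb (t : R), 0 < t -> rad a b fa fb -> bdry_bound a b t ->
  (forall y, sph y -> `|fa y| <= C * t) /\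
  forall z : vec, rho0 + 3 <= enorm z -> `|sphere_int (fun y => fw fa fb (k * dotv z y) y)| <= C * t / nu (enorm z).
Proof.
have [C C0 hC] := far_approx; exists C => // a b fa fb t t0 rab gab.
have sa := rad_scont1 rab; have sb := rad_scont2 rab.
split.
  (* The squared excess of |fa| over C t is at most fa'^2, whose integral is arbitrarily small; so
     it integrates to zero and vanishes pointwise. *)
  pose F y : R := posp (`|fa y| - C * t) ^+ 2.
  have sF : scont F.
    apply: scontX; apply: (scont_fun (f := @posp R)); first exact: posp_cont.
    by apply: scontB; [exact: scont_abs|exact: scontC].
  have F0 y : 0 <= F y by exact: sqr_ge0.
  have FI : sphere_int F = 0.
    apply/eqP; rewrite eq_le; apply/andP; split; last first.
      have := sig_le hm (@scontC R m 0) sF (fun y _ => F0 y); by rewrite (sig_cst hm) mul0r.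
    apply/ler_addgt0Pr => e e0; rewrite add0r.
    have [fa' [fb' [sa' sb' I1 h _]]] := hC a b fa fb t e t0 e0 rab gab.
    apply: le_trans I1; apply: (sig_le hm) => //; first by apply: scontD; exact: scontX.
    move=> y sy; apply: (@le_trans _ _ (fa' y ^+ 2)); last by rewrite lerDl sqr_ge0.
    rewrite -[leRHS]real_normK ?num_real// lerXn2r ?nnegrE//; first by rewrite le_max lexx.
    rewrite ge_max normr_ge0 /= lerBlDr; have -> : fa y = fa' y + (fa y - fa' y) by ring.
    by apply: le_trans (ler_normD _ _) _; rewrite lerD2l; exact: h.
  move=> y sy; have /eqP := sig_pos0 hm sF (fun y _ => F0 y) FI sy.
  rewrite expf_eq0 /= => /eqP; rewrite -subr_le0 => <-; by rewrite le_max lexx orbT.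
move=> z zr; apply/ler_addgt0Pr => e e0.
have S0 := sig1_gt0 R hm.
pose s : R := e / (sig1 R m + 1).
have s0 : 0 < s by rewrite divr_gt0// addr_gt0.
(* Energy 2 s^2 is the choice for which |x| <= s/2 + x^2/(2s) integrates to s (area + 1) = e. *)
have s2 : 0 < 2 * s * s by apply: mulr_gt0 => //; exact: mulr_gt0.
have [fa' [fb' [sa' sb' I1 _ h]]] := hC a b fa fb t _ t0 s2 rab gab.
have sda : scont (fun y => fa y - fa' y) by exact: scontB.
have sdb : scont (fun y => fb y - fb' y) by exact: scontB.
have f1 := @fw_scont R m k _ _ z sda sdb; have f2 := @fw_scont R m k _ _ z sa' sb'.
have -> : sphere_int (fun y => fw fa fb (k * dotv z y) y) =
    sphere_int (fun y => fw (fun y => fa y - fa' y) (fun y => fb y - fb' y) (k * dotv z y) y) +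
    sphere_int (fun y => fw fa' fb' (k * dotv z y) y).
  rewrite -(sigD hm f1 f2); apply: (sig_ext hm) => y _; rewrite /fw.
  by move: (cos _) (sin _) (fa y) (fb y) (fa' y) (fb' y) => ? ? ? ? ? ?; ring.
apply: le_trans (ler_normD _ _) _; apply: lerD; first exact: h.
have sq : scont (fun y => s + (2 * s)^-1 * (fa' y ^+ 2 + fb' y ^+ 2)).
  by apply: scontD; [exact: scontC|apply: scontZ; apply: scontD; exact: scontX].
have pw y : sph y -> `|fw fa' fb' (k * dotv z y) y| <= s + (2 * s)^-1 * (fa' y ^+ 2 + fb' y ^+ 2).
  move=> _; have -> : s + (2 * s)^-1 * (fa' y ^+ 2 + fb' y ^+ 2) =
     (s / 2 + fa' y ^+ 2 / (2 * s)) + (s / 2 + fb' y ^+ 2 / (2 * s)) by field; rewrite gt_eqF.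
  have [c1 c2] : `|cos (k * dotv z y)| <= 1 /\ `|sin (k * dotv z y)| <= 1.
    by rewrite !ler_norml cos_geN1 cos_le1 sin_geN1 sin_le1.
  rewrite /fw; apply: le_trans (ler_normB _ _) _; apply: lerD.
    by apply: le_trans (amgm_abs _ s0); rewrite normrM ler_piMl.
  by apply: le_trans (amgm_abs _ s0); rewrite normrM ler_piMl.
have up : sphere_int (fun y : vec => s + (2 * s)^-1 * (fa' y ^+ 2 + fb' y ^+ 2)) <= e.
  have sq2 : scont (fun y => fa' y ^+ 2 + fb' y ^+ 2) by apply: scontD; exact: scontX.
  have -> : sphere_int (fun y : vec => s + (2 * s)^-1 * (fa' y ^+ 2 + fb' y ^+ 2)) =
      s * sig1 R m + (2 * s)^-1 * sphere_int (fun y : vec => fa' y ^+ 2 + fb' y ^+ 2).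
    by rewrite -(sig_cst hm) -(sigZ hm _ sq2) -(sigD hm (@scontC R m s) (@scontZ _ _ _ _ sq2)).
  apply: (@le_trans _ _ (s * sig1 R m + (2 * s)^-1 * (2 * s * s))).
    by rewrite lerD2l ler_wpM2l// invr_ge0 mulr_ge0// ltW.
  rewrite le_eqVlt; apply/orP; left; apply/eqP.
  have -> : s * sig1 R m + (2 * s)^-1 * (2 * s * s) = s * (sig1 R m + 1) by field; rewrite gt_eqF.
  by rewrite /s divfK// gt_eqF// addr_gt0.
rewrite ler_norml; apply/andP; split.
  have pw2 y : sph y -> - fw fa' fb' (k * dotv z y) y <= s + (2 * s)^-1 * (fa' y ^+ 2 + fb' y ^+ 2).
    by move=> sy; apply: le_trans (pw y sy); rewrite -normrN ler_norm.
  have := sig_le hm (scontN f2) sq pw2.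
  have -> : sphere_int (fun y => - fw fa' fb' (k * dotv z y) y) = - sphere_int (fun y => fw fa' fb' (k * dotv z y) y).
    by rewrite -[RHS]mulN1r -(sigZ hm (-1) f2); apply: (sig_ext hm) => y _; rewrite mulN1r.
  by move=> h'; rewrite lerNl; exact: le_trans up.
by apply: le_trans up; apply: (sig_le hm) => // y sy; apply: le_trans (ler_norm _) (pw y sy).
Qed.

Lemma far_field_bound : exists2 C : R, 0 < C & forall a b fa fb (t : R), 0 < t -> rad a b fa fb -> bdry_bound a b t ->
  (forall y, sph y -> `|fa y| <= C * t /\ `|fb y| <= C * t) /\
  forall z : vec, rho0 + 3 <= enorm z ->
    `|sphere_int (fun y => fw fa fb (k * dotv z y) y)| <= C * t / nu (enorm z) /\
    `|sphere_int (fun y => fw' fa fb (k * dotv z y) y)| <= C * t / nu (enorm z).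
Proof.
have [C C0 hC] := far_field_bound_re; exists C => // a b fa fb t t0 rab gab.
have [h1 h2] := hC a b fa fb t t0 rab gab.
have [h3 h4] := hC _ _ _ _ t t0 (rad_rotation rab) (bdry_bound_rotation gab).
split=> [y sy|z zr]; first by split; [exact: h1|exact: h3].
split; first exact: h2.
by have := h4 z zr; rewrite (sig_ext hm (G := fun y => fw' fa fb (k * dotv z y) y))// => y _; rewrite fw'E.
Qed.
End FarFieldBound.

Import ComplexField.

(** * From the scattering problem to outgoing pairs *)

Section Data.
Variables (R : realType) (m : nat) (k : R) (D : set 'rV[R]_m) (rho0 : R).
Hypothesis hm : m = 2%N \/ m = 3%N.
Hypothesis rho1 : 1 <= rho0.
Notation vec := 'rV[R]_m.
Notation E := (~` closure D).
Notation nu := (@nu R m).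

Lemma cabs_re (z : R[i]) : `|complex.Re z| <= cabs z.
Proof. by rewrite -sqrtr_sqr ler_wsqrtr// lerDl sqr_ge0. Qed.
Lemma cabs_im (z : R[i]) : `|complex.Im z| <= cabs z.
Proof. by rewrite -sqrtr_sqr ler_wsqrtr// lerDr sqr_ge0. Qed.
Lemma cabs_le (z : R[i]) : cabs z <= `|complex.Re z| + `|complex.Im z|.
Proof.
rewrite -[leRHS]ger0_norm ?addr_ge0// -sqrtr_sqr ler_wsqrtr//.
rewrite -(real_normK (num_real (complex.Re z))) -(real_normK (num_real (complex.Im z))) sqrrD.
by rewrite lerD2r lerDl mulrn_wge0// mulr_ge0.
Qed.

Lemma radiation_exponent (r : R) : 0 < r -> r `^ (- ((m%:R + 1) / 2)) = (r * nu r)^-1.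
Proof.
move=> r0; rewrite powRN; congr (_^-1).
have -> : (m%:R + 1) / 2 = 1 + cm R m by rewrite /cm; field.
by rewrite powRD ?powRr1 ?(ltW r0)// (gt_eqF r0) implybT.
Qed.

Lemma scattered_rad (ui us uf : vec -> R[i]) : open D -> sound_soft_scattered D k ui us -> far_field_of k us uf ->
  rad k E rho0 (ReF us) (ImF us) (ReF uf) (ImF uf).
Proof.
move=> oD [Ca [Cb [wa [wb [pde [_ [C [r0 hC]]]]]]]] [C' [r0' hC']].
have oE : open E by rewrite openC; exact: closed_closure.
split=> //.
exists (fun i => partial i (ReF us)), (fun i j => partial j (partial i (ReF us))),
  (fun i => partial i (ImF us)), (fun i j => partial j (partial i (ImF us))).
split; [apply: C2_helm => // x Ex; exact: (pde x Ex).1|apply: C2_helm => // x Ex; exact: (pde x Ex).2|].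
pose r1 : R := Num.max rho0 (Num.max r0 r0').
(* The constants in the hypotheses may be negative, hence the absolute values. *)
exists (`|C| + `|C'|), r1; split; [by rewrite addr_ge0|by rewrite le_max lexx|].
move=> x; rewrite !ge_max => /andP[xr /andP[x0 x0']].
have xp : 0 < enorm x by apply: lt_le_trans xr; exact: lt_le_trans rho1.
have np : 0 < nu (enorm x) by exact: nu_gt0.
have q0 : 0 < enorm x * nu (enorm x) by exact: mulr_gt0.
have := hC x x0; rewrite radiation_exponent// => h.
have {h} h : cabs ((radial_deriv (ReF us) x +i* radial_deriv (ImF us) x)%C - 'i%C * k%:C%C * us x) <=
    (`|C| + `|C'|) / (enorm x * nu (enorm x)).
  apply: le_trans h _; rewrite ler_pM2r ?invr_gt0//; apply: le_trans (ler_norm _) _; by rewrite lerDl.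
have h1 := le_trans (cabs_re _) h; have h2 := le_trans (cabs_im _) h.
have := hC' x x0'; rewrite radiation_exponent// => h'.
have {h'} h' : cabs (us x - expi (k * enorm x) / (enorm x `^ ((m%:R - 1) / 2))%:C%C * uf ((enorm x)^-1 *: x)) <=
    (`|C| + `|C'|) / (enorm x * nu (enorm x)).
  apply: le_trans h' _; rewrite ler_pM2r ?invr_gt0//; apply: le_trans (ler_norm _) _; by rewrite lerDr.
have h1' := le_trans (cabs_re _) h'; have h2' := le_trans (cabs_im _) h'.
move: h1 h2 h1' h2'; rewrite -[enorm x `^ _]/(nu (enorm x)) /ReF /ImF.
have mulnu (A B : R) : `|A - B / nu (enorm x)| <= (`|C| + `|C'|) / (enorm x * nu (enorm x)) ->
    `|nu (enorm x) * A - B| <= (`|C| + `|C'|) / enorm x.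
  move=> hh; have -> : nu (enorm x) * A - B = nu (enorm x) * (A - B / nu (enorm x)) by field; rewrite gt_eqF.
  rewrite normrM gtr0_norm//; apply: le_trans (ler_wpM2l (ltW np) hh) _.
  rewrite le_eqVlt; apply/orP; left; apply/eqP; by field; rewrite !gt_eqF.
have invC (n : R) : (n%:C%C)^-1 = (n^-1)%:C%C by rewrite fmorphV.
rewrite /radial_deriv /ReF /ImF.
case: (us x) => p q; case: (uf _) => p' q'.
rewrite /expi invC.
rewrite /= !(mul0r, mulr0, mul1r, mulr1, add0r, addr0, subr0, sub0r, oppr0).
move=> h1 h2 h1' h2'; split.
- by rewrite opprK in h1.
- by [].
- apply: mulnu; move: h1'; congr (`|_ - _| <= _); field; by rewrite gt_eqF.
- apply: mulnu; move: h2'; congr (`|_ - _| <= _); field; by rewrite gt_eqF.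
Qed.

Lemma closure_boundary x : open D -> (closure E `\` E) x -> boundary_of D x.
Proof. by move=> oD [cx /contrapT cDx]; split=> //; exact: disjoint_closure cx. Qed.
End Data.

Lemma comb_lip (R : realType) (L T d p c q s p' c' q' s' : R) : `|p| <= L -> `|q| <= L -> `|c'| <= 1 -> `|s'| <= 1 ->
  `|p - p'| <= L * d -> `|q - q'| <= L * d -> `|c - c'| <= T * d -> `|s - s'| <= T * d ->
  `|(p * c + q * s) - (p' * c' + q' * s')| <= 2 * (L + L * T) * d.
Proof.
move=> hp hq hc hs h1 h2 h3 h4.
have -> : p * c + q * s - (p' * c' + q' * s') = p * (c - c') + (p - p') * c' + (q * (s - s') + (q - q') * s') by ring.
have -> : 2 * (L + L * T) * d = (L * (T * d) + L * d * 1) + (L * (T * d) + L * d * 1) by ring.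
by do 2 (apply: le_trans (ler_normD _ _) _; apply: lerD); rewrite normrM; apply: ler_pM.
Qed.

(** * Superposition of the scattered fields *)

Section Assembly.
Variables (R : realType) (m : nat) (k : R) (E : set 'rV[R]_m) (rho0 : R).
Hypothesis hm : m = 2%N \/ m = 3%N.
Hypothesis k0 : 0 < k.
Hypothesis rho1 : 1 <= rho0.
Notation vec := 'rV[R]_m.
Hypothesis farE : forall y : vec, rho0 <= enorm y -> E y.
Notation rad := (rad k E rho0).
Notation bdry_bound := (bdry_bound E).
Notation nu := (@nu R m).

Definition slip (F : vec -> R) (L : R) := forall y y' : vec, sph y -> sph y' -> `|F y - F y'| <= L * enorm (y - y').

Let mp : 0 < m%:R :> R. Proof. by rewrite ltr0n; case: hm => ->. Qed.

Lemma slip_modulus (L e : R) : 0 < L -> 0 < e -> exists2 d : R, 0 < d &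
  forall F, slip F L -> forall y y', sph y -> sph y' -> `|y - y'| < d -> `|F y - F y'| < e.
Proof.
move=> L0 e0; exists (e / (L * m%:R)); first by rewrite divr_gt0// mulr_gt0.
move=> F hF y y' sy sy' yd; apply: le_lt_trans (hF y y' sy sy') _.
apply: (@le_lt_trans _ _ (L * (m%:R * `|y - y'|))); first by rewrite ler_pM2l// enorm_norm.
by rewrite mulrA mulrC -ltr_pdivlMr// mulr_gt0.
Qed.

Lemma slip_scont F L : 0 < L -> slip F L -> scont F.
Proof.
move=> L0 hF; apply/scontP => x sx e e0.
have [d d0 hd] := slip_modulus L0 e0; exists d => // y sy yx.
exact: hd.
Qed.

Lemma sig_riemann_slip (L M e : R) : 0 < L -> 0 < M -> 0 < e ->
  exists (I : finType) (w : I -> R) (y : I -> vec), (forall j, sph (y j)) /\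
  forall F : vec -> R, slip F L -> (forall x, sph x -> `|F x| <= M) ->
    `|sphere_int F - \sum_j w j * F (y j)| <= e.
Proof.
move=> L0 M0 e0; have [K K0 hK] := @sig_riemann R m hm.
have eK : 0 < e / K by rewrite divr_gt0.
have [d d0 hd] := slip_modulus L0 eK.
have [I [w [y [sy h]]]] := hK (e / K) d M eK d0 M0.
exists I, w, y; split=> // F hF FM.
have -> : e = K * (e / K) by field; rewrite gt_eqF.
apply: h => //; first exact: slip_scont hF.
by move=> x x' sx sx' xd; apply: ltW; exact: hd.
Qed.

Lemma slip_cos (u : vec) (th L : R) : k * enorm u <= L -> slip (fun y => cos (k * dotv u y + th)) L.
Proof.
move=> uL y y' _ _; apply: le_trans (cos_lip _ _) _.
have -> : k * dotv u y + th - (k * dotv u y' + th) = k * dotv u (y - y') by rewrite dotvBr; ring.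
rewrite normrM (gtr0_norm k0); apply: (@le_trans _ _ (k * (enorm u * enorm (y - y')))).
  by rewrite ler_pM2l// dotv_CS.
by rewrite mulrA ler_wpM2r// enorm_ge0.
Qed.

Lemma slip_sin (u : vec) (L : R) : k * enorm u <= L -> slip (fun y => sin (k * dotv u y)) L.
Proof.
move=> uL y y' sy sy'; have := @slip_cos u (pi / 2) L uL y y' sy sy'.
by rewrite !cosDpihalf -opprD normrN.
Qed.

(** |z| >= 2 rho0 gives |x - z| >= |z|/2, and |z| >= 2/k makes k |x - z| >= 1, the range in which
    the Herglotz decay holds. *)
Lemma herglotz_tau : exists2 C : R, 0 < C & forall z x : vec, 2 * rho0 + 2 / k <= enorm z -> enorm x <= rho0 ->
  forall th, `|sphere_int (fun y : vec => cos (k * dotv (x - z) y + th))| <= C / nu (enorm z).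
Proof.
have [C C0 hC] := @herglotz_bound R m hm.
have nk : 0 < nu (k / 2) by apply: nu_gt0; rewrite divr_gt0.
exists (C / nu (k / 2)); first by rewrite divr_gt0.
move=> z x zr xr th.
have k2 : 0 < 2 / k by rewrite divr_gt0.
have r0 : 0 < rho0 by exact: lt_le_trans rho1.
have xz : enorm z / 2 <= enorm (x - z).
  have := enorm_leB z x; rewrite (enormB z x) => h; apply: le_trans h.
  by move: zr xr k2; move: (enorm z) (enorm x) (2 / k) => A B c *; lra.
have z0 : 0 < enorm z by apply: lt_le_trans zr; rewrite addr_gt0// mulr_gt0.
have d0 : 0 < enorm (x - z) by apply: lt_le_trans xz; rewrite divr_gt0.
have s1 : 1 <= k * enorm (x - z).
  apply: (@le_trans _ _ (k * (enorm z / 2))); last by rewrite ler_pM2l.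
  have : 2 / k <= enorm z by apply: le_trans zr; rewrite lerDr mulr_ge0// ltW.
  by rewrite ler_pdivrMr// => h; rewrite mulrA ler_pdivlMr// mul1r mulrC.
pose u := (enorm (x - z))^-1 *: (x - z).
have su : sph u by rewrite /sph /= enormZ gtr0_norm ?invr_gt0// mulVf// gt_eqF.
have := hC u th _ su s1.
have -> : (fun y => cos (k * enorm (x - z) * dotv u y + th)) = (fun y => cos (k * dotv (x - z) y + th)).
  by apply/funext => y; rewrite /u dotvZl; congr (cos (_ + _)); field; rewrite gt_eqF.
move: (sphere_int _) => S hS.
have nz : 0 < nu (enorm z) by exact: nu_gt0.
have nn : nu (k / 2) * nu (enorm z) <= nu (k * enorm (x - z)).
  rewrite -nu_mul ?(ltW z0)//; last by rewrite divr_ge0// ltW.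
  apply: (nu_le hm); first by rewrite mulr_ge0 ?divr_ge0// ltW.
  by rewrite -mulrA ler_pM2l// mulrC.
rewrite -mulrA -invfM ler_pdivlMr ?mulr_gt0// mulrC; apply: le_trans hS.
by apply: ler_wpM2r.
Qed.

Lemma rad_ext a b fa fb a' b' fa' fb' : a =1 a' -> b =1 b' -> fa =1 fa' -> fb =1 fb' -> rad a b fa fb -> rad a' b' fa' fb'.
Proof. by move=> /funext-> /funext-> /funext-> /funext->. Qed.

Lemma rad_sum (I : Type) (r : seq I) (a b fa fb : I -> vec -> R) : (exists a0 b0 fa0 fb0, rad a0 b0 fa0 fb0) ->
  (forall j, rad (a j) (b j) (fa j) (fb j)) ->
  rad (fun x => \sum_(j <- r) a j x) (fun x => \sum_(j <- r) b j x)
      (fun x => \sum_(j <- r) fa j x) (fun x => \sum_(j <- r) fb j x).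
Proof.
move=> [a0 [b0 [fa0 [fb0 H0]]]] H; elim: r => [|j r IH].
  by apply: rad_ext (rad_lin (-1) H0 H0) => x; rewrite big_nil; ring.
by apply: rad_ext (rad_lin 1 (H j) IH) => x; rewrite big_cons mul1r.
Qed.

Lemma rad_comb a b fa fb (w c s : R) : rad a b fa fb ->
  rad (fun x => w * (a x * c + b x * s)) (fun x => w * (b x * c - a x * s))
      (fun x => w * (fa x * c + fb x * s)) (fun x => w * (fb x * c - fa x * s)).
Proof.
move=> H; have H1 := rad_lin (w * c - 1) H H.
by apply: rad_ext (rad_lin (w * s) (rad_rotation H) H1) => x; ring.
Qed.

Variables (a_ b_ fa_ fb_ : vec -> vec -> R) (CA : R).
Hypothesis CA0 : 0 < CA.
Hypothesis far : forall a b fa fb (t : R), 0 < t -> rad a b fa fb -> bdry_bound a b t ->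
  (forall y, sph y -> `|fa y| <= CA * t /\ `|fb y| <= CA * t) /\
  forall z : vec, rho0 + 3 <= enorm z ->
    `|sphere_int (fun y => fw fa fb (k * dotv z y) y)| <= CA * t / nu (enorm z) /\
    `|sphere_int (fun y => fw' fa fb (k * dotv z y) y)| <= CA * t / nu (enorm z).
Hypothesis rv : forall y, sph y -> rad (a_ y) (b_ y) (fa_ y) (fb_ y).
Hypothesis bv : forall y x, sph y -> (closure E `\` E) x -> a_ y x = - cos (k * dotv x y) /\ b_ y x = - sin (k * dotv x y).

Lemma bdry_le (x : vec) : ~ E x -> enorm x <= rho0.
Proof. by move=> nE; rewrite leNgt; apply/negP => h; apply: nE; apply: farE; exact: ltW. Qed.

(** The difference of the fields for two incident directions is outgoing, with boundary values
    Lipschitz in the direction with constant k rho0. The linear far field bound transfers this to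
    [uinf]. *)
Lemma far_slip : exists2 L : R, 0 < L & forall x y y', sph x -> sph y -> sph y' ->
  [/\ `|fa_ y x| <= L, `|fb_ y x| <= L, `|fa_ y x - fa_ y' x| <= L * enorm (y - y') & `|fb_ y x - fb_ y' x| <= L * enorm (y - y')].
Proof.
have r0 : 0 < rho0 by exact: lt_le_trans rho1.
have kr : 0 < k * rho0 by rewrite mulr_gt0.
exists (CA * (1 + k * rho0)); first by rewrite mulr_gt0// addr_gt0.
move=> x y y' sx sy sy'.
have [/(_ x sx)[h1 h2] _] : (forall x, sph x -> `|fa_ y x| <= CA * 1 /\ `|fb_ y x| <= CA * 1) /\ True.
  split=> //; apply: (far ltr01 (rv sy) _).1 => p Gp; have [-> ->] := bv sy Gp.
  by rewrite !normrN !ler_norml cos_geN1 cos_le1 sin_geN1 sin_le1.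
have up : CA * 1 <= CA * (1 + k * rho0) by rewrite ler_pM2l// lerDl ltW.
have [e|n] := eqVneq y y'.
  by rewrite e !subrr normr0 enorm0 mulr0 -e; split=> //; exact: le_trans up.
have d0 : 0 < enorm (y - y').
  by rewrite lt_neqAle enorm_ge0 andbT eq_sym; apply: contra n => /eqP/enorm_eq0/eqP; rewrite subr_eq0.
have t0 : 0 < k * rho0 * enorm (y - y') by rewrite mulr_gt0.
have rD : rad (fun p => a_ y p - a_ y' p) (fun p => b_ y p - b_ y' p) (fun p => fa_ y p - fa_ y' p) (fun p => fb_ y p - fb_ y' p).
  by apply: rad_ext (rad_lin (-1) (rv sy') (rv sy)) => p; ring.
have gD : bdry_bound (fun p => a_ y p - a_ y' p) (fun p => b_ y p - b_ y' p) (k * rho0 * enorm (y - y')).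
  move=> p Gp; have [-> ->] := bv sy Gp; have [-> ->] := bv sy' Gp.
  have pr := bdry_le Gp.2; have kp : k * enorm p <= k * rho0 by rewrite ler_pM2l.
  rewrite -!opprD !normrN; split; last exact: slip_sin kp _ _ sy sy'.
  by have := slip_cos 0 kp sy sy'; rewrite !addr0.
have [/(_ x sx)[h3 h4] _] := far t0 rD gD.
have up2 : CA * (k * rho0 * enorm (y - y')) <= CA * (1 + k * rho0) * enorm (y - y').
  by rewrite mulrA ler_wpM2r ?(ltW d0)// ler_pM2l// lerDr.
by split; [exact: le_trans h1 up|exact: le_trans h2 up|exact: le_trans h3 up2|exact: le_trans h4 up2].
Qed.

(** [Fre] and [Fim] are the real and imaginary parts of uinf(x, y) phi_z(y); their integrals [Gre]
    and [Gim] form F phi_z. *)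
Let Fre (z x y : vec) : R := fa_ y x * cos (k * dotv z y) + fb_ y x * sin (k * dotv z y).
Let Fim (z x y : vec) : R := fb_ y x * cos (k * dotv z y) - fa_ y x * sin (k * dotv z y).
Let Gre (z x : vec) : R := sphere_int (Fre z x).
Let Gim (z x : vec) : R := sphere_int (Fim z x).

(** A finite combination of scattered fields whose boundary values are Riemann sums of the Herglotz
    wave and whose far field is a Riemann sum of F phi_z. *)
Lemma comb_approx (CT e : R) (z : vec) : 0 < e -> 0 < CT ->
  (forall x : vec, enorm x <= rho0 -> forall th, `|sphere_int (fun y : vec => cos (k * dotv (x - z) y + th))| <= CT) ->
  exists a b fa fb, [/\ rad a b fa fb, bdry_bound a b (CT + e), (forall x, sph x -> `|Gre z x - fa x| <= e) &
    (forall x, sph x -> `|Gim z x - fb x| <= e)].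
Proof.
move=> e0 CT0 hT.
have r0 : 0 < rho0 by exact: lt_le_trans rho1.
have [L L0 hL] := far_slip.
have kz0 : 0 <= k * enorm z by rewrite mulr_ge0 ?enorm_ge0// ltW.
pose L1 : R := 2 * (L + L * (k * enorm z)).
have L10 : 0 < L1 by rewrite mulr_gt0// ltr_pwDl// mulr_ge0// ltW.
pose L2 : R := k * (rho0 + enorm z).
have L20 : 0 < L2 by rewrite mulr_gt0// ltr_pwDl// enorm_ge0.
have LL0 : 0 < L1 + L2 by rewrite addr_gt0.
(* 2L bounds the far field integrands and 1 the cosines on the boundary, so the same nodes serve
   both. *)
have M0 : 0 < 2 * L + 1 by rewrite addr_gt0// mulr_gt0.
have [I [w [y [sy hI]]]] := sig_riemann_slip LL0 M0 e0.
pose c j := cos (k * dotv z (y j)); pose s j := sin (k * dotv z (y j)).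
exists (fun x => \sum_j w j * (a_ (y j) x * c j + b_ (y j) x * s j)),
  (fun x => \sum_j w j * (b_ (y j) x * c j - a_ (y j) x * s j)),
  (fun x => \sum_j w j * (fa_ (y j) x * c j + fb_ (y j) x * s j)),
  (fun x => \sum_j w j * (fb_ (y j) x * c j - fa_ (y j) x * s j)).
have [y0 sy0] : exists y0 : vec, sph y0.
  have i0 : (0 < m)%N by case: hm => ->.
  by exists (unitv R (Ordinal i0)); exact: enorm_unit.
have cs1 (t : R) : `|cos t| <= 1 /\ `|sin t| <= 1 by rewrite !ler_norml cos_geN1 cos_le1 sin_geN1 sin_le1.
have sl (x : vec) : sph x -> forall f g, (forall y, sph y -> `|f y| <= L) -> (forall y, sph y -> `|g y| <= L) -> slip f L -> slip g L ->
    slip (fun y => f y * cos (k * dotv z y) + g y * sin (k * dotv z y)) (L1 + L2) /\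
    forall y, sph y -> `|f y * cos (k * dotv z y) + g y * sin (k * dotv z y)| <= 2 * L + 1.
  move=> sx f g fL gL sf sg; split.
    move=> p q sp sq; apply: (@le_trans _ _ (L1 * enorm (p - q))); last by rewrite ler_wpM2r ?enorm_ge0// lerDl ltW.
    have [q1 q2] := cs1 (k * dotv z q).
    have h3 := slip_cos 0 (lexx (k * enorm z)) sp sq; rewrite !addr0 in h3.
    exact: (comb_lip (fL _ sp) (gL _ sp) q1 q2 (sf _ _ sp sq) (sg _ _ sp sq) h3 (slip_sin (lexx _) sp sq)).
  move=> p sp; have [q1 q2] := cs1 (k * dotv z p).
  apply: (@le_trans _ _ (L * 1 + L * 1)); last by rewrite mulr1 mulr_natl mulr2n lerDl.
  by apply: le_trans (ler_normD _ _) _; apply: lerD; rewrite normrM; apply: ler_pM => //; [exact: fL|exact: gL].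
split.
- apply: rad_sum; first by do 4 eexists; exact: rv sy0.
  by move=> j; apply: rad_comb; exact: rv.
- move=> x Gx; have xr := bdry_le Gx.2.
  have kx : k * enorm (x - z) <= L1 + L2.
    apply: (@le_trans _ _ L2); last by rewrite lerDr ltW.
    rewrite ler_pM2l//; apply: le_trans (enormD _ _) _; by rewrite enormN lerD2r.
  have bnd th : `|\sum_j w j * cos (k * dotv (x - z) (y j) + th)| <= CT + e.
    have := hI _ (slip_cos th kx) => h.
    have c1 p : sph p -> `|cos (k * dotv (x - z) p + th)| <= 2 * L + 1.
      move=> _; apply: le_trans (cs1 _).1 _; by rewrite lerDr mulr_ge0// ltW.
    have {c1} h := h c1; have h' := hT x xr th; move: h h'.
    move: (\sum_j _) (sphere_int _) => A B h h'.
    have -> : A = B - (B - A) by ring.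
    by apply: le_trans (ler_normB _ _) _; apply: lerD.
  split.
    have -> : \sum_j w j * (a_ (y j) x * c j + b_ (y j) x * s j) = - (\sum_j w j * cos (k * dotv (x - z) (y j) + 0)).
      rewrite -sumrN; apply: eq_bigr => j _; have [-> ->] := bv (sy j) Gx.
      by rewrite addr0 dotvBl [k * (_ - _)]mulrBr cosB /c /s; ring.
    by rewrite normrN.
  (* The imaginary part is the same wave with its phase advanced by pi/2, which is why a free phase
     is carried along. *)
  have -> : \sum_j w j * (b_ (y j) x * c j - a_ (y j) x * s j) = \sum_j w j * cos (k * dotv (x - z) (y j) + pi / 2).
    apply: eq_bigr => j _; have [-> ->] := bv (sy j) Gx.
    by rewrite cosDpihalf dotvBl [k * (_ - _)]mulrBr sinB /c /s; ring.
  exact: bnd.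
- move=> x sx.
  have [h1 h2] := sl x sx (fun y => fa_ y x) (fun y => fb_ y x)
    (fun y sy => let: And4 h _ _ _ := hL x y y sx sy sy in h) (fun y sy => let: And4 _ h _ _ := hL x y y sx sy sy in h)
    (fun y y' sy sy' => let: And4 _ _ h _ := hL x y y' sx sy sy' in h) (fun y y' sy sy' => let: And4 _ _ _ h := hL x y y' sx sy sy' in h).
  exact: hI h1 h2.
- move=> x sx.
  have nB p : sph p -> `|- fa_ p x| <= L by move=> sp; rewrite normrN; have [] := hL x p p sx sp sp.
  have nS : slip (fun p => - fa_ p x) L.
    by move=> p p' sp sp'; rewrite -opprD normrN; have [] := hL x p p' sx sp sp'.
  have [h1 h2] := sl x sx (fun y => fb_ y x) (fun y => - fa_ y x)
    (fun y sy => let: And4 _ h _ _ := hL x y y sx sy sy in h) nB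
    (fun y y' sy sy' => let: And4 _ _ _ h := hL x y y' sx sy sy' in h) nS.
  have := hI _ h1 h2; rewrite /Gim /Fim.
  have -> : (fun p => fb_ p x * cos (k * dotv z p) + - fa_ p x * sin (k * dotv z p)) =
    (fun p => fb_ p x * cos (k * dotv z p) - fa_ p x * sin (k * dotv z p)) by apply/funext => p; ring.
  congr (`|_ - _| <= _); apply: eq_bigr => j _; rewrite /c /s; ring.
Qed.

(** One factor 1/nu(|z|) comes from the boundary values, the other from the pairing. The Riemann
    error tends to zero at fixed [z], so it leaves the final bound unaffected. *)
Lemma double_herglotz_bound : exists2 C : R, 0 < C & forall z : vec, 2 * rho0 + 2 / k <= enorm z -> rho0 + 3 <= enorm z ->
  `|sphere_int (fun x => fw (Gre z) (Gim z) (k * dotv z x) x)| <= C / (nu (enorm z) * nu (enorm z)) /\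
  `|sphere_int (fun x => fw' (Gre z) (Gim z) (k * dotv z x) x)| <= C / (nu (enorm z) * nu (enorm z)).
Proof.
have [CT CT0 hT] := herglotz_tau.
exists (CA * CT); first by rewrite mulr_gt0.
move=> z z1 z2.
have r0 : 0 < rho0 by exact: lt_le_trans rho1.
have z0 : 0 < enorm z by apply: lt_le_trans z2; rewrite addr_gt0.
have nz : 0 < nu (enorm z) by exact: nu_gt0.
have T0 : 0 < CT / nu (enorm z) by rewrite divr_gt0.
have ap e (e0 : 0 < e) := comb_approx e0 T0 (fun x xr => hT z x z1 xr).
have sG : scont (Gre z).
  apply: scont_lim => e e0; have [a [b [fa [fb [ra _ h _]]]]] := ap e e0.
  by exists fa => //; exact: (rad_scont1 rho1 farE ra).
have sH : scont (Gim z).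
  apply: scont_lim => e e0; have [a [b [fa [fb [ra _ _ h]]]]] := ap e e0.
  by exists fb => //; exact: (rad_scont2 rho1 farE ra).
have S0 := sig1_gt0 R hm.
have cs1 (t : R) : `|cos t| <= 1 /\ `|sin t| <= 1 by rewrite !ler_norml cos_geN1 cos_le1 sin_geN1 sin_le1.
have main (F : (vec -> R) -> (vec -> R) -> vec -> R) :
    (forall fa fb, scont fa -> scont fb -> scont (F fa fb)) ->
    (forall fa fb ga gb x e, `|fa x - ga x| <= e -> `|fb x - gb x| <= e -> `|F fa fb x - F ga gb x| <= 2 * e) ->
    (forall a b fa fb t, 0 < t -> rad a b fa fb -> bdry_bound a b t -> `|sphere_int (F fa fb)| <= CA * t / nu (enorm z)) ->
    `|sphere_int (F (Gre z) (Gim z))| <= CA * CT / (nu (enorm z) * nu (enorm z)).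
  move=> Fs Fl Fb; apply/ler_addgt0Pr => e e0.
  pose K : R := CA / nu (enorm z) + 2 * sig1 R m.
  have K0 : 0 < K by rewrite addr_gt0// ?divr_gt0// mulr_gt0.
  pose d : R := e / K; have d0 : 0 < d by rewrite divr_gt0.
  have [a [b [fa [fb [ra ga h1 h2]]]]] := ap d d0.
  have sfa := rad_scont1 rho1 farE ra; have sfb := rad_scont2 rho1 farE ra.
  have s1 := Fs _ _ sG sH; have s2 := Fs _ _ sfa sfb.
  have Td : 0 < CT / nu (enorm z) + d by rewrite addr_gt0.
  have b1 := Fb a b fa fb _ Td ra ga.
  have b2 : `|sphere_int (F (Gre z) (Gim z)) - sphere_int (F fa fb)| <= 2 * d * sig1 R m.
    rewrite -(sigB hm s1 s2); apply: (sig_abs hm); first exact: scontB.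
    by move=> x sx; apply: Fl; [exact: h1|exact: h2].
  have -> : CA * CT / (nu (enorm z) * nu (enorm z)) + e =
      CA * (CT / nu (enorm z) + d) / nu (enorm z) + 2 * d * sig1 R m.
    have -> : e = d * K by rewrite /d divfK// gt_eqF.
    by rewrite /K; field; rewrite gt_eqF.
  move: b1 b2; move: (sphere_int _) (sphere_int _) => A B b1 b2.
  have -> : A = B + (A - B) by ring.
  by apply: le_trans (ler_normD _ _) _; exact: lerD.
split.
  apply: (main (fun f g x => fw f g (k * dotv z x) x)).
  - by move=> f g sf sg; exact: fw_scont.
  - move=> f g f' g' x e h1 h2; rewrite /fw; have [c1 c2] := cs1 (k * dotv z x).
    have -> : cos (k * dotv z x) * f x - sin (k * dotv z x) * g x - (cos (k * dotv z x) * f' x - sin (k * dotv z x) * g' x) =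
      cos (k * dotv z x) * (f x - f' x) - sin (k * dotv z x) * (g x - g' x) by ring.
    have -> : 2 * e = 1 * e + 1 * e by ring.
    by apply: le_trans (ler_normB _ _) _; apply: lerD; rewrite normrM; apply: ler_pM.
  - by move=> a b f g t t0 ra ga; have [_ /(_ z z2)[]] := far t0 ra ga.
apply: (main (fun f g x => fw' f g (k * dotv z x) x)).
- move=> f g sf sg.
  by apply: scont_ext (@fw_scont R m k _ _ z sg (@scontN _ _ _ sf)) => x _; rewrite fw'E.
- move=> f g f' g' x e h1 h2; rewrite /fw'; have [c1 c2] := cs1 (k * dotv z x).
  have -> : sin (k * dotv z x) * f x + cos (k * dotv z x) * g x - (sin (k * dotv z x) * f' x + cos (k * dotv z x) * g' x) =
    sin (k * dotv z x) * (f x - f' x) + cos (k * dotv z x) * (g x - g' x) by ring.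
  have -> : 2 * e = 1 * e + 1 * e by ring.
  by apply: le_trans (ler_normD _ _) _; apply: lerD; rewrite normrM; apply: ler_pM.
- by move=> a b f g t t0 ra ga; have [_ /(_ z z2)[]] := far t0 ra ga.
Qed.
End Assembly.

Lemma bounded_enorm (R : realType) m (D : set 'rV[R]_m) : bounded_set D ->
  exists2 rho : R, 1 <= rho & forall y, closure D y -> enorm y < rho.
Proof.
move=> [M [_ hM]]; pose M' : R := `|M| + 1.
have MM : M < M' by apply: le_lt_trans (ler_norm _) _; rewrite ltrDl.
exists (m%:R * M' + 1); first by rewrite lerDr mulr_ge0// addr_ge0.
move=> y cy; apply: (@le_lt_trans _ _ (m%:R * M')); last by rewrite ltrDl.
have cl : closed [set x : 'rV[R]_m | enorm x <= m%:R * M'].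
  have -> : [set x : 'rV[R]_m | enorm x <= m%:R * M'] = @enorm R m @^-1` [set t | t <= m%:R * M'] by [].
  by apply: closed_comp => [x _|]; [exact: enorm_cont|exact: closed_le].
suff : closure [set x : 'rV[R]_m | enorm x <= m%:R * M'] y by rewrite -((closure_id _).1 cl).
apply: closure_subset cy => x Dx /=; apply: le_trans (enorm_norm _) _.
by rewrite ler_wpM2l//; exact: (hM M' MM).
Qed.

Lemma dist_set_le (R : realType) m (D : set 'rV[R]_m) (z : 'rV[R]_m) (rho : R) : 0 < dist_set z D ->
  (forall y, D y -> enorm y <= rho) -> dist_set z D <= enorm z + rho.
Proof.
(* For empty D the infimum takes the default value 0, which [dp] excludes. *)
move=> dp hD; have [D0|/set0P[y Dy]] := eqVneq D set0.
  by move: dp; rewrite D0 /dist_set image_set0 inf0 ltxx.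
apply: (@le_trans _ _ (enorm (z - y))).
  apply: ge_inf; last by exists y.
  by exists 0 => _ [x _ <-]; exact: enorm_ge0.
by apply: le_trans (enormD _ _) _; rewrite enormN lerD2l; exact: hD.
Qed.

Lemma Re_mul (R : realType) (u v : R[i]) :
  complex.Re (u * v) = complex.Re u * complex.Re v - complex.Im u * complex.Im v.
Proof. by case: u v => [? ?] [? ?]. Qed.

Lemma Im_mul (R : realType) (u v : R[i]) :
  complex.Im (u * v) = complex.Re u * complex.Im v + complex.Im u * complex.Re v.
Proof. by case: u v => [? ?] [? ?]. Qed.

(** The conjugate in the inner product turns phi_z(x) into exp(i k z.x), which is the rotation
    performed by [fw] and [fw']. *)
Lemma W1_fw (R : realType) m (k : R) (uinf : 'rV[R]_m -> 'rV[R]_m -> R[i]) (z : 'rV[R]_m) :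
  let fa y x := complex.Re (uinf x y) in let fb y x := complex.Im (uinf x y) in
  let Gre x := sphere_int (fun y => fa y x * cos (k * dotv z y) + fb y x * sin (k * dotv z y)) in
  let Gim x := sphere_int (fun y => fb y x * cos (k * dotv z y) - fa y x * sin (k * dotv z y)) in
  W1 k uinf z = (sphere_int (fun x => fw Gre Gim (k * dotv z x) x) +i* sphere_int (fun x => fw' Gre Gim (k * dotv z x) x))%C.
Proof.
move=> fa fb Gre Gim.
have e1 x : (fun y => complex.Re (uinf x y * phi_z k z y)) =
    (fun y => fa y x * cos (k * dotv z y) + fb y x * sin (k * dotv z y)).
  by apply/funext => y; rewrite Re_mul /phi_z /= cosN sinN mulrN opprK.
have e2 x : (fun y => complex.Im (uinf x y * phi_z k z y)) =
    (fun y => fb y x * cos (k * dotv z y) - fa y x * sin (k * dotv z y)).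
  by apply/funext => y; rewrite Im_mul /phi_z /= cosN sinN mulrN addrC.
have e3 : (fun x => complex.Re ((Gre x +i* Gim x)%C * (phi_z k z x)^*%C)) = (fun x => fw Gre Gim (k * dotv z x) x).
  by apply/funext => x; rewrite Re_mul /phi_z /= cosN sinN opprK /fw [Gre x * _]mulrC [Gim x * _]mulrC.
have e4 : (fun x => complex.Im ((Gre x +i* Gim x)%C * (phi_z k z x)^*%C)) = (fun x => fw' Gre Gim (k * dotv z x) x).
  by apply/funext => x; rewrite Im_mul /phi_z /= cosN sinN opprK /fw' [Gre x * _]mulrC [Gim x * _]mulrC.
have EG : farfield_op uinf (phi_z k z) = (fun x => (Gre x +i* Gim x)%C).
  by apply/funext => x; rewrite /farfield_op /csphere_int e1 e2.
by rewrite /W1 /L2_inner EG /csphere_int e3 e4.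
Qed.

Theorem theorem27 (R : realType) (m : nat) (k : R) (D : set 'rV[R]_m)
  (us : 'rV[R]_m -> 'rV[R]_m -> R[i])
  (uinf : 'rV[R]_m -> 'rV[R]_m -> R[i]) :
  (m = 2%N \/ m = 3%N) ->
  0 < k ->
  open D ->
  bounded_set D ->
  C2_boundary D ->
  connected (~` closure D) ->
  ~ dirichlet_eigenvalue D k ->
  (* for every incident direction yh in Omega, us yh is the scattered field for
     the incident plane wave exp(i k x.yh), and uinf( . , yh) its far field *)
  (forall yh, enorm yh = 1 ->
     sound_soft_scattered D k (fun x => expi (k * dotv x yh)) (us yh) /\
     far_field_of k (us yh) (fun xh => uinf xh yh)) ->
  exists (C d0 : R), forall z : 'rV[R]_m,
    ~ closure D z -> d0 <= dist_set z D ->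
    cabs (W1 k uinf z) <= C * dist_set z D `^ (1 - m%:R).
Proof.
move=> hm k0 oD bD C2 _ _ scat.
have [rho0 rho1 hD] := bounded_enorm bD.
pose E : set 'rV[R]_m := ~` closure D.
have farE (y : 'rV[R]_m) : rho0 <= enorm y -> E y.
  by move=> yr /hD h; have := lt_le_trans h yr; rewrite ltxx.
have oE : open E by rewrite openC; exact: closed_closure.
have tang p := @tangent_ball R m hm D p oD C2.
have [CA CA0 far] := far_field_bound hm k0 oE rho1 farE tang.
have rv y : sph y -> rad k E rho0 (ReF (us y)) (ImF (us y)) (fun x => complex.Re (uinf x y)) (fun x => complex.Im (uinf x y)).
  by move=> sy; have [h1 h2] := scat y sy; exact: (scattered_rad rho1 oD h1 h2).
have bv y x : sph y -> (closure E `\` E) x -> ReF (us y) x = - cos (k * dotv x y) /\ ImF (us y) x = - sin (k * dotv x y).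
  move=> sy /(closure_boundary oD) bx; have [[_ [_ [_ [_ [_ [h _]]]]]] _] := scat y sy.
  by rewrite /ReF /ImF (h x bx).
have [C C0 hW] := double_herglotz_bound hm k0 rho1 farE CA0 far rv bv.
have r0 : 0 < rho0 by exact: lt_le_trans rho1.
have k2 : 0 < 2 / k by rewrite divr_gt0.
(* The factor 2 adds real and imaginary parts; 2^(m-1) comes from |z| >= d/2, which the threshold
   guarantees because dist(z, D) <= |z| + rho0. *)
exists (2 * C * 2 ^+ m.-1), (2 * (2 * rho0 + 2 / k + (rho0 + 3))) => z _ dz.
have d0 : 0 < dist_set z D.
  by apply: lt_le_trans dz; move: r0 k2; move: (2 / k) => q; clear; lra.
have hd := @dist_set_le R m D z rho0 d0 (fun y Dy => ltW (hD y (subset_closure Dy))).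
move: (dist_set z D) d0 hd dz => d d0 hd dz.
have [z1 z2 z3] : [/\ 2 * rho0 + 2 / k <= enorm z, rho0 + 3 <= enorm z & d / 2 <= enorm z].
  by move: r0 k2 hd dz; move: (2 / k) (enorm z) => q e; clear; split; lra.
have [w1 w2] := hW z z1 z2.
have zp : 0 < enorm z by apply: lt_le_trans z3; rewrite divr_gt0.
rewrite nu_sqr// in w1 w2.
rewrite W1_fw; apply: le_trans (cabs_le _) _ => /=; apply: le_trans (lerD w1 w2) _.
have -> : C / enorm z ^+ m.-1 + C / enorm z ^+ m.-1 = 2 * C / enorm z ^+ m.-1 by ring.
rewrite -[2 * C * _ * _]mulrA; apply: ler_wpM2l; first by rewrite mulr_ge0// ltW.
have -> : d `^ (1 - m%:R) = (d ^+ m.-1)^-1.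
  have -> : 1 - m%:R = - m.-1%:R :> R by case: hm => -> /=; ring.
  by rewrite powRN powR_mulrn// ltW.
have -> : 2 ^+ m.-1 / d ^+ m.-1 = ((d / 2) ^+ m.-1)^-1 by rewrite exprMn invfM exprVn invrK mulrC.
rewrite lef_pV2 ?posrE ?exprn_gt0 ?divr_gt0//.
by rewrite lerXn2r ?nnegrE ?divr_ge0 ?(ltW d0) ?(ltW zp).
Qed.
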